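(* For any $n\ge1$ and any permutation $w\in\mathcal{S}_n$, the polynomial \[ \mathfrak{S}_w^\vee(x_1,\ldots,x_n)=\mathrm{N}\big(x_1^{n-1}\cdots x_n^{n-1}\,\mathfrak{S}_w(x_1^{-1},\ldots,x_n^{-1})\big) \] is Lorentzian.
   Context: $\mathcal{S}_n$ is the symmetric group on $[n]$. Schubert polynomials are defined recursively: for the longest permutation $w_\circ=n\,(n-1)\cdots 2\,1$, $\mathfrak{S}_{w_\circ}=x_1^{n-1}x_2^{n-2}\cdots x_{n-1}$; if $w(i)>w(i+1)$ and $s_i=(i\ i+1)$, then $\mathfrak{S}_{ws_i}=\partial_i\mathfrak{S}_w$, where $\partial_i f=(f-s_if)/(x_i-x_{i+1})$ and $s_if$ is $f$ with $x_i,x_{i+1}$ interchanged. The linear operator $\mathrm{N}$ is defined by $\mathrm{N}(x^\mu)=x^\mu/\mu!=\prod_i x_i^{\mu_i}/\mu_i!$ for $\mu\in\mathbb{N}^n$. A subset $\mathrm{J}\subseteq\mathbb{Z}^n$ is M-convex if for any $i\in[n]$ and any $\alpha,\beta\in\mathrm{J}$ with $\alpha_i>\beta_i$ there is $j\in[n]$ with $\alpha_j<\beta_j$, $\alpha-e_i+e_j\in\mathrm{J}$ and $\beta-e_j+e_i\in\mathrm{J}$. A homogeneous polynomial $h(x_1,\ldots,x_n)$ of degree $d$ is Lorentzian if all its coefficients are nonnegative, its support (set of exponent vectors of its monomials) is M-convex, and for all $i_1,\ldots,i_{d-2}\in[n]$ the quadratic form $\partial_{x_{i_1}}\cdots\partial_{x_{i_{d-2}}}h$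 has at most one positive eigenvalue. *)

(* Defs.v *)
From mathcomp Require Import all_boot all_order all_fingroup all_algebra.
From mathcomp Require Import polyrcf mpoly zify.

Set Implicit Arguments.
Unset Strict Implicit.
Unset Printing Implicit Defensive.

Import Order.TTheory GRing.Theory Num.Theory.
Local Open Scope ring_scope.

(* Positions, values and variables are numbered from 0: 'X_i stands for
   x_{i+1}, and w : 'S_n permutes {0, ..., n-1}. *)

Definition longest_perm (n : nat) : 'S_n := perm (@rev_ord_inj n).

Definition staircase (n : nat) : 'X_{1..n} := [multinom (n - i.+1)%N | i < n].

(* g = (f - s f) / (x_i - x_j), where s exchanges x_i and x_j; the quotient is
   unique since {mpoly R[n]} is an integral domain, and it always exists
   (divdiff_exists). *)
Definition is_divdiff (R : idomainType) (n : nat) (i j : 'I_n)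
    (f g : {mpoly R[n]}) : Prop :=
  g * ('X_i - 'X_j) = f - msym (tperm i j) f.

(* is_schubert w f: f is obtained by the recursion defining the Schubert
   polynomial of w.  Every w has such an f (schubert_exists).  Products in 'S_n
   are composed left to right, so w s_i, the permutation k |-> w (s_i k), is
   (tperm i j * w)%g with j = i + 1. *)
Inductive is_schubert (R : idomainType) (n : nat) :
    'S_n -> {mpoly R[n]} -> Prop :=
| SchubertLongest : is_schubert (longest_perm n) 'X_[staircase n]
| SchubertStep (w : 'S_n) (i j : 'I_n) (f g : {mpoly R[n]}) :
    is_schubert w f -> j = i.+1 :> nat -> (w j < w i)%N ->
    is_divdiff i j f g -> is_schubert (tperm i j * w)%g g.

(* x_1^N ... x_n^N f(x_1^-1, ..., x_n^-1), for f of degree at most N in each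
   variable: the subtraction is then exact.  Schubert polynomials meet this
   condition for N = n - 1 (schubert_exponent_bound). *)
Definition reversal (R : idomainType) (n N : nat) (f : {mpoly R[n]}) :
    {mpoly R[n]} :=
  \sum_(m <- msupp f) f@_m *: 'X_[[multinom (N - m i)%N | i < n]].

(* The operator N : x^mu |-> x^mu / mu!, extended linearly. *)
Definition normalization (F : fieldType) (n : nat) (f : {mpoly F[n]}) :
    {mpoly F[n]} :=
  \sum_(m <- msupp f) (f@_m / (\prod_(i < n) (m i)`!)%N%:R) *: 'X_[m].

Definition unit_vec (n : nat) (i : 'I_n) : 'rV[int]_n := delta_mx 0 i.

Definition M_convex (n : nat) (J : 'rV[int]_n -> Prop) : Prop :=
  forall (i : 'I_n) (a b : 'rV[int]_n), J a -> J b -> b 0 i < a 0 i ->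
    exists j : 'I_n, [/\ a 0 j < b 0 j,
                         J (a - unit_vec i + unit_vec j)
                       & J (b - unit_vec j + unit_vec i)].

Definition support (R : idomainType) (n : nat) (h : {mpoly R[n]})
    (a : 'rV[int]_n) : Prop :=
  exists2 m : 'X_{1..n}, m \in msupp h & a = \row_i (m i)%:Z.

(* The symmetric matrix A with q(x) = x A x^T, for q homogeneous of degree 2. *)
Definition quadratic_form_mx (F : fieldType) (n : nat) (q : {mpoly F[n]}) :
    'M[F]_n :=
  \matrix_(i, j) (if i == j then q@_(U_(i) + U_(j)) else q@_(U_(i) + U_(j)) / 2).

(* rootsR lists each real root once, so the eigenvalues are weighted by their
   multiplicity in the characteristic polynomial. *)
Definition num_positive_eigenvalues (R : rcfType) (n : nat) (A : 'M[R]_n) : nat :=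
  (\sum_(a <- rootsR (char_poly A) | (0 < a)%R) mup a (char_poly A))%N.

(* foldr (mderiv ...) h s is the derivative of h along the variables listed in
   s; there is no condition on derivatives when d < 2. *)
Definition lorentzian (R : rcfType) (n : nat) (h : {mpoly R[n]}) : Prop :=
  exists d : nat,
    [/\ h \is d.-homog,
        forall m : 'X_{1..n}, 0 <= h@_m,
        M_convex (support h)
      & forall s : seq 'I_n, (size s + 2)%N = d ->
          (num_positive_eigenvalues
             (quadratic_form_mx (foldr (fun i p => p^`M(i)) h s)) <= 1)%N].

Section DividedDifferences.
Variables (R : idomainType) (n : nat).
Implicit Types (f g : {mpoly R[n]}) (i j : 'I_n) (m : 'X_{1..n}).

Definition exponents_le (N : nat) (f : {mpoly R[n]}) : Prop :=
  forall m, m \in msupp f -> forall k : 'I_n, (m k <= N)%N.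

Lemma exponents_le0 N : exponents_le N 0.
Proof. by move=> m; rewrite msupp0. Qed.

Lemma exponents_leD N f g :
  exponents_le N f -> exponents_le N g -> exponents_le N (f + g).
Proof.
move=> hf hg m /msuppD_le; rewrite mem_cat => /orP[/hf|/hg] //.
Qed.

Lemma exponents_leZ N c f : exponents_le N f -> exponents_le N (c *: f).
Proof. by move=> hf m /msuppZ_le /hf. Qed.

Lemma exponents_leX N m : (forall k, m k <= N)%N -> exponents_le N 'X_[m].
Proof. by move=> hm m'; rewrite msuppX inE => /eqP ->. Qed.

Lemma divdiff_unique i j f g g' :
  i != j -> is_divdiff i j f g -> is_divdiff i j f g' -> g = g'.
Proof.
rewrite /is_divdiff => ij h h'; apply: (@mulIf _ ('X_i - 'X_j)).
  apply/eqP => /(congr1 (mcoeff U_(i)%MM)) /eqP.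
  have /negbTE nU : U_(j)%MM != U_(i)%MM.
    by apply/eqP => /mnmP/(_ i); rewrite !mnmE eqxx eq_sym (negbTE ij).
  by rewrite mcoeffB !mcoeffX eqxx nU subr0 mcoeff0 oner_eq0.
by rewrite h h'.
Qed.

Lemma divdiff_monomial_le i j m N : i != j -> (m j <= m i)%N ->
  (forall k, m k <= N)%N ->
  exists2 g, is_divdiff i j 'X_[m] g & exponents_le N g.
Proof.
move=> ij le_ji hN.
pose b := m j; pose c := (m i - m j)%N.
pose M a k := [multinom if l == i then a - k else if l == j then b + k else m l | l < n]%N.
exists (\sum_(0 <= k < c) 'X_[M (b + c).-1 k]); last first.
  rewrite big_seq; apply: (big_ind (exponents_le N)).
  - exact: exponents_le0.
  - exact: exponents_leD.
  move=> k; rewrite mem_index_iota => /andP[_ kc]; apply: exponents_leX => l.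
  rewrite mnmE; case: eqP => _; [|case: eqP => _ //].
    by move: (hN i) kc; rewrite /b /c; move: (m i) (m j) le_ji => x y; lia.
  by move: (hN i) kc; rewrite /b /c; move: (m i) (m j) le_ji => x y; lia.
rewrite /is_divdiff msymX mulr_suml.
have step k : (0 <= k < c)%N -> 'X_[R, M (b + c).-1 k] * ('X_i - 'X_j)
    = - ('X_[M (b + c)%N k.+1] - 'X_[M (b + c)%N k]).
  move=> /andP[_ kc]; rewrite opprB mulrBr -!mpolyXD; congr (_ - _).
    congr 'X_[_]; apply/mnmP => l; rewrite !mnmE.
    by case: (eqVneq l i) => _; [lia | rewrite addn0].
  congr 'X_[_]; apply/mnmP => l; rewrite !mnmE.
  case: (eqVneq l i) => [->|_]; first by rewrite (eq_sym j i) (negbTE ij); lia.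
  by case: (eqVneq l j) => _; lia.
rewrite big_nat (eq_bigr _ step) -big_nat sumrN telescope_sumr // opprB.
congr (_ - _).
  congr 'X_[_]; apply/mnmP => l; rewrite !mnmE subn0 addn0 /b /c subnKC //.
  by case: eqP => [->//|_]; case: eqP => [->|].
congr 'X_[_]; apply/mnmP => l; rewrite !mnmE tpermV /b /c.
case: tpermP => [->|->|/eqP li /eqP lj].
- by rewrite eqxx; lia.
- by rewrite eq_sym (negbTE ij) eqxx; lia.
- by rewrite (negbTE li) (negbTE lj).
Qed.

Lemma divdiff_exists_le i j N f : i != j -> exponents_le N f ->
  exists2 g, is_divdiff i j f g & exponents_le N g.
Proof.
move=> ij hf; rewrite [f]mpolyE big_seq.
apply: (big_ind (fun p => exists2 g, is_divdiff i j p g & exponents_le N g)).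
- exists 0; last exact: exponents_le0.
  by rewrite /is_divdiff mul0r raddf0 subr0.
- move=> p q [g hg gN] [g' hg' gN']; exists (g + g'); last exact: exponents_leD.
  by rewrite /is_divdiff mulrDl hg hg' raddfD opprD addrACA.
move=> m hm.
suff [g hg gN] : exists2 g, is_divdiff i j 'X_[m] g & exponents_le N g.
  exists (f@_m *: g); last exact: exponents_leZ.
  by rewrite /is_divdiff -scalerAl hg msymZ scalerBr.
have [le_ji|lt_ij] := leqP (m j) (m i).
  by apply: divdiff_monomial_le => // k; apply: hf.
pose m' := [multinom m (tperm i j k) | k < n].
have [||g hg gN] := @divdiff_monomial_le i j m' N ij.
- by rewrite !mnmE tpermL tpermR ltnW.
- by move=> k; rewrite mnmE; apply: hf.
exists (- g); last by rewrite -scaleN1r; apply: exponents_leZ.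
rewrite /is_divdiff mulNr hg !msymX opprB tpermV; congr ('X_[_] - 'X_[_]).
by apply/mnmP => k; rewrite !mnmE tpermK.
Qed.

Lemma divdiff_exists i j f : i != j -> exists g, is_divdiff i j f g.
Proof.
move=> ij; pose N := (\max_(m <- msupp f) \max_(k < n) m k)%N.
have [|g hg _] := @divdiff_exists_le i j N f ij; last by exists g.
move=> m hm k; apply: leq_trans (leq_bigmax_seq _ hm isT).
exact: (leq_bigmax k).
Qed.

Lemma schubert_exponent_bound (w : 'S_n) f :
  is_schubert w f -> exponents_le n.-1 f.
Proof.
elim=> {w f} [|w i j f g _ hf ij _ hg].
  by apply: exponents_leX => k; rewrite mnmE; lia.
have neq_ij : i != j by apply/eqP => e; move: ij; rewrite e; lia.
have [g' hg' g'N] := divdiff_exists_le neq_ij hf.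
by rewrite (divdiff_unique neq_ij hg hg').
Qed.

Lemma schubert_exists (w : 'S_n) : exists f : {mpoly R[n]}, is_schubert w f.
Proof.
have [N] := ubnP (\sum_(k < n) k * w k)%N; elim: N w => // N IH w ltN.
have [/existsP[i /existsP[j /andP[/eqP ij lt_ij]]]|noasc] :=
  boolP [exists i : 'I_n, exists j : 'I_n, (j == i.+1 :> nat) && (w i < w j)%N].
  have neq_ij : i != j by apply/eqP => e; move: ij; rewrite e; lia.
  have neq_ji : j != i by rewrite eq_sym.
  have [|f hf] := IH (tperm i j * w)%g.
    apply: leq_trans (ltN : (_ <= N)%N).
    rewrite (bigD1 i) // (bigD1 j) //= [ltnRHS](bigD1 i) // [in ltnRHS](bigD1 j) //=.
    rewrite !permM tpermL tpermR.
    rewrite (eq_bigr (fun k : 'I_n => k * w k)%N); last first.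
      by move=> k /andP[ki kj]; rewrite permM tpermD // eq_sym.
    by rewrite !addnA ltn_add2r ij; move: lt_ij; nia.
  have [g hg] := divdiff_exists f neq_ij.
  exists g; rewrite -[w]mul1g -(tperm2 i j) -mulgA.
  apply: SchubertStep hf ij _ hg.
  by rewrite !permM tpermL tpermR.
have desc (i j : 'I_n) : j = i.+1 :> nat -> (w j < w i)%N.
  move=> ij; move: noasc; rewrite negb_exists => /forallP/(_ i).
  rewrite negb_exists => /forallP/(_ j); rewrite ij eqxx /= -leqNgt leq_eqVlt.
  case/orP=> [/eqP/val_inj/perm_inj e|//]; by move: ij; rewrite e; lia.
have up k (kn : (k < n)%N) : (w (Ordinal kn) + k <= n.-1)%N.
  elim: k kn => [|k IHk] kn; first by rewrite addn0; case: (w _) => /=; lia.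
  by have := desc (Ordinal (ltnW kn)) (Ordinal kn) erefl; have := IHk (ltnW kn); lia.
have down d : forall k (kn : (k < n)%N), (n - k.+1 = d)%N -> (d <= w (Ordinal kn))%N.
  elim: d => [//|d IHd] k kn e.
  have kn1 : (k.+1 < n)%N by lia.
  have := desc (Ordinal kn) (Ordinal kn1) erefl.
  have := IHd k.+1 kn1; lia.
suff -> : w = longest_perm n by eexists; apply: SchubertLongest.
apply/permP => -[k kn]; apply/val_inj; rewrite permE /=.
by have := up k kn; have := down _ k kn erefl; lia.
Qed.

End DividedDifferences.

(* Main.v *)
(* For w in S_N let X_w be the set of N x N matrices L P_w U with L lower and U
   upper triangular, both invertible. Consider the functions on X_w spanned by
   products of T_r entries of each row r and s_k forms from each of finitely many
   pencils, a pencil being spanned by the last entry of a row and a generic linear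
   form in that row. The rank of this space has, for large T and s, a leading term
   H given by weighting the coefficients of the Schubert polynomial of w:
   - below, by Monk's rule: products of minors vanish exactly on the cells covered
     by X_w, and the functions which survive on these can be counted by induction;
   - above, by induction along adjacent transpositions from w = 1, where explicit
     monomials span.
   X_w contains a slice parametrized by an affine space of dimension N(N-1) - l(w),
   on which all squarefree monomials occur as lowest monomials of products of row
   entries. So the sets of lowest exponents satisfy C >= A + B + {0,1}^d, and a discrete
   Brunn-Minkowski inequality makes the d-th root of the leading term superadditive:
   f(t + t')^2 >= 4^e f(t) f(t') for the dual Schubert polynomial and, pencils
   playing the role of derivatives, for each derivative f of it, of degree e.
   For e = 2 this is the reverse Cauchy-Schwarz inequality, hence at most one
   positive eigenvalue; applied to all derivatives it also gives the exchange
   property of the support. *)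

Require Import Defs.
From mathcomp Require Import all_boot all_order all_fingroup all_algebra.
From mathcomp Require Import zify.

Set Implicit Arguments.
Unset Strict Implicit.
Unset Printing Implicit Defensive.

(** * A discrete Brunn-Minkowski inequality *)

Section DiscreteBrunnMinkowski.

(** The two rank estimates play opposite roles: the lower bound is applied to two factors, the upper
    bound to the space containing their products. The inequality survives only because both have the
    same leading term. Two limits follow: row and pencil degrees grow at the same rate [x], then the
    ratio [s] of the pencil degrees grows. A pencil contributes a factor 1 + S z to the weight of
    its row; taking top powers of S lowers an exponent by one, which differentiates an exponential
    series. Doubling the degrees of K pencils costs 2 ^ K, squared 4 ^ K; the dimension is e + K,
    and 4 ^ e is left. Inside S_N Monk's rule is complete only if the maximal value stands to the
    right of the positions moved. Hence w in S_n is regarded as a permutation of n + 1 points fixing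
    the last one; this is paid for by one more pencil in each old row and n pencils in the new row.
    Generic pencils cannot be treated all at once: they are added one by one, from the bottom row
    upwards, each as a deformation of a coordinate pencil adapted to the cell. The degenerate cells
    exist for this induction over rows. *)

Lemma sumset_count (P Q C : pred nat) M :
  (exists2 i, (i < M)%N & P i) -> (exists2 j, (j < M)%N & Q j) ->
  (forall i j, (i < M)%N -> (j < M)%N -> P i -> Q j -> C (i + j)%N /\ C (i + j).+1) ->
  (count P (iota 0 M) + count Q (iota 0 M) <= count C (iota 0 (M + M)))%N.
Proof.
move=> exP exQ hC.
have exP' : exists i, (i < M)%N && P i by case: exP => i h1 h2; exists i; rewrite h1.
have exQ' : exists j, (j < M)%N && Q j by case: exQ => i h1 h2; exists i; rewrite h1.
case: (ex_minnP exP') => a /andP[aM Pa] amin.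
have ubQ j : (j < M)%N && Q j -> (j <= M)%N by move=> /andP[/ltnW].
case: (ex_maxnP exQ' ubQ) => b /andP[bM Qb] bmax.
rewrite -!size_filter.
set As := filter P _; set Bs := filter Q _; set Cs := filter C _.
have memA i : (i \in As) = (i < M)%N && P i by rewrite mem_filter mem_iota /= add0n andbC.
have memB i : (i \in Bs) = (i < M)%N && Q i by rewrite mem_filter mem_iota /= add0n andbC.
(* With a the least point of P and b the greatest of Q, the translates a + Q and P + b + 1 lie in C
   and are disjoint, since a + j <= a + b < i + b + 1. *)
rewrite addnC -(size_map (addn a) Bs) -(size_map (fun i => (i + b).+1) As) -size_cat.
apply: uniq_leq_size.
  rewrite cat_uniq !map_inj_uniq ?filter_uniq ?iota_uniq //; last 2 first.
  - by move=> x y [] /addIn.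
  - by move=> x y /addnI.
  rewrite andbT /=; apply/hasPn => x /mapP[i]; rewrite memA => hi ->.
  apply/negP => /mapP[j]; rewrite memB => hj; have := amin _ hi; have := bmax _ hj; lia.
move=> x; rewrite mem_cat mem_filter mem_iota /= add0n.
case/orP => /mapP[i]; rewrite ?memA ?memB => /andP[iM h] ->.
  by have [-> _] := hC _ _ aM iM Pa h; rewrite /=; lia.
by have [_ ->] := hC _ _ iM bM h Qb; rewrite /=; lia.
Qed.

(** The hypothesis compares sqrt q * u k with sqrt m * c k and can therefore be summed over k;
    working with squares avoids the roots at the price of the cross terms. *)
Lemma sqr_sum_le (q m M : nat) (u c : nat -> nat) :
  (forall k, q * u k ^ 2 <= m * c k ^ 2)%N ->
  (q * (\sum_(0 <= k < M) u k) ^ 2 <= m * (\sum_(0 <= k < M) c k) ^ 2)%N.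
Proof.
move=> h; elim: M => [|M IH]; first by rewrite !big_geq // !muln0.
rewrite !big_nat_recr //=; move: (\sum_(_ <= _ < _) u _)%N (\sum_(_ <= _ < _) c _)%N IH => U V IH.
have hM := h M; set x := u M in hM *; set y := c M in hM *.
have cross : (q * (U * x) <= m * (V * y))%N.
  rewrite -leq_sqr; apply: leq_trans (_ : (q * U ^ 2) * (q * x ^ 2) <= _)%N; first by apply/eq_leq; lia.
  by apply: leq_trans (leq_mul IH hM) _; apply/eq_leq; lia.
by rewrite !sqrnD !mulnDr; move: cross IH hM; lia.
Qed.

Lemma level_sum (x m : nat) : (x <= m)%N -> (\sum_(1 <= v < m.+1) (v <= x) = x)%N.
Proof.
move=> xm; rewrite (@big_cat_nat _ _ _ x.+1) //= [X in (_ + X)%N]big1_seq; last first.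
  by move=> v /=; rewrite mem_index_iota => /andP[h _]; rewrite leqNgt h.
rewrite addn0 big_nat_cond (eq_bigr (fun=> 1%N)); last first.
  by move=> v /andP[/andP[_ h] _]; rewrite -ltnS h.
by rewrite -big_nat_cond sum_nat_const_nat subn1 muln1.
Qed.

Lemma count_iota_sum (P : pred nat) M : count P (iota 0 M) = (\sum_(0 <= i < M) P i)%N.
Proof. by rewrite /index_iota subn0 -sumn_count sumnE big_map. Qed.

(** A discrete Prekopa-Leindler inequality on the line. Scaling [a] by max [b] and [b] by max [a]
    gives both the maximum m, so their level sets are nonempty at the same heights 1, ..., m and
    [sumset_count] applies at each. Summing over the heights recovers the masses; the factor 4 is
    the inequality of arithmetic and geometric means. *)
Lemma brunn_minkowski_line (q M : nat) (a b c : nat -> nat) :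
  (forall i j, (i < M)%N -> (j < M)%N ->
     (q * (a i * b j) <= c (i + j) ^ 2)%N /\ (q * (a i * b j) <= c (i + j).+1 ^ 2)%N) ->
  (4 * q * ((\sum_(0 <= i < M) a i) * (\sum_(0 <= j < M) b j)) <= (\sum_(0 <= k < M + M) c k) ^ 2)%N.
Proof.
move=> h.
have [->|q0] := posnP q; first by rewrite muln0.
pose al := (\max_(i < M) a i)%N; pose be := (\max_(j < M) b j)%N.
have leal i : (i < M)%N -> (a i <= al)%N by move=> iM; apply: (leq_bigmax (Ordinal iM)).
have lebe i : (i < M)%N -> (b i <= be)%N by move=> iM; apply: (leq_bigmax (Ordinal iM)).
have [al0|al0] := posnP al.
  by rewrite big_nat big1 ?mul0n ?muln0 // => i iM; have := leal _ (andP iM).2; lia.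
have [be0|be0] := posnP be.
  have -> : (\sum_(0 <= j < M) b j = 0)%N; last by rewrite !muln0.
  by rewrite big_nat big1 // => i iM; have := lebe _ (andP iM).2; lia.
have M0 : (0 < M)%N.
  case: posnP => // M0; move: al0; rewrite /al big1 // => -[i hi] _; exfalso.
  by move: hi; rewrite M0.
have cM : (0 < #|'I_M|)%N by rewrite card_ord.
have [ia ha] := eq_bigmax (fun i : 'I_M => a i) cM.
have [jb hb] := eq_bigmax (fun j : 'I_M => b j) cM.
pose m := (al * be)%N.
(* The set that receives the sum of the two level sets at height v: there q v^2 <= q (be a_i) (al
   b_j) = q a_i b_j m <= c_k^2 m. *)
pose Cv v k := (q * v ^ 2 <= c k ^ 2 * m)%N.
have lev v : (1 <= v < m.+1)%N -> ((\sum_(0 <= i < M) (v <= be * a i)) + \sum_(0 <= j < M) (v <= al * b j)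
    <= \sum_(0 <= k < M + M) Cv v k)%N.
  move=> /andP[v1 vm]; rewrite -!count_iota_sum; apply: sumset_count.
  - by exists ia; rewrite // -ha mulnC.
  - by exists jb; rewrite // -hb.
  move=> i j iM jM hi hj; have [h1 h2] := h i j iM jM.
  have hv : (q * v ^ 2 <= q * (a i * b j) * m)%N.
    rewrite -mulnA leq_mul2l; apply/orP; right; rewrite -mulnn.
    by apply: leq_trans (leq_mul hi hj) _; rewrite /m; lia.
  by split; apply: leq_trans hv _; rewrite leq_mul2r ?h1 ?h2 orbT.
pose u k := (\sum_(1 <= v < m.+1) Cv v k)%N.
have hu k : (q * u k ^ 2 <= m * c k ^ 2)%N.
  have [->|u0] := posnP (u k); first by rewrite muln0.
  rewrite leqNgt; apply/negP => hlt.
  (* If q * u k ^ 2 exceeded m * c k ^ 2, only heights v < u k could be counted by [u k], hence at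
     most u k - 1 of them. *)
  suff : (u k <= (u k).-1)%N by lia.
  rewrite -[X in (_ <= X)%N](@level_sum _ m); last first.
    rewrite /u; apply: leq_trans (leq_pred _) _.
    apply: leq_trans (leq_sum _ (fun v _ => leq_b1 _)) _.
    by rewrite sum_nat_const_nat subn1 muln1.
  rewrite {1}/u big_nat [X in (_ <= X)%N]big_nat; apply: leq_sum => v _.
  rewrite /Cv; case: (leqP v (u k).-1) => h2; first exact: leq_b1.
  rewrite leqn0 eqb0 -ltnNge; have : (u k <= v)%N by lia.
  rewrite -leq_sqr => h3; have := leq_mul (leqnn q) h3; lia.
have := sqr_sum_le (M + M) hu.
have : (be * (\sum_(0 <= i < M) a i) + al * (\sum_(0 <= j < M) b j) <= \sum_(0 <= k < M + M) u k)%N.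
  rewrite /u exchange_big /= !big_distrr /=.
  rewrite (eq_big_nat _ _ (F2 := fun i => \sum_(1 <= v < m.+1) (v <= be * a i))%N); last first.
    by move=> i /andP[_ iM]; rewrite level_sum // /m mulnC leq_mul2r leal ?orbT.
  rewrite [X in (_ + X <= _)%N](eq_big_nat _ _ (F2 := fun j => \sum_(1 <= v < m.+1) (v <= al * b j))%N); last first.
    by move=> j /andP[_ jM]; rewrite level_sum // /m leq_mul2l lebe ?orbT.
  rewrite exchange_big /= [X in (_ + X <= _)%N]exchange_big /= -big_split /=.
  by rewrite big_nat [X in (_ <= X)%N]big_nat; apply: leq_sum => v hv; apply: lev.
move: (\sum_(_ <= _ < _) a _)%N (\sum_(_ <= _ < _) b _)%N (\sum_(_ <= _ < _) u _)%N (\sum_(_ <= _ < _) c _)%N.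
move=> Sa Sb Su Sc h1 h2.
have m0 : (0 < m)%N by rewrite muln_gt0 al0.
rewrite -(leq_pmul2l m0); apply: leq_trans h2.
have h3 : ((be * Sa + al * Sb) ^ 2 <= Su ^ 2)%N by rewrite leq_sqr.
have h4 : (4 * (be * Sa * (al * Sb)) <= (be * Sa + al * Sb) ^ 2)%N.
  by rewrite mulnA -mulnA nat_AGM2.
have := leq_mul (leqnn q) (leq_trans h4 h3); rewrite /m; lia.
Qed.

Definition addseq (a b : seq nat) : seq nat := [seq (p.1 + p.2)%N | p <- zip a b].

Lemma size_addseq a b : size a = size b -> size (addseq a b) = size b.
Proof. by move=> e; rewrite size_map size_zip e minnn. Qed.

(** Slicing along the first coordinate: slices of A at i and of B at j feed the slices of C at i + j
    and at i + j + 1, and the inductive estimates are the hypothesis of [brunn_minkowski_line] with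
    q = 4 ^ d. The cube of bit vectors is essential: with A + B alone two single points would
    already violate the bound. *)
Theorem discrete_brunn_minkowski d (A B C : seq (seq nat)) :
  uniq A -> uniq B -> uniq C ->
  (forall a, a \in A -> size a = d) -> (forall b, b \in B -> size b = d) ->
  (forall a b (x : bitseq), a \in A -> b \in B -> size x = d ->
     addseq (addseq a b) (map nat_of_bool x) \in C) ->
  (4 ^ d * (size A * size B) <= size C ^ 2)%N.
Proof.
elim: d A B C => [|d IH] A B C uA uB uC sA sB hC.
  have small (X : seq (seq nat)) : uniq X -> (forall a, a \in X -> size a = 0%N) -> (size X <= 1)%N.
    move=> uX sX; apply: (@uniq_leq_size _ X [:: [::]]) => // x /sX /size0nil ->.
    by rewrite inE.
  have hA := small _ uA sA; have hB := small _ uB sB.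
  case: A uA sA hA hC => [|a A] uA sA hA hC; first by rewrite mul0n muln0.
  case: B uB sB hB hC => [|b B] uB sB hB hC; first by rewrite !muln0.
  have := hC a b [::] (mem_head _ _) (mem_head _ _) erefl.
  case: C {uC hC} => // c C _; apply: leq_trans (_ : 1 <= _)%N; last by rewrite expn_gt0.
  by rewrite mul1n; move: hA hB => /=; lia.
pose sl (X : seq (seq nat)) i := [seq behead a | a <- X & head 0%N a == i].
have slP (X : seq (seq nat)) (i : nat) (t : seq nat) : (forall a, a \in X -> (0 < size a)%N) -> (t \in sl X i) = (i :: t \in X).
  move=> sX; apply/mapP/idP => [[a]|h].
    rewrite mem_filter => /andP[/eqP hi aX] ->.
    by move: aX (sX _ aX); rewrite -hi; case: a {hi}.
  by exists (i :: t) => //; rewrite mem_filter /= eqxx.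
have sl_uniq X i : uniq X -> (forall a, a \in X -> (0 < size a)%N) -> uniq (sl X i).
  move=> uX sX; rewrite map_inj_in_uniq ?filter_uniq //.
  move=> x y; rewrite !mem_filter => /andP[/eqP hx xX] /andP[/eqP hy yX].
  by move: (sX _ xX) (sX _ yX) hx hy; case: x {xX} => //= ? ? ; case: y {yX} => //= ? ? _ _ -> -> ->.
(* C may contain words of any length; the empty one is discarded so that [behead] is injective on
   slices. *)
pose C' := [seq c <- C | (0 < size c)%N].
have uC' : uniq C' by rewrite filter_uniq.
have sC' c : c \in C' -> (0 < size c)%N by rewrite mem_filter => /andP[].
have sA' a : a \in A -> (0 < size a)%N by move/sA ->.
have sB' a : a \in B -> (0 < size a)%N by move/sB ->.
pose M := (\max_(a <- A ++ B) head 0%N a).+1.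
have hM a : a \in A ++ B -> (head 0%N a < M)%N by move=> ha; rewrite ltnS; apply: leq_bigmax_seq.
have szsl X L : size [seq a <- X | (head 0%N a < L)%N] = (\sum_(0 <= i < L) size (sl X i))%N.
  rewrite size_filter -sum1_count big_seq_cond -big_seq_cond.
  under [RHS]eq_bigr => i _ do rewrite size_map size_filter -sum1_count big_mkcond /=.
  rewrite exchange_big /= big_mkcond; apply: eq_bigr => a _; rewrite -big_mkcond /=.
  rewrite (eq_bigl (pred1 (head 0%N a))) => [|i]; last by rewrite /= eq_sym.
  by rewrite sum1_count count_uniq_mem ?iota_uniq // mem_index_iota /=; case: ltnP.
have eA : size A = (\sum_(0 <= i < M) size (sl A i))%N.
  by rewrite -szsl; congr size; apply/esym/all_filterP/allP => a aA; apply: hM; rewrite mem_cat aA.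
have eB : size B = (\sum_(0 <= i < M) size (sl B i))%N.
  by rewrite -szsl; congr size; apply/esym/all_filterP/allP => a aA; apply: hM; rewrite mem_cat aA orbT.
have leC : (\sum_(0 <= k < M + M) size (sl C' k) <= size C)%N.
  by rewrite -szsl size_filter; apply: leq_trans (count_size _ _) _; rewrite size_filter count_size.
rewrite eA eB expnS; apply: leq_trans (_ : (\sum_(0 <= k < M + M) size (sl C' k)) ^ 2 <= _)%N; last first.
  by rewrite leq_sqr.
apply: brunn_minkowski_line => i j iM jM.
have key (e : bool) : (4 ^ d * (size (sl A i) * size (sl B j)) <= size (sl C' (i + j + e)) ^ 2)%N.
  apply: IH; try by apply: sl_uniq.
  - by move=> a; rewrite slP // => /sA [].
  - by move=> a; rewrite slP // => /sB [].
  move=> a b x; rewrite !slP // => aA bB sx.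
  have := hC (i :: a) (j :: b) (e :: x) aA bB; rewrite /= sx => /(_ erefl) h.
  by rewrite mem_filter h.
by split; [have := key false; rewrite addn0 | have := key true; rewrite addn1].
Qed.

End DiscreteBrunnMinkowski.

From mathcomp Require Import reals mpoly polyrcf ring lra.
From mathcomp Require boolp.

Import Order.TTheory GRing.Theory Num.Theory.
Local Open Scope ring_scope.

(** * Divided differences *)

Section DividedDifferenceOperator.
Variables (R : idomainType) (n : nat).
Implicit Types (f g : {mpoly R[n]}) (i j k : 'I_n) (m : 'X_{1..n}).

Lemma msym_XU (s : 'S_n) i : msym s 'X_i = 'X_(s i) :> {mpoly R[n]}.
Proof.
rewrite msymX; congr 'X_[_]; apply/mnmP => k; rewrite !mnmE.
by rewrite -(inj_eq (@perm_inj _ s)) permKV.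
Qed.

Lemma mpolyXB_neq0 i j : i != j -> 'X_i - 'X_j != 0 :> {mpoly R[n]}.
Proof.
move=> ij; apply/eqP => /(congr1 (mcoeff U_(i)%MM)) /eqP.
rewrite mcoeffB !mcoeffXU eqxx (eq_sym j) (negbTE ij) subr0 mcoeff0.
by rewrite oner_eq0.
Qed.

Lemma dd_subproof i j f :
  exists g, (i != j) ==> (g * ('X_i - 'X_j) == f - msym (tperm i j) f).
Proof.
case: (eqVneq i j) => [_|ij]; first by exists 0.
by have [g hg] := divdiff_exists f ij; exists g; rewrite /= hg.
Qed.

(** Total in i and j: for i = j the implication in [dd_subproof] leaves the value arbitrary. The
    lock prevents unfolding of the choice. *)
Definition dd i j f : {mpoly R[n]} :=
  locked (xchoose (dd_subproof i j f)).

Lemma ddP i j f : i != j -> is_divdiff i j f (dd i j f).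
Proof.
by move=> ij; rewrite /dd -lock; have /implyP/(_ ij)/eqP := xchooseP (dd_subproof i j f).
Qed.

Lemma ddE i j f g : i != j -> is_divdiff i j f g -> dd i j f = g.
Proof. by move=> ij; apply: divdiff_unique => //; apply: ddP. Qed.

Lemma dd_is_linear i j : i != j -> linear (dd i j).
Proof.
move=> ij c f g; apply: ddE => //; rewrite /is_divdiff mulrDl -scalerAl.
refine (etrans (congr2 +%R (congr1 (GRing.scale c) (ddP f ij)) (ddP g ij)) _).
by rewrite msymD msymZ scalerBr opprD addrACA.
Qed.

Lemma ddD i j f g : i != j -> dd i j (f + g) = dd i j f + dd i j g.
Proof. by move=> ij; have := dd_is_linear ij 1 f g; rewrite !scale1r. Qed.

Lemma dd0 i j : i != j -> dd i j 0 = 0.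
Proof. by move=> ij; apply: ddE => //; rewrite /is_divdiff mul0r msym0 subr0. Qed.

Lemma ddZ i j c f : i != j -> dd i j (c *: f) = c *: dd i j f.
Proof. by move=> ij; have := dd_is_linear ij c f 0; rewrite dd0 // !addr0. Qed.

Lemma ddN i j f : i != j -> dd i j (- f) = - dd i j f.
Proof. by move=> ij; rewrite -scaleN1r ddZ // scaleN1r. Qed.

Lemma dd_sum i j (I : Type) (r : seq I) (P : pred I) (F : I -> {mpoly R[n]}) :
  i != j -> dd i j (\sum_(x <- r | P x) F x) = \sum_(x <- r | P x) dd i j (F x).
Proof. by move=> ij; apply: (big_morph _ (fun f g => ddD f g ij) (dd0 ij)). Qed.

Lemma dd_sym i j f : i != j -> msym (tperm i j) (dd i j f) = dd i j f.
Proof.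
move=> ij; have nz := mpolyXB_neq0 ij; apply: (mulIf nz); rewrite ddP //.
have := congr1 (msym (tperm i j)) (ddP f ij).
rewrite msymM !msymB !msym_XU tpermL tpermR -msymMm tperm2 msym1m => h.
by apply: oppr_inj; rewrite -mulrN !opprB.
Qed.

Lemma dd_eq0P i j f : i != j -> dd i j f = 0 <-> msym (tperm i j) f = f.
Proof.
move=> ij; split=> h.
  by have := ddP f ij; rewrite h /is_divdiff mul0r => /esym/eqP; rewrite subr_eq0 => /eqP.
by apply: ddE => //; rewrite /is_divdiff mul0r h subrr.
Qed.

Lemma ddM i j f g : i != j ->
  dd i j (f * g) = dd i j f * g + msym (tperm i j) f * dd i j g.
Proof.
move=> ij; apply: ddE => //; rewrite /is_divdiff mulrDl mulrAC ddP // -mulrA ddP //.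
rewrite msymM; ring.
Qed.

(** Possible exponents m' after a divided difference of the monomial m. The strict bound by the
    larger of the two old exponents is what keeps Schubert exponents inside the staircase. *)
Definition dd_rel i j m m' : Prop :=
  [/\ forall k, k != i -> k != j -> m' k = m k,
      (m' i < maxn (m i) (m j))%N, (m' j < maxn (m i) (m j))%N
    & (m' i + m' j).+1 = (m i + m j)%N].

Lemma dd_supp_monomial i j m : i != j -> (m j <= m i)%N ->
  exists2 g, is_divdiff i j ('X_[m] : {mpoly R[n]}) g & forall m', m' \in msupp g -> dd_rel i j m m'.
Proof.
move=> ij le_ji; pose b := m j; pose c := (m i - m j)%N.
pose M (a q : nat) := [multinom if l == i then a - q else if l == j then b + q else m l | l < n]%N.
exists (\sum_(0 <= q < c) 'X_[M (b + c).-1 q]); last first.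
  rewrite big_seq; apply: (big_ind (fun g : {mpoly R[n]} =>
    forall m', m' \in msupp g -> dd_rel i j m m')).
  - by move=> m'; rewrite msupp0.
  - by move=> p p' hp hq m' /msuppD_le; rewrite mem_cat => /orP[/hp|/hq].
  move=> q; rewrite mem_index_iota => /andP[_ kc] m'; rewrite msuppX inE => /eqP ->.
  move: kc le_ji; rewrite /dd_rel /M !mnmE eqxx (eq_sym j) (negbTE ij) eqxx /b /c.
  move: (m i) (m j) => x y kc le_ji; split; try lia.
  by move=> l li lj; rewrite mnmE (negbTE li) (negbTE lj).
rewrite /is_divdiff msymX mulr_suml.
have step q : (0 <= q < c)%N -> 'X_[R, M (b + c).-1 q] * ('X_i - 'X_j)
    = - ('X_[M (b + c)%N q.+1] - 'X_[M (b + c)%N q]).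
  move=> /andP[_ kc]; rewrite opprB mulrBr -!mpolyXD; congr (_ - _).
    congr 'X_[_]; apply/mnmP => l; rewrite !mnmE.
    by case: (eqVneq l i) => _; [lia | rewrite addn0].
  congr 'X_[_]; apply/mnmP => l; rewrite !mnmE.
  case: (eqVneq l i) => [->|_]; first by rewrite (eq_sym j i) (negbTE ij); lia.
  by case: (eqVneq l j) => _; lia.
rewrite big_nat (eq_bigr _ step) -big_nat sumrN telescope_sumr // opprB.
congr (_ - _).
  congr 'X_[_]; apply/mnmP => l; rewrite !mnmE subn0 addn0 /b /c subnKC //.
  by case: eqP => [->//|_]; case: eqP => [->|].
congr 'X_[_]; apply/mnmP => l; rewrite !mnmE tpermV /b /c.
case: tpermP => [->|->|/eqP li /eqP lj].
- by rewrite eqxx; lia.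
- by rewrite eq_sym (negbTE ij) eqxx; lia.
- by rewrite (negbTE li) (negbTE lj).
Qed.

Lemma dd_supp i j f m' : i != j -> m' \in msupp (dd i j f) ->
  exists2 m, m \in msupp f & dd_rel i j m m'.
Proof.
move=> ij.
suff [g hg gP] : exists2 g, is_divdiff i j f g &
    forall m', m' \in msupp g -> exists2 m, m \in msupp f & dd_rel i j m m'.
  by rewrite (ddE ij hg); apply: gP.
pose K (p : {mpoly R[n]}) := exists2 g, is_divdiff i j p g &
  forall m', m' \in msupp g -> exists2 m, m \in msupp f & dd_rel i j m m'.
rewrite -/(K f) [f in K f]mpolyE big_seq; apply: (big_ind K).
- by exists 0; [rewrite /is_divdiff mul0r msym0 subr0 | move=> m1; rewrite msupp0].
- move=> p q [g hg gP] [g' hg' gP']; exists (g + g').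
    by rewrite /is_divdiff mulrDl hg hg' msymD opprD addrACA.
  by move=> m1 /msuppD_le; rewrite mem_cat => /orP[/gP|/gP'].
move=> m hm.
suff [g hg gP] : exists2 g, is_divdiff i j ('X_[m] : {mpoly R[n]}) g &
    forall m', m' \in msupp g -> dd_rel i j m m'.
  exists (f@_m *: g).
    by rewrite /is_divdiff -scalerAl hg msymZ scalerBr.
  by move=> m1 /msuppZ_le /gP h; exists m.
have [le_ji|lt_ij] := leqP (m j) (m i); first exact: dd_supp_monomial.
pose m2 := [multinom m (tperm i j k) | k < n].
have [|g hg gP] := @dd_supp_monomial i j m2 ij.
  by rewrite !mnmE tpermL tpermR ltnW.
exists (- g).
  rewrite /is_divdiff mulNr hg !msymX opprB tpermV; congr ('X_[_] - 'X_[_]).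
  by apply/mnmP => k; rewrite !mnmE tpermK.
move=> m1; rewrite (perm_mem (msuppN g)) => /gP; rewrite /dd_rel /m2 !mnmE tpermL tpermR.
rewrite (maxnC (m j)) (addnC (m j)) => -[h1 h2 h3 h4]; split => // k ki kj.
by rewrite h1 // mnmE tpermD // eq_sym.
Qed.

Lemma msym_mulXB (s : 'S_n) g h i j i' j' : s i = i' -> s j = j' ->
  g * ('X_i - 'X_j) = h -> msym s g * ('X_i' - 'X_j') = msym s h.
Proof. by move=> <- <- <-; rewrite -!msym_XU -msymB -msymM. Qed.

(** The computation behind the braid relation in plain letters: [f1], [f2], [f21], [f12], [f121]
    stand for the images of f under words in the two transpositions, and x, y, z for the three
    differences of variables. *)
Lemma dd_braid_subproof (A : comPzRingType) (a b c a2 b1 a12 f f1 f2 f21 f12 f121 x y z : A) :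
  z = x + y -> a * x = f - f1 -> b * y = a - a2 -> c * x = b - b1 ->
  b1 * z = a - a12 -> a2 * z = f2 - f21 -> a12 * y = f12 - f121 ->
  c * (x * y * z) = f - f1 - f2 + f21 + f12 - f121.
Proof.
move=> hz h1 h2 h3 h4 h5 h6.
have -> : c * (x * y * z) = (c * x) * y * z by ring.
rewrite h3.
have -> : (b - b1) * y * z = (b * y) * z - (b1 * z) * y by ring.
rewrite h2 h4 hz.
have -> : (a - a2) * (x + y) - (a - a12) * y = a * x - a2 * (x + y) + a12 * y by ring.
rewrite -hz h1 h5 h6; ring.
Qed.

(* Both sides of the braid relation equal the antisymmetrization of f divided
   by the Vandermonde product of the three variables. *)
Lemma dd_braid_antisym i j k f : i != j -> j != k -> i != k ->
  dd i j (dd j k (dd i j f)) * (('X_i - 'X_j) * ('X_j - 'X_k) * ('X_i - 'X_k))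
  = f - msym (tperm i j) f - msym (tperm j k) f
    + msym (tperm j k) (msym (tperm i j) f) + msym (tperm i j) (msym (tperm j k) f)
    - msym (tperm i j) (msym (tperm j k) (msym (tperm i j) f)).
Proof.
move=> ij jk ik; set a := dd i j f; set b := dd j k a.
set s1 := msym (tperm i j); set s2 := msym (tperm j k).
have ti : tperm i j k = k by rewrite tpermD // eq_sym.
have tk : tperm j k i = i by rewrite tpermD // eq_sym.
have hs1a : s1 a = a by apply: dd_sym.
apply: (@dd_braid_subproof _ a b _ (s2 a) (s1 b) (s1 (s2 a))).
- by rewrite addrA subrK.
- exact: ddP.
- exact: ddP.
- exact: ddP.
- have -> : a - s1 (s2 a) = s1 (a - s2 a) by rewrite /s1 msymB -/s1 hs1a.
  by apply: (msym_mulXB (i := j) (j := k)); [exact: tpermR | exact: ti | exact: ddP].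
- have -> : s2 f - s2 (s1 f) = s2 (f - s1 f) by rewrite /s2 msymB.
  by apply: (msym_mulXB (i := i) (j := j)); [exact: tk | exact: tpermL | exact: ddP].
have -> : s1 (s2 f) - s1 (s2 (s1 f)) = s1 (s2 (f - s1 f)) by rewrite /s1 /s2 !msymB.
apply: (msym_mulXB (i := i) (j := k)); [exact: tpermL | exact: ti | ].
by apply: (msym_mulXB (i := i) (j := j)); [exact: tk | exact: tpermL | exact: ddP].
Qed.

Lemma dd_swap i j f : i != j -> dd j i f = - dd i j f.
Proof.
move=> ij; apply: ddE; first by rewrite eq_sym.
by rewrite /is_divdiff tpermC -(ddP f ij) mulNr -mulrN opprB.
Qed.

(** Exchanging i and k negates each of the three divided differences and each of the three factors
    of the denominator, so the antisymmetrization formula for (k, j, i) describes the right-hand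
    side. *)
Lemma dd_braid i j k f : i != j -> j != k -> i != k ->
  dd i j (dd j k (dd i j f)) = dd j k (dd i j (dd j k f)).
Proof.
move=> ij jk ik; have ji : j != i by rewrite eq_sym.
have kj : k != j by rewrite eq_sym. have ki : k != i by rewrite eq_sym.
have h1 := dd_braid_antisym f ij jk ik.
have h2 := dd_braid_antisym f kj ji ki.
have e : dd k j (dd j i (dd k j f)) = - dd j k (dd i j (dd j k f)).
  by rewrite !(dd_swap _ jk) !(dd_swap _ ij) !ddN // opprK.
have nz : ('X_i - 'X_j) * ('X_j - 'X_k) * ('X_i - 'X_k) != 0 :> {mpoly R[n]}.
  by rewrite !mulf_neq0 // mpolyXB_neq0.
apply: (mulIf nz); refine (etrans h1 _); symmetry.
have e2 : dd j k (dd i j (dd j k f)) * (('X_i - 'X_j) * ('X_j - 'X_k) * ('X_i - 'X_k))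
  = dd k j (dd j i (dd k j f)) * (('X_k - 'X_j) * ('X_j - 'X_i) * ('X_k - 'X_i)).
  by rewrite e; move: (dd j k _) ('X_i) ('X_j) ('X_k) => u x y z; ring.
refine (etrans e2 (etrans h2 _)); rewrite (tpermC k j) (tpermC j i).
have -> : msym (tperm i j) (msym (tperm j k) (msym (tperm i j) f))
        = msym (tperm j k) (msym (tperm i j) (msym (tperm j k) f)).
  rewrite -!msymMm !mulgA; congr (msym _ f).
  have -> : (tperm i j * tperm j k * tperm i j = tperm j k ^ tperm i j)%g.
    by rewrite conjgE tpermV mulgA.
  have -> : (tperm j k * tperm i j * tperm j k = tperm i j ^ tperm j k)%g.
    by rewrite conjgE tpermV mulgA.
  by rewrite !tpermJ tpermL tpermR !tpermD // eq_sym.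
have reorder (A : comPzRingType) (x0 x1 x2 x3 x4 x5 : A) :
  x0 - x1 - x2 + x3 + x4 - x5 = x0 - x2 - x1 + x4 + x3 - x5 by ring.
exact: reorder.
Qed.

Lemma dd_comm_subproof (A : comPzRingType) (p q a b a' b' f1 f2 f3 f0 x y z t : A) :
  a * (z - t) = f0 - f1 -> b * (x - y) = f0 - f2 -> p * (x - y) = a - a' ->
  q * (z - t) = b - b' -> a' * (z - t) = f2 - f3 -> b' * (x - y) = f1 - f3 ->
  p * ((x - y) * (z - t)) = q * ((x - y) * (z - t)).
Proof.
move=> h1 h2 h3 h4 h5 h6.
rewrite mulrA h3 mulrBl h1 h5 [X in q * X]mulrC mulrA h4 mulrBl h2 h6; ring.
Qed.

Lemma dd_comm i j k l f : i != j -> k != l -> i != k -> i != l -> j != k -> j != l ->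
  dd i j (dd k l f) = dd k l (dd i j f).
Proof.
move=> ij kl ik il jk jl.
have comm_t : (tperm k l * tperm i j = tperm i j * tperm k l)%g.
  apply: (mulgI (tperm i j)^-1%g); rewrite mulKg mulgA -mulgA -conjgE tpermJ.
  by rewrite !tpermD.
have h1 := ddP f kl; have h2 := ddP f ij; have h3 := ddP (dd k l f) ij.
have h4 := ddP (dd i j f) kl.
have h5 : msym (tperm i j) (dd k l f) * ('X_k - 'X_l)
    = msym (tperm i j) f - msym (tperm k l * tperm i j)%g f.
  by rewrite msymMm -msymB; apply: msym_mulXB h1; rewrite tpermD.
have h6 : msym (tperm k l) (dd i j f) * ('X_i - 'X_j)
    = msym (tperm k l) f - msym (tperm k l * tperm i j)%g f.
  by rewrite comm_t msymMm -msymB; apply: msym_mulXB h2; rewrite tpermD // eq_sym.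
have nz : ('X_i - 'X_j) * ('X_k - 'X_l) != 0 :> {mpoly R[n]}.
  by rewrite mulf_neq0 // mpolyXB_neq0.
apply: (mulIf nz); exact: dd_comm_subproof h1 h2 h3 h4 h5 h6.
Qed.

End DividedDifferenceOperator.

(** * Schubert polynomials *)

Section SchubertPolynomial.
Variables (R : idomainType) (n : nat).
Implicit Types (f g : {mpoly R[n]}) (i j k l : 'I_n) (m : 'X_{1..n}) (w v : 'S_n).

Lemma neq_succ i j : j = i.+1 :> nat -> i != j.
Proof. by move=> ij; apply/eqP => e; move: ij; rewrite e; lia. Qed.

Lemma schubert_step w i j f : is_schubert w f -> j = i.+1 :> nat -> (w j < w i)%N ->
  is_schubert (tperm i j * w)%g (dd i j f).
Proof.
by move=> hf ij wij; apply: (SchubertStep hf ij wij); apply/ddP/neq_succ.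
Qed.

Lemma schubert_inv w f : is_schubert w f ->
  (w = longest_perm n /\ f = 'X_[staircase n]) \/
  exists i j f', [/\ j = i.+1 :> nat, (w i < w j)%N,
    is_schubert (tperm i j * w)%g f' & f = dd i j f'].
Proof.
case=> [|w' i j f' g hf ij wij hg]; [by left | right].
exists i, j, f'; rewrite !permM tpermL tpermR mulgA tperm2 mul1g; split=> //.
by rewrite (ddE (neq_succ ij) hg).
Qed.

(** Exchanging the values at an ascent lowers it, so it is an induction measure towards the longest
    permutation, where the recursion starts. *)
Definition pos_weight w := (\sum_(k < n) k * w k)%N.

Lemma pos_weight_lt w i j : j = i.+1 :> nat -> (w i < w j)%N ->
  (pos_weight (tperm i j * w)%g < pos_weight w)%N.
Proof.
move=> ij lt_ij; have neq_ij := neq_succ ij; have neq_ji : j != i by rewrite eq_sym.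
rewrite /pos_weight (bigD1 i) // (bigD1 j) //= [ltnRHS](bigD1 i) // [in ltnRHS](bigD1 j) //=.
rewrite !permM tpermL tpermR.
rewrite (eq_bigr (fun k : 'I_n => k * w k)%N); last first.
  by move=> k /andP[ki kj]; rewrite permM tpermD // eq_sym.
by rewrite !addnA ltn_add2r ij; move: lt_ij; nia.
Qed.

(** Three consecutive positions carry increasing values. Reversing the three values gives a common
    ancestor F; from it each of the two immediate ancestors of w is reached by two divided
    differences. *)
Lemma schubert_adjacent w i j l (F : {mpoly R[n]}) :
  j = i.+1 :> nat -> l = j.+1 :> nat -> (w i < w j)%N -> (w j < w l)%N ->
  is_schubert (tperm i l * w)%g F ->
  is_schubert (tperm i j * w)%g (dd j l (dd i j F)) /\
  is_schubert (tperm j l * w)%g (dd i j (dd j l F)).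
Proof.
move=> ij jl wij wjl hF; have nij := neq_succ ij; have njl := neq_succ jl.
have nil : i != l by apply/eqP => e; move: jl; rewrite -e ij; lia.
have nji : j != i by rewrite eq_sym. have nlj : l != j by rewrite eq_sym.
have nli : l != i by rewrite eq_sym.
have vi : (tperm i l * w)%g i = w l by rewrite permM tpermL.
have vl : (tperm i l * w)%g l = w i by rewrite permM tpermR.
have vj : (tperm i l * w)%g j = w j by rewrite permM tpermD.
split.
  have h1 : is_schubert (tperm i j * (tperm i l * w))%g (dd i j F).
    by apply: schubert_step => //; rewrite vi vj.
  have e1 : (tperm i j * (tperm i l * w))%g l = w i by rewrite permM tpermD.
  have e2 : (tperm i j * (tperm i l * w))%g j = w l by rewrite permM tpermR.
  have lt : ((tperm i j * (tperm i l * w))%g l < (tperm i j * (tperm i l * w))%g j)%N.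
    by rewrite e1 e2 (ltn_trans wij wjl).
  have := schubert_step h1 jl lt.
  congr is_schubert; rewrite !mulgA; congr (_ * _)%g.
  have -> : tperm i l = (tperm j l ^ tperm i j)%g by rewrite tpermJ tpermR tpermD.
  by rewrite conjgE tpermV !mulgA -(mulgA (tperm j l)) tperm2 mulg1 tperm2 mul1g.
have h1 : is_schubert (tperm j l * (tperm i l * w))%g (dd j l F).
  by apply: schubert_step => //; rewrite vl vj.
have e1 : (tperm j l * (tperm i l * w))%g i = w l by rewrite permM tpermD.
have e2 : (tperm j l * (tperm i l * w))%g j = w i by rewrite permM tpermL.
have lt : ((tperm j l * (tperm i l * w))%g j < (tperm j l * (tperm i l * w))%g i)%N.
  by rewrite e1 e2 (ltn_trans wij wjl).
have := schubert_step h1 ij lt.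
congr is_schubert; rewrite !mulgA; congr (_ * _)%g.
have -> : tperm i l = (tperm i j ^ tperm j l)%g by rewrite tpermJ tpermL tpermD.
by rewrite conjgE tpermV !mulgA -(mulgA (tperm i j)) tperm2 mulg1 tperm2 mul1g.
Qed.

(** A diamond argument on the last steps of the two derivations, at ascents i and k of w. Equal
    ascents follow by induction; for neighbouring or distant ones a common ancestor exists by
    [schubert_exists], and the two ways down agree by [dd_braid] or [dd_comm]. *)
Lemma schubert_unique w f g : is_schubert w f -> is_schubert w g -> f = g.
Proof.
have [N] := ubnP (pos_weight w); elim: N w f g => // N IH w f g ltN.
have IHi i j : j = i.+1 :> nat -> (w i < w j)%N -> forall f1 f2,
    is_schubert (tperm i j * w)%g f1 -> is_schubert (tperm i j * w)%g f2 -> f1 = f2.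
  move=> ij wij f1 f2; apply: IH.
  exact: leq_trans (pos_weight_lt ij wij) ltN.
have no_asc i j : j = i.+1 :> nat -> (w i < w j)%N -> w <> longest_perm n.
  move=> ij wij e; move: wij; rewrite e !permE /= ij; have := ltn_ord j; lia.
move=> /schubert_inv[[-> ->]|[i [j [f' [ij wij hf ->]]]]].
  move=> /schubert_inv[[_ ->]//|[k [l [g' [kl wkl _ _]]]]].
  by move: wkl; rewrite !permE /= kl; have := ltn_ord l; lia.
move=> /schubert_inv[[e _]|[k [l [g' [kl wkl hg ->]]]]].
  by case: (no_asc _ _ ij wij).
have nij := neq_succ ij; have nkl := neq_succ kl.
have [eik|nik] := eqVneq i k.
  have ejl : j = l by apply/val_inj; rewrite /= ij kl eik.
  by rewrite -eik -ejl in hg *; rewrite (IHi _ _ ij wij _ _ hf hg).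
have [ejk|njk] := eqVneq j k.
  rewrite -ejk in kl wkl hg *.
  have [F hF] := schubert_exists R (tperm i l * w)%g.
  have [h1 h2] := schubert_adjacent ij kl wij wkl hF.
  rewrite (IHi _ _ ij wij _ _ hf h1) (IHi _ _ kl wkl _ _ hg h2).
  apply: dd_braid => //; first exact: neq_succ.
  by apply/eqP => e; move: kl; rewrite -e ij; lia.
have [eil|nil] := eqVneq i l.
  rewrite eil in ij wij hf *.
  have [F hF] := schubert_exists R (tperm k j * w)%g.
  have [h1 h2] := schubert_adjacent kl ij wkl wij hF.
  rewrite (IHi _ _ ij wij _ _ hf h2) (IHi _ _ kl wkl _ _ hg h1).
  apply/esym/dd_braid => //; first exact: neq_succ.
  by apply/eqP => e; move: ij; rewrite -e kl; lia.
have njl : j != l.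
  by apply/eqP => e; move/eqP: nik; apply; apply/val_inj => /=; move: ij kl; rewrite e => ->; lia.
have [F hF] := schubert_exists R (tperm i j * (tperm k l * w))%g.
have comm_t : (tperm k l * tperm i j = tperm i j * tperm k l)%g.
  by apply: (mulgI (tperm i j)^-1%g); rewrite mulKg mulgA -mulgA -conjgE tpermJ !tpermD.
have h1 : is_schubert (tperm k l * w)%g (dd i j F).
  have := schubert_step hF ij; rewrite !permM tpermL tpermR !tpermD 1?eq_sym // wij.
  by move=> /(_ isT); rewrite !mulgA tperm2 mul1g.
have h2 : is_schubert (tperm i j * w)%g (dd k l F).
  have e1 : (tperm i j * (tperm k l * w))%g l = w k by rewrite !permM (tpermD nil njl) tpermR.
  have e2 : (tperm i j * (tperm k l * w))%g k = w l by rewrite !permM (tpermD nik njk) tpermL.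
  have := schubert_step hF kl; rewrite e1 e2 => /(_ wkl).
  by rewrite !mulgA comm_t -(mulgA (tperm i j)) tperm2 mulg1.
rewrite (IHi _ _ ij wij _ _ hf h2) (IHi _ _ kl wkl _ _ hg h1).
by apply: dd_comm.
Qed.

Definition Sch w : {mpoly R[n]} := locked (sval (boolp.cid (schubert_exists R w))).

Lemma SchP w : is_schubert w (Sch w).
Proof. by rewrite /Sch -lock; apply: svalP. Qed.

Lemma SchE w f : is_schubert w f -> Sch w = f.
Proof. by move=> hf; apply: schubert_unique hf; apply: SchP. Qed.

Lemma dd_Sch_desc w i j : j = i.+1 :> nat -> (w j < w i)%N ->
  dd i j (Sch w) = Sch (tperm i j * w)%g.
Proof. by move=> ij wij; apply/esym/SchE/schubert_step => //; apply: SchP. Qed.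

Lemma dd_Sch_asc w i j : j = i.+1 :> nat -> (w i < w j)%N -> dd i j (Sch w) = 0.
Proof.
move=> ij wij; apply/dd_eq0P; first exact: neq_succ.
have -> : w = (tperm i j * (tperm i j * w))%g by rewrite mulgA tperm2 mul1g.
rewrite -dd_Sch_desc //; first by apply: dd_sym; apply: neq_succ.
by rewrite !permM tpermL tpermR.
Qed.

Lemma Sch_ind (P : 'S_n -> Prop) :
  P (longest_perm n) ->
  (forall w i j, j = i.+1 :> nat -> (w j < w i)%N -> P w -> P (tperm i j * w)%g) ->
  forall w, P w.
Proof.
move=> h0 hS w; have := SchP w; move: (Sch w) => f.
by elim=> {w f} // w i j f g _ hw ij wij _; apply: hS.
Qed.

Lemma Sch_longest : Sch (longest_perm n) = 'X_[staircase n].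
Proof. by apply: SchE; apply: SchubertLongest. Qed.

(** The Lehmer code; its sum [len] is the number of inversions. *)
Definition code w i := #|[set j : 'I_n | (i < j)%N && (w j < w i)%N]|.
Definition len w := (\sum_(i < n) code w i)%N.

Lemma len_step w i j : j = i.+1 :> nat -> (w j < w i)%N ->
  (len (tperm i j * w)%g).+1 = len w.
Proof.
move=> ij wij; have nij := neq_succ ij; have nji : j != i by rewrite eq_sym.
set v := (tperm i j * w)%g.
have ck k : k != i -> k != j -> code v k = code w k.
  move=> ki kj; rewrite /code -(card_imset _ (@perm_inj _ (tperm i j))).
  apply: eq_card => x; rewrite inE -[x in LHS](tpermK i j) mem_imset; last exact: perm_inj.
  rewrite inE !permM tpermK (tpermD (x := i) (y := j) (z := k)) 1?eq_sym //; congr (_ && _).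
  have hk1 : (k != i :> nat) by []. have hk2 : (k != j :> nat) by [].
  by case: tpermP => [->|->|//]; lia.
have ci : code v i = code w j.
  rewrite /code; apply: eq_card => x; rewrite !inE !permM tpermL.
  have [->|xj] := eqVneq x j; first by rewrite tpermR ltnn; lia.
  have [->|xi] := eqVneq x i; first by lia.
  rewrite tpermD 1?eq_sym //; congr (_ && _).
  have : (x != j :> nat) by []. by lia.
have cj : (code v j).+1 = code w i.
  rewrite /code (cardsD1 j [set x : 'I_n | (i < x)%N && _]) !inE wij ij ltnSn add1n; congr _.+1.
  apply: eq_card => x; rewrite !inE !permM tpermR.
  have [->|xj] := eqVneq x j; first by lia.
  have [->|xi] := eqVneq x i; first by lia.
  rewrite tpermD 1?eq_sym //=; congr (_ && _).
  have : (x != j :> nat) by []. by lia.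
rewrite /len (bigD1 i) // (bigD1 j) //= [RHS](bigD1 i) // (bigD1 j) //= ci -cj.
rewrite (eq_bigr (code w)); last by move=> k /andP[ki kj]; apply: ck.
by rewrite addSn addnCA.
Qed.

Lemma mdeg_dd_rel i j m m' : i != j -> dd_rel i j m m' -> (mdeg m').+1 = mdeg m.
Proof.
move=> ij [h1 _ _ h4]; rewrite !mdegE (bigD1 i) // (bigD1 j) 1?eq_sym //=.
rewrite [RHS](bigD1 i) // (bigD1 j) 1?eq_sym //= !addnA -h4 addSn; congr (_ + _).+1.
by apply: eq_bigr => k /andP[ki kj]; apply: h1.
Qed.

Lemma Sch_homog w : Sch w \is (len w).-homog.
Proof.
elim/Sch_ind: w => [|w i j ij wij hw].
  rewrite Sch_longest dhomogX /= mdegE /len; apply/eqP/eq_bigr => i _.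
  rewrite mnmE /code.
  have -> : [set j : 'I_n | (i < j)%N && (longest_perm n j < longest_perm n i)%N]
     = [set j : 'I_n | (i < j)%N].
    by apply/setP => j; rewrite !inE !permE /=; have := ltn_ord j; lia.
  rewrite cardsE -sum1_card -(big_mkord (fun j : nat => (i < j)%N) (fun=> 1%N)).
  rewrite (@big_cat_nat _ _ _ i.+1) //= big_nat_cond big_pred0 => [|j]; last by lia.
  transitivity (\sum_(i.+1 <= j < n) 1)%N; first by rewrite sum_nat_const_nat muln1.
  by rewrite add0n big_nat_cond [RHS]big_nat_cond; apply: eq_bigl => j; lia.
rewrite -dd_Sch_desc //; apply/dhomogP => m'.
move=> /(dd_supp (neq_succ ij))[m hm /(mdeg_dd_rel (neq_succ ij))] /= e.
have /dhomogP/(_ _ hm) /= := hw; rewrite -(len_step ij wij) -e; lia.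
Qed.

Lemma Sch_exponent w m : m \in msupp (Sch w) -> forall k, (m k <= n - k.+1)%N.
Proof.
elim/Sch_ind: w m => [|w i j ij wij hw] m.
  by rewrite Sch_longest msuppX inE => /eqP -> k; rewrite mnmE.
rewrite -dd_Sch_desc // => /(dd_supp (neq_succ ij))[m1 /hw hm [h1 h2 h3 _]] k.
have hi := hm i; have hj := hm j.
have [->|ki] := eqVneq k i; first by lia.
have [->|kj] := eqVneq k j; first by lia.
by rewrite h1.
Qed.

End SchubertPolynomial.

Section LeadingVariable.
Variables (R : idomainType) (n : nat).
Implicit Types (i j k : 'I_n.+1) (w : 'S_n.+1).

(** One better than the staircase bound in the first variable. It ensures that multiplication by
    this variable, as in Monk's rule, keeps its exponent at most n, so that the weights in n - m 0
    never meet a truncated subtraction. *)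
Lemma Sch_exponent0 w m : (w ord0 < n)%N -> m \in msupp (Sch R w) -> (m ord0 < n)%N.
Proof.
elim/(@Sch_ind R): w m => [|w i j ij wij hw] m; first by rewrite permE /=; lia.
move=> w0; rewrite -dd_Sch_desc // => /(dd_supp (neq_succ ij))[m1 hm [h1 h2 h3 _]].
have hi := Sch_exponent hm i; have hj := Sch_exponent hm j.
have [i0|i0] := eqVneq i ord0; first by move: h2 hi hj; rewrite ij i0 /=; lia.
have j0 : j != ord0 by apply/eqP => e; move: ij; rewrite e.
by rewrite h1 1?eq_sym //; apply: hw hm; move: w0; rewrite permM tpermD.
Qed.

End LeadingVariable.

(** * Monk's rule *)

Section Covers.
Variable N : nat.
Implicit Types (i j k a b c p : 'I_N) (w : 'S_N).

(** Covers in the Bruhat order: exchanging the values at a < b raises the number of inversions by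
    exactly one. *)
Definition cov w a b :=
  [&& (a < b)%N, (w a < w b)%N &
    [forall c : 'I_N, ~~ [&& (a < c)%N, (c < b)%N, (w a < w c)%N & (w c < w b)%N]]].

Lemma covP w a b : reflect ([/\ (a < b)%N, (w a < w b)%N &
    forall c, (a < c)%N -> (c < b)%N -> (w a < w c)%N -> (w c < w b)%N -> False]) (cov w a b).
Proof.
apply: (iffP and3P) => -[-> -> h]; split=> //.
  by move=> c h1 h2 h3 h4; move/forallP/(_ c): h; rewrite h1 h2 h3 h4.
by apply/forallP => c; apply/negP => /and4P[]; apply: h.
Qed.

Lemma perm_neq w a b : (a != b :> nat) -> (w a != w b :> nat).
Proof. by apply: contra => /eqP/val_inj/perm_inj ->. Qed.

Lemma tperm_adj_cases i j c : [\/ c = i /\ tperm i j c = j, c = j /\ tperm i j c = i |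
  [/\ (c != i :> nat), (c != j :> nat) & tperm i j c = c]].
Proof.
case: tpermP => [->|->|/eqP ci /eqP cj]; [by constructor 1|by constructor 2|constructor 3].
by split.
Qed.

Lemma tperm_adj_lt i j a b : j = i.+1 :> nat -> (a < b)%N ->
  ~~ ((a == i :> nat) && (b == j :> nat)) -> (tperm i j a < tperm i j b)%N.
Proof.
move=> ij ab; case: (tperm_adj_cases i j a) => [[? ->]|[? ->]|[? ? ->]];
case: (tperm_adj_cases i j b) => [[? ->]|[? ->]|[? ? ->]]; subst; lia.
Qed.

Lemma tperm_adj_ltV i j a c : j = i.+1 :> nat -> (tperm i j a < tperm i j c)%N ->
  (a < c)%N \/ a = j /\ c = i.
Proof.
move=> ij h; have [ac|ca|e] := ltngtP a c; [by left| |by move: h; rewrite (val_inj e) ltnn].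
have [/andP[/eqP ci /eqP aj]|nca] := boolP ((c == i :> nat) && (a == j :> nat)).
  by right; split; apply: val_inj.
by have := ltn_trans h (tperm_adj_lt ij ca nca); rewrite ltnn.
Qed.

(** The combinatorial core of Monk's rule. A divided difference at i keeps the terms whose
    permutation descends at i; conjugation by the adjacent transposition matches them with the terms
    of the rule for the permutation obtained by removing the descent. The pair (i, j) itself is
    excluded and treated in [dd_monk_defect]. *)
Lemma cov_desc w i j a b : j = i.+1 :> nat -> (a < b)%N ->
  ~~ ((a == i :> nat) && (b == j :> nat)) ->
  cov w a b && ((tperm a b * w)%g j < (tperm a b * w)%g i)%N =
  (w j < w i)%N && cov (tperm i j * w)%g (tperm i j a) (tperm i j b).
Proof.
move=> ij ab nab; have ltab := tperm_adj_lt ij ab nab.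
have lij : (i < j)%N by rewrite ij.
have ne (x y : 'I_N) : (x < y)%N -> x != y by move=> h; rewrite -val_eqE neq_ltn h.
have ne' (x y : 'I_N) : (x < y)%N -> y != x by move=> h; rewrite eq_sym ne.
have wlt x y : x != y -> ~~ (w x < w y)%N -> (w y < w x)%N.
  by rewrite -leqNgt leq_eqVlt val_eqE (inj_eq perm_inj) eq_sym => /negPf ->.
have adjl (x : 'I_N) : (i < x)%N -> x != j -> (j < x)%N.
  by move=> h nx; rewrite ltn_neqAle ij h andbT -ij eq_sym val_eqE.
have adjr (x : 'I_N) : (x < j)%N -> x != i -> (x < i)%N.
  by rewrite ij ltnS => h nx; rewrite ltn_neqAle h andbT val_eqE.
have nab' : a = i -> b != j by move=> ai; move: nab; rewrite ai eqxx.
rewrite !permM; apply/andP/andP.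
  move=> [/covP[_ lab nb] hd].
  have wij : (w j < w i)%N.
    have [ai|ai] := eqVneq a i.
      have jb := nab' ai; have ti : tperm a b i = b by rewrite -ai tpermL.
      have tj : tperm a b j = j by rewrite tpermD // ai; apply: ne.
      move: hd; rewrite ti tj => h; rewrite -ai; apply: wlt; first by rewrite ai; apply: ne.
      apply/negP => h'; apply: (nb j) => //; first by rewrite ai.
      by apply: adjl => //; rewrite -ai.
    have [bi|bi] := eqVneq b i.
      have ti : tperm a b i = a by rewrite -bi tpermR.
      have aj : (a < j)%N by apply: ltn_trans ab _; rewrite bi.
      have tj : tperm a b j = j by rewrite tpermD ?ne // bi.
      by move: hd; rewrite ti tj => h; rewrite -bi; apply: ltn_trans h lab.
    have [aj|aj] := eqVneq a j.
      have tj : tperm a b j = b by rewrite -aj tpermL.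
      by move: hd; rewrite tj tpermD // => h; rewrite -aj; apply: ltn_trans lab h.
    have [bj|bj] := eqVneq b j.
      have tj : tperm a b j = a by rewrite -bj tpermR.
      move: hd; rewrite tj tpermD // => h; rewrite -bj.
      apply: wlt; first by rewrite eq_sym.
      apply/negP => h'; apply: (nb i) => //; last by rewrite bj.
      by apply: adjr => //; rewrite -bj.
    by move: hd; rewrite !tpermD.
  split=> //; apply/covP; rewrite !permM !tpermK; split=> // c.
  rewrite permM; move: (tperm i j c) (tpermK i j c) => c' <- h1 h2 h3 h4.
  have [lac|[aj ci]] := tperm_adj_ltV ij h1; last first.
    have tj : tperm a b j = b by rewrite -aj tpermL.
    have bi : (i < b)%N by apply: ltn_trans lij _; rewrite -aj.
    have ti : tperm a b i = i by rewrite tpermD ?ne' // aj.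
    by move: hd; rewrite tj ti -ci ltnNge (ltnW h4).
  have [lcb|[cj bi]] := tperm_adj_ltV ij h2; last first.
    have ti : tperm a b i = a by rewrite -bi tpermR.
    have aj : (a < j)%N by apply: ltn_trans ab _; rewrite bi.
    have tj : tperm a b j = j by rewrite tpermD ?ne // bi.
    by move: hd; rewrite ti tj -cj ltnNge (ltnW h3).
  exact: (nb c').
move=> [wij /covP[_]]; rewrite !permM !tpermK => lab nb.
have nbb c : (tperm i j a < tperm i j c)%N -> (tperm i j c < tperm i j b)%N ->
    (w a < w c)%N -> (w c < w b)%N -> False.
  by move=> h1 h2 h3 h4; apply: (nb (tperm i j c)); rewrite ?permM ?tpermK.
split.
  apply/covP; split=> // c h1 h2 h3 h4; apply: (nbb c) => //; apply: (tperm_adj_lt ij) => //.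
    apply/negP => /andP[/eqP/val_inj ai /eqP/val_inj cj].
    by move: h3; rewrite cj ai ltnNge (ltnW wij).
  apply/negP => /andP[/eqP/val_inj ci /eqP/val_inj bj].
  by move: h4; rewrite ci bj ltnNge (ltnW wij).
have [ai|ai] := eqVneq a i.
  have jb := nab' ai; have ti : tperm a b i = b by rewrite -ai tpermL.
  have tj : tperm a b j = j by rewrite tpermD // ai; apply: ne.
  by rewrite ti tj; apply: ltn_trans wij _; rewrite -ai.
have [bi|bi] := eqVneq b i.
  have aj : (a < j)%N by apply: ltn_trans ab _; rewrite bi.
  have ti : tperm a b i = a by rewrite -bi tpermR.
  have tj : tperm a b j = j by rewrite tpermD ?ne // bi.
  have sa : tperm i j a = a by rewrite tpermD ?ne' // -bi.
  have sb : tperm i j b = j by rewrite bi tpermL.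
  rewrite ti tj; apply: wlt; first exact: ne.
  apply/negP => h; apply: (nbb j) => //; rewrite ?sa ?sb ?tpermR //; first by rewrite -bi.
  by rewrite bi.
have [aj|aj] := eqVneq a j.
  have ib : (i < b)%N by apply: ltn_trans lij _; rewrite -aj.
  have tj : tperm a b j = b by rewrite -aj tpermL.
  have sa : tperm i j a = i by rewrite aj tpermR.
  have sb : tperm i j b = b by rewrite tpermD ?ne // -aj.
  rewrite tj tpermD //; apply: wlt; first exact: ne.
  apply/negP => h; apply: (nbb i) => //; rewrite ?sa ?sb ?tpermL //; first by rewrite -aj.
  by rewrite aj.
have [bj|bj] := eqVneq b j.
  have tj : tperm a b j = a by rewrite -bj tpermR.
  by rewrite tj tpermD //; apply: ltn_trans lab _; rewrite bj.
by rewrite !tpermD.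
Qed.

End Covers.

Section Monk.
Variables (R : idomainType) (N : nat).
Implicit Types (i j k a b c p : 'I_N) (w : 'S_N).
Local Notation Sch := (Sch R).

Definition monk_term w k c : {mpoly R[N]} :=
  if cov w k c then Sch (tperm k c * w)%g
  else if cov w c k then - Sch (tperm k c * w)%g else 0.

Definition monk_defect w k : {mpoly R[N]} := 'X_k * Sch w - \sum_c monk_term w k c.

Lemma cov_asym w a b : cov w a b -> cov w b a = false.
Proof. by move=> /covP[h _ _]; apply/negP => /covP[h' _ _]; lia. Qed.

Lemma dd_Sch_if w i j : j = i.+1 :> nat ->
  dd i j (Sch w) = if (w j < w i)%N then Sch (tperm i j * w)%g else 0.
Proof.
move=> ij; case: ltnP => h; first exact: dd_Sch_desc.
apply: dd_Sch_asc => //; rewrite ltn_neqAle h andbT; apply: perm_neq; lia.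
Qed.

Lemma tperm_adj_mul i j k c w : (tperm i j * (tperm k c * w))%g =
  (tperm (tperm i j k) (tperm i j c) * (tperm i j * w))%g.
Proof.
rewrite -tpermJ conjgE tpermV !mulgA; congr (_ * _)%g.
by rewrite -!mulgA tperm2 mulg1.
Qed.

Lemma dd_monk_term w i j k c : j = i.+1 :> nat ->
  ~~ ((k == i :> nat) && (c == j :> nat)) -> ~~ ((k == j :> nat) && (c == i :> nat)) ->
  dd i j (monk_term w k c) =
  if (w j < w i)%N then monk_term (tperm i j * w)%g (tperm i j k) (tperm i j c) else 0.
Proof.
move=> ij n1 n2; have nij := neq_succ ij.
have [kc|ck|e] := ltngtP k c.
- have h := cov_desc w ij kc n1.
  have f1 : cov w c k = false by apply/negP => /covP[]; lia.
  have f2 : cov (tperm i j * w)%g (tperm i j c) (tperm i j k) = false.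
    by apply/negP => /covP[]; have := tperm_adj_lt ij kc n1; lia.
  rewrite /monk_term f1 f2; move: h.
  case: (cov w k c) => h; last by rewrite dd0 //; move: h; case: ifP => //= _ <-.
  rewrite dd_Sch_if // tperm_adj_mul; move: h; by case: ifP => /= h; case: ifP => //= h' <-.
- have n2' : ~~ ((c == i :> nat) && (k == j :> nat)) by rewrite andbC.
  have h := cov_desc w ij ck n2'.
  have f1 : cov w k c = false by apply/negP => /covP[]; lia.
  have f2 : cov (tperm i j * w)%g (tperm i j k) (tperm i j c) = false.
    by apply/negP => /covP[]; have := tperm_adj_lt ij ck n2'; lia.
  rewrite /monk_term f1 f2; move: h; rewrite tpermC.
  case: (cov w c k) => h; last by rewrite dd0 //; move: h; case: ifP => //= _ <-.
  rewrite ddN // dd_Sch_if // tpermC tperm_adj_mul; move: h.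
  rewrite tpermC [tperm (tperm i j c) _]tpermC; case: ifP => /= h.
    by move=> /esym/andP[-> ->].
  by rewrite oppr0; case: ifP => //= h' <-.
have -> : k = c by apply: val_inj.
have f u a : cov u a a = false by apply/negP => /covP[]; rewrite ltnn.
by rewrite /monk_term !f dd0 // if_same.
Qed.

Lemma cov_adj w i j : j = i.+1 :> nat -> cov w i j = (w i < w j)%N.
Proof.
move=> ij; apply/covP/idP => [[]//|h]; split=> //; first by lia.
by move=> c; lia.
Qed.

Lemma dd_X i j k : i != j -> dd i j 'X_k = (k == i)%:R - (k == j)%:R :> {mpoly R[N]}.
Proof.
move=> ij; have ji : j != i by rewrite eq_sym. apply: ddE => //; rewrite /is_divdiff msym_XU.
case: tpermP => [->|->|/eqP/negbTE -> /eqP/negbTE ->]; rewrite ?eqxx ?(negbTE ij) ?(negbTE ji).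
- by rewrite subr0 mul1r.
- by rewrite sub0r mulN1r opprB.
- by rewrite subrr mul0r subrr.
Qed.

(** The Leibniz rule. For k in {i, j} the difference quotient of the variable leaves an extra
    Schubert polynomial, which cancels against the term of index {i, j} that [dd_monk_term] leaves
    out. *)
Lemma dd_monk_defect w k i j : j = i.+1 :> nat ->
  dd i j (monk_defect w k) =
  if (w j < w i)%N then monk_defect (tperm i j * w)%g (tperm i j k) else 0.
Proof.
move=> ij; have nij := neq_succ ij; have nji : j != i by rewrite eq_sym.
have nwij : (w i != w j :> nat) by apply: perm_neq; lia.
rewrite /monk_defect ddD // ddN // ddM // dd_X // msym_XU dd_sum //.
have fji u : cov u j i = false by apply/negP => /covP[]; lia.
have tji : tperm j i = tperm i j by rewrite tpermC.
have s1 : (tperm i j * (tperm i j * w))%g = w by rewrite mulgA tperm2 mul1g.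
have [ki|ki] := eqVneq k i; [|have [kj|kj] := eqVneq k j].
- subst k; rewrite tpermL (negbTE nij) subr0 mul1r dd_Sch_if //.
  rewrite (bigD1 j) //= (eq_bigr (fun c => if (w j < w i)%N then
      monk_term (tperm i j * w)%g j (tperm i j c) else 0)); last first.
    by move=> c cj; rewrite dd_monk_term // ?tpermL // !val_eqE ?eqxx ?(negbTE cj) ?(negbTE nij).
  have -> : dd i j (monk_term w i j) = if (w j < w i)%N then 0 else Sch w.
    rewrite /monk_term cov_adj // fji; case: ltnP => h1; case: ltnP => h2; try by lia.
      by rewrite dd_Sch_desc ?s1 // !permM tpermL tpermR.
    by rewrite dd0.
  case: ltnP => h; last by rewrite mulr0 addr0 big1 // addr0 subrr.
  rewrite add0r [in RHS](reindex_inj (@perm_inj _ (tperm i j))) (bigD1 j) //= tpermR.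
  have -> : monk_term (tperm i j * w) j i = - Sch w.
    by rewrite /monk_term fji cov_adj // !permM tpermL tpermR h tji s1.
  by move: (Sch w) ('X_j * _) (\sum_(_ | _) _) => A B C; ring.
- subst k; rewrite tpermR sub0r mulN1r dd_Sch_if //.
  rewrite (bigD1 i) //= (eq_bigr (fun c => if (w j < w i)%N then
      monk_term (tperm i j * w)%g i (tperm i j c) else 0)); last first.
    by move=> c ci; rewrite dd_monk_term // ?tpermR // !val_eqE ?eqxx ?(negbTE ci) ?(negbTE nji) ?andbF.
  have -> : dd i j (monk_term w j i) = if (w j < w i)%N then 0 else - Sch w.
    rewrite /monk_term fji cov_adj // tji; case: ltnP => h1; case: ltnP => h2; try by lia.
      by rewrite ddN // dd_Sch_desc ?s1 // !permM tpermL tpermR.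
    by rewrite dd0.
  case: ltnP => h.
    rewrite add0r [in RHS](reindex_inj (@perm_inj _ (tperm i j))) (bigD1 i) //= tpermL.
    have -> : monk_term (tperm i j * w) i j = Sch w.
      by rewrite /monk_term cov_adj // !permM tpermL tpermR h s1.
    by move: (Sch w) ('X_i * _) (\sum_(_ | _) _) => A B C; ring.
  by rewrite mulr0 addr0 [\sum_(_ | _) _]big1 // addr0 subrr.
rewrite subrr mul0r add0r tpermD 1?eq_sym //.
rewrite (eq_bigr (fun c => if (w j < w i)%N then
    monk_term (tperm i j * w)%g k (tperm i j c) else 0)); last first.
  by move=> c _; rewrite dd_monk_term ?val_eqE ?(negbTE ki) ?(negbTE kj) // tpermD // eq_sym.
rewrite dd_Sch_if //; case: ltnP => h; last by rewrite mulr0 big1 // subr0.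
by rewrite [in RHS](reindex_inj (@perm_inj _ (tperm i j))).
Qed.

Lemma Sch_msupp_max w m k : k.+1 = N :> nat -> m \in msupp (Sch w) -> m k = 0%N.
Proof. by move=> kN /Sch_exponent/(_ k); lia. Qed.

(** Symmetry spreads the absence of the last variable to all variables, so E is constant. *)
Lemma symmetric_eq0 (E : {mpoly R[N]}) :
  (forall i j, j = i.+1 :> nat -> msym (tperm i j) E = E) ->
  (forall m k, k.+1 = N :> nat -> m \in msupp E -> m k = 0%N) ->
  E@_0 = 0 -> E = 0.
Proof.
move=> hs hN h0.
have h d : forall k, (N - k.+1 = d)%N -> forall m, m \in msupp E -> m k = 0%N.
  elim: d => [|d IH] k e m hm; first by apply: hN hm; have := ltn_ord k; lia.
  have kN : (k.+1 < N)%N by lia.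
  have := IH (Ordinal kN); rewrite /= => /(_ _ [multinom m (tperm k (Ordinal kN) l) | l < N]).
  rewrite mnmE tpermR; apply=> //=; first by lia.
  rewrite mcoeff_msupp.
  have <- : (msym (tperm k (Ordinal kN)) E)@_m = E@_[multinom m (tperm k (Ordinal kN) l) | l < N].
    by rewrite mcoeff_sym.
  by rewrite hs // -mcoeff_msupp.
apply/mpolyP => m; rewrite mcoeff0.
have [hm|] := boolP (m \in msupp E); last by rewrite mcoeff_msupp negbK => /eqP.
suff -> : m = 0%MM by [].
by apply/mnmP => k; rewrite mnm0E; apply: h hm.
Qed.

Lemma Sch_coeff0 w a b : (a < b)%N -> (w b < w a)%N -> (Sch w)@_0 = 0.
Proof.
move=> ab wab; apply: (dhomog_nemf_coeff (Sch_homog R w)); rewrite /= mdeg0 eq_sym -lt0n.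
rewrite /len (bigD1 a) //= addn_gt0 /code; apply/orP; left.
by apply/card_gt0P; exists b; rewrite inE ab.
Qed.

Lemma monk_termP (P : {mpoly R[N]} -> Prop) w k c : P 0 ->
  (cov w k c || cov w c k -> P (Sch (tperm k c * w)%g) /\ P (- Sch (tperm k c * w)%g)) ->
  P (monk_term w k c).
Proof.
rewrite /monk_term => h0; case: ifP => _ /=; first by case.
by case: ifP => _ //=; case.
Qed.

(** By induction on the length all divided differences of the defect vanish, so the defect is
    symmetric. The maximal value to the right of k keeps k away from the last variable, and it
    excludes a cover that would move the value at k beyond position N. *)
Lemma monk_defect0 w k p : (k < p)%N -> (w p).+1 = N -> monk_defect w k = 0.
Proof.
have [n] := ubnP (len w); elim: n w k p => // n IH w k p ltn kp wp.
apply: symmetric_eq0.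
- move=> i j ij; apply/dd_eq0P; first exact: neq_succ.
  rewrite dd_monk_defect //; case: ltnP => // wji.
  have := len_step ij wji => e.
  (* The pair (k, p) is not the descent (i, j), because the value at p is maximal; hence k stays to
     the left of p. *)
  apply: (IH _ _ (tperm i j p)); first by lia.
    apply: tperm_adj_lt => //; apply/negP => /andP[/eqP/val_inj ei /eqP/val_inj ej]; subst.
    by have := ltn_ord (w i); lia.
  by rewrite permM tpermK.
- move=> m l lN; apply: contraTeq; rewrite mcoeff_msupp negbK => ml.
  rewrite mcoeffB raddf_sum /= big1 => [|c _].
    rewrite subr0; rewrite mulrC mcoeff_eq0; apply/negP; rewrite (perm_mem (msuppMX _ _)).
    move=> /mapP[m' /Sch_msupp_max - /(_ l lN) m'l em]; move: ml.
    rewrite em mnmDE m'l mnm1E; case: (k =P l) => [kl|//]; move: kp; rewrite kl; have := ltn_ord p; lia.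
  have h v : (Sch v)@_m = 0.
    by apply: contraNeq ml; rewrite -mcoeff_msupp => /Sch_msupp_max ->.
  by apply: (monk_termP (P := fun f => f@_m = 0)); rewrite ?mcoeff0 ?mcoeffN ?h ?oppr0.
rewrite mcoeffB raddf_sum /= big1 => [|c _].
  rewrite subr0; apply/eqP; rewrite mulrC mcoeff_eq0 (perm_mem (msuppMX _ _)).
  apply/negP => /mapP[m' _ /(congr1 (fun m : 'X_{1..N} => m k))].
  by rewrite mnmDE mnm1E mnm0E eqxx.
apply: (monk_termP (P := fun f => f@_0 = 0)); rewrite ?mcoeff0 // mcoeffN.
have [kc|ck|/val_inj ->] := ltngtP k c.
- move=> /orP[/covP[_ h _]|/covP[]]; last by lia.
  by rewrite (@Sch_coeff0 _ k c) ?oppr0 // !permM tpermL tpermR.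
- move=> /orP[/covP[]|/covP[_ h _]]; first by lia.
  by rewrite (@Sch_coeff0 _ c k) ?oppr0 // !permM tpermL tpermR.
by move=> /orP[] /covP[]; rewrite ltnn.
Qed.

Lemma monk w k p : (k < p)%N -> (w p).+1 = N ->
  'X_k * Sch w = \sum_(c | cov w k c) Sch (tperm k c * w)%g
                 - \sum_(c | cov w c k) Sch (tperm k c * w)%g.
Proof.
move=> kp wp; have /eqP := monk_defect0 kp wp; rewrite /monk_defect subr_eq0 => /eqP ->.
rewrite [X in _ = X - _]big_mkcond [X in _ = _ - X]big_mkcond /= -sumrB.
apply: eq_bigr => c _; rewrite /monk_term.
by case: ifP => [/cov_asym ->|_]; rewrite ?subr0 // sub0r; case: ifP; rewrite ?oppr0.
Qed.

(** In the sum over a <= k a cover with both ends at most k occurs once with each sign and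
    cancels. *)
Lemma monk_sum w k p : (k < p)%N -> (w p).+1 = N ->
  (\sum_(a < N | (a <= k)%N) 'X_a) * Sch w =
  \sum_(a < N | (a <= k)%N) \sum_(b : 'I_N | (k < b)%N && cov w a b) Sch (tperm a b * w)%g.
Proof.
move=> kp wp; rewrite mulr_suml.
under eq_bigr => a ak do rewrite (monk (leq_ltn_trans ak kp) wp).
rewrite sumrB; apply/eqP; rewrite subr_eq; apply/eqP.
have split a : (a <= k)%N -> \sum_(c | cov w a c) Sch (tperm a c * w)%g =
   \sum_(b : 'I_N | (k < b)%N && cov w a b) Sch (tperm a b * w)%g +
   \sum_(b : 'I_N | (b <= k)%N && cov w a b) Sch (tperm a b * w)%g.
  move=> ak; rewrite (bigID (fun b : 'I_N => (k < b)%N)) /=; congr (_ + _); apply: eq_bigl => b.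
    by rewrite andbC.
  by rewrite -leqNgt andbC.
rewrite (eq_bigr _ split) big_split /=; congr (_ + _).
rewrite (exchange_big_dep (fun b : 'I_N => (b <= k)%N)) /=; last by move=> a b _ /andP[].
apply: eq_bigr => b bk; apply: eq_big => a; last by rewrite tpermC.
rewrite bk /=; apply/andP/idP => [[]//|h]; split=> //.
by move/covP: (h) => [ab _ _]; lia.
Qed.

End Monk.

(** * Permutations whose first value is maximal *)

Section Rotation.
Variables (R : idomainType) (n : nat).
Implicit Types (i j k : 'I_n.+1) (w : 'S_n.+1).

(** With products read from left to right, [cyc * w] lists w(1), ..., w(n), w(0). *)
Definition cyc : 'S_n.+1 := perm (@ordS_inj n.+1).

Lemma cycE k : (k < n)%N -> cyc k = k.+1 :> nat.
Proof. by move=> kn; rewrite permE /= modn_small. Qed.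

Lemma cyc_max : cyc ord_max = ord0.
Proof. by apply: val_inj; rewrite permE /= modnn. Qed.

Lemma cycV_succ i j : j = i.+1 :> nat -> cyc i = j.
Proof. by move=> ij; apply: val_inj; rewrite /= cycE //; have := ltn_ord j; lia. Qed.

Lemma divdiff_XU i j (m m' : 'X_{1..n.+1}) : j = i.+1 :> nat ->
  m i = (m' i).+1 -> m j = m' j -> m' i = m' j ->
  (forall k, k != i -> k != j -> m k = m' k) ->
  dd i j ('X_[m] : {mpoly R[n.+1]}) = 'X_[m'].
Proof.
move=> ij mi mj e mk; have nij := neq_succ ij; apply: ddE => //.
rewrite /is_divdiff mulrBr -!mpolyXD msymX; congr ('X_[_] - 'X_[_]); apply/mnmP => k;
  rewrite !(mnmDE, mnm1E) ?mnmE ?tpermV.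
  have [<-|ki] := eqVneq i k; first by rewrite mi addn1.
  have [->|kj] := eqVneq k j; first by rewrite addn0 mj.
  by rewrite addn0 mk // eq_sym.
case: tpermP => [->|->|/eqP ki /eqP kj]; rewrite ?eqxx ?(negbTE nij).
- by rewrite eq_sym (negbTE nij) mj addn0.
- by rewrite mi e addn1.
- by rewrite eq_sym (negbTE kj) addn0 mk.
Qed.

Lemma Sch_cyc_longest : Sch R (cyc * longest_perm n.+1)%g =
  'X_[[multinom (n - i.+1)%N | i < n.+1]].
Proof.
(* Exponents after the largest value of the longest permutation has been carried from position 0 to
   position k by adjacent steps. *)
pose e (k : nat) := [multinom (if (i < k)%N then n - i.+1 else n - i)%N | i < n.+1].
have [v [h1 h2 h4]] : exists v : 'S_n.+1, [/\ forall l : 'I_n.+1, (l < n)%N -> v l = (n - l.+1)%N :> nat,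
    v ord_max = n :> nat & Sch R v = 'X_[e n]].
  have h (k : nat) : (k <= n)%N -> exists v : 'S_n.+1, [/\ forall l : 'I_n.+1, (l < k)%N -> v l = (n - l.+1)%N :> nat,
      forall l : 'I_n.+1, l = k :> nat -> v l = n :> nat, forall l : 'I_n.+1, (k < l)%N -> v l = (n - l)%N :> nat
      & Sch R v = 'X_[e k]].
    elim: k => [_|k IH kn].
      exists (longest_perm n.+1); split=> [//|l l0|l _|].
      - by rewrite permE /= l0 subn1.
      - by rewrite permE /= subSS.
      - by rewrite Sch_longest; congr 'X_[_]; apply/mnmP => i; rewrite !mnmE subSS.
    have [v [h1 h2 h3 h4]] := IH (ltnW kn).
    pose i := Ordinal (ltnW kn : (k < n.+1)%N); pose j := Ordinal (kn : (k.+1 < n.+1)%N).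
    have ij : j = i.+1 :> nat by [].
    have nij := neq_succ ij.
    have vi : v i = n :> nat by apply: h2.
    have vj : v j = (n - k.+1)%N :> nat by apply: h3 => /=.
    exists (tperm i j * v)%g; split.
    - move=> l; rewrite ltnS leq_eqVlt => /predU1P[e1|lk]; rewrite permM.
        have -> : l = i by apply: val_inj.
        by rewrite tpermL vj.
      by rewrite tpermD ?h1 // -val_eqE /=; lia.
    - move=> l lk; have -> : l = j by apply: val_inj.
      by rewrite permM tpermR.
    - move=> l lk; rewrite permM tpermD ?h3 //; first by lia.
        by rewrite -val_eqE /=; lia.
      by rewrite -val_eqE /=; lia.
    rewrite -dd_Sch_desc //; last by rewrite vi vj; lia.
    rewrite h4; apply: divdiff_XU => //; rewrite ?mnmE /= ?ltnn ?ltnS ?leqnn; try by [lia | case: ltnP; lia].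
    move=> l; rewrite -!val_eqE !mnmE /= => li lj.
    by case: (ltngtP l k) => lk; case: (ltnP l k.+1) => //; lia.
  have [v [h1 h2 h3 h4]] := h n (leqnn n).
  by exists v; split=> //; apply: h2.
have -> : (cyc * longest_perm n.+1)%g = v.
  apply/permP => l; apply: val_inj; rewrite /= permM permE /= subSS.
  have [ln|ln] := ltnP l n; first by rewrite h1 // cycE.
  have -> : l = ord_max by apply: val_inj => /=; have := ltn_ord l; lia.
  by rewrite cyc_max h2 subn0.
rewrite h4; congr 'X_[_]; apply/mnmP => i; rewrite !mnmE.
by case: ltnP => // h; have := ltn_ord i; lia.
Qed.

Lemma dd_mul_sym i j (f g : {mpoly R[n.+1]}) : i != j -> msym (tperm i j) f = f ->
  dd i j (f * g) = f * dd i j g.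
Proof. by move=> ij h; rewrite ddM // h (proj2 (dd_eq0P f ij) h) mul0r add0r. Qed.

(** As long as the largest value stays in front, no step of the recursion touches position 0, so the
    divided differences commute with the power of the first variable, and [cyc] carries each of them
    to the preceding position. *)
Lemma Sch_rotation w : w ord0 = ord_max ->
  Sch R w = 'X_[U_(ord0) *+ n] * msym cyc (Sch R (cyc * w)%g).
Proof.
elim/(@Sch_ind R): w => [_|w i j ij wij hw].
  rewrite Sch_cyc_longest Sch_longest msymX -mpolyXD; congr 'X_[_]; apply/mnmP => i.
  rewrite mnmDE mulmnE mnm1E !mnmE subSS.
  have [<-|i0] := eqVneq ord0 i.
    rewrite mul1n subn0 -[LHS]addn0; congr addn; apply/esym/eqP.
    have -> : (cyc^-1)%g ord0 = ord_max by apply: (@perm_inj _ cyc); rewrite permKV cyc_max.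
    by rewrite subn_eq0.
  rewrite mul0n add0n; have i1 : (i.-1.+1 = i)%N.
    by rewrite prednK // lt0n; move: i0; rewrite -val_eqE eq_sym.
  have i2 : (i.-1 < n.+1)%N by rewrite i1 ltnW.
  have -> : (cyc^-1)%g i = Ordinal i2; last by rewrite /= i1.
  by apply: (@perm_inj _ cyc); rewrite permKV; apply/esym/cycV_succ; rewrite /= i1.
have nij := neq_succ ij.
rewrite permM; have [i0|i0] := eqVneq i ord0.
  rewrite -i0 tpermL => wj; move: wij; rewrite wj /=; have := ltn_ord (w i); lia.
have j0 : j != ord0 by apply/eqP => e; move: ij; rewrite e.
rewrite tpermD // => w0.
have i2 : (i.-1 < n.+1)%N by apply: leq_ltn_trans (leq_pred _) (ltn_ord i).
pose i' := Ordinal i2.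
have i1 : (i.-1.+1 = i)%N by rewrite prednK // lt0n; move: i0; rewrite -val_eqE.
have ci' : cyc i' = i by apply: cycV_succ; rewrite /= i1.
have ci : cyc i = j by apply: cycV_succ.
have ii' : i = i'.+1 :> nat by rewrite /= i1.
rewrite -dd_Sch_desc // hw // dd_mul_sym //; last first.
  rewrite msymX; congr 'X_[_]; apply/mnmP => k; rewrite mnmE !mulmnE !mnm1E tpermV.
  by congr (_ * _)%N; congr nat_of_bool; rewrite -(can_eq (tpermK i j)) tpermK tpermD.
congr (_ * _); apply: ddE => //; rewrite /is_divdiff.
have -> : (cyc * (tperm i j * w) = tperm i' i * (cyc * w))%g.
  rewrite -ci -{1}ci' -tpermJ conjgE !mulgA; congr (_ * _)%g.
  by rewrite mulgV mul1g.
rewrite -dd_Sch_desc //; last by rewrite !permM ci ci'.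
have := ddP (Sch R (cyc * w)%g) (neq_succ ii'); rewrite /is_divdiff.
move=> /(congr1 (msym cyc)); rewrite msymM !raddfB /= !msym_XU ci' ci => ->.
congr (_ - _); rewrite -!msymMm; congr (msym _ _).
have -> : tperm i j = (tperm i' i ^ cyc)%g by rewrite tpermJ ci' ci.
by rewrite conjgE !mulgA mulgV mul1g.
Qed.

End Rotation.

Lemma longestE n (k : 'I_n) : longest_perm n k = (n - k.+1)%N :> nat.
Proof. by rewrite permE. Qed.

(** * Adding a fixed last point *)

Section Stability.
Variables (R : idomainType) (n : nat).

Definition stab (w : 'S_n) : 'S_n.+1 := lift_perm ord_max ord_max w.

Lemma stab_max (w : 'S_n) : stab w ord_max = ord_max.
Proof. by rewrite /stab lift_perm_id. Qed.

Lemma lift_max_nat (k : 'I_n) : lift ord_max k = k :> nat.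
Proof. by rewrite /= /bump leqNgt ltn_ord. Qed.

Lemma stab_lift (w : 'S_n) k : stab w (lift ord_max k) = lift ord_max (w k).
Proof. by rewrite /stab lift_perm_lift. Qed.

Lemma stab_tperm i j (w : 'S_n) :
  stab (tperm i j * w)%g = (tperm (lift ord_max i) (lift ord_max j) * stab w)%g.
Proof.
apply/permP => k; rewrite permM; have [k'|->] := unliftP ord_max k.
  move=> ->; rewrite -(inj_tperm _ _ _ (@lift_inj _ ord_max)) !stab_lift permM //.
by rewrite tpermD ?stab_max // eq_sym neq_lift.
Qed.

Lemma mwiden_msym i j (f : {mpoly R[n]}) :
  mwiden (msym (tperm i j) f) = msym (tperm (lift ord_max i) (lift ord_max j)) (mwiden f).
Proof.
rewrite [f]mpolyE; elim/big_rec: _ => [|m g _ IH]; first by rewrite !(raddf0, mwiden0).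
rewrite raddfD !mwidenD raddfD /= {}IH; congr (_ + _).
rewrite msymZ !mwidenZ msymZ msymX !mwidenX msymX; congr (_ *: 'X_[_]).
apply/mnmP => k; rewrite mnmE !tpermV; have [k'|->] := unliftP ord_max k; last first.
  by rewrite tpermD ?mnmwiden_ordmax // eq_sym neq_lift.
move=> ->; rewrite -(inj_tperm _ _ _ (@lift_inj _ ord_max)).
have lw (l : 'I_n) : lift ord_max l = widen_ord (leqnSn n) l by apply: val_inj; rewrite /= /bump leqNgt ltn_ord.
by rewrite !lw !mnmwiden_widen mnmE.
Qed.

(** Adding a fixed point to the longest permutation gives [cyc * longest_perm], whose Schubert
    polynomial is the monomial of [Sch_cyc_longest]; the remaining steps are the same in both
    groups. *)
Lemma Sch_stab (w : 'S_n) : Sch R (stab w) = mwiden (Sch R w).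
Proof.
have lw (l : 'I_n) : lift ord_max l = widen_ord (leqnSn n) l by apply: val_inj; rewrite /= /bump leqNgt ltn_ord.
elim/(@Sch_ind R): w => [|w i j ij wij hw].
  have -> : stab (longest_perm n) = (cyc n * longest_perm n.+1)%g.
    apply/permP => k; rewrite permM; have [k'|->] := unliftP ord_max k.
      move=> ->; apply: ord_inj; rewrite stab_lift lift_max_nat !longestE cycE ?lift_max_nat //.
    by rewrite stab_max cyc_max permE; apply: val_inj; rewrite /= subSS subn0.
  rewrite Sch_cyc_longest Sch_longest mwidenX; congr 'X_[_]; apply/mnmP => k.
  have [k'|->] := unliftP ord_max k; last by rewrite mnmwiden_ordmax mnmE /=; lia.
  by move=> ->; rewrite mnmE lift_max_nat lw mnmwiden_widen mnmE.
have ij' : lift ord_max j = (lift ord_max i).+1 :> nat by rewrite !lift_max_nat.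
rewrite stab_tperm -!dd_Sch_desc //; last by rewrite !stab_lift !lift_max_nat.
rewrite hw; apply: ddE; first exact: neq_succ.
rewrite /is_divdiff -mwiden_msym -mwidenB -(ddP _ (neq_succ ij)) mwidenM mwidenB !mwidenX.
by rewrite !mnmwiden1 !lw.
Qed.

End Stability.

Lemma Sch1 (R : idomainType) n : Sch R (1%g : 'S_n) = 1.
Proof.
elim: n => [|n IH].
  have -> : (1%g : 'S_0) = longest_perm 0 by apply/permP => -[].
  by rewrite Sch_longest -mpolyX0; congr 'X_[_]; apply/mnmP => -[].
have -> : (1%g : 'S_n.+1) = stab 1%g by rewrite /stab lift_perm1.
by rewrite Sch_stab IH mwiden1.
Qed.

(** * A positive recursion for Schubert coefficients *)

Section SchubertCoefficients.
Variables (R : realFieldType) (n : nat).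
Implicit Types (i j k : 'I_n.+1) (w : 'S_n.+1) (m : 'X_{1..n.+1}).

Definition shift_mnm m : 'X_{1..n.+1} :=
  [multinom (if (k == ord_max :> 'I_n.+1) then 0%N else m (cyc n k)) | k < n.+1].

Lemma Sch_coeff_rot w m : w ord0 = ord_max ->
  (Sch R w)@_m = if m ord0 == n then (Sch R (cyc n * w)%g)@_(shift_mnm m) else 0.
Proof.
move=> w0; case: eqP => [m0|m0].
  rewrite Sch_rotation // mulrC.
  have em : m = (U_(ord0) *+ n + (m - U_(ord0) *+ n))%MM.
    apply/mnmP => k; rewrite mnmDE mulmnE mnm1E mnmBE mulmnE mnm1E.
    by have [<-|_] := eqVneq ord0 k; lia.
  rewrite {1}em mcoeffMX mcoeff_sym; congr (_ @_ _); apply/mnmP => k; rewrite !mnmE.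
  have [->|kn] := eqVneq k ord_max; first by rewrite cyc_max m0 !(mulmnE, mnm1E) eqxx; lia.
  have : ord0 != cyc n k by rewrite -cyc_max (inj_eq perm_inj) eq_sym.
  by rewrite !(mulmnE, mnm1E) => /negbTE ->; rewrite mul0n subn0.
apply/eqP; rewrite mcoeff_eq0; apply/negP => hm; apply: m0.
have := Sch_exponent hm ord0; move: hm; rewrite Sch_rotation // mulrC.
rewrite (perm_mem (msuppMX _ _)) => /mapP[m' _ ->]; rewrite mnmDE mulmnE mnm1E eqxx /=; lia.
Qed.

(** Monk's rule for the first variable has no negative terms, and all its permutations have a larger
    first value. *)
Lemma Sch_coeff_monk w m : (w ord0 < n)%N ->
  (Sch R w)@_m = \sum_(b | cov w ord0 b) (Sch R (tperm ord0 b * w)%g)@_(m + U_(ord0)).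
Proof.
move=> w0; pose p := (w^-1)%g ord_max.
have wp : w p = ord_max by rewrite /p permKV.
have p0 : (@ord0 n < p)%N.
  by rewrite lt0n; apply/eqP => e; move: w0; rewrite (_ : ord0 = p) ?wp ?ltnn //; apply: ord_inj.
have := congr1 (mcoeff (m + U_(ord0))) (monk R p0 (congr1 (fun x => (nat_of_ord x).+1) wp)).
rewrite mulrC addmC mcoeffMX => ->; rewrite mcoeffB !raddf_sum /= [X in _ + X = _]big_pred0 ?addr0 //.
Qed.

Lemma Sch_coeff_zero w : (Sch R w)@_0 = (w == 1%g)%:R.
Proof.
have [->|w1] := eqVneq w 1%g; first by rewrite Sch1 mcoeff1 eqxx.
have [/existsP[a /existsP[b /andP[ab wab]]]|noinv] :=
  boolP [exists a : 'I_n.+1, exists b : 'I_n.+1, (a < b)%N && (w b < w a)%N].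
  exact: Sch_coeff0 wab.
have mono (a b : 'I_n.+1) : (a < b)%N -> (w a < w b)%N.
  move=> ab; rewrite ltn_neqAle perm_neq /=; last by rewrite neq_ltn ab.
  rewrite leqNgt; apply: contra noinv => h; apply/existsP; exists a; apply/existsP; exists b.
  by rewrite ab.
case/eqP: w1; apply/permP => k; apply: ord_inj; rewrite perm1.
have up d : forall k : 'I_n.+1, (k <= d)%N -> (k <= w k)%N.
  elim: d => [|d IH] [[|l] hl] //= ld.
  have := IH (Ordinal (ltnW hl)) ld; have := mono (Ordinal (ltnW hl)) (Ordinal hl) (ltnSn _).
  by move=> /=; lia.
have dn d : forall k : 'I_n.+1, (n - k <= d)%N -> (w k <= k)%N.
  elim: d => [|d IH] l ld; first by have := ltn_ord (w l); lia.
  have [ln|ln] := leqP n l; first by have := ltn_ord (w l); lia.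
  have h : (l.+1 < n.+1)%N by [].
  by have := IH (Ordinal h); have := mono l (Ordinal h) (ltnSn _) => /=; lia.
by have := up k k (leqnn _); have := dn n k (leq_subr _ _); lia.
Qed.

(** [Sch_coeff_monk] raises w(0) until it is maximal, then [Sch_coeff_rot] drops a variable; p
    bounds the number of variables that can still occur. *)
Lemma Sch_coeff_ge0 w m : 0 <= (Sch R w)@_m.
Proof.
suff h (p : nat) : forall w m, (forall k, (p <= k)%N -> m k = 0%N) -> 0 <= (Sch R w)@_m.
  by apply: (h n.+1) => k; rewrite leqNgt ltn_ord.
elim: p => [|p IH] {w m} w m hm.
  have -> : m = 0%MM by apply/mnmP => k; rewrite mnm0E hm.
  by rewrite Sch_coeff_zero ler0n.
have [d] := ubnP (n - w ord0); elim: d w m hm => // d IHd w m hm hd.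
have [w0|w0] := ltnP (w ord0) n.
  rewrite Sch_coeff_monk //; apply: sumr_ge0 => b /covP[ab wab _]; apply: IHd.
    move=> k pk; rewrite mnmDE hm // mnm1E; case: eqP => // e.
    by move: pk; rewrite -e ltn0.
  by rewrite permM tpermL; lia.
rewrite Sch_coeff_rot; last by apply: ord_inj; have := ltn_ord (w ord0); rewrite /=; lia.
case: ifP => // _; apply: IH => k pk; rewrite mnmE; case: eqP => // /eqP kn.
have kn' : (k < n)%N by move: kn; rewrite -val_eqE /=; have := ltn_ord k; lia.
by apply: hm; rewrite cycE.
Qed.

End SchubertCoefficients.

(** * Ranks of graded function spaces *)

Section FunctionSpaces.
Variables (F : realFieldType) (N : nat).
Notation X := 'M[F]_N.
Implicit Types (D E : X -> Prop) (f g h : X -> F).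

Section Graded.
Variables (J : eqType) (G : J -> (X -> F) -> Prop).
Implicit Types (e : J -> nat).

(** The homogeneous part of multidegree e of the algebra generated by the functions [G j] in degree
    j. Since multidegrees are functions, [gr_ext] serves to replace them by pointwise equal ones. *)
Inductive gr : (J -> nat) -> (X -> F) -> Prop :=
| gr1 : gr (fun=> 0%N) (fun=> 1)
| gr_mul j g e f : G j g -> gr e f -> gr (fun k => (e k + (k == j))%N) (fun x => g x * f x)
| gr0 e : gr e (fun=> 0)
| gr_lin c e f g : gr e f -> gr e g -> gr e (fun x => c * f x + g x).

Lemma gr_ext e e' f f' : gr e f -> e =1 e' -> f =1 f' -> gr e' f'.
Proof. by move=> h /boolp.funext <- /boolp.funext <-. Qed.

Lemma gr_gen j g : G j g -> gr (fun k => (k == j)%N) g.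
Proof. by move=> hg; apply: gr_ext (gr_mul hg gr1) _ _ => x //=; rewrite mulr1. Qed.

Lemma grZ c e f : gr e f -> gr e (fun x => c * f x).
Proof. by move=> h; apply: gr_ext (gr_lin c h (gr0 e)) _ _ => x //=; rewrite addr0. Qed.

Lemma grD e f g : gr e f -> gr e g -> gr e (fun x => f x + g x).
Proof. by move=> h h'; apply: gr_ext (gr_lin 1 h h') _ _ => x //=; rewrite mul1r. Qed.

Lemma gr_sum e (I : Type) (r : seq I) (P : pred I) (f : I -> X -> F) :
  (forall i, P i -> gr e (f i)) -> gr e (fun x => \sum_(i <- r | P i) f i x).
Proof.
move=> h; elim: r => [|i r IH]; first by apply: gr_ext (gr0 e) _ _ => // x; rewrite big_nil.
case Pi: (P i); last by apply: gr_ext IH _ _ => // x; rewrite big_cons Pi.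
by apply: gr_ext (grD (h i Pi) IH) _ _ => // x; rewrite big_cons Pi.
Qed.

Lemma grM e e' f f' : gr e f -> gr e' f' -> gr (fun k => (e k + e' k)%N) (fun x => f x * f' x).
Proof.
move=> h h'; elim: h => {e f} [|j g e f hg _ IH|e|c e f g _ IHf _ IHg].
- by apply: gr_ext h' _ _ => // x; rewrite mul1r.
- by apply: gr_ext (gr_mul hg IH) _ _ => [k|x]; [rewrite addnAC | rewrite mulrA].
- by apply: gr_ext (gr0 _) _ _ => // x; rewrite mul0r.
- by apply: gr_ext (gr_lin c IHf IHg) _ _ => // x; rewrite mulrDl mulrA.
Qed.

Lemma gr_exp e f m : gr e f -> gr (fun k => (m * e k)%N) (fun x => f x ^+ m).
Proof.
move=> h; elim: m => [|m IH]; first by apply: gr_ext gr1 _ _.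
by apply: gr_ext (grM h IH) _ _ => [k|x]; rewrite ?exprS ?mulSn.
Qed.

Lemma gr_prod (I : Type) (r : seq I) (e : I -> J -> nat) (f : I -> X -> F) :
  (forall i, gr (e i) (f i)) ->
  gr (fun k => \sum_(i <- r) e i k)%N (fun x => \prod_(i <- r) f i x).
Proof.
move=> h; elim: r => [|i r IH].
  by apply: gr_ext gr1 _ _ => k; rewrite big_nil.
by apply: gr_ext (grM (h i) IH) _ _ => k; rewrite big_cons.
Qed.

End Graded.

Lemma gr_sub (J : eqType) (G G' : J -> (X -> F) -> Prop) e f :
  (forall j, (0 < e j)%N -> forall g, G j g -> gr G' (fun k => (k == j)%N) g) ->
  gr G e f -> gr G' e f.
Proof.
move=> hG h; elim: h hG => {e f} [|j g e f hg _ IH|e|c e f g _ IHf _ IHg] hG.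
- exact: gr1.
- apply: gr_ext (grM (hG j _ g hg) (IH _)) _ _ => //.
  + by rewrite eqxx addn1.
  + by move=> k hk; apply: hG; lia.
  + by move=> k; rewrite addnC.
- exact: gr0.
- by apply: gr_lin; [apply: IHf | apply: IHg].
Qed.

(** Independence of the restrictions to D. Coefficients are indexed by all naturals, so that lists
    can be concatenated and replaced without casts. *)
Definition indep D (fs : seq (X -> F)) :=
  forall c : nat -> F, (forall x, D x -> \sum_(i < size fs) c i * nth (fun=> 0) fs i x = 0) ->
    forall i, (i < size fs)%N -> c i = 0.

Definition rk_ge D (V : (X -> F) -> Prop) (r : nat) :=
  exists fs, [/\ size fs = r, forall i, (i < size fs)%N -> V (nth (fun=> 0) fs i) & indep D fs].

Lemma rk_ge_mono D D' (V V' : (X -> F) -> Prop) r :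
  (forall x, D x -> D' x) -> (forall f, V f -> V' f) -> rk_ge D V r -> rk_ge D' V' r.
Proof.
move=> hD hV [fs [sf hf ind]]; exists fs; split=> // [i /hf/hV //|c hc].
by apply: ind => x /hD; apply: hc.
Qed.

Lemma rk_ge0 D V : rk_ge D V 0.
Proof. by exists [::]; split. Qed.

Lemma indep_cat D fs gs : indep D gs ->
  (forall c : nat -> F, (forall x, D x ->
     \sum_(i < size fs) c i * nth (fun=> 0) fs i x +
     \sum_(i < size gs) c (size fs + i)%N * nth (fun=> 0) gs i x = 0) ->
     forall i, (i < size fs)%N -> c i = 0) -> indep D (fs ++ gs).
Proof.
move=> hg hf c hc.
have hc' x : D x -> \sum_(i < size fs) c i * nth (fun=> 0) fs i x +
     \sum_(i < size gs) c (size fs + i)%N * nth (fun=> 0) gs i x = 0.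
  move=> /hc; rewrite size_cat big_split_ord /= => e; rewrite -[RHS]e; congr (_ + _).
    by apply: eq_bigr => i _; rewrite nth_cat ltn_ord.
  by apply: eq_bigr => i _; rewrite nth_cat ltnNge leq_addr /= addKn.
have c0 := hf c hc'; move=> i; rewrite size_cat => ilt.
have [/c0 //|fi] := ltnP i (size fs).
rewrite -(subnKC fi); apply: (hg (fun i => c (size fs + i)%N)); last by rewrite ltn_subLR.
move=> x /hc'; rewrite [X in X + _]big1 ?add0r // => k _; rewrite c0 ?mul0r //.
Qed.

Definition curve := 'I_N -> 'I_N -> {poly F}.
Definition at_curve (g : curve) (t : F) : X := \matrix_(i, j) (g i j).[t].

(** A stand-in for regular functions: being polynomial along every polynomial curve of matrices is
    all that the arguments on irreducibility and closures need. *)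
Definition pf f := forall g : curve, exists p : {poly F}, forall t, f (at_curve g t) = p.[t].

Lemma pfC c : pf (fun=> c).
Proof. by move=> g; exists c%:P => t; rewrite hornerC. Qed.

Lemma pfD f g : pf f -> pf g -> pf (fun x => f x + g x).
Proof.
by move=> hf hg c; have [p hp] := hf c; have [q hq] := hg c; exists (p + q) => t; rewrite hornerD hp hq.
Qed.

Lemma pfM f g : pf f -> pf g -> pf (fun x => f x * g x).
Proof.
by move=> hf hg c; have [p hp] := hf c; have [q hq] := hg c; exists (p * q) => t; rewrite hornerM hp hq.
Qed.

Lemma pf_sum (I : Type) (r : seq I) (P : pred I) (f : I -> X -> F) :
  (forall i, pf (f i)) -> pf (fun x => \sum_(i <- r | P i) f i x).
Proof.
move=> h; elim: r => [|i r IH].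
  by rewrite (_ : (fun=> _) = fun=> 0); [exact: pfC | apply: boolp.funext => x; rewrite big_nil].
case Pi: (P i).
  rewrite (_ : (fun=> _) = fun x => f i x + \sum_(i <- r | P i) f i x); first exact: pfD.
  by apply: boolp.funext => x; rewrite big_cons Pi.
by rewrite (_ : (fun=> _) = fun x => \sum_(i <- r | P i) f i x) //; apply: boolp.funext => x; rewrite big_cons Pi.
Qed.

Lemma pf_coord i j : pf (fun x : X => x i j).
Proof. by move=> g; exists (g i j) => t; rewrite mxE. Qed.

Lemma gr_pf (J : eqType) (G : J -> (X -> F) -> Prop) e f :
  (forall j g, G j g -> pf g) -> gr G e f -> pf f.
Proof.
move=> hG; elim=> {e f} [|j g e f hg _ IH|e|c e f g _ IHf _ IHg].
- exact: pfC.
- by apply: pfM => //; apply: hG hg.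
- exact: pfC.
- by apply: pfD => //; apply: pfM => //; apply: pfC.
Qed.

Lemma poly_nonroot (p : {poly F}) : p != 0 -> exists t, p.[t] != 0.
Proof.
move=> p0; pose s := [seq (i%:R : F) | i <- iota 0 (size p)].
have us : uniq s by rewrite map_inj_uniq ?iota_uniq //; apply: mulrIn; rewrite oner_eq0.
have [/(max_poly_roots p0)/(_ us)|/allPn[x _ hx]] := boolP (all (root p) s); last by exists x.
by rewrite size_map size_iota ltnn.
Qed.

Lemma poly_eq0_of (p q : {poly F}) : q != 0 -> (forall t, q.[t] != 0 -> p.[t] = 0) -> p = 0.
Proof.
move=> q0 h; apply/eqP; apply: contraT => p0.
have [t] := poly_nonroot (mulf_neq0 p0 q0); rewrite hornerM mulf_eq0 negb_or => /andP[/eqP pt /h].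
by [].
Qed.

(** A substitute for irreducibility: two points of D lie on a curve that stays in D for all but
    finitely many parameters. If a product of two [pf] functions vanishes on D, then one of the
    factors does ([irr_prime]). *)
Definition irr D := forall x y, D x -> D y -> exists (g : curve) (q : {poly F}),
  [/\ at_curve g 0 = x, at_curve g 1 = y, q != 0 & forall t, q.[t] != 0 -> D (at_curve g t)].

Definition in_closure D x := exists (g : curve) (q : {poly F}),
  [/\ at_curve g 0 = x, q != 0 & forall t, q.[t] != 0 -> D (at_curve g t)].

Lemma irr_prime D f g : irr D -> pf f -> pf g -> (exists2 x, D x & f x != 0) ->
  (forall x, D x -> f x * g x = 0) -> forall x, D x -> g x = 0.
Proof.
move=> hD hf hg [x Dx fx] h y Dy; have [c [q [c0 c1 q0 hq]]] := hD x y Dx Dy.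
have [p hp] := hf c; have [r hr] := hg c.
have pr : p * r = 0.
  by apply: (poly_eq0_of q0) => t /hq /h; rewrite hornerM -hp -hr.
move/eqP: pr; rewrite mulf_eq0 => /orP[] /eqP e.
  by move: fx; rewrite -c0 hp e horner0 eqxx.
by rewrite -c1 hr e horner0.
Qed.

Lemma closure_eq0 D f x : in_closure D x -> pf f -> (forall x, D x -> f x = 0) -> f x = 0.
Proof.
move=> [c [q [<- q0 hq]]] hf h; have [p hp] := hf c.
have p0 : p = 0 by apply: (poly_eq0_of q0) => t /hq /h; rewrite -hp.
by rewrite hp p0 horner0.
Qed.

Lemma indep_mul D f gs : irr D -> pf f -> (forall i, (i < size gs)%N -> pf (nth (fun=> 0) gs i)) ->
  (exists2 x, D x & f x != 0) -> indep D gs ->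
  indep D [seq (fun x => f x * g x) | g <- gs].
Proof.
move=> hD hf hgs hx ind c; rewrite size_map => hc; apply: ind.
apply: (irr_prime hD hf _ hx).
  apply: pf_sum => i; apply: pfM; [exact: pfC | exact: hgs].
move=> x Dx; rewrite mulr_sumr -[RHS](hc x Dx); apply: eq_bigr => i _.
by rewrite (nth_map (fun=> 0)) // mulrCA.
Qed.

Lemma rk_ge_mul D f (V V' : (X -> F) -> Prop) r : irr D -> pf f -> (forall g, V g -> pf g) ->
  (exists2 x, D x & f x != 0) -> (forall g, V g -> V' (fun x => f x * g x)) ->
  rk_ge D V r -> rk_ge D V' r.
Proof.
move=> hD hf hV hx hVV [gs [sg hg ind]]; exists [seq (fun x => f x * g x) | g <- gs].
rewrite size_map; split=> //.
  by move=> i ig; rewrite (nth_map (fun=> 0)) //; apply/hVV/hg.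
by apply: indep_mul => // i ig; apply/hV/hg.
Qed.

(* One step of the restriction argument: functions vanishing on E, together with
   f times functions that are independent on E, where E lies in the closure of D. *)
Lemma rk_ge_extend D E f (V W : (X -> F) -> Prop) a b :
  irr E -> (forall x, E x -> in_closure D x) -> pf f -> (forall g, V g -> pf g) ->
  (forall g, W g -> pf g) -> (exists2 x, E x & f x != 0) ->
  rk_ge D (fun g => V g /\ forall x, E x -> g x = 0) a -> rk_ge E W b ->
  rk_ge D (fun g => V g \/ exists2 y, W y & g = (fun x => f x * y x)) (b + a).
Proof.
move=> hE hcl hf hV hW hx [gs [sg hg ig]] [ys [sy hy iy]].
exists ([seq (fun x => f x * y x) | y <- ys] ++ gs); split.
- by rewrite size_cat size_map sg sy.
- move=> i; rewrite size_cat size_map nth_cat size_map => ilt; case: ltnP => h.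
    by rewrite (nth_map (fun=> 0)) //; right; exists (nth (fun=> 0) ys i) => //; apply: hy.
  by left; apply: (hg _ _).1; lia.
apply: indep_cat => // c hc.
apply: (indep_mul hE hf _ hx iy) => [i ilt|x Ex]; first by apply/hW/hy.
have := @closure_eq0 D _ x (hcl _ Ex) _ hc.
rewrite [X in _ + X = _]big1 ?addr0 => [h|k _]; last by rewrite (hg k (ltn_ord k)).2 ?mulr0.
apply: h; apply: pfD; apply: pf_sum => i; apply: pfM; try exact: pfC.
  have := ltn_ord i; rewrite [X in (_ < X)%N]size_map => ilt.
  by rewrite (nth_map (fun=> 0)) //; apply: pfM => //; apply/hW/hy.
by apply: hV (hg i (ltn_ord i)).1.
Qed.

End FunctionSpaces.

(** * Degenerate matrix Schubert cells *)

Section MatrixSchubert.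
Variables (F : realFieldType) (n : nat).
Notation N := n.+1.
Notation X := 'M[F]_N.
Implicit Types (v : 'S_N) (i : nat) (L U : X) (lam : 'I_N -> F).

Definition ltri L := (forall a b : 'I_N, (a < b)%N -> L a b = 0) /\ forall a, L a a != 0.
Definition utri U := (forall a b : 'I_N, (b < a)%N -> U a b = 0) /\ forall a, U a a != 0.

Definition pt i lam (B : X) : X :=
  \matrix_(r, c) if (r < i)%N then lam r * (c == ord_max)%:R else B (inord (r - i)) c.

(* For i = 0 this is the cell of v. For i > 0 it is a degeneration: rows r < i are
   multiples of the last basis vector and the others repeat the first rows of a
   matrix of the cell. *)
Definition Dset i v (A : X) := exists L U lam,
  [/\ ltri L, utri U, forall r, lam r != 0 & A = pt i lam (L *m row_perm v U)].

Definition seg (a b : F) : {poly F} := a%:P + (b - a) *: 'X.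

Lemma seg_horner a b t : (seg a b).[t] = a + (b - a) * t.
Proof. by rewrite /seg !hornerE. Qed.

Lemma seg_neq0 a b : a != 0 -> seg a b != 0.
Proof. by apply: contraNneq => h; have := seg_horner a b 0; rewrite h horner0 mulr0 addr0 => <-. Qed.

(** L, U and lam are interpolated linearly. Invertibility is lost only at zeros of the product of
    the interpolated diagonals, each of which is nonzero at t = 0. *)
Lemma Dset_irr i v : irr (Dset i v).
Proof.
move=> _ _ [L0 [U0 [l0 [[L0a L0b] [U0a U0b] l0b ->]]]] [L1 [U1 [l1 [[L1a L1b] [U1a U1b] l1b ->]]]].
pose g : curve F N := fun r c => if (r < i)%N then seg (l0 r) (l1 r) * (c == ord_max)%:R
  else \sum_l seg (L0 (inord (r - i)) l) (L1 (inord (r - i)) l) * seg (U0 (v l) c) (U1 (v l) c).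
pose Lt t : X := \matrix_(a, b) (seg (L0 a b) (L1 a b)).[t].
pose Ut t : X := \matrix_(a, b) (seg (U0 a b) (U1 a b)).[t].
pose lt t r := (seg (l0 r) (l1 r)).[t].
have gE t : at_curve g t = pt i (lt t) (Lt t *m row_perm v (Ut t)).
  apply/matrixP => r c; rewrite /g !mxE; case: ifP => ri.
    by rewrite hornerM; congr (_ * _); case: eqP => _; rewrite hornerE.
  by rewrite horner_sum; apply: eq_bigr => l _; rewrite hornerM !mxE.
exists g, (\prod_k (seg (L0 k k) (L1 k k) * seg (U0 k k) (U1 k k) * seg (l0 k) (l1 k))).
split.
- rewrite gE; congr (pt i _ (_ *m row_perm v _)).
  + by apply: boolp.funext => r; rewrite /lt seg_horner mulr0 addr0.
  + by apply/matrixP => a b; rewrite mxE seg_horner mulr0 addr0.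
  + by apply/matrixP => a b; rewrite mxE seg_horner mulr0 addr0.
- rewrite gE; congr (pt i _ (_ *m row_perm v _)).
  + by apply: boolp.funext => r; rewrite /lt seg_horner mulr1 addrC subrK.
  + by apply/matrixP => a b; rewrite mxE seg_horner mulr1 addrC subrK.
  + by apply/matrixP => a b; rewrite mxE seg_horner mulr1 addrC subrK.
- by apply/prodf_neq0 => k _; rewrite !mulf_neq0 ?seg_neq0.
move=> t; rewrite horner_prod => /prodf_neq0 h; rewrite gE.
have hk k : [/\ (seg (L0 k k) (L1 k k)).[t] != 0, (seg (U0 k k) (U1 k k)).[t] != 0 & lt t k != 0].
  by have := h k isT; rewrite !hornerM !mulf_eq0 !negb_or => /andP[/andP[-> ->]].
exists (Lt t), (Ut t), (lt t); split=> //.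
- split=> [a b ab|a]; rewrite mxE; last by case: (hk a).
  by rewrite seg_horner L0a ?L1a // subr0 mul0r addr0.
- split=> [a b ab|a]; rewrite mxE; last by case: (hk a).
  by rewrite seg_horner U0a ?U1a // subr0 mul0r addr0.
- by move=> r; case: (hk r).
Qed.

(** Adding t times row v(a) of U to row a of the permuted matrix leaves the boundary cell: for t !=
    0 the result factors through the lower triangular matrix 1 + t^-1 E_ba. The new row v(a) of the
    upper factor mixes rows v(a) and v(b) of U and stays upper triangular because v a < v b. *)
Lemma Dset_closure i v (a b : 'I_N) x : (a < b)%N -> (v a < v b)%N ->
  Dset i (tperm a b * v)%g x -> in_closure (Dset i v) x.
Proof.
move=> ab vab [L [U [lam [[La Lb] [Ua Ub] hl ->]]]].
set v' := (tperm a b * v)%g.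
have nab : a != b by rewrite -val_eqE neq_ltn ab.
pose Mt t : X := \matrix_(r, c) (U (v' r) c + (r == a)%:R * (t * U (v a) c)).
pose g : curve F N := fun r c => if (r < i)%N then (lam r * (c == ord_max)%:R)%:P
  else \sum_l (L (inord (r - i)) l)%:P * ((U (v' l) c)%:P + ((l == a)%:R * U (v a) c) *: 'X).
have gE t : at_curve g t = pt i lam (L *m Mt t).
  apply/matrixP => r c; rewrite /g !mxE; case: ifP => ri; first by rewrite hornerC.
  rewrite horner_sum; apply: eq_bigr => l _; rewrite !hornerE !mxE; congr (_ * (_ + _)); ring.
exists g, 'X; split; last 2 first.
- by rewrite polyX_eq0.
- move=> t; rewrite hornerX gE => t0.
  pose L1 : X := 1%:M + t^-1 *: delta_mx b a.
  pose U1 : X := \matrix_(r, c) if r == v a then t * U (v a) c + U (v b) c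
     else if r == v b then - t^-1 * U (v b) c else U r c.
  have nvab : (v b == v a) = false by rewrite (inj_eq perm_inj) eq_sym (negbTE nab).
  have MtE : Mt t = L1 *m row_perm v U1.
    apply/matrixP => r c; rewrite mulmxDl mul1mx -scalemxAl !mxE (bigD1 a) //= big1 ?addr0; last first.
      by move=> k ka; rewrite !mxE (negbTE ka) andbF mul0r.
    rewrite !mxE !eqxx andbT !(inj_eq perm_inj) permM.
    case: tpermP => [->|->|/eqP ra /eqP rb].
    - by rewrite eqxx (negbTE nab) mul1r mul0r mulr0 addr0 addrC.
    - by rewrite [b == a]eq_sym (negbTE nab) !eqxx mul0r addr0 mul1r; field.
    - by rewrite (negbTE ra) (negbTE rb) !mul0r mulr0 !addr0.
  exists (L *m L1), U1, lam; split=> //; last by rewrite MtE mulmxA.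
  + have LLE r c : (L *m L1) r c = L r c + t^-1 * (L r b * (c == a)%:R).
      rewrite mulmxDr mulmx1 -scalemxAr !mxE; congr (_ + _ * _).
      rewrite (bigD1 b) //= big1 ?addr0 => [|k kb]; first by rewrite mxE eqxx.
      by rewrite mxE (negbTE kb) mulr0.
    split=> [r c rc|r]; rewrite LLE.
      rewrite La // add0r; case: eqP => [ca|]; last by rewrite !mulr0.
      by rewrite La ?mul0r ?mulr0 //; move: rc; rewrite ca => /ltn_trans; apply.
    case: (r =P a) => [->|_]; last by rewrite !mulr0 addr0.
    by rewrite (La _ _ ab) mul0r mulr0 addr0.
  + split=> [r c rc|r]; rewrite mxE.
      case: eqP => [rv|_]; first by rewrite !Ua ?mulr0 ?addr0 -?rv //; apply: ltn_trans vab; rewrite -rv.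
      by case: eqP => [rv|_]; rewrite Ua ?mulr0 // -rv.
    case: (r =P v a) => [->|_]; first by rewrite (Ua (v b)) // addr0 mulf_neq0.
    by case: (r =P v b) => [->|_] //; rewrite mulf_neq0 // oppr_eq0 invr_eq0.
rewrite gE; congr (pt i _ (_ *m _)); apply/matrixP => r c.
by rewrite !mxE mul0r mulr0 addr0.
Qed.

Lemma Dset_inhabited i v : exists x, Dset i v x.
Proof.
exists (pt i (fun=> 1) (1%:M *m row_perm v 1%:M)), 1%:M, 1%:M, (fun=> 1).
split=> // [| |r]; last by rewrite oner_eq0.
  split=> [a b ab|a]; rewrite mxE ?eqxx ?oner_eq0 // -val_eqE /=.
  by move: ab; case: ltngtP.
split=> [a b ab|a]; rewrite mxE ?eqxx ?oner_eq0 // -val_eqE /=.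
by move: ab; case: ltngtP.
Qed.

Section Minors.
Variables (i k : nat) (hk : (i + k < N)%N).

Let hk1 : (k.+1 <= N)%N. Proof. by apply: leq_ltn_trans hk; apply: leq_addl. Qed.

Definition wd (r : 'I_k.+1) : 'I_N := widen_ord hk1 r.

(** Uses the rows i, ..., i + k, which on [Dset i v] are the first k + 1 rows of the cell matrix. *)
Definition minor (C : 'I_k.+1 -> 'I_N) (A : X) : F :=
  \det (\matrix_(r < k.+1, s < k.+1) A (inord (i + r)) (C s)).

Lemma minor_Dset C v L U lam : ltri L ->
  minor C (pt i lam (L *m row_perm v U)) =
  (\prod_r L (wd r) (wd r)) * \det (\matrix_(r < k.+1, s < k.+1) U (v (wd r)) (C s)).
Proof.
move=> [La Lb]; rewrite /minor.
have -> : \matrix_(r < k.+1, s < k.+1) (pt i lam (L *m row_perm v U)) (inord (i + r)) (C s) =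
    (\matrix_(r < k.+1, s < k.+1) L (wd r) (wd s)) *m
    (\matrix_(r < k.+1, s < k.+1) U (v (wd r)) (C s)).
  apply/matrixP => r s; rewrite !mxE inordK; last first.
    by apply: leq_ltn_trans hk; rewrite leq_add2l -ltnS.
  rewrite ltnNge leq_addr /= addKn.
  have -> : inord r = wd r by apply: ord_inj; rewrite inordK //; apply: leq_trans (ltn_ord r) hk1.
  rewrite (bigID (fun l : 'I_N => (l < k.+1)%N)) /= [X in _ + X]big1 ?addr0; last first.
    by move=> l; rewrite -leqNgt => h; rewrite La ?mul0r //; apply: leq_trans h; apply: (ltn_ord r).
  by rewrite (big_ord_narrow hk1); apply: eq_bigr => l _; rewrite !mxE.
rewrite det_mulmx; congr (_ * _); rewrite det_trig.
  by apply: eq_bigr => r _; rewrite mxE.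
by apply/is_trig_mxP => r s rs; rewrite mxE La.
Qed.

Lemma minor_eq0 (C : 'I_k.+1 -> 'I_N) v x : (forall s : 'S_k.+1, exists r, (C (s r) < v (wd r))%N) ->
  Dset i v x -> minor C x = 0.
Proof.
move=> h [L [U [lam [hL [Ua Ub] hl ->]]]]; rewrite minor_Dset //.
suff -> : \det (\matrix_(r < k.+1, s < k.+1) U (v (wd r)) (C s)) = 0 by rewrite mulr0.
rewrite /determinant big1 // => s _; have [r hr] := h s.
by rewrite (bigD1 r) //= mxE Ua ?mul0r ?mulr0.
Qed.

(** A nonzero term of the expansion needs v(s r) >= v(r) for all r; comparing the sums over r leaves
    only the identity. *)
Lemma minor_neq0 v x : Dset i v x -> minor (fun s => v (wd s)) x != 0.
Proof.
move=> [L [U [lam [hL [Ua Ub] hl ->]]]]; rewrite minor_Dset //.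
rewrite mulf_neq0 //; first by apply/prodf_neq0 => r _; apply: hL.2.
rewrite /determinant (bigD1 1%g) //= [X in _ + X]big1 ?addr0.
  rewrite odd_perm1 expr0 mul1r; apply/prodf_neq0 => r _; rewrite mxE perm1; exact: Ub.
move=> s s1.
have [/existsP[r hr]|/existsPn hn] := boolP [exists r, (v (wd (s r)) < v (wd r))%N].
  by rewrite (bigD1 r) //= mxE Ua ?mul0r ?mulr0.
case/eqP: s1; apply/permP => r; rewrite perm1.
have hle r' : true -> (v (wd r') <= v (wd (s r')) ?= iff (v (wd r') == v (wd (s r')) :> nat))%N.
  by move=> _; split=> //; rewrite leqNgt; apply: hn.
have [_] := leqif_sum hle; rewrite [X in (_ == X)](reindex_inj (@perm_inj _ (s^-1)%g)) /=.
under [X in _ == X]eq_bigr => r' _ do rewrite permKV.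
rewrite eqxx => /esym/forallP/(_ r)/eqP/ord_inj/perm_inj e.
by apply: ord_inj; rewrite -[RHS]/(nat_of_ord (wd r)) e.
Qed.

Lemma minor_vanish (C : 'I_k.+1 -> 'I_N) v x : (\sum_r C r <= \sum_r v (wd r))%N ->
  (forall s : 'S_k.+1, exists r, v (wd r) != C (s r)) -> Dset i v x -> minor C x = 0.
Proof.
move=> hs hne; apply: minor_eq0 => s; apply/existsP; apply: contraT => /existsPn hn.
have [r0 /negP[]] := hne s; rewrite -val_eqE.
have hle r : true -> (v (wd r) <= C (s r) ?= iff (v (wd r) == C (s r) :> nat))%N.
  by move=> _; split=> //; rewrite leqNgt; apply: hn.
have [h1] := leqif_sum hle.
have es : (\sum_r C (s r) = \sum_r C r)%N by rewrite [RHS](reindex_inj (@perm_inj _ s)).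
rewrite es in h1 *.
by rewrite eqn_leq h1 hs => /esym/forallP/(_ r0).
Qed.

Lemma pf_minor C : pf (minor C).
Proof.
rewrite /minor /determinant; apply: pf_sum => s.
apply: pfM; first exact: pfC.
rewrite (_ : (fun=> _) = fun x : X => \prod_(r < k.+1) x (inord (i + r)) (C (s r))); last first.
  by apply: boolp.funext => x; apply: eq_bigr => r _; rewrite mxE.
elim: (index_enum _) => [|r l IH].
  by rewrite (_ : (fun=> _) = fun=> 1); [exact: pfC | apply: boolp.funext => x; rewrite big_nil].
rewrite (_ : (fun=> _) = fun x : X => x (inord (i + r)) (C (s r)) * \prod_(r <- l) x (inord (i + r)) (C (s r))).
  by apply: pfM => //; apply: pf_coord.
by apply: boolp.funext => x; rewrite big_cons.
Qed.

(** The covers in Monk's rule for the sum of the first k + 1 variables, that is, those that change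
    the set of the first k + 1 values. *)
Definition sib v (p : 'I_N * 'I_N) := [&& (p.1 <= k)%N, (k < p.2)%N & cov v p.1 p.2].
Definition sibv v (p : 'I_N * 'I_N) : 'S_N := (tperm p.1 p.2 * v)%g.
Definition colsum v := (\sum_r v (wd r))%N.

Lemma wdE (a : 'I_N) : (a <= k)%N -> exists r, wd r = a.
Proof. by move=> ak; exists (Ordinal (ak : (a < k.+1)%N)); apply: ord_inj. Qed.

Lemma colsum_sib v p : sib v p -> (colsum v < colsum (sibv v p))%N.
Proof.
case: p => a b /and3P[/= ak kb /covP[_ vab _]]; have [r0 er] := wdE ak.
rewrite /colsum (bigD1 r0) //= [ltnRHS](bigD1 r0) //= er permM tpermL.
rewrite (eq_bigr (fun r => nat_of_ord ((tperm a b * v)%g (wd r)))) ?ltn_add2r //.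
move=> r rr0; rewrite permM tpermD //; first by rewrite -er; apply: contra rr0 => /eqP/(congr1 val) /= e; apply/eqP/ord_inj.
by rewrite -val_eqE /=; have := ltn_ord r; lia.
Qed.

(** Makes the table of the siblings' minors against the siblings' cells triangular once the siblings
    are sorted by [colsum]. *)
Lemma minor_sib_vanish v p q x : sib v p -> sib v q -> p != q ->
  (colsum (sibv v q) <= colsum (sibv v p))%N -> Dset i (sibv v p) x ->
  minor (fun s => sibv v q (wd s)) x = 0.
Proof.
move=> hp hq pq hle; apply: minor_vanish => // s.
case: p q hp hq pq {hle} => a b [c d] /and3P[/= ak kb /covP[_ vab _]] /and3P[/= ck kd /covP[_ vcd _]] pq.
have val r : exists2 r', sibv v (c, d) (wd (s r)) = v (tperm c d (wd r')) & (wd r' <= k)%N.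
  by exists (s r); [rewrite permM | rewrite -ltnS /=].
have [bd|nbd] := eqVneq b d.
  have nac : a != c by apply: contra pq => /eqP ->; rewrite bd.
  have [r er] := wdE ck; exists r; have [r' -> r'k] := val r.
  have nbc : b != c by rewrite -val_eqE /=; lia.
  have -> : sibv v (a, b) (wd r) = v c by rewrite /sibv permM er tpermD.
  rewrite (inj_eq (@perm_inj _ v)); case: tpermP => [_|e|/eqP nc _]; [|by move: r'k; rewrite e; lia|by rewrite eq_sym].
  by rewrite -val_eqE /=; lia.
have [r er] := wdE ak; exists r; have [r' -> r'k] := val r.
rewrite permM er tpermL (inj_eq (@perm_inj _ v)); case: tpermP => [_ //|e|_ _]; first by move: r'k; rewrite e; lia.
by move: r'k; rewrite -val_eqE /=; lia.
Qed.

(** Multiples of the minor of v vanish on all sibling cells, while the minor of a sibling p is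
    nonzero on the cell of p. Siblings are added by increasing [colsum], so that everything
    collected earlier vanishes on the cell of p and [rk_ge_extend] adds its contribution. The factor
    h adjusts degrees. *)
Lemma rk_sec v (h : X -> F) (Vm Y Z : (X -> F) -> Prop) r0 (r : 'I_N * 'I_N -> nat) :
  pf h -> (forall g, Y g -> pf g) -> (forall g, Z g -> pf g) -> (forall g, Vm g -> pf g) ->
  (forall g, Vm g -> Z (fun x => minor (fun s => v (wd s)) x * g x)) ->
  (forall p y, sib v p -> Y y -> Z (fun x => (minor (fun s => sibv v p (wd s)) x * h x) * y x)) ->
  (forall p, sib v p -> exists2 x, Dset i (sibv v p) x & h x != 0) ->
  rk_ge (Dset i v) Vm r0 -> (forall p, sib v p -> rk_ge (Dset i (sibv v p)) Y (r p)) ->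
  rk_ge (Dset i v) Z (\sum_(p | sib v p) r p + r0).
Proof.
move=> hh hY hZ hVm hVZ hYZ hhx hr0 hr.
pose le p q := (colsum (sibv v q) <= colsum (sibv v p))%N.
have key (L : seq ('I_N * 'I_N)) : uniq L -> sorted le L -> all (sib v) L ->
    rk_ge (Dset i v) (fun g => Z g /\ forall p, sib v p -> p \notin L -> all (le p) L ->
       forall x, Dset i (sibv v p) x -> g x = 0) (\sum_(p <- L) r p + r0).
  elim: L => [_ _ _|p L IH].
    rewrite big_nil add0n; apply: rk_ge_mul hr0.
    - exact: Dset_irr.
    - exact: (pf_minor (fun s => v (wd s))).
    - exact: hVm.
    - by have [x Dx] := Dset_inhabited i v; exists x => //; apply: minor_neq0.
    move=> g hg; split; first exact: hVZ.
    move=> p hp _ _ x hx; rewrite (_ : minor _ x = 0) ?mul0r //.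
    apply: minor_vanish hx; first by apply/ltnW/colsum_sib.
    move=> s; apply/existsP; apply: contraT => /existsPn hn.
    have := colsum_sib hp; rewrite /colsum.
    rewrite [X in (_ < X)%N](eq_bigr (fun r => nat_of_ord (v (wd (s r))))); last first.
      by move=> r1 _; have := hn r1; rewrite negbK => /eqP ->.
    by rewrite -(reindex_inj (@perm_inj _ s) (P := xpredT) (F := fun r => nat_of_ord (v (wd r)))) ltnn.
  rewrite cons_uniq => /andP[pL uL] sL /andP[hp hL].
  have lep : all (le p) L.
    by apply: order_path_min sL => x y z; rewrite /le => h1 h2; apply: leq_trans h2 h1.
  rewrite big_cons -addnA; have [x0 Dx0 hx0] := hhx p hp.
  have e1 : rk_ge (Dset i v) (fun g => (Z g /\ (forall q, sib v q -> q \notin L -> all (le q) L ->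
       forall x, Dset i (sibv v q) x -> g x = 0)) /\ forall x, Dset i (sibv v p) x -> g x = 0)
       (\sum_(p <- L) r p + r0).
    apply: rk_ge_mono (IH uL (path_sorted sL) hL) => // g [Zg hg]; split; first by split.
    exact: hg.
  have hcl x : Dset i (sibv v p) x -> in_closure (Dset i v) x.
    by move: hp => /and3P[_ _ /covP[ab vab _]]; apply: Dset_closure.
  apply: rk_ge_mono (rk_ge_extend (@Dset_irr i (sibv v p)) hcl (pfM (pf_minor (fun s => sibv v p (wd s))) hh) _ hY _ e1 (hr p hp)) => //.
  - move=> g [[Zg hg]|[y Yy ->]].
      split=> // q hq; rewrite inE negb_or => /andP[qp qL] /andP[qlep qleL]; exact: hg.
    split; first exact: hYZ.
    move=> q hq; rewrite inE negb_or => /andP[qp _] /andP[qlep _] x Dx.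
    by rewrite (minor_sib_vanish hq hp qp qlep Dx) !mul0r.
  - by move=> g [Zg _]; apply: hZ.
  - by exists x0 => //; rewrite mulf_neq0 // minor_neq0.
pose L := sort le (enum [pred p | sib v p]).
have le_total : total le by move=> p q; rewrite /le leq_total.
have hL : all (sib v) L by apply/allP => p; rewrite mem_sort mem_enum.
have := key L; rewrite sort_uniq enum_uniq sort_sorted // => /(_ isT isT hL).
rewrite (_ : \sum_(p <- L) r p = \sum_(p | sib v p) r p)%N; last first.
  by rewrite (perm_big (enum [pred p | sib v p])) ?perm_sort // big_enum.
by apply: rk_ge_mono => // g [].
Qed.

End Minors.
End MatrixSchubert.

(** * Semicontinuity of the rank *)

Section Degeneration.
Variables (F : realFieldType) (N : nat).
Notation X := 'M[F]_N.
Implicit Types (D : X -> Prop).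

Definition evmx (fs : seq (X -> F)) k (xs : 'I_k -> X) : 'M[F]_(size fs, k) :=
  \matrix_(i, j) nth (fun=> 0) fs i (xs j).

(** A nontrivial relation valid at the points chosen so far fails at some point of D, and adjoining
    that point raises the rank of the evaluation matrix. *)
Lemma indep_points D fs : indep D fs ->
  exists k (xs : 'I_k -> X), (forall j, D (xs j)) /\ row_free (evmx fs xs).
Proof.
move=> ind.
have h d : forall k (xs : 'I_k -> X), (forall j, D (xs j)) ->
    (size fs - \rank (evmx fs xs) <= d)%N ->
    exists k (xs : 'I_k -> X), (forall j, D (xs j)) /\ row_free (evmx fs xs).
  elim: d => [|d IH] k xs hxs hd.
    exists k, xs; split=> //; rewrite /row_free eqn_leq rank_leq_row.
    by move: hd; rewrite leqn0 subn_eq0.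
  have [free|nfree] := boolP (row_free (evmx fs xs)); first by exists k, xs.
  have /rowV0Pn[c ck c0] : kermx (evmx fs xs) != 0 by rewrite kermx_eq0.
  have [x Dx hx] : exists2 x, D x & \sum_i c 0 i * nth (fun=> 0) fs i x != 0.
    apply: boolp.contrapT => hn; case/eqP: c0; apply/rowP => i; rewrite mxE.
    pose c' (i : nat) := if insub i is Some j then c 0 j else 0.
    have := ind c' _ i (ltn_ord i); rewrite /c' valK; apply=> x Dx.
    apply/eqP; apply: contraT => hx; case: hn; exists x => //; move: hx.
    by under eq_bigr => j _ do rewrite valK.
  pose xs' := fun j : 'I_(k + 1) => match split j with inl j => xs j | inr _ => x end.
  have hM : evmx fs xs' = row_mx (evmx fs xs) (\col_i nth (fun=> 0) fs i x).
    by apply/matrixP => i j; rewrite !mxE /xs'; case: (split j) => j'; rewrite mxE.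
  apply: (IH _ xs') => [j|]; first by rewrite /xs'; case: (split j).
  suff lt : (\rank (evmx fs xs) < \rank (evmx fs xs'))%N by lia.
  have : (kermx (evmx fs xs') < kermx (evmx fs xs))%MS.
    rewrite ltmxE; apply/andP; split.
      apply/sub_kermxP; have := mulmx_ker (evmx fs xs'); rewrite {2}hM mul_mx_row.
      by move/eqP; rewrite -row_mx0 => /eqP/eq_row_mx[].
    apply/negP => /(submx_trans ck)/sub_kermxP; rewrite hM mul_mx_row -row_mx0.
    move=> /eq_row_mx[_ /matrixP/(_ 0 0)]; rewrite !mxE => e; move: hx.
    by case/eqP; rewrite -[RHS]e; apply: eq_bigr => i _; rewrite mxE.
  move/rank_ltmx; rewrite !mxrank_ker; have := rank_leq_row (evmx fs xs); lia.
by apply: (h _ 0%N (fun=> 0) _ (leqnn _)); case.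
Qed.

Lemma indep_of_points D fs k (xs : 'I_k -> X) : (forall j, D (xs j)) ->
  row_free (evmx fs xs) -> indep D fs.
Proof.
move=> hxs free c hc i ilt.
have e : (\row_(i < size fs) c i) *m evmx fs xs = 0 *m evmx fs xs.
  apply/rowP => j; rewrite mul0mx mxE [RHS]mxE -[RHS](hc _ (hxs j)); apply: eq_bigr => a _.
  by rewrite !mxE.
by have /rowP/(_ (Ordinal ilt)) := row_free_inj free e; rewrite !mxE.
Qed.

(** Independence at t = 0 is seen at finitely many points. With B a right inverse of the evaluation
    matrix at t = 0, the determinant of the evaluation matrix at t times B is a polynomial in t with
    value 1 at 0, and independence persists where it is nonzero. The factor 'X excludes t = 0, where
    no deformed generators are assumed. *)
Lemma rk_degenerate D (J : eqType) (G : J -> (X -> F) -> Prop)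
    (Gt : F -> J -> (X -> F) -> Prop) e r :
  (forall j g, G j g -> exists p : X -> {poly F}, (forall x, D x -> g x = (p x).[0]) /\
     forall t, t != 0 -> exists g', gr (Gt t) (fun k => (k == j)%N) g' /\
       forall x, D x -> g' x = (p x).[t]) ->
  rk_ge D (gr G e) r ->
  exists2 q : {poly F}, q != 0 & forall t, q.[t] != 0 -> rk_ge D (gr (Gt t) e) r.
Proof.
move=> hG [fs [sf hf ind]].
have fam e' f : gr G e' f -> exists p : X -> {poly F}, (forall x, D x -> f x = (p x).[0]) /\
     forall t, t != 0 -> exists f', gr (Gt t) e' f' /\ forall x, D x -> f' x = (p x).[t].
  elim=> {e' f} [|j g e' f hg _ [p [p0 hp]]|e'|c e' f g _ [p [p0 hp]] _ [q [q0 hq]]].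
  - exists (fun=> 1%:P); split=> [x _|t t0]; first by rewrite hornerC.
    by exists (fun=> 1); split=> [|x _]; [exact: gr1 | rewrite hornerC].
  - have [q [q0 hq]] := hG j g hg; exists (fun x => q x * p x); split=> [x Dx|t t0].
      by rewrite hornerM q0 ?p0.
    have [g' [hg' eg]] := hq t t0; have [f' [hf' ef]] := hp t t0.
    exists (fun x => g' x * f' x); split=> [|x Dx]; last by rewrite hornerM eg ?ef.
    by apply: gr_ext (grM hg' hf') _ _ => // k; rewrite addnC.
  - exists (fun=> 0); split=> [x _|t t0]; first by rewrite horner0.
    by exists (fun=> 0); split=> [|x _]; [exact: gr0 | rewrite horner0].
  - exists (fun x => c%:P * p x + q x); split=> [x Dx|t t0].
      by rewrite hornerD hornerM hornerC p0 ?q0.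
    have [f' [hf' ef]] := hp t t0; have [g' [hg' eg]] := hq t t0.
    exists (fun x => c * f' x + g' x); split=> [|x Dx]; first exact: gr_lin.
    by rewrite hornerD hornerM hornerC ef ?eg.
have [k [xs [hxs free]]] := indep_points ind.
have hp i : exists p : X -> {poly F}, (i < size fs)%N ->
    (forall x, D x -> nth (fun=> 0) fs i x = (p x).[0]) /\
    forall t, t != 0 -> exists f', gr (Gt t) e f' /\ forall x, D x -> f' x = (p x).[t].
  have [ilt|nlt] := boolP (i < size fs)%N; last by exists (fun=> 0).
  by have [p hp] := fam _ _ (hf i ilt); exists p.
pose p i := sval (boolp.cid (hp i)).
have pP i (ilt : (i < size fs)%N) := svalP (boolp.cid (hp i)) ilt.
have /row_freeP[B hB] := free.
pose M : 'M[{poly F}]_(size fs, k) := \matrix_(i, j) p i (xs j).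
pose q := \det (M *m map_mx polyC B).
have qE t : q.[t] = \det ((\matrix_(i, j) (p i (xs j)).[t]) *m B).
  rewrite /q -horner_evalE -det_map_mx map_mxM /=; congr (\det (_ *m _)).
    by apply/matrixP => i j; rewrite !mxE.
  by apply/matrixP => i j; rewrite !mxE /= horner_evalE hornerC.
exists ('X * q).
  rewrite mulf_neq0 ?polyX_eq0 //; apply/eqP => q0; have := qE 0; rewrite q0 horner0.
  have -> : \matrix_(i, j) (p i (xs j)).[0] = evmx fs xs.
    by apply/matrixP => i j; rewrite !mxE; have [-> //] := pP i (ltn_ord i).
  by rewrite hB det1 => /eqP; rewrite eq_sym oner_eq0.
move=> t; rewrite hornerM hornerX mulf_eq0 negb_or => /andP[t0 qt].
have hf' i : exists f', (i < size fs)%N -> gr (Gt t) e f' /\ forall x, D x -> f' x = (p i x).[t].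
  have [ilt|nlt] := boolP (i < size fs)%N; last by exists (fun=> 0).
  by have [_ h] := pP i ilt; have [f' h'] := h t t0; exists f'.
pose f' i := sval (boolp.cid (hf' i)).
have fP i (ilt : (i < size fs)%N) := svalP (boolp.cid (hf' i)) ilt.
pose fs' := mkseq f' (size fs).
exists fs'; rewrite size_mkseq; split=> //.
  by move=> i ilt; rewrite nth_mkseq //; case: (fP i ilt).
apply: (indep_of_points hxs); rewrite -kermx_eq0.
have sz : size fs' = size fs by rewrite size_mkseq.
have -> : evmx fs' xs = castmx (esym sz, erefl k) (\matrix_(i, j) (p i (xs j)).[t]).
  apply/matrixP => i j; rewrite mxE castmxE mxE /= cast_ord_id.
  have ilt : (i < size fs)%N by rewrite -sz.
  by rewrite nth_mkseq //; case: (fP i ilt) => _ h; apply: h.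
rewrite kermx_eq0 /row_free.
have : row_free (\matrix_(i < size fs, j < k) (p i (xs j)).[t]).
  apply/row_freeP; exists (B *m invmx ((\matrix_(i, j) (p i (xs j)).[t]) *m B)).
  by rewrite mulmxA mulmxV // unitmxE -qE unitfE.
by move: (\matrix_(i, j) _) => Q; case: _ / (esym sz) => /eqP; rewrite castmx_id => ->.
Qed.

End Degeneration.

(** * First rows of the cell matrices *)

Section Rotation.
Variables (F : realFieldType) (n : nat).
Notation N := n.+1.
Notation X := 'M[F]_N.

(** If v(0) is maximal, the first row of a cell matrix is a multiple of the last basis vector. It
    can be split off as one more degenerate row, and [c0] is chosen so that its scale agrees with
    lam. A rank on the smaller set is a lower bound on the larger one. *)
Lemma Dset_rot i (v : 'S_N) (x : X) : (i < N)%N -> v ord0 = ord_max ->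
  Dset i.+1 (cyc n * v)%g x -> Dset i v x.
Proof.
move=> iN v0 [L [U [lam [[La Lb] [Ua Ub] hl ->]]]].
pose c0 := lam (inord i) / U ord_max ord_max.
pose pr (r : 'I_N) : 'I_N := inord r.-1.
pose L' : X := \matrix_(r, c) if r == ord0 then (c == ord0)%:R * c0
   else if c == ord0 then 0 else L (pr r) (pr c).
have prE (r : 'I_N) : r != ord0 -> (pr r).+1 = r.
  move=> r0; have r1 : (0 < r)%N by rewrite lt0n; move: r0; rewrite -val_eqE.
  have rN : (r.-1 < N)%N by exact: leq_ltn_trans (leq_pred _) (ltn_ord r).
  by rewrite /pr inordK // prednK.
exists L', U, lam; split=> //.
  split=> [a b ab|a]; rewrite mxE.
    have b0 : b != ord0 by apply: contraTneq ab => ->.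
    rewrite (negbTE b0); case: eqP => [_|/eqP a0]; first by rewrite mul0r.
    by apply: La; have := prE a a0; have := prE b b0; lia.
  have [_|a0] := eqVneq a ord0; last exact: Lb.
  by rewrite mul1r mulf_neq0 ?invr_neq0.
apply/matrixP => r c; rewrite !mxE; have [ri|ri] := ltnP r i; first by rewrite (ltnW ri : (r < i.+1)%N).
have [er|nr] := eqVneq (r : nat) i.
  rewrite er ltnSn subnn; have -> : inord 0 = ord0 :> 'I_N by apply: ord_inj; rewrite inordK.
  rewrite (bigD1 ord0) //= big1 ?addr0 => [|l l0]; last by rewrite mxE eqxx (negbTE l0) !mul0r.
  rewrite !mxE !eqxx mul1r v0 /c0; have -> : inord i = r by apply: ord_inj; rewrite inordK.
  have [->|cm] := eqVneq c ord_max; first by rewrite mulr1 divfK.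
  have cn : (c < n)%N by move: cm; rewrite -val_eqE /=; have := ltn_ord c; lia.
  by rewrite (Ua ord_max c cn) !mulr0.
have ri' : (i < r)%N by rewrite ltn_neqAle eq_sym nr.
rewrite ltnS leqNgt ri' /=.
have rN := ltn_ord r.
have n0 : inord (r - i) != ord0 :> 'I_N.
  by rewrite -val_eqE /= inordK; lia.
rewrite [RHS]big_ord_recl [LHS]big_ord_recr /= !mxE (negbTE n0) eqxx mul0r add0r.
rewrite [X in _ + X](_ : _ = 0) ?addr0; last first.
  by rewrite La ?mul0r // inordK /=; lia.
apply: eq_bigr => l _; rewrite !mxE (negbTE n0) /=; congr (_ * U _ _).
  congr (L _ _); apply: ord_inj; rewrite /pr !inordK //=; try by [lia | have := ltn_ord l; lia].
by rewrite permM; congr (v _); apply/cycV_succ.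
Qed.

Lemma Dset_coord0 (i : 'I_N) (v : 'S_N) (x : X) (c : 'I_N) :
  (c < v ord0)%N -> Dset i v x -> x i c = 0.
Proof.
move=> cv [L [U [lam [[La Lb] [Ua Ub] hl ->]]]]; rewrite !mxE ltnn subnn.
have -> : inord 0 = ord0 :> 'I_N by apply: ord_inj; rewrite inordK.
rewrite big1 // => l _; rewrite !mxE; have [->|l0] := eqVneq l ord0; first by rewrite Ua ?mulr0.
by rewrite La ?mul0r // lt0n; move: l0; rewrite -val_eqE.
Qed.

Lemma Dset_coord_lead (i : 'I_N) (v : 'S_N) (x : X) : Dset i v x -> x i (v ord0) != 0.
Proof.
move=> [L [U [lam [[La Lb] [Ua Ub] hl ->]]]]; rewrite !mxE ltnn subnn.
have -> : inord 0 = ord0 :> 'I_N by apply: ord_inj; rewrite inordK.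
rewrite (bigD1 ord0) //= big1 ?addr0 => [|l l0]; last first.
  by rewrite La ?mul0r // lt0n; move: l0; rewrite -val_eqE.
by rewrite mxE mulf_neq0.
Qed.

Lemma Dset_coord_max (i : nat) (r : 'I_N) (v : 'S_N) : exists2 x : X, Dset i v x & x r ord_max != 0.
Proof.
pose U : X := \matrix_(a, b) (a <= b)%:R.
exists (pt i (fun=> 1) (1%:M *m row_perm v U)).
  exists 1%:M, U, (fun=> 1); split=> [||s|//]; last by rewrite oner_eq0.
    split=> [a b ab|a]; rewrite mxE ?eqxx ?oner_eq0 // -val_eqE /=.
    by move: ab; case: ltngtP.
  by split=> [a b ab|a]; rewrite mxE ?leqnn ?oner_eq0 // leqNgt ab.
rewrite mxE; case: ifP => _; first by rewrite eqxx mulr1 oner_eq0.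
by rewrite mul1mx !mxE -ltnS ltn_ord oner_eq0.
Qed.

End Rotation.

(** * Weighted counts of Schubert coefficients *)

(* The coefficient of z^m in (1 + z)^t (1 + S z)^a. *)
Fixpoint bb (S t a m : nat) : nat :=
  match a, m with
  | 0, _ => 'C(t, m)
  | a'.+1, 0 => 1
  | a'.+1, m'.+1 => bb S t a' m'.+1 + S * bb S t a' m'
  end.

Lemma bb0 S t a : bb S t a 0 = 1%N.
Proof. by case: a => //=; rewrite bin0. Qed.

Lemma bbSt S t a m : bb S t.+1 a m.+1 = (bb S t a m.+1 + bb S t a m)%N.
Proof.
elim: a m => [|a IH] m /=; first by rewrite binS.
by rewrite IH; case: m => [|m]; rewrite ?bb0 /= ?IH; lia.
Qed.

Lemma bbSa S t a m : bb S t a.+1 m.+1 = (bb S t a m.+1 + S * bb S t a m)%N.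
Proof. by []. Qed.

Lemma bb_mono S t t' a m : (t <= t')%N -> (bb S t a m <= bb S t' a m)%N.
Proof.
move=> /subnKC <-; elim: (t' - t)%N => [|d IH]; first by rewrite addn0.
apply: leq_trans IH _; rewrite addnS; case: m => [|m]; first by rewrite !bb0.
by rewrite bbSt leq_addr.
Qed.

Section LinearForm.
Variables (R : comNzRingType) (n : nat).
Implicit Types (p q : {mpoly R[n]}) (phi : 'X_{1..n} -> R).

(** A weight on exponents, extended linearly. Multiplication by monomials and permutation of
    variables are moved onto the weight. *)
Definition lf phi p := \sum_(m <- msupp p) p@_m * phi m.

Lemma lf_sup phi p (r : seq 'X_{1..n}) : uniq r -> {subset msupp p <= r} ->
  lf phi p = \sum_(m <- r) p@_m * phi m.
Proof.
move=> ur sub; rewrite [RHS](bigID (mem (msupp p))) /= [X in _ = _ + X]big1 ?addr0.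
  rewrite -big_filter; apply: perm_big; apply: uniq_perm; rewrite ?filter_uniq ?msupp_uniq //.
  by move=> m; rewrite mem_filter /=; case: (boolP (m \in msupp p)) => [/sub ->|].
by move=> m /memN_msupp_eq0 ->; rewrite mul0r.
Qed.

Lemma lf_ext phi psi p : {in msupp p, phi =1 psi} -> lf phi p = lf psi p.
Proof. by move=> h; rewrite /lf big_seq [RHS]big_seq; apply: eq_bigr => m /h ->. Qed.

Lemma lfD phi p q : lf phi (p + q) = lf phi p + lf phi q.
Proof.
pose r := undup (msupp p ++ msupp q ++ msupp (p + q)).
have ur : uniq r by rewrite undup_uniq.
rewrite !(@lf_sup phi _ r) //; last 3 first.
- by move=> m h; rewrite mem_undup !mem_cat h ?orbT.
- by move=> m h; rewrite mem_undup !mem_cat h ?orbT.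
- by move=> m h; rewrite mem_undup !mem_cat h ?orbT.
by rewrite -big_split; apply: eq_bigr => m _; rewrite mcoeffD mulrDl.
Qed.

Lemma lf0 phi : lf phi 0 = 0.
Proof. by rewrite /lf msupp0 big_nil. Qed.

Lemma lfZ phi c p : lf phi (c *: p) = c * lf phi p.
Proof.
rewrite (@lf_sup phi _ (msupp p)) ?msupp_uniq //; last by move=> m /msuppZ_le.
by rewrite /lf mulr_sumr; apply: eq_bigr => m _; rewrite mcoeffZ mulrA.
Qed.

Lemma lf_sum phi (I : Type) (r : seq I) (P : pred I) (f : I -> {mpoly R[n]}) :
  lf phi (\sum_(i <- r | P i) f i) = \sum_(i <- r | P i) lf phi (f i).
Proof. by apply: big_morph; [exact: lfD | exact: lf0]. Qed.

Lemma lfX phi m : lf phi 'X_[m] = phi m.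
Proof. by rewrite /lf msuppX big_seq1 mcoeffX eqxx mul1r. Qed.

Lemma lfDl phi psi p : lf (fun m => phi m + psi m) p = lf phi p + lf psi p.
Proof. by rewrite /lf -big_split; apply: eq_bigr => m _; rewrite mulrDr. Qed.

Lemma lfZl c phi p : lf (fun m => c * phi m) p = c * lf phi p.
Proof. by rewrite /lf mulr_sumr; apply: eq_bigr => m _; rewrite mulrCA. Qed.

Lemma lf_mulX phi (m0 : 'X_{1..n}) p : lf phi ('X_[m0] * p) = lf (fun m => phi (m0 + m)%MM) p.
Proof.
rewrite {1}[p]mpolyE mulr_sumr lf_sum; apply: eq_bigr => m _.
by rewrite -scalerAr lfZ -mpolyXD lfX.
Qed.

Lemma lf_msym phi (s : 'S_n) p : lf phi (msym s p) = lf (fun m => phi [multinom m ((s^-1)%g k) | k < n]) p.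
Proof.
rewrite {1}[p]mpolyE raddf_sum lf_sum; apply: eq_bigr => m _.
by rewrite /= msymZ lfZ msymX lfX.
Qed.

End LinearForm.

Section Weights.
Variables (F : realFieldType) (n S : nat).
Notation N := n.+1.
Implicit Types (v : 'S_N) (i : nat) (T al : 'I_N -> nat) (m : 'X_{1..N}).

Definition inc (r : 'I_N) T : 'I_N -> nat := fun k => (T k + (k == r))%N.

(** Variable k is weighted with the parameters of row i + k. The degenerate rows r < i carry no
    weight, and a variable without a row must not occur. *)
Definition wt i T al m : nat :=
  (\prod_(k < N) (if i + k < N then bb S (T (inord (i + k))) (al (inord (i + k))) (n - m k)
                  else m k == 0))%N.

Definition Hw i v T al : F := lf (fun m => (wt i T al m)%:R) (Sch F v).

Lemma lf_ge0 (phi : 'X_{1..N} -> F) v : (forall m, 0 <= phi m) -> 0 <= lf phi (Sch F v).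
Proof. by move=> h; apply: sumr_ge0 => m _; rewrite mulr_ge0 ?Sch_coeff_ge0. Qed.

Lemma lf_le (phi psi : 'X_{1..N} -> F) v : (forall m, m \in msupp (Sch F v) -> phi m <= psi m) ->
  lf phi (Sch F v) <= lf psi (Sch F v).
Proof.
by move=> h; rewrite /lf big_seq [leRHS]big_seq; apply: ler_sum => m /h hm; rewrite ler_wpM2l ?Sch_coeff_ge0.
Qed.

Lemma Hw_ge0 i v T al : 0 <= Hw i v T al.
Proof. by apply: lf_ge0 => m; rewrite ler0n. Qed.

Lemma Hw_ext i v T al T' al' : (forall r : 'I_N, (i <= r)%N -> T r = T' r /\ al r = al' r) ->
  Hw i v T al = Hw i v T' al'.
Proof.
move=> h; apply: lf_ext => m _; congr (_%:R); apply: eq_bigr => k _; case: ifP => // ik.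
by have [|-> ->] := h (inord (i + k)); first by rewrite inordK // leq_addr.
Qed.

(** With all rows degenerate only the constant coefficient counts, which is 1 for the identity and 0
    otherwise. *)
Lemma Hw_last v T al : Hw N v T al <= 1.
Proof.
have -> : Hw N v T al = (Sch F v)@_0.
  rewrite /Hw (lf_ext (psi := fun m => (m == 0%MM)%:R)) => [|m _]; last first.
    congr (_%:R); rewrite /wt; have [->|m0] := eqVneq m 0%MM.
      by apply: big1 => k _; rewrite ltnNge leq_addr /= mnm0E.
    have [k mk] : exists k, m k != 0%N.
      apply/existsP; apply: contraT => /existsPn hn; case/eqP: m0; apply/mnmP => k.
      by rewrite mnm0E; apply/eqP; have := hn k; rewrite negbK.
    by rewrite (bigD1 k) //= ltnNge leq_addr /= (negbTE mk).
  rewrite (@lf_sup _ _ _ _ (undup (0%MM :: msupp (Sch F v)))) ?undup_uniq //; last first.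
    by move=> m hm; rewrite mem_undup inE hm orbT.
  rewrite (bigD1_seq 0%MM) ?undup_uniq ?mem_undup ?mem_head //= eqxx mulr1 big1 ?addr0 //.
  by move=> m /negbTE ->; rewrite mulr0.
by rewrite Sch_coeff_zero; case: eqP; rewrite ?ler01 ?lexx.
Qed.

Lemma Hw_rot i v T al : (i < N)%N -> v ord0 = ord_max ->
  Hw i v T al = Hw i.+1 (cyc n * v)%g T al.
Proof.
move=> iN v0; rewrite {1}/Hw Sch_rotation // lf_mulX lf_msym; apply: lf_ext => m hm.
congr (_%:R); rewrite /wt big_ord_recl [RHS]big_ord_recr /= addn0 iN.
have mmax : m ord_max = 0%N by apply: Sch_msupp_max hm.
have c0 : ((cyc n)^-1)%g ord0 = ord_max by apply: (@perm_inj _ (cyc n)); rewrite permKV cyc_max.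
rewrite mnmDE mulmnE mnm1E eqxx mul1n mnmE c0 mmax addn0 subnn bb0 mul1n.
have -> : (i.+1 + n < N)%N = false by rewrite addSnnS ltnNge leq_addl.
rewrite eqxx muln1; apply: eq_bigr => k _.
have ck : ((cyc n)^-1)%g (lift ord0 k) = widen_ord (leqnSn n) k.
  by apply: (@perm_inj _ (cyc n)); rewrite permKV; apply/esym/cycV_succ.
by rewrite mnmDE mulmnE mnm1E mnmE ck /= mul0n add0n /bump /= add1n addnS.
Qed.

Lemma wt_split i T al m : (i < N)%N -> wt i T al m =
  (bb S (T (inord i)) (al (inord i)) (n - m ord0) * \prod_(k < n) (if i + k.+1 < N then
     bb S (T (inord (i + k.+1))) (al (inord (i + k.+1))) (n - m (lift ord0 k)) else m (lift ord0 k) == 0))%N.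
Proof. by move=> iN; rewrite /wt big_ord_recl /= addn0 iN. Qed.

Lemma inordS_neq i k : (i + k.+1 < N)%N -> (inord (i + k.+1) == inord i :> 'I_N) = false.
Proof. by move=> h; apply/negP => /eqP/(congr1 val); rewrite /= !inordK //; lia. Qed.

(** Raising a parameter of row i adds x times the weight at the next lower power. Lowering n - m 0
    by one amounts to multiplying the monomial by the first variable, so Monk's rule turns the
    change into a sum over covers. *)
Lemma Hw_monk (x : nat) i v T al T' al' : (i < N)%N -> (v ord0 < n)%N ->
  (forall r, r != inord i -> T' r = T r /\ al' r = al r) ->
  (forall m : nat, bb S (T' (inord i)) (al' (inord i)) m.+1 =
     bb S (T (inord i)) (al (inord i)) m.+1 + x * bb S (T (inord i)) (al (inord i)) m)%N ->
  Hw i v T' al' = Hw i v T al + x%:R * \sum_(b | cov v ord0 b) Hw i (tperm ord0 b * v)%g T al.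
Proof.
move=> iN v0 hr hb.
have := Sch_coeff_monk F; pose p := (v^-1)%g ord_max.
have vp : v p = ord_max by rewrite /p permKV.
have p0 : (@ord0 n < p)%N.
  by rewrite lt0n; apply/eqP => e; move: v0; rewrite (_ : ord0 = p) ?vp ?ltnn //; apply: ord_inj.
move=> _; have M := monk F p0 (congr1 (fun x => (nat_of_ord x).+1) vp).
rewrite [X in _ = _ - X]big_pred0 ?subr0 in M; last first.
  by move=> c; apply/negP => /covP[]; rewrite ltn0.
rewrite /Hw -lf_sum -M lf_mulX -lfZl -lfDl; apply: lf_ext => m hm.
have m0 := Sch_exponent0 v0 hm.
rewrite -natrM -natrD; congr (_%:R); rewrite !wt_split //.
have -> : (n - m ord0 = (n - (U_(ord0) + m)%MM ord0).+1)%N.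
  by rewrite mnmDE mnm1E eqxx; move: m0; lia.
have e k : (U_(ord0) + m)%MM (lift ord0 k) = m (lift ord0 k) by rewrite mnmDE mnm1E.
rewrite hb mulnDl mulnA; congr (_ * _ + _ * _)%N; apply: eq_bigr => k _; rewrite ?e;
  case: ifP => // h; by case: (hr (inord (i + k.+1))) => [|-> ->]; rewrite ?inordS_neq.
Qed.

Lemma Hw_incT i v T al : (i < N)%N -> (v ord0 < n)%N ->
  Hw i v (inc (inord i) T) al = Hw i v T al + \sum_(b | cov v ord0 b) Hw i (tperm ord0 b * v)%g T al.
Proof.
move=> iN v0; rewrite (@Hw_monk 1 i v T al) ?mul1r //.
  by move=> r /negbTE h; rewrite /inc h addn0.
by move=> m; rewrite /inc eqxx addn1 bbSt mul1n.
Qed.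

Lemma Hw_incA i v T al : (i < N)%N -> (v ord0 < n)%N ->
  Hw i v T (inc (inord i) al) = Hw i v T al + S%:R * \sum_(b | cov v ord0 b) Hw i (tperm ord0 b * v)%g T al.
Proof.
move=> iN v0; rewrite (@Hw_monk S i v T al) //.
  by move=> r /negbTE h; rewrite /inc h addn0.
by move=> m; rewrite /inc eqxx addn1 bbSa.
Qed.

Lemma Hw_eq0 i v T al : (i < N)%N -> (v ord0 < n)%N -> T (inord i) = 0%N -> al (inord i) = 0%N ->
  Hw i v T al = 0.
Proof.
move=> iN v0 hT ha; rewrite /Hw (lf_ext (psi := fun=> 0)) => [|m hm].
  by rewrite /lf big1 // => m _; rewrite mulr0.
rewrite wt_split // hT ha /=; have := Sch_exponent0 v0 hm.
by case e : (n - m ord0)%N => [|x] //; lia.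
Qed.

End Weights.

(** * Lower bounds for ranks *)

Section LowerBound.
Variables (F : realFieldType) (n S : nat).
Notation N := n.+1.
Notation X := 'M[F]_N.
Implicit Types (v : 'S_N) (i : nat) (T al : 'I_N -> nat) (s : nat -> nat) (rho : nat -> 'I_N).

Lemma pfX (f : X -> F) m : pf f -> pf (fun x => f x ^+ m).
Proof.
move=> hf; elim: m => [|m IH].
  by rewrite (_ : (fun=> _) = fun=> 1); [exact: pfC | apply: boolp.funext => x; rewrite expr0].
rewrite (_ : (fun=> _) = fun x => f x * f x ^+ m); first exact: pfM.
by apply: boolp.funext => x; rewrite exprS.
Qed.

Definition rkR (D : X -> Prop) V (h : F) := exists2 r, rk_ge D V r & h <= r%:R.

Lemma rkR_le D V h h' : h' <= h -> rkR D V h -> rkR D V h'.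
Proof. by move=> hh [r hr hl]; exists r => //; apply: le_trans hl. Qed.

Lemma rkR_mono D D' (V V' : (X -> F) -> Prop) h :
  (forall x, D x -> D' x) -> (forall f, V f -> V' f) -> rkR D V h -> rkR D' V' h.
Proof. by move=> hD hV [r hr hl]; exists r => //; apply: rk_ge_mono hr. Qed.

Lemma rkR_sec i k (hk : (i + k < N)%N) v (h : X -> F) (Vm Y Z : (X -> F) -> Prop) h0 (hb : 'I_N * 'I_N -> F) :
  pf h -> (forall g, Y g -> pf g) -> (forall g, Z g -> pf g) -> (forall g, Vm g -> pf g) ->
  (forall g, Vm g -> Z (fun x => minor i (fun s : 'I_k.+1 => v (wd hk s)) x * g x)) ->
  (forall p y, sib k v p -> Y y -> Z (fun x => (minor i (fun s : 'I_k.+1 => sibv v p (wd hk s)) x * h x) * y x)) ->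
  (forall p, sib k v p -> exists2 x, Dset i (sibv v p) x & h x != 0) ->
  rkR (Dset i v) Vm h0 -> (forall p, sib k v p -> rkR (Dset i (sibv v p)) Y (hb p)) ->
  rkR (Dset i v) Z (h0 + \sum_(p | sib k v p) hb p).
Proof.
move=> hh hY hZ hVm h1 h2 h3 [r0 hr0 hl0] h4.
have h5 p : exists r, sib k v p -> rk_ge (Dset i (sibv v p)) Y r /\ hb p <= r%:R.
  case: (boolP (sib k v p)) => [/h4[r hr hl]|_]; last by exists 0%N.
  by exists r.
pose r p := sval (boolp.cid (h5 p)).
have rP p (hp : sib k v p) := svalP (boolp.cid (h5 p)) hp.
exists (\sum_(p | sib k v p) r p + r0)%N.
  apply: (rk_sec hh hY hZ hVm h1 h2 h3 hr0) => p hp; exact: (rP p hp).1.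
rewrite natrD addrC lerD // natr_sum; apply: ler_sum => p hp; exact: (rP p hp).2.
Qed.

Lemma sum_sib0 v (f : 'I_N * 'I_N -> F) :
  \sum_(p | sib 0 v p) f p = \sum_(b | cov v ord0 b) f (ord0, b).
Proof.
rewrite (eq_bigl (fun p : 'I_N * 'I_N => (p.1 == ord0) && cov v ord0 p.2)); last first.
  case=> a b; rewrite /sib /= leqn0 -val_eqE /=; case: eqP => //= a0.
  have -> : a = ord0 by apply: ord_inj.
  by case c : (cov v ord0 b); rewrite ?andbF // andbT; case/covP: c.
rewrite (eq_bigr (fun p => f (p.1, p.2))) => [|[]//].
rewrite -(pair_big (fun a : 'I_N => a == ord0) (fun b => cov v ord0 b) (fun a b => f (a, b))) /=.
by rewrite big_pred1_eq.
Qed.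

Lemma minor0E i (C : 'I_1 -> 'I_N) (x : X) : minor i C x = x (inord i) (C ord0).
Proof. by rewrite /minor det_mx11 mxE addn0. Qed.

Lemma rkR_sec0 i (iN : (i < N)%N) v (h : X -> F) (Vm Y Z : (X -> F) -> Prop) h0 (hb : 'I_N -> F) :
  pf h -> (forall g, Y g -> pf g) -> (forall g, Z g -> pf g) -> (forall g, Vm g -> pf g) ->
  (forall g, Vm g -> Z (fun x => x (inord i) (v ord0) * g x)) ->
  (forall b y, cov v ord0 b -> Y y -> Z (fun x => (x (inord i) (v b) * h x) * y x)) ->
  (forall b, cov v ord0 b -> exists2 x, Dset i (tperm ord0 b * v)%g x & h x != 0) ->
  rkR (Dset i v) Vm h0 ->
  (forall b, cov v ord0 b -> rkR (Dset i (tperm ord0 b * v)%g) Y (hb b)) ->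
  rkR (Dset i v) Z (h0 + \sum_(b | cov v ord0 b) hb b).
Proof.
move=> hh hY hZ hVm h1 h2 h3 h4 h5.
have hk : (i + 0 < N)%N by rewrite addn0.
have wd0 : wd hk ord0 = ord0 by apply: ord_inj.
have sib0 p : sib 0 v p -> p = (ord0, p.2) /\ cov v ord0 p.2.
  case: p => a b /and3P[/= a0 _ c].
  by have <- : a = ord0 by apply: ord_inj => /=; lia.
rewrite (_ : \sum_(b | _) _ = \sum_(p | sib 0 v p) hb p.2); last by rewrite sum_sib0.
apply: (@rkR_sec i 0 hk v h Vm Y Z) => //.
- move=> g /h1; congr Z; apply: boolp.funext => x; by rewrite minor0E wd0.
- move=> p y /sib0[-> c] Yy; have := h2 _ _ c Yy; congr Z; apply: boolp.funext => x.
  by rewrite minor0E wd0 /sibv permM tpermL.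
- by move=> p /sib0[-> c]; apply: h3.
- by move=> p /sib0[-> c]; apply: h5.
Qed.

(** The coefficients lie on the moment curve, so that distinct parameters give independent forms by
    a Vandermonde argument. *)
Definition ell (r : 'I_N) (t : F) : X -> F := fun x => \sum_(p < N) t ^+ p * x r p.

(* inl r generates degree T r, with the entries of row r; inr k generates degree
   s k, with the two sections of the k-th pencil. *)
Definition Gen rho (B : nat -> X -> F) (j : 'I_N + nat) (f : X -> F) : Prop :=
  match j with
  | inl r => exists c, f = (fun x => x r c)
  | inr k => f = (fun x => x (rho k) ord_max) \/ f = B k
  end.

Definition ex T s (j : 'I_N + nat) := match j with inl r => T r | inr k => s k end.

Definition VV rho B T s := gr (Gen rho B) (ex T s).

Definition incs (k : nat) s : nat -> nat := fun l => (s l + (l == k))%N.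

Lemma VV_ext rho B T s T' s' f f' : VV rho B T s f -> T =1 T' -> s =1 s' -> f =1 f' ->
  VV rho B T' s' f'.
Proof. by move=> h hT hs hf; apply: gr_ext h _ hf => -[r|k] /=. Qed.

Lemma VV_row rho B T s r c f : VV rho B T s f -> VV rho B (inc r T) s (fun x => x r c * f x).
Proof.
move=> h; have hg : Gen rho B (inl r) (fun x => x r c) by exists c.
by apply: gr_ext (gr_mul hg h) _ _ => // -[r'|k] /=; rewrite ?addn0.
Qed.

Lemma VV_max rho B T s k f : VV rho B T s f ->
  VV rho B T (incs k s) (fun x => x (rho k) ord_max * f x).
Proof.
move=> h; have hg : Gen rho B (inr k) (fun x => x (rho k) ord_max) by left.
by apply: gr_ext (gr_mul hg h) _ _ => // -[r'|l] /=; rewrite ?addn0.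
Qed.

Lemma VV_pen rho B T s k f : VV rho B T s f -> VV rho B T (incs k s) (fun x => B k x * f x).
Proof.
move=> h; have hg : Gen rho B (inr k) (B k) by right.
by apply: gr_ext (gr_mul hg h) _ _ => // -[r'|l] /=; rewrite ?addn0.
Qed.

Lemma VV_maxX rho B T s k m f : VV rho B T s f ->
  VV rho B T (fun l => s l + m * (l == k))%N (fun x => x (rho k) ord_max ^+ m * f x).
Proof.
elim: m => [|m IH] h.
  by apply: VV_ext h _ _ _ => // [l|x]; rewrite ?mul0n ?addn0 // expr0 mul1r.
apply: VV_ext (VV_max k (IH h)) _ _ _ => // [l|x]; last by rewrite exprS mulrA.
by rewrite /incs mulSn addnA addnAC.
Qed.

Lemma VV_pf rho B T s f : (forall k, pf (B k)) -> VV rho B T s f -> pf f.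
Proof.
move=> hB; apply: gr_pf => -[r|k] g /=; first by move=> [c ->]; apply: pf_coord.
by case=> ->; [apply: pf_coord | apply: hB].
Qed.

Lemma VV_upd rho B B' T s f : (forall k, (0 < s k)%N -> B k = B' k) ->
  VV rho B T s f -> VV rho B' T s f.
Proof.
move=> hB; apply: gr_sub => -[r|k] /= h g hg; apply: gr_gen => //=.
by rewrite -hB.
Qed.

Lemma pf_ell r t : pf (ell r t).
Proof. by apply: pf_sum => p; apply: pfM; [apply: pfC | apply: pf_coord]. Qed.

(** The number of pencils attached to row r. In the spaces below every pencil also adds one to the
    degree of its row. *)
Definition alpha K rho (r : 'I_N) : nat := (\sum_(k < K) (rho k == r))%N.
Definition sS K (k : nat) : nat := if (k < K)%N then S else 0.
Definition addT T T' : 'I_N -> nat := fun k => (T k + T' k)%N.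
Definition Bl rho (eps : nat -> F) k := ell (rho k) (eps k).

(* The rank on a degenerate cell is at least the weighted count, for K pencils of
   degree S each. *)
Definition good K rho eps i v T :=
  rkR (Dset i v) (VV rho (Bl rho eps) (addT T (alpha K rho)) (sS K)) (Hw F S i v T (alpha K rho)).

Lemma alphaS K rho : alpha K.+1 rho = inc (rho K) (alpha K rho).
Proof. by apply: boolp.funext => r; rewrite /alpha big_ord_recr /= /inc eq_sym. Qed.

Lemma Bl_pf rho eps k : pf (Bl rho eps k).
Proof. exact: pf_ell. Qed.

(** Rows i < r0 carry no pencil, so only the degree T(i) is to be peeled off, one unit per Monk
    step. If v(0) is not maximal and T(i) = 0, the count vanishes; if v(0) is maximal, row i
    degenerates and i increases. The bound b is carried along because generic parameters will be
    chosen for finitely many T at a time. *)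
Lemma good_descend K rho eps (r0 : nat) (b : nat) : (r0 <= N)%N ->
  (forall k, (k < K)%N -> (r0 <= rho k)%N) ->
  (forall v T, (forall r, (T r <= b)%N) -> good K rho eps r0 v T) ->
  forall i v T, (i <= r0)%N -> (forall r, (T r <= b)%N) -> good K rho eps i v T.
Proof.
move=> r0N hrho h0 i v T ir; have [d] := ubnP (r0 - i); elim: d i v T ir => // d IHd i v T ir.
have [e|ne] := eqVneq i r0; first by move=> _; rewrite e; apply: h0.
have iN : (i < N)%N by apply: leq_trans r0N; rewrite ltn_neqAle ne.
have al0 : alpha K rho (inord i) = 0%N.
  apply: big1 => k _; case: eqP => // /(congr1 val); rewrite /= inordK // => e.
  by have := hrho k (ltn_ord k); rewrite e leqNgt ltn_neqAle ne ir.
have [dv] := ubnP (n - v ord0); elim: dv v T => // dv IHv v T.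
have [v0|v0] := ltnP (v ord0) n; last first.
  have vm : v ord0 = ord_max by apply: ord_inj => /=; have := ltn_ord (v ord0); lia.
  move=> _ hd hT; rewrite /good (Hw_rot _ _ _ _ iN vm).
  have [||r hr hl] := IHd i.+1 (cyc n * v)%g T _ _ hT; first by rewrite ltn_neqAle ne.
    by move: hd; rewrite ltnS; apply: leq_trans; rewrite subnS prednK // subn_gt0 ltn_neqAle ne.
  by exists r => //; apply: rk_ge_mono hr => // x; apply: Dset_rot.
move=> hv hd; have [t] := ubnP (T (inord i)); elim: t T => // t IHt T ht hT.
case Ti : (T (inord i)) ht => [|t'] ht.
  exists 0%N; first exact: rk_ge0.
  by rewrite Hw_eq0.
pose T' : 'I_N -> nat := fun r => (T r - (r == inord i))%N.
have TE : T = inc (inord i) T'.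
  apply: boolp.funext => r; rewrite /inc /T'; case: eqP => [->|]; last by rewrite addn0 subn0.
  by rewrite Ti; lia.
have hT' r : (T' r <= b)%N by apply: leq_trans (leq_subr _ _) (hT r).
rewrite /good {2}TE Hw_incT //.
have pfV T1 s1 g : VV rho (Bl rho eps) T1 s1 g -> pf g by apply: VV_pf; apply: Bl_pf.
apply: (@rkR_sec0 i iN v (fun=> 1) (VV rho (Bl rho eps) (addT T' (alpha K rho)) (sS K))
   (VV rho (Bl rho eps) (addT T' (alpha K rho)) (sS K)) _ _
   (fun b => Hw F S i (tperm ord0 b * v)%g T' (alpha K rho))).
- exact: pfC.
- by move=> g; apply: pfV.
- by move=> g; apply: pfV.
- by move=> g; apply: pfV.
- move=> g hg; apply: VV_ext (VV_row (inord i) (v ord0) hg) _ _ _ => // r.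
  by rewrite TE /inc /addT addnAC.
- move=> c y _ hy; apply: VV_ext (VV_row (inord i) (v c) hy) _ _ _ => // [r|x].
    by rewrite TE /inc /addT addnAC.
  by rewrite mulr1.
- move=> c _; have [x Dx] := Dset_inhabited F i (tperm ord0 c * v)%g.
  by exists x => //; rewrite oner_eq0.
- by apply: IHt => //; rewrite /T' eqxx Ti; lia.
- move=> c /covP[_ vc _]; apply: IHv => //; rewrite permM tpermL.
  by move: hv vc; have := ltn_ord (v c); lia.
Qed.

Lemma good0 rho eps i v T : (i <= N)%N -> good 0 rho eps i v T.
Proof.
move=> iN; pose b := (\max_r T r)%N.
apply: (@good_descend 0 rho eps N b) => // [{}v T' hT|r]; last exact: (leq_bigmax r).
exists 1%N; last by rewrite mulr1n Hw_last.
exists [:: fun x : X => \prod_r x r ord_max ^+ T' r]; split=> //.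
  case=> // _ /=; rewrite /VV.
  have h r : gr (Gen rho (Bl rho eps)) (fun k => T' r * (k == inl r))%N (fun x : X => x r ord_max ^+ T' r).
    by apply: gr_exp; apply: gr_gen; exists ord_max.
  apply: gr_ext (gr_prod (index_enum _) h) _ _ => // -[r|k] /=; last first.
    by rewrite big1 // => r _; rewrite muln0.
  rewrite /addT /alpha big_ord0 addn0 (bigD1 r) //= eqxx muln1 big1 ?addn0 // => r' r'r.
  by rewrite (_ : (inl r == inl r') = false) ?muln0 //; apply/eqP => -[e]; rewrite e eqxx in r'r.
move=> c hc [|//] _; have [x Dx] := Dset_inhabited F N v.
have := hc x Dx; rewrite big_ord_recl big_ord0 addr0 /= => /eqP.
rewrite mulf_eq0 => /orP[/eqP //|/prodf_eq0[r _]].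
rewrite expf_eq0; case: Dx => L [U [lam [_ _ hl ->]]].
by rewrite mxE ltn_ord eqxx mulr1 (negbTE (hl r)) andbF.
Qed.

Lemma rkR_transfer D (J : eqType) (G G' : J -> (X -> F) -> Prop) e h :
  (forall j g, G j g -> exists g', gr G' (fun k => (k == j)%N) g' /\ forall x, D x -> g x = g' x) ->
  rkR D (gr G e) h -> rkR D (gr G' e) h.
Proof.
move=> hG [r [fs [sf hf ind]] hl]; exists r => //.
have tr e' f : gr G e' f -> exists f', gr G' e' f' /\ forall x, D x -> f x = f' x.
  elim=> {e' f} [|j g e' f hg _ [f' [hf' ef]]|e'|c e' f g _ [f' [hf' ef]] _ [g' [hg' eg]]].
  - by exists (fun=> 1); split=> //; apply: gr1.
  - have [g' [hg' eg]] := hG j g hg; exists (fun x => g' x * f' x); split.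
      by apply: gr_ext (grM hg' hf') _ _ => // k; rewrite addnC.
    by move=> x Dx; rewrite eg ?ef.
  - by exists (fun=> 0); split=> //; apply: gr0.
  - exists (fun x => c * f' x + g' x); split; first exact: gr_lin.
    by move=> x Dx; rewrite eg ?ef.
have hfam i : exists f', (i < size fs)%N -> gr G' e f' /\ forall x, D x -> nth (fun=> 0) fs i x = f' x.
  have [ilt|nlt] := boolP (i < size fs)%N; last by exists (fun=> 0).
  by have [f' h'] := tr _ _ (hf i ilt); exists f'.
pose f' i := sval (boolp.cid (hfam i)).
have fP i (ilt : (i < size fs)%N) := svalP (boolp.cid (hfam i)) ilt.
exists (mkseq f' (size fs)); rewrite size_mkseq; split=> //.
  by move=> i ilt; rewrite nth_mkseq //; case: (fP i ilt).
move=> c hc; rewrite size_mkseq; apply: ind => x Dx; rewrite -[RHS](hc x Dx) size_mkseq.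
by apply: eq_bigr => i _; rewrite nth_mkseq //; case: (fP i (ltn_ord i)) => _ ->.
Qed.

Definition upd (A : Type) (f : nat -> A) K a := fun k => if k == K then a else f k.

(* With the pencil <x_{r,n}, x_{r,v(0)}>, whose second section vanishes on all
   sibling varieties, its powers can be peeled off one at a time. *)
Lemma special_pencil K rho eps v T : (v ord0 < n)%N ->
  good K rho eps (rho K) v T ->
  (forall b, cov v ord0 b -> good K rho eps (rho K) (tperm ord0 b * v)%g T) ->
  rkR (Dset (rho K) v)
    (VV rho (upd (Bl rho eps) K (fun x => x (rho K) (v ord0))) (addT T (alpha K.+1 rho)) (sS K.+1))
    (Hw F S (rho K) v T (alpha K.+1 rho)).
Proof.
move=> v0 gv gb; set B := upd _ _ _.
have iN : (rho K < N)%N by [].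
have iE : inord (rho K) = rho K by apply: ord_inj; rewrite inordK.
have pfB k : pf (B k) by rewrite /B /upd; case: eqP => _; [apply: pf_coord | apply: Bl_pf].
have hVB T1 f : VV rho (Bl rho eps) T1 (sS K) f -> VV rho B T1 (sS K) f.
  apply: VV_upd => k; rewrite /sS /B /upd; case: (ltngtP k K) => //.
(* Induction on the degree sg of the new pencil. Multiples of its second section come from the
   previous degree; on a cover cell, where that section vanishes, the power sg + 1 of the first
   section times an entry of column v(b) embeds the space without the new pencil. *)
have key sg : rkR (Dset (rho K) v)
    (VV rho B (addT T (alpha K.+1 rho)) (fun l => sS K l + sg * (l == K))%N)
    (Hw F S (rho K) v T (alpha K rho) + sg%:R * \sum_(b | cov v ord0 b) Hw F S (rho K) (tperm ord0 b * v)%g T (alpha K rho)).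
  elim: sg => [|sg IH].
    rewrite mul0r addr0; case: gv => r hr hl; exists r => //.
    apply: (rk_ge_mul (f := fun x => x (rho K) (v ord0)) _ _ _ _ _ hr).
    - exact: Dset_irr.
    - exact: pf_coord.
    - by move=> g; apply: VV_pf; apply: Bl_pf.
    - by have [x Dx] := Dset_inhabited F (rho K) v; exists x => //; apply: Dset_coord_lead.
    move=> g /hVB hg; apply: VV_ext (VV_row (rho K) (v ord0) hg) _ _ _ => // [r'|l].
      by rewrite alphaS /inc /addT addnA.
    by rewrite mul0n addn0.
  rewrite -natr1 mulrDl mul1r addrA.
  apply: (@rkR_sec0 _ iN v (fun x => x (rho K) ord_max ^+ sg.+1) _
    (VV rho (Bl rho eps) (addT T (alpha K rho)) (sS K)) _ _ _ _ _ _ _ _ _ _ IH) => //.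
  - by apply: pfX; apply: pf_coord.
  - by move=> g; apply: VV_pf; apply: Bl_pf.
  - by move=> g; apply: VV_pf.
  - by move=> g; apply: VV_pf.
  - move=> g hg; apply: VV_ext (VV_pen K hg) _ _ _ => // [l|x]; first by rewrite /incs mulSn addnA addnAC.
    by rewrite /B /upd eqxx iE.
  - move=> b y _ /hVB hy; apply: VV_ext (VV_row (rho K) (v b) (VV_maxX K sg.+1 hy)) _ _ _ => // [r|x].
      by rewrite alphaS /inc /addT addnA.
    by rewrite iE mulrA.
  - move=> b _; have [x Dx hx] := Dset_coord_max F (rho K) (rho K) (tperm ord0 b * v)%g.
    by exists x => //; rewrite expf_neq0.
apply: rkR_le (rkR_mono _ _ (key S)) => //.
  rewrite alphaS; have := @Hw_incA F n S (rho K) v T (alpha K rho) iN v0.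
  by rewrite iE => ->.
move=> f hf; apply: VV_ext hf _ _ _ => // l; rewrite /sS ltnS.
by case: ltngtP => _; rewrite ?muln0 ?muln1 ?addn0.
Qed.

Definition cofin (P : F -> Prop) := exists2 q : {poly F}, q != 0 & forall t, q.[t] != 0 -> P t.

Lemma cofinT P : (forall t, P t) -> cofin P.
Proof. by move=> h; exists 1; rewrite ?oner_eq0. Qed.

Lemma cofin_sub (P Q : F -> Prop) : (forall t, P t -> Q t) -> cofin P -> cofin Q.
Proof. by move=> h [q q0 hq]; exists q => // t /hq/h. Qed.

Lemma cofinI P Q : cofin P -> cofin Q -> cofin (fun t => P t /\ Q t).
Proof.
move=> [q q0 hq] [p p0 hp]; exists (q * p); first by rewrite mulf_neq0.
by move=> t; rewrite hornerM mulf_eq0 negb_or => /andP[/hq h1 /hp h2].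
Qed.

Lemma cofin_fin (I : finType) (P : I -> F -> Prop) :
  (forall x : I, cofin (P x)) -> cofin (fun t => forall x : I, P x t).
Proof.
move=> h; have [q q0 hq] : cofin (fun t => forall x : I, x \in enum I -> P x t).
  elim: (enum I) => [|i s IH]; first exact: cofinT.
  apply: cofin_sub (cofinI (h i) IH) => t [h1 h2] j; rewrite inE => /predU1P[->//|]; exact: h2.
by exists q => // t ht i; apply: hq => //; rewrite mem_enum.
Qed.

Lemma cofin_exists P : cofin P -> exists t, P t.
Proof. by move=> [q q0 hq]; have [t ht] := poly_nonroot q0; exists t; apply: hq. Qed.

Lemma cofin_neq a : cofin (fun t => t != a).
Proof.
exists ('X - a%:P); first by rewrite polyXsubC_eq0.
by move=> t; rewrite !hornerE subr_eq0.
Qed.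

(** On the cell the entries of row [rho K] to the left of column v(0) vanish. Hence the generic form
    is t^v(0) times a form [bt t] that tends to the entry in column v(0) as t tends to 0, and
    [rk_degenerate] carries the rank of the special pencil over to generic t. *)
Lemma generic_pencil K rho eps v T : (v ord0 < n)%N ->
  good K rho eps (rho K) v T ->
  (forall b, cov v ord0 b -> good K rho eps (rho K) (tperm ord0 b * v)%g T) ->
  cofin (fun t => good K.+1 rho (upd eps K t) (rho K) v T).
Proof.
move=> v0 gv gb; have [r hr hl] := special_pencil v0 gv gb.
pose bt (t : F) : X -> F := fun x => \sum_(p < N | (v ord0 <= p)%N) t ^+ (p - v ord0) * x (rho K) p.
have [q q0 hq] : exists2 q : {poly F}, q != 0 & forall t, q.[t] != 0 -> rk_ge (Dset (rho K) v)
    (VV rho (upd (Bl rho eps) K (bt t)) (addT T (alpha K.+1 rho)) (sS K.+1)) r.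
  apply: rk_degenerate hr.
  move=> [r'|k] g /=.
    move=> [c ->]; exists (fun x => (x r' c)%:P); split=> [x _|t _]; first by rewrite hornerC.
    exists (fun x => x r' c); split=> [|x _]; last by rewrite hornerC.
    by apply: gr_gen; exists c.
  case=> ->.
    exists (fun x => (x (rho k) ord_max)%:P); split=> [x _|t _]; first by rewrite hornerC.
    exists (fun x => x (rho k) ord_max); split=> [|x _]; last by rewrite hornerC.
    by apply: gr_gen; left.
  rewrite {1}/upd; case: eqP => [->|/eqP kK].
    exists (fun x => \sum_(p < N | (v ord0 <= p)%N) (x (rho K) p)%:P * 'X^(p - v ord0)); split.
      move=> x _; rewrite horner_sum (bigD1 (v ord0)) //= subnn expr0 mulr1 hornerC big1 ?addr0 //.
      move=> p /andP[vp pv]; rewrite hornerM hornerXn expr0n subn_eq0.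
      by rewrite leqNgt ltn_neqAle vp -val_eqE eq_sym in pv *; rewrite pv mulr0.
    move=> t _; exists (bt t); split.
      by apply: gr_gen; right; rewrite /upd eqxx.
    by move=> x _; rewrite horner_sum; apply: eq_bigr => p _; rewrite !hornerE mulrC.
  exists (fun x => (Bl rho eps k x)%:P); split=> [x _|t _]; first by rewrite hornerC.
  exists (Bl rho eps k); split=> [|x _]; last by rewrite hornerC.
  by apply: gr_gen; right; rewrite /upd (negbTE kK).
  exists ('X * q); first by rewrite mulf_neq0 ?polyX_eq0.
  move=> t; rewrite hornerM hornerX mulf_eq0 negb_or => /andP[t0 /hq hrt].
  apply: (@rkR_transfer _ _ (Gen rho (upd (Bl rho eps) K (bt t)))); last by exists r.
  move=> [r'|k] g /=; first by exists g; split=> //; apply: gr_gen.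
  case=> ->; first by exists (fun x => x (rho k) ord_max); split=> //; apply: gr_gen; left.
  rewrite /upd; case: eqP => [->|/eqP kK]; last first.
    by exists (Bl rho eps k); split=> //; apply: gr_gen; right; rewrite /Bl /upd (negbTE kK).
  exists (fun x => t ^- (v ord0) * Bl rho (upd eps K t) K x); split.
    by apply: grZ; apply: gr_gen; right.
  move=> x Dx; rewrite /bt /Bl /upd eqxx /ell [X in _ = _ * X](bigID (fun p : 'I_N => (v ord0 <= p)%N)) /=.
  rewrite [X in _ = _ * (_ + X)]big1 ?addr0 => [|p]; last first.
    by rewrite -ltnNge => h; rewrite (Dset_coord0 h Dx) mulr0.
  rewrite mulr_sumr; apply: eq_bigr => p vp; rewrite mulrA; congr (_ * _).
  by rewrite -{2}(subnK vp) exprD mulrCA mulVf ?mulr1 // expf_neq0.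
Qed.

(** For i > rho K the row of the new pencil is degenerate, and a power of its last entry embeds the
    old space. For i = rho K the pencil is generic, or a rotation applies if v(0) is maximal. For i
    < rho K the order of the rows allows [good_descend]. Only finitely many pairs (v, T) matter, so
    one t serves all. *)
Lemma good_step K rho eps b : (forall k, (k < K)%N -> (rho K <= rho k)%N) ->
  (forall i v T, (i <= N)%N -> (forall r, (T r <= b)%N) -> good K rho eps i v T) ->
  cofin (fun t => forall i v T, (i <= N)%N -> (forall r, (T r <= b)%N) ->
    good K.+1 rho (upd eps K t) i v T).
Proof.
move=> hrho hg.
have iN : (rho K < N)%N by [].
pose fT (T : {ffun 'I_N -> 'I_b.+1}) : 'I_N -> nat := fun r => T r.
have hc : cofin (fun t => forall vT : 'S_N * {ffun 'I_N -> 'I_b.+1}, (vT.1 ord0 < n)%N ->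
    good K.+1 rho (upd eps K t) (rho K) vT.1 (fT vT.2)).
  apply: cofin_fin => -[v T] /=.
  have [v0|v0] := ltnP (v ord0) n; last exact: cofinT.
  have hT r : (fT T r <= b)%N by rewrite -ltnS ltn_ord.
  have := @generic_pencil K rho eps v (fT T) v0 (hg _ _ _ (ltnW iN) hT) (fun _ _ => hg _ _ _ (ltnW iN) hT).
  by apply: cofin_sub.
apply: cofin_sub hc => t ht.
have above i v T : (rho K < i)%N -> (i <= N)%N -> (forall r, (T r <= b)%N) ->
    good K.+1 rho (upd eps K t) i v T.
  move=> ri iN' hT; have [r hr hl] := hg i v T iN' hT; exists r; last first.
    apply: le_trans hl; rewrite (@Hw_ext F n S i v T _ T (alpha K rho)) // => r' ir'.
    rewrite alphaS /inc; split=> //; rewrite [_ == _](_ : _ = false) ?addn0 //.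
    by apply/eqP => e; move: ri ir'; rewrite e ltnNge => /negP.
  apply: (rk_ge_mul (f := fun x => x (rho K) ord_max ^+ S.+1) _ _ _ _ _ hr).
  - exact: Dset_irr.
  - by apply: pfX; apply: pf_coord.
  - by move=> g; apply: VV_pf; apply: Bl_pf.
  - by have [x Dx hx] := Dset_coord_max F i (rho K) v; exists x => //; rewrite expf_neq0.
  move=> g hg'; have h1 : VV rho (Bl rho (upd eps K t)) (addT T (alpha K rho)) (sS K) g.
    apply: VV_upd hg' => k; rewrite /sS; case: (ltnP k K) => // kK _.
    by rewrite /Bl /upd ltn_eqF.
  apply: VV_ext (VV_row (rho K) ord_max (VV_maxX K S h1)) _ _ _ => // [r'|l|x].
  - by rewrite alphaS /inc /addT addnA.
  - by rewrite /sS ltnS; case: ltngtP => _; rewrite ?muln0 ?muln1 ?addn0.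
  - by rewrite exprS mulrA.
have at_ v T : (forall r, (T r <= b)%N) -> good K.+1 rho (upd eps K t) (rho K) v T.
  move=> hT; have [v0|v0] := ltnP (v ord0) n.
    pose T1 : {ffun 'I_N -> 'I_b.+1} := [ffun r => inord (T r)].
    have -> : T = fT T1 by apply: boolp.funext => r; rewrite /fT ffunE inordK // ltnS.
    exact: (ht (v, T1)).
  have vm : v ord0 = ord_max by apply: ord_inj => /=; have := ltn_ord (v ord0); lia.
  rewrite /good (Hw_rot _ _ _ _ iN vm).
  have [r hr hl] := above (rho K).+1 (cyc n * v)%g T (ltnSn _) iN hT.
  by exists r => //; apply: rk_ge_mono hr => // x; apply: Dset_rot.
move=> i v T iN' hT; have [ri|ir] := ltnP (rho K) i; first exact: above.
apply: (@good_descend K.+1 rho _ (rho K) b) => //; first exact: ltnW.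
by move=> k; rewrite ltnS leq_eqVlt => /predU1P[->//|]; apply: hrho.
Qed.

End LowerBound.

(** The same parameters must work for S and S', because products of functions of pencil degree s x
    have pencil degree 2 s x. They are chosen distinct for the sake of the upper bound. *)
Lemma good_pencils (F : realFieldType) (n S S' K : nat) (rho : nat -> 'I_n.+1) b :
  (forall k l, (k <= l)%N -> (l < K)%N -> (rho l <= rho k)%N) ->
  exists eps : nat -> F, (forall k l, (k < l)%N -> (l < K)%N -> eps k != eps l) /\
  forall i v T, (i <= n.+1)%N -> (forall r, (T r <= b)%N) ->
    good S K rho eps i v T /\ good S' K rho eps i v T.
Proof.
elim: K => [_|K IH hrho].
  by exists (fun=> 0); split=> // i v T iN _; split; apply: good0.
have [k l kl lK|eps [dist hg]] := IH; first by apply: hrho => //; apply: leqW.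
have hr k : (k < K)%N -> (rho K <= rho k)%N by move=> kK; apply: hrho => //; apply: ltnW.
have h1 := @good_step F n S K rho eps b hr (fun i v T iN hT => (hg i v T iN hT).1).
have h2 := @good_step F n S' K rho eps b hr (fun i v T iN hT => (hg i v T iN hT).2).
have [t [ht1 [ht2 hQ]]] := cofin_exists (cofinI h1 (cofinI h2 (cofin_fin (fun k : 'I_K => cofin_neq (eps k))))).
exists (upd eps K t); split=> [k l kl|i v T iN hT]; last by split; [apply: ht1 | apply: ht2].
rewrite ltnS leq_eqVlt /upd => /predU1P[e|lK].
  by rewrite e eqxx (ltn_eqF (leq_trans kl _)) ?e // eq_sym; apply: (hQ (Ordinal (leq_trans kl (eq_leq e)))).
by rewrite !ltn_eqF ?(ltn_trans kl) //; apply: dist.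
Qed.

(** * Growth of the counts *)

Lemma leq_prod_nat (I : Type) (r : seq I) (P : pred I) (f g : I -> nat) :
  (forall i, P i -> f i <= g i)%N -> (\prod_(i <- r | P i) f i <= \prod_(i <- r | P i) g i)%N.
Proof. by move=> h; elim/big_ind2: _ => // *; apply: leq_mul. Qed.

Lemma bin_le_exp t m : ('C(t, m) <= t ^ m)%N.
Proof.
elim: t m => [|t IH] [|m] //.
rewrite binS; have h1 := IH m.+1; have h2 := IH m; rewrite expnS in h1.
have h3 : (t ^ m <= t.+1 ^ m)%N by case: (m) => // m'; rewrite leq_exp2r.
by rewrite expnS; nia.
Qed.

Lemma bb_bound S t a m kp c : (t <= c * kp)%N -> (S <= c * kp)%N -> (0 < kp)%N ->
  (bb S t a m <= (a.+1 * c.+1 * kp) ^ m)%N.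
Proof.
move=> ht hS kp0; elim: a m => [|a IH] m.
  rewrite mul1n /=; apply: leq_trans (bin_le_exp t m) _; case: m => // m.
  by rewrite leq_exp2r //; nia.
case: m => [|m]; first by rewrite /= expn0.
rewrite bbSa; apply: leq_trans (leq_add (IH m.+1) (leq_mul hS (IH m))) _.
rewrite !expnS; set A := (a.+1 * c.+1 * kp)%N.
have h : (A ^ m <= (a.+2 * c.+1 * kp) ^ m)%N by case: (m) => // m'; rewrite leq_exp2r // /A; nia.
by rewrite -mulnDl; apply: leq_mul => //; rewrite /A; nia.
Qed.

Lemma bb_growth S t a m e : (bb S (t + e) a m.+1 <= bb S t a m.+1 + e * bb S (t + e) a m)%N.
Proof.
elim: e => [|e IH]; first by rewrite addn0 leq_addr.
rewrite addnS bbSt mulSn; apply: leq_trans (leq_add IH (leqnn _)) _.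
have := @bb_mono S (t + e) (t + e).+1 a m (leqnSn _); nia.
Qed.

Lemma prod_le_sum (I : eqType) (r : seq I) (f g : I -> nat) : uniq r -> (forall i, f i <= g i)%N ->
  (\prod_(i <- r) g i <= \prod_(i <- r) f i + \sum_(a <- r) (g a - f a) * \prod_(b <- r | b != a) g b)%N.
Proof.
move=> ur h; elim: r ur => [_|i r IH /= /andP[ir ur]]; first by rewrite !big_nil.
rewrite !big_cons eqxx /=.
have -> : (\prod_(b <- r | b != i) g b = \prod_(b <- r) g b)%N.
  rewrite big_seq_cond [RHS]big_seq; apply: eq_bigl => b; case: (boolP (b \in r)) => //= br.
  by apply: contraNneq ir => <-.
have e : (\sum_(a <- r) (g a - f a) * \prod_(b <- i :: r | b != a) g b =
   g i * \sum_(a <- r) (g a - f a) * \prod_(b <- r | b != a) g b)%N.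
  rewrite big_distrr /= big_seq [RHS]big_seq; apply: eq_bigr => a ar; rewrite big_cons.
  have ia : i != a by apply: contraNneq ir => ->.
  by rewrite ia mulnCA.
rewrite e; have := IH ur; move: (\prod_(_ <- r) g _)%N (\prod_(_ <- r) f _)%N (\sum_(_ <- r) _)%N => A B C hh.
by have := h i; move: (f i) (g i) => x y xy; nia.
Qed.

(** If each factor changes by a lower-order amount, so does the product. The common factor kp avoids
    the exponent -1 that would occur when all x i are 0. *)
Lemma prod_growth (I : finType) (f g x : I -> nat) (C kp : nat) : (0 < C)%N ->
  (forall i, f i <= g i)%N -> (forall i, g i <= C * kp ^ x i)%N ->
  (forall i, kp * (g i - f i) <= C * kp ^ x i)%N ->
  (kp * \prod_i g i <= kp * \prod_i f i + #|I| * C ^ #|I| * kp ^ (\sum_i x i))%N.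
Proof.
move=> C0 fg hg hd; have := prod_le_sum (index_enum_uniq I) fg.
move=> /(leq_mul (leqnn kp)); rewrite mulnDr => /leq_trans; apply; rewrite leq_add2l.
rewrite big_distrr /=; apply: leq_trans (_ : \sum_(a : I) C ^ #|I| * kp ^ (\sum_i x i) <= _)%N; last first.
  by rewrite sum_nat_const mulnA.
apply: leq_sum => a _; have ex : (\sum_i x i = x a + \sum_(b | b != a) x b)%N by rewrite (bigD1 a).
rewrite mulnA ex expnD.
have h1 : (\prod_(b | b != a) g b <= \prod_(b | b != a) (C * kp ^ x b))%N by apply: leq_prod_nat.
rewrite big_split /= prod_nat_const (big_morph _ (expnD kp) (expn0 kp)) in h1 *.
apply: leq_trans (leq_mul (hd a) h1) _.
by rewrite -!expn_sum mulnACA leq_mul // -expnS leq_pexp2l // cardC1 prednK //; apply/card_gt0P; exists a.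
Qed.

Section Weights.
Variables (F : realFieldType) (n : nat).
Notation N := n.+1.
Implicit Types (v : 'S_N) (S : nat) (T al : 'I_N -> nat) (m : 'X_{1..N}).

Lemma wt0E S T al m : wt S 0 T al m = (\prod_(k < N) bb S (T k) (al k) (n - m k))%N.
Proof.
by apply: eq_bigr => k _; rewrite add0n ltn_ord; have -> : inord k = k by apply: ord_inj; rewrite inordK.
Qed.

Lemma wt_mono S T T' al m : (forall r, (T r <= T' r)%N) -> (wt S 0 T al m <= wt S 0 T' al m)%N.
Proof. by move=> h; rewrite !wt0E; apply: leq_prod_nat => k _; apply: bb_mono. Qed.

Lemma Hw_mono S v T T' al : (forall r, (T r <= T' r)%N) -> Hw F S 0 v T al <= Hw F S 0 v T' al.
Proof. by move=> h; apply: lf_le => m _; rewrite ler_nat; apply: wt_mono. Qed.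

(** By [sum_codim] the order of growth of the count when T and S grow proportionally; by
    [card_isvar] the dimension of the slice. *)
Definition codim v := (N * n - len v)%N.

Lemma sum_codim v m : m \in msupp (Sch F v) -> (\sum_(k < N) (n - m k) = codim v)%N.
Proof.
move=> hm; have /dhomogP/(_ _ hm) /= hd := Sch_homog F v.
have hk k : (m k <= n)%N by apply: leq_trans (Sch_exponent hm k) _; rewrite subSS leq_subr.
rewrite /codim -hd mdegE; apply/eqP; rewrite -(eqn_add2r (\sum_k m k)) -big_split /=.
rewrite (eq_bigr (fun=> n)) => [|k _]; last by rewrite subnK.
rewrite sum_nat_const card_ord subnK //.
by apply: leq_trans (leq_sum _ (fun k _ => hk k)) _; rewrite sum_nat_const card_ord.
Qed.

Lemma Hw_growth v al a c : exists2 C : F, 0 <= C & forall kp S T T', (0 < kp)%N ->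
  (forall r, (T r <= a * kp)%N) -> (S <= a * kp)%N ->
  (forall r, (T r <= T' r)%N) -> (forall r, (T' r <= T r + c)%N) ->
  kp%:R * Hw F S 0 v T' al <= kp%:R * Hw F S 0 v T al + C * kp%:R ^+ codim v.
Proof.
pose A := (\max_r al r)%N.
pose C0 := ((A.+1 * (a + c).+1) ^ n)%N.
pose C1 := (c.+1 * C0)%N.
have C00 : (0 < C0)%N by rewrite expn_gt0.
have C01 : (C0 <= C1)%N by rewrite leq_pmull.
pose M := lf (fun=> 1) (Sch F v).
have M0 : 0 <= M by apply: lf_ge0 => m; rewrite ler01.
pose B := (#|'I_N| * C1 ^ #|'I_N|)%N.
exists (B%:R * M); first by rewrite mulr_ge0.
move=> kp S T T' kp0 hT hS hTT hT'.
have e1 U : kp%:R * Hw F S 0 v U al = lf (fun m => (kp * wt S 0 U al m)%:R) (Sch F v).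
  by rewrite /Hw -lfZl; apply: lf_ext => m _; rewrite natrM.
have e2 : B%:R * M * kp%:R ^+ codim v = lf (fun=> (B * kp ^ codim v)%:R) (Sch F v).
  by rewrite mulrAC /M -lfZl; apply: lf_ext => m _; rewrite mulr1 natrM natrX.
rewrite !e1 e2 -lfDl; apply: lf_le => m hm; rewrite -natrD ler_nat !wt0E -(sum_codim hm).
have hk k : (m k <= n)%N by apply: leq_trans (Sch_exponent hm k) _; rewrite subSS leq_subr.
have hT2 r : (T' r <= (a + c) * kp)%N.
  by apply: leq_trans (hT' r) _; rewrite mulnDl leq_add ?leq_pmulr.
have hS2 : (S <= (a + c) * kp)%N by apply: leq_trans hS _; rewrite leq_mul2r leq_addr orbT.
have bd t r x : (t <= (a + c) * kp)%N -> (x <= n)%N -> (bb S t (al r) x <= C0 * kp ^ x)%N.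
  move=> ht xn; apply: leq_trans (bb_bound (al r) x ht hS2 kp0) _; rewrite expnMn leq_mul2r.
  apply/orP; right; apply: leq_trans (_ : (A.+1 * (a + c).+1) ^ x <= _)%N; last by rewrite leq_pexp2l // muln_gt0.
  by case: (x) => // x'; rewrite leq_exp2r // leq_mul2r ltnS (leq_bigmax r) orbT.
apply: prod_growth => [|k|k|k]; first by rewrite muln_gt0.
- exact: bb_mono.
- by apply: leq_trans (bd _ _ _ (hT2 k) (leq_subr _ _)) _; rewrite leq_mul2r C01 orbT.
case e : (n - m k)%N => [|x]; first by rewrite !bb0 subnn muln0.
have xn : (x <= n)%N by have := leq_subr (m k) n; lia.
have h1 : (bb S (T' k) (al k) x.+1 - bb S (T k) (al k) x.+1 <= c * bb S (T k + c) (al k) x)%N.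
  rewrite leq_subLR; apply: leq_trans (bb_growth S (T k) (al k) x c); exact: bb_mono.
apply: leq_trans (leq_mul (leqnn kp) h1) _; rewrite expnS.
have h2 : (bb S (T k + c) (al k) x <= C0 * kp ^ x)%N.
  by apply: bd xn; rewrite mulnDl leq_add ?leq_pmulr.
rewrite /C1; move: h2; move: (bb _ _ _ _) (kp ^ x)%N => u y; nia.
Qed.

(** The row degrees of a minor on the first k + 1 rows. *)
Definition rect k : 'I_N -> nat := fun r => (r <= k)%N.

Lemma wt_monk S k T al m : (k < N)%N -> (forall r, m r <= n)%N ->
  (wt S 0 (addT T (rect k)) al m <= wt S 0 T al m +
    \sum_(a < N | (a <= k)%N) wt S 0 (addT T (rect k)) al (U_(a) + m)%MM)%N.
Proof.
move=> kN hm; rewrite !wt0E.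
apply: leq_trans (prod_le_sum (f := fun r => bb S (T r) (al r) (n - m r)) _ _) _.
- exact: index_enum_uniq.
- by move=> r; apply: bb_mono; rewrite leq_addr.
rewrite leq_add2l [X in (_ <= X)%N]big_mkcond /=; apply: leq_sum => a _.
rewrite {1}/addT /rect; case: ifP => ak; last first.
  by rewrite addn0 subnn.
rewrite wt0E [X in (_ <= X)%N](bigD1 a) //= mnmDE mnm1E eqxx; apply: leq_mul; last first.
  by apply/eq_leq/eq_bigr => b ba; rewrite mnmDE mnm1E eq_sym (negbTE ba).
rewrite {1}/addT ak addn1; case e : (n - m a)%N => [|x]; first by rewrite !bb0.
rewrite bbSt addKn; have -> : (n - (true + m a) = x)%N by have := hm a; rewrite /=; lia.
by apply: bb_mono.
Qed.

(** Several rows are raised at once, so this is only an inequality: a difference of products is at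
    most the sum of the single differences, each multiplied by the larger values of the other
    factors. *)
Lemma Hw_monk_le S k (v : 'S_N) T al (p : 'I_N) : (k < p)%N -> v p = ord_max ->
  Hw F S 0 v (addT T (rect k)) al <= Hw F S 0 v T al +
    \sum_(q | sib k v q) Hw F S 0 (sibv v q) (addT T (rect k)) al.
Proof.
move=> kp vp; have kN : (k < N)%N by apply: ltn_trans kp (ltn_ord p).
have M := @monk_sum F N v (Ordinal kN) p kp (congr1 (fun x => (nat_of_ord x).+1) vp).
have -> : \sum_(q | sib k v q) Hw F S 0 (sibv v q) (addT T (rect k)) al =
    lf (fun m => (wt S 0 (addT T (rect k)) al m)%:R) ((\sum_(a < N | (a <= k)%N) 'X_a) * Sch F v).
  rewrite M /= lf_sum; under [RHS]eq_bigr => a _ do rewrite lf_sum.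
  rewrite pair_big_dep /=; apply: eq_big => [[a b]|[a b] _] //.
rewrite mulr_suml lf_sum.
under [X in _ <= _ + X]eq_bigr => a _ do rewrite lf_mulX.
rewrite [X in _ <= _ + X](_ : _ = lf (fun m => \sum_(a < N | (a <= k)%N) (wt S 0 (addT T (rect k)) al (U_(a) + m)%MM)%:R) (Sch F v)); last first.
  by rewrite /lf exchange_big /=; apply: eq_bigr => m _; rewrite mulr_sumr.
rewrite -lfDl; apply: lf_le => m hm; rewrite -natr_sum -natrD ler_nat; apply: wt_monk => // r.
by apply: leq_trans (Sch_exponent hm r) _; rewrite subSS leq_subr.
Qed.

End Weights.

(** * Spanning families bound the rank from above *)

Section Spanning.
Variables (F : realFieldType) (N : nat).
Notation X := 'M[F]_N.

Inductive lspan (I : Type) (P : I -> Prop) (M : I -> X -> F) : (X -> F) -> Prop :=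
| lspan0 : lspan P M (fun=> 0)
| lspanD c i f : P i -> lspan P M f -> lspan P M (fun x => c * M i x + f x).

Lemma lspan_lin (I : Type) (P : I -> Prop) M c f g : lspan P M f -> lspan P M g ->
  lspan P M (fun x => c * f x + g x).
Proof.
move=> hf hg; elim: hf => [|d i f' Pi _ IH].
  by rewrite (_ : (fun=> _) = g) //; apply: boolp.funext => x; rewrite mulr0 add0r.
rewrite (_ : (fun=> _) = fun x => (c * d) * M i x + (c * f' x + g x)); first exact: lspanD.
by apply: boolp.funext => x; ring.
Qed.

Lemma lspan1 (I : Type) (P : I -> Prop) M i : P i -> lspan P M (M i).
Proof.
move=> Pi; rewrite (_ : M i = fun x => 1 * M i x + 0); first exact: lspanD (lspan0 _ _).
by apply: boolp.funext => x; rewrite mul1r addr0.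
Qed.

Lemma lspan_mul (I J : Type) (P : I -> Prop) (Q : J -> Prop) M M' h f :
  (forall i, P i -> exists j, Q j /\ forall x, h x * M i x = M' j x) ->
  lspan P M f -> lspan Q M' (fun x => h x * f x).
Proof.
move=> hij; elim=> [|c i f' Pi _ IH].
  by rewrite (_ : (fun=> _) = fun=> 0); [exact: lspan0 | apply: boolp.funext => x; rewrite mulr0].
have [j [Qj ej]] := hij i Pi.
rewrite (_ : (fun=> _) = fun x => c * M' j x + h x * f' x); first exact: lspanD.
by apply: boolp.funext => x; rewrite mulrDr mulrCA ej.
Qed.

Lemma rk_le_span D (V : (X -> F) -> Prop) (I : eqType) (P : I -> Prop) M (L : seq I) r :
  (forall f, V f -> lspan P M f) -> (forall i, P i -> i \in L) -> rk_ge D V r -> (r <= size L)%N.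
Proof.
move=> hV hL [fs [sf hf ind]].
have coef f : V f -> exists c : 'rV[F]_(size L), forall x, f x = \sum_i c 0 i * M (tnth (in_tuple L) i) x.
  move=> /hV; elim=> [|d i f' Pi _ [c hc]].
    by exists 0 => x; rewrite big1 // => i _; rewrite mxE mul0r.
  have /tnthP[j ej] : i \in in_tuple L by apply: hL.
  exists (d *: delta_mx 0 j + c) => x; rewrite hc ej.
  under [RHS]eq_bigr => k _ do rewrite !mxE mulrDl.
  rewrite big_split /=; congr (_ + _); rewrite (bigD1 j) //= !eqxx mulr1 big1 ?addr0 //.
  by move=> k /negbTE ->; rewrite mulr0 mul0r.
have hc i : exists c : 'rV[F]_(size L), (i < size fs)%N ->
    forall x, nth (fun=> 0) fs i x = \sum_j c 0 j * M (tnth (in_tuple L) j) x.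
  have [ilt|nlt] := boolP (i < size fs)%N; last by exists 0.
  by have [c h] := coef _ (hf i ilt); exists c.
pose c i := sval (boolp.cid (hc i)).
have cP i (ilt : (i < size fs)%N) := svalP (boolp.cid (hc i)) ilt.
pose Cm : 'M[F]_(size fs, size L) := \matrix_(i, j) c i 0 j.
rewrite -sf leqNgt; apply/negP => lt.
have /rowV0Pn[u uk u0] : kermx Cm != 0.
  rewrite kermx_eq0 /row_free; apply/eqP => e; have := rank_leq_col Cm; rewrite e; lia.
case/eqP: u0; apply/rowP => i; rewrite mxE.
pose u' (i : nat) := if insub i is Some j then u 0 j else 0.
have := ind u' _ i (ltn_ord i); rewrite /u' valK; apply => x Dx.
under eq_bigr => j _ do rewrite valK (cP j (ltn_ord j)) mulr_sumr.
rewrite exchange_big big1 // => k _ /=.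
have /matrixP/(_ 0 k) := sub_kermxP uk; rewrite !mxE => e.
transitivity ((\sum_j u 0 j * Cm j k) * M (tnth (in_tuple L) k) x); last by rewrite e mul0r.
by rewrite mulr_suml; apply: eq_bigr => j _; rewrite mxE mulrA.
Qed.

End Spanning.

(** * Upper bounds for ranks *)

Section Counting.
Local Open Scope nat_scope.

Definition excess (l sg : seq nat) := sumn [seq p.1 - p.2 | p <- zip l sg].

(** Enumerates the vectors whose excess over [sg] is at most t: an entry below s is free, an entry s
    + d costs d. *)
Fixpoint codes (sg : seq nat) (t : nat) : seq (seq nat) :=
  if sg is s :: sg' then
    flatten [seq [seq c :: l | l <- codes sg' t] | c <- iota 0 s] ++
    flatten [seq [seq (s + d) :: l | l <- codes sg' (t - d)] | d <- iota 0 t.+1]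
  else [:: [::]].

Lemma codesE s sg t : codes (s :: sg) t =
  flatten [seq [seq c :: l | l <- codes sg t] | c <- iota 0 s] ++
  flatten [seq [seq (s + d) :: l | l <- codes sg (t - d)] | d <- iota 0 t.+1].
Proof. by []. Qed.

Lemma codes_mem sg t l : size l = size sg -> excess l sg <= t -> l \in codes sg t.
Proof.
elim: sg t l => [|s sg IH] t [|c l] // [sl].
rewrite /excess [zip _ _]/= map_cons [sumn _]/= -/(excess l sg) codesE mem_cat => hl.
have [cs|sc] := ltnP c s; apply/orP.
  left; apply/flatten_mapP; exists c; first by rewrite mem_iota.
  by apply/map_f/IH => //; lia.
right; apply/flatten_mapP; exists (c - s); first by rewrite mem_iota /=; lia.
by rewrite subnKC //; apply/map_f/IH => //; lia.
Qed.

(** The S free entries correspond to a factor 1 + S z; the sum over the costs d is absorbed by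
    repeated use of Pascal's rule [bbSt], which explains t + size bs. *)
Lemma size_codes S (bs : bitseq) t :
  size (codes [seq (if b then S else 0) | b <- bs] t) <= bb S (t + size bs) (count id bs) (size bs).
Proof.
elim: bs t => [|b bs IH] t; first by rewrite [count _ _]/= [size [::]]/= bb0.
rewrite [count _ _]/= [size (b :: _)]/= map_cons codesE.
set m := size bs; set a := count id bs.
have h2 t' : \sum_(0 <= d < t'.+1) size (codes [seq (if b then S else 0) | b <- bs] (t' - d)) <=
    bb S (t' + m.+1) a m.+1.
  elim: t' => [|t' IHt].
    rewrite big_nat1 subn0 add0n; apply: leq_trans (IH 0) _; rewrite add0n.
    by rewrite bbSt leq_addl.
  rewrite big_nat_recl // subn0 addSn bbSt addnC leq_add //.
  apply: leq_trans (IH t'.+1) _; apply: bb_mono; rewrite /m; lia.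
have szf (A : Type) (f : nat -> seq A) L : size (flatten [seq f c | c <- L]) = \sum_(c <- L) size (f c).
  by rewrite size_flatten /shape -map_comp sumnE big_map.
rewrite size_cat !szf.
under eq_bigr => c _ do rewrite size_map.
under [X in _ + X]eq_bigr => d _ do rewrite size_map.
rewrite big_const_seq count_predT iter_addn addn0 mulnC size_iota; have := h2 t; rewrite /index_iota subn0 => h3.
have -> : (if b then S else 0) = b * S by case: (b); rewrite ?mul1n.
case: b; rewrite -mulnA; last by rewrite mul0n !add0n; exact: h3.
rewrite mul1n.
have -> : true + a = a.+1 by [].
rewrite bbSa addnC leq_add // leq_mul2l; apply/orP; right.
by apply: leq_trans (IH t) _; apply: bb_mono; rewrite /m; lia.
Qed.

Definition rows (A : eqType) (Ls : seq (seq A)) : seq (seq A) :=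
  foldr (fun L acc => [seq l :: ls | l <- L, ls <- acc]) [:: [::]] Ls.

Lemma rows_mem (A : eqType) (Ls : seq (seq A)) ls :
  all2 (fun l (L : seq A) => l \in L) ls Ls -> ls \in rows Ls.
Proof.
elim: Ls ls => [|L Ls IH] [|l ls] //= /andP[lL /IH h].
by apply/allpairsP; exists (l, ls).
Qed.

Lemma size_rows (A : eqType) (Ls : seq (seq A)) : size (rows Ls) = \prod_(L <- Ls) size L.
Proof. by elim: Ls => [|L Ls IH]; rewrite ?big_nil // big_cons /= size_allpairs IH. Qed.

End Counting.

(** * The identity permutation: explicit spanning monomials *)

Section IdentityBound.
Variables (F : realFieldType) (n S K : nat).
Notation N := n.+1.
Notation X := 'M[F]_N.
Variables (rho : nat -> 'I_N) (eps : nat -> F).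
Hypothesis eps_inj : forall k l, (k < l)%N -> (l < K)%N -> eps k != eps l.
Hypothesis al_le : forall r, (alpha K rho r <= n)%N.
Implicit Types (T : 'I_N -> nat) (s : nat -> nat) (cc : 'I_N -> 'I_n -> nat).

(** The rank of pencil k among the pencils of its row. The pair of row and rank determines k
    ([ix_inj]). *)
Definition ix k := alpha k rho (rho k).

Lemma alpha_mono k l r : (k <= l)%N -> (alpha k rho r <= alpha l rho r)%N.
Proof.
move/subnKC <-; elim: (l - k)%N => [|d IH]; first by rewrite addn0.
by rewrite addnS alphaS /inc; apply: leq_trans IH (leq_addr _ _).
Qed.

Lemma ix_lt k : (k < K)%N -> (ix k < alpha K rho (rho k))%N.
Proof.
by move=> kK; apply: leq_trans (alpha_mono (rho k) kK); rewrite alphaS /inc eqxx addn1.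
Qed.

Lemma ix_inj k l : rho k = rho l -> ix k = ix l -> k = l.
Proof.
wlog kl : k l / (k <= l)%N.
  by move=> h e1 e2; case: (leqP k l) => [|/ltnW] kl; [|apply/esym]; apply: h.
move=> e1 e2; apply/eqP; rewrite eqn_leq kl /= leqNgt; apply/negP => lt.
have := alpha_mono (rho l) lt; rewrite alphaS /inc e1 eqxx addn1.
by rewrite -{1}e1 -[alpha k rho _]/(ix k) e2 ltnn.
Qed.

Lemma ix_surj k r j : (j < alpha k rho r)%N -> exists2 l, (l < k)%N & rho l = r /\ ix l = j.
Proof.
elim: k => [|k IH]; first by rewrite /alpha big_ord0.
rewrite alphaS /inc; case: eqP => [er|_]; last first.
  by rewrite addn0 => /IH[l lk h]; exists l => //; apply: ltnW.
rewrite addn1 ltnS leq_eqVlt => /predU1P h; case: h => [ej|h].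
  by exists k; rewrite // /ix -er ej.
by have [l lk e] := IH h; exists l => //; apply: ltnW.
Qed.

Definition form (r : 'I_N) (j : 'I_n) : X -> F :=
  if [pick k : 'I_K | (rho k == r) && (ix k == j)] is Some k then ell r (eps k)
  else fun x => x r (widen_ord (leqnSn n) j).

Lemma form_pencil k (j : 'I_n) : (k < K)%N -> ix k = j -> form (rho k) j = ell (rho k) (eps k).
Proof.
move=> kK e; rewrite /form; case: pickP => [l /andP[/eqP e1 /eqP e2]|/(_ (Ordinal kK))].
  by rewrite (ix_inj e1 (etrans e2 (esym e))).
by rewrite /= e !eqxx.
Qed.

Lemma form_coord r (j : 'I_n) : (alpha K rho r <= j)%N -> form r j = fun x => x r (widen_ord (leqnSn n) j).
Proof.
move=> h; rewrite /form; case: pickP => // l /andP[/eqP e1 /eqP e2].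
by have := ix_lt (ltn_ord l); rewrite e1 e2 ltnNge h.
Qed.

(** Together with the last entry the n forms are a basis of the linear forms in row r. A vector z
    annihilated by all of them vanishes in the positions of plain coordinates, so it lists the
    coefficients of a polynomial of size at most alpha(r) that has the alpha(r) distinct parameters
    as roots. *)
Lemma coord_span (r c : 'I_N) : exists (a0 : F) (a : 'I_n -> F), forall x : X,
  x r c = a0 * x r ord_max + \sum_j a j * form r j x.
Proof.
pose w (j : 'I_n) := widen_ord (leqnSn n) j.
pose Y : 'M[F]_n := \matrix_(j, p) form r j (delta_mx r (w p)).
have formE j (x : X) : form r j x = \sum_p Y j p * x r (w p) + form r j (delta_mx r ord_max) * x r ord_max.
  rewrite /Y; under eq_bigr => p _ do rewrite mxE.
  rewrite /form; case: pickP => [k _|_].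
    rewrite /ell big_ord_recr /=; congr (_ + _); last first.
      by rewrite (bigD1 ord_max) //= mxE !eqxx mulr1 big1 ?addr0 // => p /negbTE h; rewrite mxE h andbF mulr0.
    apply: eq_bigr => p _; rewrite (bigD1 (w p)) //= mxE !eqxx mulr1 big1 ?addr0 // => q /negbTE h.
    by rewrite mxE h andbF mulr0.
  rewrite (bigD1 j) //= mxE !eqxx mul1r big1 ?addr0.
    by rewrite mxE eqxx /= [_ == _](_ : _ = false) ?mul0r ?addr0 // -val_eqE /= ltn_eqF.
  by move=> p pj; rewrite mxE eqxx /= [_ == _](_ : _ = false) ?mul0r // -val_eqE /= eq_sym val_eqE (negbTE pj).
have Yu : Y \in unitmx.
  rewrite -unitmx_tr -row_free_unit -kermx_eq0; apply/rowV0P => z /sub_kermxP hz.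
  have zY j : \sum_p Y j p * z 0 p = 0.
    have /rowP/(_ j) := hz; rewrite mxE [X in _ = X -> _]mxE => h; rewrite -[RHS]h.
    by apply: eq_bigr => p _; rewrite [in RHS]mxE mulrC.
  have YE j p : Y j p = form r j (delta_mx r (w p)) by rewrite mxE.
  have z0 (j : 'I_n) : (alpha K rho r <= j)%N -> z 0 j = 0.
    move=> h; have := zY j; rewrite (bigD1 j) //= YE form_coord // mxE !eqxx mul1r big1 ?addr0 //.
    by move=> p pj; rewrite YE form_coord // mxE eqxx /= -val_eqE /= eq_sym val_eqE (negbTE pj) mul0r.
  pose p := \poly_(i < n) (if insub i is Some j then z 0 j else 0).
  have pz (j : 'I_n) : p`_j = z 0 j by rewrite coef_poly ltn_ord valK.
  suff p0 : p = 0 by apply/rowP => j; rewrite -pz p0 coef0 mxE.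
  apply/eqP; apply: contraT => pn0.
  pose rs := [seq eps k | k <- [seq k <- iota 0 K | rho k == r]].
  have urs : uniq rs.
    rewrite map_inj_in_uniq ?filter_uniq ?iota_uniq // => k l; rewrite !mem_filter !mem_iota /= !add0n.
    move=> /andP[_ kK] /andP[_ lK] e; case: (ltngtP k l) => // h.
      by have := eps_inj h lK; rewrite e eqxx.
    by have := eps_inj h kK; rewrite e eqxx.
  have rrs : all (root p) rs.
    apply/allP => y /mapP[k]; rewrite mem_filter mem_iota /= add0n => /andP[/eqP rk kK] ->.
    have kn : (ix k < n)%N by apply: leq_trans (ix_lt kK) (al_le _).
    have := zY (Ordinal kn); rewrite /root => e; apply/eqP; rewrite -[RHS]e.
    rewrite horner_poly; apply: eq_bigr => j _; rewrite valK YE mulrC; congr (_ * _).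
    rewrite -rk form_pencil // /ell (bigD1 (w j)) //= mxE !eqxx mulr1 big1 ?addr0 // => q /negbTE h.
    by rewrite mxE h andbF mulr0.
  have := max_poly_roots pn0 rrs urs; rewrite size_map size_filter => lt.
  have cnt : count (fun k => rho k == r) (iota 0 K) = alpha K rho r.
    by rewrite -sum1_count big_mkcond /alpha -(big_mkord xpredT (fun k => nat_of_bool (rho k == r))) /index_iota subn0; apply: eq_bigr => k _; case: eqP.
  have szp : (size p <= alpha K rho r)%N.
    apply/leq_sizeP => j hj; have [jn|jn] := ltnP j n; last by rewrite coef_poly ltnNge jn.
    by rewrite (pz (Ordinal jn)) z0.
  by move: lt; rewrite cnt ltnNge szp.
have [cn|cn] := ltnP c n; last first.
  exists 1, (fun=> 0) => x; rewrite mul1r big1 ?addr0 => [|j _]; last by rewrite mul0r.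
  by congr (x _ _); apply: ord_inj => /=; have := ltn_ord c; lia.
pose c' := Ordinal cn; pose a j := invmx Y c' j.
exists (- \sum_j a j * form r j (delta_mx r ord_max)), a => x.
have -> : \sum_j a j * form r j x = (\sum_j \sum_i a j * (Y j i * x r (w i))) +
    (\sum_j a j * form r j (delta_mx r ord_max)) * x r ord_max.
  under eq_bigr => j _ do rewrite formE mulrDr mulrA mulr_sumr.
  by rewrite big_split /= mulr_suml.
rewrite addrC mulNr addrK exchange_big /=.
have -> : x r c = \sum_p (1%:M : 'M[F]_n) c' p * x r (w p).
  rewrite (bigD1 c') //= mxE eqxx mul1r big1 ?addr0 => [|p /negbTE h]; last first.
    by rewrite mxE eq_sym h mul0r.
  by congr (x _ _); apply: ord_inj.
apply: eq_bigr => p _; rewrite -(mulVmx Yu) mxE mulr_suml; apply: eq_bigr => j _.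
by rewrite mulrA.
Qed.

Definition sg s r (j : 'I_n) : nat := (\sum_(k < K | (rho k == r) && (ix k == j)) s k)%N.

Definition rowmon (t : nat) (c : 'I_n -> nat) (r : 'I_N) (x : X) : F :=
  x r ord_max ^+ (t - \sum_j c j) * \prod_j form r j x ^+ c j.

Definition mon T s cc (x : X) : F :=
  \prod_r rowmon (T r + \sum_j sg s r j) (cc r) r x.

(** A form belonging to a pencil is supplied by that pencil up to [sg s r j] times; only the excess
    must be paid from the row degree. *)
Definition valid T s cc := forall r, (\sum_j (cc r j - sg s r j) <= T r)%N.

Lemma valid_le T s cc r : valid T s cc -> (\sum_j cc r j <= T r + \sum_j sg s r j)%N.
Proof.
move=> /(_ r) h; apply: leq_trans (leq_add h (leqnn _)); rewrite -big_split /=.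
by apply: leq_sum => j _; lia.
Qed.

Lemma mon_upd T s cc T' s' cc' r0 h x :
  (forall r, r != r0 -> [/\ T' r = T r, forall j, sg s' r j = sg s r j & forall j, cc' r j = cc r j]) ->
  rowmon (T' r0 + \sum_j sg s' r0 j) (cc' r0) r0 x = h * rowmon (T r0 + \sum_j sg s r0 j) (cc r0) r0 x ->
  h * mon T s cc x = mon T' s' cc' x.
Proof.
move=> hr h0; rewrite /mon (bigD1 r0) //= [RHS](bigD1 r0) //= h0 mulrA; congr (_ * _).
apply: eq_bigr => r rr0; have [-> e1 e2] := hr r rr0.
rewrite /rowmon; congr (_ ^+ (_ + _ - _) * _).
- by apply: eq_bigr.
- by apply: eq_bigr.
- by apply: eq_bigr => j _; rewrite e2.
Qed.

Lemma rowmon0 t c r x : (\sum_j c j <= t)%N -> rowmon t.+1 c r x = x r ord_max * rowmon t c r x.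
Proof. by move=> h; rewrite /rowmon subSn // exprS mulrA. Qed.

Definition inc2 (r0 : 'I_N) (j0 : 'I_n) cc r j := (cc r j + (r == r0) * (j == j0))%N.

Lemma rowmonS t (c c' : 'I_n -> nat) r j0 x : (forall j, c' j = c j + (j == j0))%N ->
  rowmon t.+1 c' r x = form r j0 x * rowmon t c r x.
Proof.
move=> hc; rewrite /rowmon (eq_bigr _ (fun j _ => hc j)) big_split /= (bigD1 j0 (F := fun j => nat_of_bool (j == j0))) //=.
rewrite eqxx [X in (_ + (_ + X))%N]big1 => [|j /negbTE -> //]; rewrite addn0 addn1 subSS mulrCA; congr (_ * _).
rewrite (bigD1 j0) //= [in RHS](bigD1 j0) //= hc eqxx addn1 exprS mulrA; congr (_ * _).
by apply: eq_bigr => j /negbTE h; rewrite hc h addn0.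
Qed.

Lemma sg_incs k s (kK : (k < K)%N) (kn : (ix k < n)%N) r j :
  sg (incs k s) r j = (sg s r j + (r == rho k) * (j == Ordinal kn))%N.
Proof.
rewrite /sg /incs big_split /=; congr (_ + _)%N.
have [/andP[/eqP er /eqP ej]|ne] := boolP ((rho k == r) && (ix k == j)).
  rewrite (bigD1 (Ordinal kK)) /=; last by rewrite er ej !eqxx.
  rewrite eqxx big1 ?addn0; last by move=> l /andP[_]; rewrite -val_eqE /= => /negbTE ->.
  by rewrite er eqxx; have -> : j = Ordinal kn by [apply: ord_inj]; rewrite eqxx.
rewrite big1 => [|l /andP[/eqP er /eqP ej]]; last first.
  by case: eqP => // e; move: ne; rewrite -e er ej !eqxx.
case: (r =P rho k) => [er|_]; last by rewrite mul0n.
case: (j =P Ordinal kn) => [ej|_]; last by rewrite muln0.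
by move: ne; rewrite er ej !eqxx.
Qed.

(** Multiplication by a generator preserves the span of valid monomials. A row entry is expanded by
    [coord_span] and pays with one unit of T; a section of a pencil is the last entry or the form in
    its own slot, whose allowance grows by one. *)
Lemma VV_mon (e : 'I_N + nat -> nat) f : gr (Gen rho (Bl rho eps)) e f ->
  (forall k, (K <= k)%N -> e (inr k) = 0%N) ->
  lspan (valid (e \o inl) (e \o inr)) (mon (e \o inl) (e \o inr)) f.
Proof.
elim=> {e f} [|j g e f hg _ IH|e|c e f g _ IHf _ IHg] he.
- pose c0 : 'I_N -> 'I_n -> nat := fun _ _ => 0%N.
  have e1 : (fun _ : X => 1) = mon (fun=> 0%N) (fun=> 0%N) c0; last first.
    by rewrite e1; apply: (@lspan1 F N _ _ (mon (fun=> 0%N) (fun=> 0%N)) c0) => r; rewrite big1.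
  apply: boolp.funext => x; rewrite /mon big1 // => r _; rewrite /rowmon.
  rewrite [X in _ * X]big1 ?mulr1 => [|j _]; last exact: expr0.
  by rewrite /sg [X in (_ + X)%N]big1 ?expr0 // => j _; rewrite big1.
- have he' k : (K <= k)%N -> e (inr k) = 0%N by move=> /he; case: (e _).
  have {}IH := IH he'.
  case: j hg he => [r|k] /= hg he.
    have [c ->] := hg; have [a0 [a ea]] := coord_span r c.
    set T := e \o inl in IH *; set s := e \o inr in IH *.
    set T' := _ \o inl; set s' := _ \o inr.
    have eT : T' = inc r T by apply: boolp.funext.
    have es : s' = s by apply: boolp.funext => k; rewrite /s' /= addn0.
    rewrite {}eT {}es {T' s'}.
    have h0 : lspan (valid (inc r T) s) (mon (inc r T) s) (fun x => x r ord_max * f x).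
      apply: lspan_mul IH => cc hv; exists cc; split.
        by move=> r'; apply: leq_trans (hv r') (leq_addr _ _).
      move=> x; apply: (@mon_upd _ _ _ _ _ _ r) => [r' /negbTE h|]; first by rewrite /inc h addn0.
      by rewrite /inc eqxx addn1 addSn rowmon0 // valid_le.
    have hj j : lspan (valid (inc r T) s) (mon (inc r T) s) (fun x => form r j x * f x).
      apply: lspan_mul IH => cc hv; exists (inc2 r j cc); split.
        move=> r'; rewrite /inc /inc2; case: eqP => [->|_]; last first.
          by under eq_bigr do rewrite mul0n addn0; rewrite addn0; apply: hv.
        apply: leq_trans (_ : \sum_j' ((cc r j' - sg s r j') + (j' == j)) <= _)%N.
          by apply: leq_sum => j' _; rewrite mul1n; move: (cc r j') (sg s r j') (j' == j) => u z []; lia.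
        rewrite big_split /= leq_add ?hv // (bigD1 j) //= eqxx big1 ?addn0 // => j' /negbTE -> //.
      move=> x; apply: (@mon_upd _ _ _ _ _ _ r) => [r' /negbTE h|].
        by rewrite /inc /inc2 h addn0; split=> // j'; rewrite mul0n addn0.
      by rewrite /inc eqxx addn1 addSn; apply: rowmonS => j'; rewrite /inc2 eqxx mul1n.
    rewrite (_ : (fun x : X => x r c * f x) = fun x : X => a0 * (x r ord_max * f x) + \sum_j a j * (form r j x * f x)).
      apply: lspan_lin => //; elim: (index_enum _) => [|j l IHl].
        by rewrite (_ : (fun=> _) = fun=> 0); [exact: lspan0 | apply: boolp.funext => x; rewrite big_nil].
      rewrite (_ : (fun=> _) = fun x : X => a j * (form r j x * f x) + \sum_(j <- l) a j * (form r j x * f x)).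
        exact: lspan_lin.
      by apply: boolp.funext => x; rewrite big_cons.
    apply: boolp.funext => x; rewrite ea mulrDl mulrA; congr (_ + _); rewrite mulr_suml.
    by apply: eq_bigr => j _; rewrite mulrA.
  have kK : (k < K)%N.
    by rewrite ltnNge; apply/negP => /he; rewrite eqxx; lia.
  have kn : (ix k < n)%N by apply: leq_trans (ix_lt kK) (al_le _).
  set T := e \o inl in IH *; set s := e \o inr in IH *.
  set T' := _ \o inl; set s' := _ \o inr.
  have eT : T' = T by apply: boolp.funext => r; rewrite /T' /= addn0.
  have es : s' = incs k s by apply: boolp.funext.
  rewrite {}eT {}es {T' s'}.
  have sgs r : (\sum_j sg (incs k s) r j = \sum_j sg s r j + (r == rho k))%N.
    under eq_bigr do rewrite (sg_incs s kK kn).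
    have s1 : (\sum_(i < n) (i == Ordinal kn) = 1)%N.
      by rewrite (bigD1 (Ordinal kn)) // eqxx big1 // => j /negbTE ->.
    by rewrite big_split /= -big_distrr /= s1 muln1.
  have sgr r : r != rho k -> forall j, sg (incs k s) r j = sg s r j.
    by move=> /negbTE h j; rewrite (sg_incs s kK kn) h addn0.
  apply: lspan_mul IH => cc hv; case: hg => ->.
    exists cc; split.
      move=> r; apply: leq_trans (hv r); apply: leq_sum => j _; apply: leq_sub2l.
      by rewrite (sg_incs s kK kn) leq_addr.
    move=> x; apply: (@mon_upd _ _ _ _ _ _ (rho k)) => [r h|].
      by split=> //; apply: sgr.
    by rewrite sgs eqxx addn1 addnS rowmon0 // valid_le.
  exists (inc2 (rho k) (Ordinal kn) cc); split.
    move=> r; apply: leq_trans (hv r); apply: leq_sum => j _.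
    by rewrite (sg_incs s kK kn) /inc2 subnDr.
  move=> x; apply: (@mon_upd _ _ _ _ _ _ (rho k)) => [r h|].
    by split=> //; [apply: sgr | move=> j; rewrite /inc2 (negbTE h) addn0].
  rewrite sgs eqxx addn1 addnS (@rowmonS _ (cc (rho k)) _ _ (Ordinal kn)) => [|j]; last first.
    by rewrite /inc2 eqxx mul1n.
  by rewrite form_pencil.
- exact: lspan0.
- by apply: lspan_lin; [apply: IHf | apply: IHg].
Qed.

Lemma sg_final r (j : 'I_n) : sg (sS S K) r j = if (j < alpha K rho r)%N then S else 0%N.
Proof.
rewrite /sg; case: ltnP => [/ix_surj[l lK [er ej]]|h].
  rewrite (bigD1 (Ordinal lK)) /=; last by rewrite er ej !eqxx.
  rewrite /sS lK big1 ?addn0 // => k /andP[/andP[/eqP er' /eqP ej']] /negP[].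
  by rewrite -val_eqE /=; apply/eqP/ix_inj; rewrite ?er ?ej.
rewrite big1 // => k /andP[/eqP er /eqP ej].
by have := ix_lt (ltn_ord k); rewrite er ej ltnNge h.
Qed.

Lemma Hw_id T al : Hw F S 0 1%g T al = (\prod_r bb S (T r) (al r) n)%:R.
Proof.
rewrite /Hw Sch1 -mpolyX0 lfX wt0E; congr (_%:R); apply: eq_bigr => r _.
by rewrite mnm0E subn0.
Qed.

(** Holds on any domain, since the monomials span as functions of matrices. They are counted row by
    row through [codes]; the n forms of a row cause the shift of T by n. *)
Lemma identity_bound D T r : rk_ge D (VV rho (Bl rho eps) T (sS S K)) r ->
  r%:R <= Hw F S 0 1%g (fun k => T k + n)%N (alpha K rho).
Proof.
move=> hr; rewrite Hw_id ler_nat.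
pose fun_of (l : seq (seq nat)) (r : 'I_N) (j : 'I_n) := nth 0%N (nth [::] l r) j.
pose toL (cc : 'I_N -> 'I_n -> nat) := [seq [seq cc r j | j <- enum 'I_n] | r <- enum 'I_N].
have toLK cc r' j : fun_of (toL cc) r' j = cc r' j.
  rewrite /fun_of /toL (nth_map ord0) ?size_enum_ord // (nth_map j) ?size_enum_ord //.
  by rewrite !nth_ord_enum.
pose Ls := [seq codes [seq sg (sS S K) r j | j <- enum 'I_n] (T r) | r <- enum 'I_N].
have := @rk_le_span F N D (VV rho (Bl rho eps) T (sS S K)) _
  (fun l => l \in rows Ls) (fun l => mon T (sS S K) (fun_of l)) (rows Ls) r _ _ hr.
have hV f : VV rho (Bl rho eps) T (sS S K) f ->
    lspan (fun l => l \in rows Ls) (fun l => mon T (sS S K) (fun_of l)) f.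
  move=> hf; have := VV_mon hf; rewrite /ex.
  have -> : (fun j => match j with inl r => T r | inr k => sS S K k end) \o inl = T by [].
  have -> : (fun j => match j with inl r => T r | inr k => sS S K k end) \o inr = sS S K by [].
  have hk k : (K <= k)%N -> sS S K k = 0%N by rewrite /sS leqNgt; case: ltnP.
  move=> /(_ hk) h.
  rewrite (_ : f = fun x => 1 * f x); last by apply: boolp.funext => x; rewrite mul1r.
  apply: lspan_mul h => cc hv; exists (toL cc); split; last first.
    move=> x; rewrite mul1r /mon; apply: eq_bigr => r' _; rewrite /rowmon.
    congr (_ ^+ (_ - _) * _); first by apply: eq_bigr => j _; rewrite toLK.
    by apply: eq_bigr => j _; rewrite toLK.
  apply: rows_mem; rewrite /toL /Ls; elim: (enum 'I_N) => //= r' l ->; rewrite andbT.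
  apply: codes_mem; rewrite ?size_map // /excess zip_map -map_comp sumnE big_map big_enum /=.
  exact: hv.
move=> /(_ hV (fun l hl => hl)); rewrite size_rows big_map big_enum /= => /leq_trans; apply.
apply: leq_prod_nat => r' _.
have -> : [seq sg (sS S K) r' j | j <- enum 'I_n] = [seq (if b then S else 0%N) | b <- [seq (j < alpha K rho r')%N | j <- iota 0 n]].
  rewrite -val_enum_ord -!map_comp; apply: eq_map => j /=; exact: sg_final.
apply: leq_trans (size_codes _ _ _) _; rewrite size_map size_iota count_map.
have -> : count (preim (fun j => (j < alpha K rho r')%N) id) (iota 0 n) = alpha K rho r' => //.
have -> : iota 0 n = iota 0 (alpha K rho r') ++ iota (alpha K rho r') (n - alpha K rho r').
  by rewrite -iotaD subnKC.
rewrite count_cat -[RHS]addn0; congr (_ + _)%N.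
  by rewrite -[RHS](size_iota 0); apply/eqP; rewrite -all_count; apply/allP => j; rewrite mem_iota.
by apply/eqP; rewrite -leqn0 leqNgt -has_count; apply/hasPn => j; rewrite mem_iota /= -leqNgt => /andP[].
Qed.

End IdentityBound.

(** * Propagation of an excess of rank *)

Section UpperBound.
Variables (F : realFieldType) (n S K : nat) (rho : nat -> 'I_n.+1) (eps : nat -> F).
Notation N := n.+1.
Notation X := 'M[F]_N.
Notation al := (alpha K rho).
Notation V T := (VV rho (Bl rho eps) (addT T al) (sS S K)).
Notation H v T := (Hw F S 0 v T al).
Implicit Types (v w : 'S_N) (T : 'I_N -> nat).

Lemma gr_minor k (hk : (0 + k < N)%N) B (C : 'I_k.+1 -> 'I_N) :
  gr (F := F) (Gen rho B) (fun j => if j is inl a then rect k a else 0%N) (minor (F := F) 0 C).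
Proof.
apply: gr_ext (gr_sum (I := 'S_k.+1) (index_enum _) (P := xpredT)
  (f := fun s (x : X) => (-1) ^+ s * \prod_(r < k.+1) x (inord (0 + r)) (C (s r))) _) _ _; last first.
- by move=> x; rewrite /minor /determinant; apply: eq_bigr => s _; congr (_ * _); apply: eq_bigr => r _; rewrite mxE.
- by move=> j; reflexivity.
move=> s _; apply: grZ.
apply: gr_ext (gr_prod (index_enum _) (I := 'I_k.+1) (e := fun r j => (j == inl (inord (0 + r)))%N)
  (f := fun r (x : X) => x (inord (0 + r)) (C (s r))) _) _ _; last by [].
  by move=> r; apply: gr_gen; exists (C (s r)).
case=> [a|l]; last by rewrite big1.
rewrite /rect; have [ak|ka] := leqP a k.
  rewrite (bigD1 (Ordinal (ak : (a < k.+1)%N))) //= add0n inord_val eqxx big1 // => r ra.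
  case: eqP => // -[e]; case/negP: ra; apply/eqP/ord_inj; rewrite /= e inordK //.
  by apply: leq_ltn_trans hk; rewrite add0n -ltnS.
rewrite big1 // => r _; case: eqP => // -[e]; move: ka; rewrite e add0n inordK; last first.
  by apply: leq_ltn_trans hk; rewrite add0n -ltnS.
by rewrite ltnNge -ltnS ltn_ord.
Qed.

Lemma VV_minor k (hk : (0 + k < N)%N) B (C : 'I_k.+1 -> 'I_N) T s (g : X -> F) : VV rho B T s g ->
  VV rho B (addT T (rect k)) s (fun x => minor 0 C x * g x).
Proof.
move=> hg; apply: gr_ext (grM (gr_minor hk B C) hg) _ _ => // -[a|l] //=.
by rewrite /addT addnC.
Qed.

Lemma sec_step k (hk : (0 + k < N)%N) v T h0 (hb : 'I_N * 'I_N -> F) :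
  rkR (Dset 0 v) (V T) h0 ->
  (forall p, sib k v p -> rkR (Dset 0 (sibv v p)) (V T) (hb p)) ->
  rkR (Dset 0 v) (V (addT T (rect k))) (h0 + \sum_(p | sib k v p) hb p).
Proof.
have hpf T' g : V T' g -> pf g by apply: VV_pf; apply: Bl_pf.
have hV (C : 'I_k.+1 -> 'I_N) g : V T g -> V (addT T (rect k)) (fun x => minor 0 C x * g x).
  move=> /(VV_minor hk C) h; apply: VV_ext h _ _ _ => // r.
  by rewrite /addT addnAC.
move=> hv hs; apply: (@rkR_sec F n 0 k hk v (fun=> 1) (V T) (V T) (V (addT T (rect k)))) hv hs => //; try exact: hpf.
- exact: pfC.
- by move=> g /(hV (fun s => v (wd hk s))).
- move=> p y sp /(hV (fun s => sibv v p (wd hk s))) h.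
  by apply: VV_ext h _ _ _ => // x; rewrite mulr1.
- by move=> p sp; have [x hx] := Dset_inhabited F 0 (sibv v p); exists x => //; rewrite oner_eq0.
Qed.

Definition shift k T j : 'I_N -> nat := fun r => (T r + j * rect k r)%N.

Lemma shift0 k T : shift k T 0 = T.
Proof. by apply: boolp.funext => r; rewrite /shift addn0. Qed.

Lemma shiftS k T j : shift k T j.+1 = addT (shift k T j) (rect k).
Proof. by apply: boolp.funext => r; rewrite /shift /addT mulSn addnCA addnC. Qed.

Section Chain.
Variables (k m : nat) (T : 'I_N -> nat).
Hypothesis hk : (0 + k < N)%N.
Hypothesis hg : forall v j, (j <= m)%N -> good S K rho eps 0 v (shift k T j).

Lemma sum_sib_ge0 v U : 0 <= \sum_(q | sib k v q) H (sibv v q) U.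
Proof. by apply: sumr_ge0 => q _; apply: Hw_ge0. Qed.

Lemma chain_step (v p : 'S_N) (a : 'I_N) j : (k < a)%N -> v a = ord_max ->
  H v (shift k T j) <= H v (shift k T j.-1) + \sum_(q | sib k v q) H (sibv v q) (shift k T j).
Proof.
move=> ka va; case: j => [|j]; first by rewrite /= lerDl sum_sib_ge0.
by rewrite /= shiftS; apply: Hw_monk_le ka va.
Qed.

(** An excess of the rank over the count at T survives every shift: a section step adds the counts
    of the siblings, which is at least the growth of the count of w. The siblings enter one shift
    late, hence [j.-1]. *)
Lemma chainA (w : 'S_N) (a : 'I_N) h j : (j <= m)%N -> (k < a)%N -> w a = ord_max ->
  rkR (Dset 0 w) (V T) h ->
  rkR (Dset 0 w) (V (shift k T j)) (h + H w (shift k T j.-1) - H w T).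
Proof.
move=> jm ka wa hh; elim: j jm => [|j IH] jm; first by rewrite /= shift0 addrK.
have := sec_step hk (IH (ltnW jm)) (fun q _ => hg (sibv w q) (ltnW jm)).
rewrite -shiftS; apply: rkR_le; rewrite [j.+1.-1]/=.
by have := chain_step 1%g j ka wa; lra.
Qed.

(** The sibling [q0] contributes its excess anew at every step, so the excess on v grows linearly in
    j. This gain compensates for [codim v] being larger than [codim w]. *)
Lemma chainB (v w : 'S_N) (q0 : 'I_N * 'I_N) (a b : 'I_N) h j : (j <= m)%N ->
  (k < a)%N -> v a = ord_max -> (k < b)%N -> w b = ord_max ->
  sib k v q0 -> w = sibv v q0 -> rkR (Dset 0 w) (V T) h ->
  rkR (Dset 0 v) (V (shift k T j)) (H v (shift k T j.-2) + j%:R * (h - H w T)).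
Proof.
move=> jm ka va kb wb sq ew hh; elim: j jm => [|j IH] jm.
  by rewrite /= mul0r addr0; apply: hg.
pose hb q := H (sibv v q) (shift k T j.-1) + (if q == q0 then h - H w T else 0).
have hs q : sib k v q -> rkR (Dset 0 (sibv v q)) (V (shift k T j)) (hb q).
  move=> _; rewrite /hb; case: eqP => [->|_].
    rewrite -ew addrCA addrA; exact: (chainA (ltnW jm) kb wb hh).
  rewrite addr0; apply: rkR_le (hg _ (ltnW jm)).
  by apply: Hw_mono => // r; rewrite /shift leq_add2l leq_mul2r leq_pred orbT.
have := sec_step hk (IH (ltnW jm)) hs.
rewrite -shiftS; apply: rkR_le; rewrite [j.+1.-2]/= /hb big_split /= -big_mkcondr /=.
rewrite [X in _ <= _ + (_ + X)](_ : _ = h - H w T); last first.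
  by rewrite (eq_bigl (fun q => q == q0)) ?big_pred1_eq // => q; apply: andb_idl => /eqP ->.
have := chain_step 1%g j.-1 ka va; rewrite -natr1 mulrDl mul1r; lra.
Qed.

End Chain.
End UpperBound.

Section UpperBoundInduction.
Variables (F : realFieldType) (n : nat).
Notation N := n.+1.
Notation X := 'M[F]_N.

(* With S and T of order kp, the rank exceeds the weighted count only by
   O(kp^(codim w - 1)). *)
Definition has_ub (w : 'S_N) := forall a, exists C b, 0 <= C :> F /\
  forall kp S K rho (eps : nat -> F) T r, (0 < kp)%N -> (S <= a * kp)%N ->
  (forall k l, (k < l)%N -> (l < K)%N -> eps k != eps l) ->
  (forall r, (alpha K rho r <= n)%N) ->
  (forall v U, (forall r, (U r <= b * kp)%N) -> good S K rho eps 0 v U) ->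
  (forall r, (T r <= a * kp)%N) ->
  rkR (Dset 0 w) (VV rho (Bl rho eps) (addT T (alpha K rho)) (sS S K)) r ->
  kp%:R * (r - Hw F S 0 w T (alpha K rho)) <= C * kp%:R ^+ codim w.

(** There are finitely many [al] with values at most n; their constants are added up. *)
Lemma Hw_growth_unif v a c : exists2 C : F, 0 <= C & forall al, (forall r : 'I_N, (al r <= n)%N) ->
  forall kp S T T', (0 < kp)%N ->
  (forall r, (T r <= a * kp)%N) -> (S <= a * kp)%N ->
  (forall r, (T r <= T' r)%N) -> (forall r, (T' r <= T r + c)%N) ->
  kp%:R * Hw F S 0 v T' al <= kp%:R * Hw F S 0 v T al + C * kp%:R ^+ codim v.
Proof.
pose ge (al : {ffun 'I_N -> 'I_N}) : 'I_N -> nat := fun r => al r.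
have h al : {C : F | 0 <= C & forall kp S T T', (0 < kp)%N ->
  (forall r, (T r <= a * kp)%N) -> (S <= a * kp)%N ->
  (forall r, (T r <= T' r)%N) -> (forall r, (T' r <= T r + c)%N) ->
  kp%:R * Hw F S 0 v T' (ge al) <= kp%:R * Hw F S 0 v T (ge al) + C * kp%:R ^+ codim v}.
  by have /boolp.cid2[C] := @Hw_growth F n v (ge al) a c; exists C.
exists (\sum_al s2val (h al)); first by apply: sumr_ge0 => al _; case: (h al).
move=> al hal; pose al' : {ffun 'I_N -> 'I_N} := [ffun r => inord (al r)].
have -> : al = ge al' by apply: boolp.funext => r; rewrite /ge ffunE inordK // ltnS.
move=> kp S T T' kp0 hT hS h1 h2; have := s2valP' (h al') kp S T T' kp0 hT hS h1 h2.
move=> /le_trans; apply; rewrite lerD2l ler_wpM2r ?exprn_ge0 //.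
by rewrite (bigD1 al') //= lerDl; apply: sumr_ge0 => x _; case: (h x).
Qed.

Lemma has_ub1 : has_ub 1%g.
Proof.
(* The allowance n + n pays for alpha <= n and for the shift by n in [identity_bound]. *)
move=> a; have [C C0 hC] := Hw_growth_unif 1%g a (n + n); exists C, 0%N; split=> // kp S K rho eps T r kp0 hS dist ale _ hT [m hm rm].
have := identity_bound dist ale hm; set T' := (fun _ => _) => h1.
have hT' : addT T (alpha K rho) = addT T (alpha K rho) by [].
have := hC (alpha K rho) ale kp S T T' kp0 hT hS.
rewrite /T' /addT => /(_ (fun r => leq_trans (leq_addr _ _) (leq_addr _ _))) h2.
have {}h2 := h2 (fun r => _ : (T r + alpha K rho r + n <= T r + (n + n))%N).
have {}h2 := h2 (fun r => ltac:(by rewrite -addnA leq_add2l leq_add2r)).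
rewrite mulrBr lerBlDr addrC; apply: le_trans h2; rewrite ler_pM2l ?ltr0n //.
exact: le_trans rm h1.
Qed.

Lemma len_le (w : 'S_N) : (len w <= N * n)%N.
Proof.
rewrite /len -[X in (X * _)%N]card_ord -sum_nat_const; apply: leq_sum => i _.
rewrite /code; apply: leq_trans (_ : #|[set~ i]| <= _)%N; last by rewrite cardsC1 card_ord.
by apply/subset_leq_card/subsetP => j; rewrite !inE => /andP[ij _]; apply: contraTneq ij => ->; rewrite ltnn.
Qed.

(** After kp shifts an excess on w has become kp times as large on v, where it is bounded by order
    codim v - 1; dividing by kp gives order codim w - 1. The growth lemma is used with increment 2
    because of the index [j.-2] in [chainB]. *)
Lemma has_ub_step (v : 'S_N) (i j : 'I_N) : j = i.+1 :> nat -> (v i < v j)%N ->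
  v ord_max = ord_max -> (j < n)%N -> has_ub v -> has_ub (tperm i j * v)%g.
Proof.
move=> ij vij vmax jn hv a; set w := (tperm i j * v)%g.
have [C1 [b1 [C10 h1]]] := hv a.+1.
have [C2 C20 h2] := Hw_growth_unif v a.+1 2.
have lenw : (len v).+1 = len w.
  have := @len_step n.+1 w i j ij; rewrite /w mulgA tperm2 mul1g !permM tpermL tpermR; exact.
have cod : codim v = (codim w).+1.
  by have := len_le w; rewrite /codim; lia.
exists (C1 + C2), (maxn b1 a.+1); split; first exact: addr_ge0.
move=> kp S K rho eps T r kp0 hS dist ale hg hT hr.
have hk : (0 + i < N)%N by rewrite add0n.
have shT (T' := shift i T kp) r' : (T' r' <= a.+1 * kp)%N.
  by rewrite /T' /shift mulSn addnC leq_add // -[leqRHS]muln1 leq_mul2l /rect leq_b1 orbT.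
have hg' v' j' : (j' <= kp)%N -> good S K rho eps 0 v' (shift i T j').
  move=> jk; apply: hg => r'; apply: leq_trans (_ : _ <= a.+1 * kp)%N _; last by rewrite leq_mul2r leq_maxr orbT.
  by apply: leq_trans (shT r'); rewrite /shift leq_add2l leq_mul2r jk orbT.
have sq : sib i v (i, j).
  rewrite /sib /= leqnn ij ltnSn /=; apply/covP; split=> //; first by rewrite ij.
  by move=> c h1'; rewrite ij ltnS => h2'; move: (leq_ltn_trans h2' h1'); rewrite ltnn.
have mx : w ord_max = ord_max.
  by rewrite /w permM tpermD // -val_eqE /=; [rewrite ltn_eqF //; lia | rewrite ltn_eqF].
have im : (i < (ord_max : 'I_N))%N by rewrite /=; lia.
have B := @chainB F n S K rho eps i kp T hk hg' v w (i, j) ord_max ord_max r kp (leqnn _) im vmax im mx sq erefl hr.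
have {}B := h1 kp S K rho eps (shift i T kp) _ kp0 (leq_trans hS (leq_mul (leqnSn a) (leqnn kp))) dist ale
  (fun v U hU => hg v U (fun r => leq_trans (hU r) (leq_mul (leq_maxl _ _) (leqnn _)))) shT B.
have G := h2 (alpha K rho) ale kp S (shift i T kp.-2) (shift i T kp) kp0.
have {}G := G (fun r => leq_trans (leq_add (leqnn _) (leq_mul (leq_trans (leq_pred _) (leq_pred _)) (leqnn _))) (shT r)).
have {}G := G (leq_trans hS (leq_mul (leqnSn a) (leqnn kp))).
have {}G := G (fun r => leq_add (leqnn _) (leq_mul (leq_trans (leq_pred _) (leq_pred _)) (leqnn _))).
have {}G := G (fun r => ltac:(rewrite /shift /rect; case: (r <= i)%N; lia)).
rewrite -(ler_pM2l (x := kp%:R)) ?ltr0n // [leRHS]mulrCA -exprS -cod.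
move: B G; set x := kp%:R * (r - _); set u := Hw _ _ _ _ (shift _ _ kp.-2) _; set u' := Hw _ _ _ _ (shift _ _ kp) _.
rewrite (_ : kp%:R * (u + x - u') = kp%:R * u + kp%:R * x - kp%:R * u'); last by ring.
rewrite mulrDl; lra.
Qed.

End UpperBoundInduction.

Section UpperBoundAll.
Variables (F : realFieldType) (n : nat).
Notation N := n.+1.

Lemma asc_perm1 (w : 'S_N) : (forall i j : 'I_N, j = i.+1 :> nat -> (w i < w j)%N) -> w = 1%g.
Proof.
move=> h.
have up k (kN : (k < N)%N) : (k <= w (Ordinal kN))%N.
  elim: k kN => // k IH kN; exact: leq_ltn_trans (IH (ltnW kN)) (h (Ordinal (ltnW kN)) (Ordinal kN) erefl).
have down d : forall k (kN : (k < N)%N), (k + d = n)%N -> (w (Ordinal kN) <= k)%N.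
  elim: d => [|d IH] k kN e; first by have := ltn_ord (w (Ordinal kN)); lia.
  have kN1 : (k.+1 < N)%N by lia.
  have := IH _ kN1; rewrite addSnnS => /(_ e).
  by have := h (Ordinal kN) (Ordinal kN1) erefl; lia.
apply/permP => i; rewrite perm1; apply: ord_inj; apply/eqP; rewrite eqn_leq.
case: i => k kN; rewrite (up k kN) andbT; apply: (down (n - k)%N); lia.
Qed.

(** The descents removed never involve the last position, so the maximal value remains to the right
    of them, as Monk's rule requires. *)
Lemma has_ub_max (w : 'S_N) : w ord_max = ord_max -> has_ub F w.
Proof.
have [m] := ubnP (len w); elim: m w => // m IH w lw wmax.
have [/existsP[i /existsP[j /and3P[/eqP ij jn wji]]]|noD] :=
  boolP [exists i : 'I_N, exists j : 'I_N, [&& j == i.+1 :> nat, (j < n)%N & (w j < w i)%N]].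
  have e : w = (tperm i j * (tperm i j * w))%g by rewrite mulgA tperm2 mul1g.
  rewrite e; apply: has_ub_step => //.
  - by rewrite !permM tpermL tpermR.
  - by rewrite permM tpermD // -val_eqE /= ltn_eqF //; lia.
  - apply: IH; first by have := len_step ij wji; lia.
    by rewrite permM tpermD // -val_eqE /= ltn_eqF //; lia.
rewrite (@asc_perm1 w); first exact: has_ub1.
move=> i j ij; rewrite ltnNge; apply/negP => wji.
have nij : i != j by apply/eqP => e; move: ij; rewrite e; lia.
have {}wji : (w j < w i)%N.
  by rewrite ltn_neqAle wji andbT val_eqE (inj_eq perm_inj) eq_sym.
have [jn|nj] := ltnP j n.
  by case/negP: noD; apply/existsP; exists i; apply/existsP; exists j; rewrite ij eqxx -ij jn wji.
have ej : j = ord_max by apply: ord_inj => /=; have := ltn_ord j; lia.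
by move: wji; rewrite ej wmax ltnNge -ltnS ltn_ord.
Qed.

End UpperBoundAll.

(** * Superadditivity from lowest exponents *)

Section Lowest.
Variables (F : fieldType) (d : nat).
Implicit Types (P Q : {mpoly F[d]}) (a b m : 'X_{1..d}).

(** A valuation by [lowM]. The order on exponents refines the total degree, which [low_var]
    exploits. *)
Definition low P m := P@_m != 0 /\ forall m', (m' < m)%O -> P@_m' = 0.

Lemma mulcoeff0 P Q m : (forall k1 k2, m = (k1 + k2)%MM -> P@_k1 * Q@_k2 = 0) -> (P * Q)@_m = 0.
Proof. by move=> h; rewrite mcoeffM big1 // => k /eqP; apply: h. Qed.

Lemma lowM P Q a b : low P a -> low Q b -> low (P * Q) (a + b)%MM.
Proof.
move=> [Pa hP] [Qb hQ]; have ge (k : 'X_{1..d}) m R : R@_k != 0 -> (forall m', (m' < m)%O -> R@_m' = 0) -> (m <= k)%O.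
  by move=> Rk h; rewrite leNgt; apply: contra_neqN Rk; apply: h.
split; last first.
  move=> m hm; apply: mulcoeff0 => k1 k2 e; apply/eqP; rewrite mulf_eq0 -[_ || _]negbK negb_or.
  apply/negP => /andP[/ge h1 /ge h2]; move: hm; rewrite e ltNge.
  by rewrite (le_trans (y := (a + k2)%MM)) ?lemc_add2l ?lemc_add2r ?h1 ?h2.
pose P' := P - P@_a *: 'X_[a].
have -> : P = P@_a *: 'X_[a] + P' by rewrite /P' addrC subrK.
rewrite mulrDl mcoeffD [X in _ + X]mulcoeff0 ?addr0.
  by rewrite -scalerAl mcoeffZ [_ * Q]mulrC mcoeffMX mulf_neq0.
move=> k1 k2 e; apply/eqP; rewrite mulf_eq0 -[_ || _]negbK negb_or; apply/negP => /andP[h1 /ge h2].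
have k1a : k1 != a.
  by apply: contraNneq h1 => ->; rewrite /P' mcoeffB mcoeffZ mcoeffX eqxx mulr1 subrr.
have ak1 : (a < k1)%O.
  rewrite lt_neqAle eq_sym k1a; apply: (ge _ k1 a P) => //.
  by move: h1; rewrite /P' mcoeffB mcoeffZ mcoeffX (eq_sym a) (negbTE k1a) mulr0 subr0.
have := ltmc_le_add ak1 (h2 _ hQ); by rewrite e ltxx.
Qed.

Lemma low_exists P : P != 0 -> exists m, low P m.
Proof.
move=> P0; exists (mlast P); split; last by move=> m'; apply: mcoeff_lt_mlast.
by rewrite -mcoeff_msupp mlast_supp.
Qed.

(* Distinct lowest exponents in a linear span: subtract multiples of one member
   so as to kill its lowest exponent in all the others. *)
Lemma low_span k (P : 'I_k -> {mpoly F[d]}) :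
  (forall c : 'I_k -> F, \sum_i c i *: P i = 0 -> forall i, c i = 0) ->
  exists L, [/\ uniq L, size L = k &
    forall m, m \in L -> exists c : 'I_k -> F, low (\sum_i c i *: P i) m].
Proof.
elim: k P => [|k IH] P ind; first by exists [::].
have P0 : P ord0 != 0.
  apply/eqP => e; have := ind (fun i => (i == ord0)%:R) _ ord0; rewrite eqxx => h.
  suff /eqP : (1 : F) = 0 by rewrite oner_eq0.
  by apply: h; rewrite big_ord_recl e scaler0 add0r big1 // => i _; rewrite scale0r.
have [m0 [m0n lm0]] := low_exists P0.
pose q i := (P (lift ord0 i))@_m0 / (P ord0)@_m0.
pose P' i := P (lift ord0 i) - q i *: P ord0.
have comb (c : 'I_k -> F) : \sum_i c i *: P' i =
    \sum_i (if unlift ord0 i is Some j then c j else - \sum_j c j * q j) *: P i.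
  rewrite big_ord_recl unlift_none /= addrC scaleNr scaler_suml -sumrB.
  by apply: eq_bigr => i _; rewrite liftK scalerBr scalerA.
have [|L [uL sL hL]] := IH P'.
  move=> c; rewrite comb => /ind h i; have := h (lift ord0 i); by rewrite liftK.
have m0L : m0 \notin L.
  apply/negP => /hL[c [h _]]; case/eqP: h; rewrite raddf_sum big1 // => i _.
  by rewrite /= mcoeffZ mcoeffB mcoeffZ /q divfK // subrr mulr0.
exists (m0 :: L); split; rewrite /= ?m0L ?sL // => m; rewrite inE => /predU1P[->|/hL[c hc]].
  exists (fun i => (i == ord0)%:R); rewrite big_ord_recl eqxx scale1r big1 ?addr0 // => i _.
  by rewrite scale0r.
by exists (fun i => if unlift ord0 i is Some j then c j else - \sum_j c j * q j); rewrite -comb.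
Qed.

Lemma low_indep (I : finType) (P : I -> {mpoly F[d]}) (m : I -> 'X_{1..d}) (c : I -> F) :
  injective m -> (forall i, low (P i) (m i)) -> \sum_i c i *: P i = 0 -> forall i, c i = 0.
Proof.
move=> minj hl e i; apply/eqP; apply: contraT => ci.
case: (arg_minP (P := fun i => c i != 0) m ci) => j cj jmin.
have := congr1 (mcoeff (m j)) e; rewrite raddf_sum mcoeff0 (bigD1 j) //= big1 ?addr0.
  by move/eqP; rewrite mcoeffZ mulf_eq0 (negbTE cj) /= (negbTE (hl j).1).
move=> l lj; rewrite mcoeffZ; have [->|cl] := eqVneq (c l) 0; first by rewrite mul0r.
rewrite (hl l).2 ?mulr0 // lt_neqAle jmin // andbT.
by apply: contraNneq lj => /minj ->.
Qed.

End Lowest.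

Section Nonroot.
Variable F : realFieldType.

Lemma digits_inj d B (a b : 'I_d -> nat) : (forall i, a i < B)%N -> (forall i, b i < B)%N ->
  (\sum_(i < d) a i * B ^ i = \sum_(i < d) b i * B ^ i)%N -> a =1 b.
Proof.
elim: d a b => [|d IH] a b ha hb; first by move=> _ [].
rewrite !big_ord_recl /= !muln1.
have sh (f : 'I_d.+1 -> nat) : (\sum_(i < d) f (lift ord0 i) * B ^ bump 0 i = (\sum_(i < d) f (lift ord0 i) * B ^ i) * B)%N.
  by rewrite big_distrl /=; apply: eq_bigr => i _; rewrite /bump /= add1n expnSr mulnA.
rewrite !sh => e.
have B0 : (0 < B)%N by apply: leq_ltn_trans (ha ord0).
have e0 : a ord0 = b ord0.
  by have := congr1 (modn^~ B) e; rewrite ![(_ + _ * B)%N]addnC !modnMDl !modn_small.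
have e1 : (\sum_(i < d) a (lift ord0 i) * B ^ i = \sum_(i < d) b (lift ord0 i) * B ^ i)%N.
  by move: e; rewrite e0 => /addnI/eqP; rewrite eqn_pmul2r // => /eqP.
move=> i; case: (unliftP ord0 i) => [j ->|-> //].
exact: (IH _ _ (fun j => ha (lift ord0 j)) (fun j => hb (lift ord0 j)) e1 j).
Qed.

(** Kronecker substitution x_i = t^(B^i): with B above all exponents, distinct monomials go to
    distinct powers of t. *)
Lemma mpoly_nonroot d (P : {mpoly F[d]}) : P != 0 -> exists z, P.@[z] != 0.
Proof.
move=> P0; pose B := (\max_(m <- msupp P) mdeg m).+1.
have hB m i : m \in msupp P -> (m i < B)%N.
  move=> hm; rewrite ltnS; apply: leq_trans (leq_bigmax_seq _ hm isT).
  by rewrite mdegE (bigD1 i) //= leq_addr.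
pose e (m : 'X_{1..d}) := (\sum_(i < d) m i * B ^ i)%N.
pose p : {poly F} := \sum_(m <- msupp P) P@_m *: 'X^(e m).
have pe t : p.[t] = P.@[fun i => t ^+ (B ^ i)].
  rewrite mevalE /p horner_sum; apply: eq_bigr => m _; rewrite hornerZ hornerXn; congr (_ * _).
  by rewrite /e expr_sum; apply: eq_bigr => i _; rewrite mulnC exprM.
have p0 : p != 0.
  have [m hm] : exists m, m \in msupp P.
    by exists (mlast P); apply: mlast_supp.
  apply/eqP => /(congr1 (fun q : {poly F} => q`_(e m))); rewrite coef0 /p coef_sum.
  rewrite (bigD1_seq m) ?msupp_uniq //= big1_seq ?addr0; last first.
    move=> m' /andP[nm hm']; rewrite coefZ coefXn; case: eqP => [/eqP|]; rewrite ?mulr0 //.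
    move=> /eqP ee; case/eqP: nm; apply/mnmP => i.
    by apply: (digits_inj (fun i => hB m' i hm') (fun i => hB m i hm)); rewrite -/(e m') -/(e m) ee.
  by rewrite coefZ coefXn eqxx mulr1; apply/eqP; rewrite -mcoeff_msupp.
have [t ht] := poly_nonroot p0; exists (fun i => t ^+ (B ^ i)).
by rewrite -pe.
Qed.

End Nonroot.

(** * An affine slice of the cell *)

Section Slice.
Variables (F : realFieldType) (n : nat) (w : 'S_n.+1).
Notation N := n.+1.
Notation X := 'M[F]_N.

(** The first alternative lists the free entries of L, the second those of U. An entry (l, m) of U
    with l < m and w l > w m is set to zero, so that U is still upper triangular after its indices
    are permuted by w. *)
Definition isvar (p : 'I_N * 'I_N) := (p.2 < p.1)%N || ((p.1 < p.2)%N && (w p.1 < w p.2)%N).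
Notation d := #|[set p | isvar p]|.
Definition var (k : 'I_d) : 'I_N * 'I_N := enum_val k.

Lemma isvar_row (i : 'I_N) : (\sum_j isvar (i, j) + code w i = n)%N.
Proof.
rewrite /code -sum1_card (big_mkcond (fun j => j \in _)) -big_split /=.
transitivity (\sum_(j : 'I_N) (j != i))%N.
  apply: eq_bigr => j _; rewrite inE /isvar /=.
  have [->|ji] := eqVneq j i; first by rewrite !ltnn.
  have : (w j != w i :> nat) by rewrite val_eqE (inj_eq perm_inj).
  move: ji; rewrite -val_eqE /=; move: (nat_of_ord (w j)) (nat_of_ord (w i)) (nat_of_ord i) (nat_of_ord j) => a b s t.
  by case: (ltngtP t s) => //= _ _; case: (ltngtP a b).
rewrite -[RHS]/(n.+1.-1) -[X in X.-1]card_ord -(cardC1 i) -sum1_card [RHS]big_mkcond /=.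
by apply: eq_bigr => j _; rewrite !inE; case: eqP.
Qed.

Lemma card_isvar : d = codim w.
Proof.
suff e : (d + len w = N * n)%N by rewrite /codim -e addnK.
have -> : (d = \sum_i \sum_j isvar (i, j))%N.
  rewrite -sum1_card pair_bigA big_mkcond; apply: eq_bigr => -[i j] _; rewrite inE.
  by case: (isvar _).
rewrite /len -big_split /= (eq_bigr (fun=> n)) => [|i _]; last exact: isvar_row.
by rewrite sum_nat_const card_ord.
Qed.

Definition lm (y : 'I_N * 'I_N -> F) (i l : 'I_N) : F :=
  if l == i then 1 else if (l < i)%N then y (i, l) else 0.
Definition um (y : 'I_N * 'I_N -> F) (l m : 'I_N) : F :=
  if m == l then 1 else if (l < m)%N then y (l, m) else 0.

Lemma lum y i m : \sum_l lm y i l * um y l m =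
  (if m == i then 1 else y (i, m)) + \sum_(l : 'I_N | (l < i)%N && (l < m)%N) y (i, l) * y (l, m).
Proof.
rewrite (bigD1 i) //= {1}/lm eqxx mul1r.
have -> : \sum_(l | l != i) lm y i l * um y l m = \sum_(l : 'I_N | (l < i)%N) y (i, l) * um y l m.
  rewrite big_mkcond [RHS]big_mkcond; apply: eq_bigr => l _; rewrite /lm.
  have [->|li] := eqVneq l i; first by rewrite ltnn.
  by case: ltnP => //; rewrite mul0r.
have [->|mi] := eqVneq m i.
  rewrite {1}/um eqxx; congr (_ + _); apply: eq_big => [l|l li]; first by rewrite andbb.
  by rewrite /um -val_eqE /= gtn_eqF // li.
have mi' : (m != i :> nat) by [].
case: (ltngtP m i) mi' => // h _; last first.
  rewrite {1}/um (negbTE mi) h; congr (_ + _); apply: eq_big => [l|l li].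
    by case: ltnP => //= li; rewrite (ltn_trans li h).
  by rewrite /um -val_eqE /= gtn_eqF (ltn_trans li h).
rewrite {1}/um (negbTE mi) ltnNge (ltnW h) add0r (bigD1 m) //= {1}/um eqxx mulr1; congr (_ + _).
rewrite big_mkcond [RHS]big_mkcond; apply: eq_bigr => l _.
have [->|lm'] := eqVneq l m; first by rewrite ltnn andbF.
rewrite andbT /um eq_sym (negbTE lm').
by case: (l < i)%N => //=; case: (l < m)%N => //; rewrite mulr0.
Qed.

Definition yv (z : 'I_d -> F) p := \sum_(k | var k == p) z k.
Definition Yv p : {mpoly F[d]} := \sum_(k | var k == p) 'X_k.
(* L * U * P_w, for unitriangular L and U whose free entries are the codim w pairs
   satisfying isvar. *)
Definition slice z : X := \matrix_(i, j) \sum_l lm (yv z) i l * um (yv z) l ((w^-1)%g j).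
Definition Pm i m : {mpoly F[d]} :=
  (if m == i then 1 else Yv (i, m)) + \sum_(l : 'I_N | (l < i)%N && (l < m)%N) Yv (i, l) * Yv (l, m).

Lemma yv0 z p : ~~ isvar p -> yv z p = 0.
Proof.
move=> h; rewrite /yv big1 // => k /eqP e; case/negP: h; rewrite -e /var.
by have := enum_valP k; rewrite inE.
Qed.

Lemma Yv_eval z p : (Yv p).@[z] = yv z p.
Proof. by rewrite /Yv raddf_sum; apply: eq_bigr => k _; rewrite /= mevalXU. Qed.

Lemma slice_eval z i m : slice z i (w m) = (Pm i m).@[z].
Proof.
rewrite mxE permK lum /Pm rmorphD raddf_sum /=; congr (_ + _).
  by case: eqP => _; rewrite ?rmorph1 // Yv_eval.
by apply: eq_bigr => l _; rewrite rmorphM /= !Yv_eval.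
Qed.

Lemma slice_Dset z : Dset 0 w (slice z).
Proof.
exists (\matrix_(i, l) lm (yv z) i l), (\matrix_(a, b) um (yv z) ((w^-1)%g a) ((w^-1)%g b)), (fun=> 1).
split=> [||r|]; last 2 first.
- exact: oner_neq0.
- apply/matrixP => i j; rewrite !mxE ltn0 subn0.
  have -> : inord i = i by apply: ord_inj; rewrite inordK.
  by apply: eq_bigr => l _; rewrite !mxE permK.
- split=> [a b ab|a]; rewrite mxE /lm ?eqxx ?oner_neq0 // -val_eqE /= gtn_eqF //.
  by rewrite ltnNge ltnW.
split=> [a b ab|a]; rewrite mxE /um ?eqxx ?oner_neq0 //.
have ne : (w^-1)%g b != (w^-1)%g a.
  by rewrite (inj_eq perm_inj) -val_eqE /= ltn_eqF.
rewrite (negbTE ne); case: ltnP => // h; rewrite yv0 // /isvar /= !permKV.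
by rewrite negb_or negb_and -!leqNgt (ltnW h) (ltnW ab) orbT.
Qed.

Lemma sum_delta (k : 'I_N) (x : F) (f : 'I_N -> F) : \sum_l x * (l == k)%:R * f l = x * f k.
Proof.
by rewrite (bigD1 k) //= eqxx mulr1 big1 ?addr0 // => l /negbTE ->; rewrite mulr0 mul0r.
Qed.

(** Forward substitution against the unitriangular rows of P. Their second pattern of zeros
    guarantees that rows l with w l < c get coefficient 0. *)
Lemma elim_row k (P : X) (v : 'I_N -> F) (c : nat) : (k <= N)%N ->
  (forall l : 'I_N, (l < k)%N -> [/\ P l l = 1, forall m : 'I_N, (m < l)%N -> P l m = 0 &
     forall m, (w m < w l)%N -> P l m = 0]) ->
  (forall m, (w m < c)%N -> v m = 0) ->
  exists a : 'I_N -> F, [/\ forall l : 'I_N, (k <= l)%N -> a l = 0, forall l, (w l < c)%N -> a l = 0 &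
    forall m : 'I_N, (m < k)%N -> v m = \sum_l a l * P l m].
Proof.
move=> kN hP hv; elim: k kN hP => [|k IH] kN hP.
  by exists (fun=> 0).
have [|a [a1 a2 a3]] := IH (ltnW kN); first by move=> l lk; apply: hP; apply: ltnW.
pose k' := Ordinal kN; have [Pkk Pk1 Pk2] := hP k' (ltnSn k).
pose x := v k' - \sum_l a l * P l k'.
exists (fun l => a l + x * (l == k')%:R).
have e m : \sum_l (a l + x * (l == k')%:R) * P l m = \sum_l a l * P l m + x * P k' m.
  under eq_bigr => l _ do rewrite mulrDl.
  by rewrite big_split /= sum_delta.
split.
- move=> l kl; rewrite a1 ?(ltnW kl) // add0r -val_eqE /= gtn_eqF // mulr0 //.
- move=> l lc; rewrite a2 // add0r; case: eqP => [el|_]; rewrite ?mulr0 // mulr1 /x -el hv // sub0r.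
  rewrite big1 ?oppr0 // => l' _; have [lt|ge] := ltnP (w l') c; first by rewrite a2 ?mul0r.
  have [lt|ge'] := ltnP l' k; last by rewrite a1 ?mul0r.
  have [_ _ h] := hP l' (ltnW lt); rewrite (h l) ?mulr0 //; exact: leq_trans lc ge.
move=> m; rewrite ltnS leq_eqVlt e => /predU1P[mk|mk]; last by rewrite -a3 // Pk1 // mulr0 addr0.
have -> : m = k' by apply: ord_inj.
by rewrite Pkk mulr1 /x addrC subrK.
Qed.

(** An LU decomposition built row by row that preserves the zeros prescribed by w; the pivots are
    the given nonzero entries R i i. *)
Lemma lu_rows (R : X) : (forall i m, (w m < w i)%N -> R i m = 0) -> (forall i, R i i != 0) ->
  forall k, (k <= N)%N -> exists P : X,
    (forall l : 'I_N, (l < k)%N -> [/\ P l l = 1, forall m : 'I_N, (m < l)%N -> P l m = 0 &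
     forall m, (w m < w l)%N -> P l m = 0]) /\
    (forall l : 'I_N, (l < k)%N -> exists c : 'I_N -> F, [/\ c l != 0,
     forall m : 'I_N, (l < m)%N -> c m = 0 & forall j, R l j = \sum_m c m * P m j]).
Proof.
move=> hR hd; elim=> [|k IH] kN; first by exists 0.
have [P [h1 h2]] := IH (ltnW kN); pose k' := Ordinal kN.
have [a [a1 a2 a3]] := @elim_row k P (fun m => R k' m) (w k') (ltnW kN) h1 (hR k').
have ak l m : (w m <= w k')%N -> a l * P l m = 0.
  move=> hm; have [lt|ge] := ltnP (w l) (w k'); first by rewrite a2 ?mul0r.
  have [lk|kl] := ltnP l k; last by rewrite a1 ?mul0r.
  have [_ _ h] := h1 l lk; rewrite h ?mulr0 //; apply: leq_ltn_trans hm _.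
  rewrite ltn_neqAle ge andbT val_eqE (inj_eq perm_inj) eq_sym -val_eqE /= ltn_eqF //.
pose q m := (R k' m - \sum_l a l * P l m) / R k' k'.
have qk : q k' = 1 by rewrite /q big1 ?subr0 ?divff // => l _; apply: ak.
pose P' : X := \matrix_(l, m) if l == k' then q m else P l m.
have Pk m : P' k' m = q m by rewrite mxE eqxx.
have Pl (l m : 'I_N) : (l < k)%N -> P' l m = P l m by move=> lk; rewrite mxE -val_eqE /= ltn_eqF.
have sumP (c : 'I_N -> F) m : c k' = 0 -> \sum_l c l * P' l m = \sum_l c l * P l m.
  by move=> c0; apply: eq_bigr => l _; rewrite mxE; case: eqP => // ->; rewrite c0 !mul0r.
exists P'; split=> l; rewrite ltnS leq_eqVlt => /predU1P[lk|lk].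
- have -> : l = k' by apply: ord_inj.
  split=> [|m mk|m mk]; rewrite Pk //; rewrite /q; first by rewrite -a3 // subrr mul0r.
  by rewrite hR // big1 ?subrr ?mul0r // => l' _; apply: ak; apply: ltnW.
- by have [p1 p2 p3] := h1 l lk; split=> [|m ml|m ml]; rewrite Pl //; [apply: p2 | apply: p3].
- have -> : l = k' by apply: ord_inj.
  exists (fun m => a m + R k' k' * (m == k')%:R).
  have ak0 : a k' = 0 by rewrite a1.
  split=> [|m km|j]; first by rewrite ak0 add0r eqxx mulr1.
    by rewrite a1 ?(ltnW km) // add0r -val_eqE /= gtn_eqF // mulr0.
  under eq_bigr => m _ do rewrite mulrDl.
  rewrite big_split /= sumP // sum_delta.
  by rewrite Pk /q mulrC divfK // addrC subrK.
have [c [c1 c2 c3]] := h2 l lk; exists c; split=> // j; rewrite sumP //; exact: c2.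
Qed.

(** Up to scaling of rows the slice is the whole cell. Functions of a fixed degree are homogeneous
    in each row ([row_homog]), so independence may be tested on the slice. *)
Lemma Dset_slice x : Dset 0 w x -> exists z c, x = \matrix_(i, j) (c i * slice z i j).
Proof.
move=> [L [U [lam [[La Lb] [Ua Ub] hl ->]]]].
pose R : X := \matrix_(i, m) U (w i) (w m).
have [|i|P [h1 h2]] := @lu_rows R _ _ N (leqnn N).
- by move=> i m wm; rewrite mxE Ua.
- by rewrite mxE.
have hc i : exists c : 'I_N -> F, [/\ c i != 0,
     forall m : 'I_N, (i < m)%N -> c m = 0 & forall j, R i j = \sum_m c m * P m j] by apply: h2.
pose M i := sval (boolp.cid (hc i)); have MP i := svalP (boolp.cid (hc i)).
pose Q i m := \sum_l L i l * M l m.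
have Qu (i m : 'I_N) : (i < m)%N -> Q i m = 0.
  move=> im; apply: big1 => l _; have [il|li] := ltnP i l; first by rewrite La ?mul0r.
  have [_ h _] := MP l; rewrite [M l m](h m) ?mulr0 //; exact: leq_ltn_trans li im.
have Qd i : Q i i != 0.
  rewrite /Q (bigD1 i) //= big1 ?addr0; first by have [h _ _] := MP i; rewrite mulf_neq0.
  move=> l li; have [il|] := ltnP i l; first by rewrite La ?mul0r.
  rewrite leq_eqVlt val_eqE (negbTE li) /= => h'; have [_ h _] := MP l.
  by rewrite [M l i](h i) ?mulr0.
pose y (p : 'I_N * 'I_N) := if (p.2 < p.1)%N then Q p.1 p.2 / Q p.1 p.1 else P p.1 p.2.
pose z (k : 'I_d) := y (var k).
have zy p : isvar p -> yv z p = y p.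
  move=> hp; have hp' : p \in [set p | isvar p] by rewrite inE.
  rewrite /yv (big_pred1 (enum_rank_in hp' p)) => [|k].
    by rewrite /z /var enum_rankK_in.
  by rewrite /= -(inj_eq enum_val_inj) enum_rankK_in.
exists z, (fun i => Q i i); apply/matrixP => i j; rewrite mxE ltn0 subn0.
have -> : inord i = i by apply: ord_inj; rewrite inordK.
rewrite [RHS]mxE [slice _ _ _]mxE mulr_sumr.
transitivity (\sum_m Q i m * P m ((w^-1)%g j)).
  rewrite mxE /Q; under [RHS]eq_bigr => m _ do rewrite mulr_suml.
  rewrite exchange_big; apply: eq_bigr => l _; rewrite mxE.
  have [_ _ h] := MP l; have := h ((w^-1)%g j); rewrite mxE permKV => ->.
  by rewrite mulr_sumr; apply: eq_bigr => m _; rewrite mulrA.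
apply: eq_bigr => m _; rewrite mulrA; congr (_ * _).
  rewrite /lm; have [->|mi] := eqVneq m i; first by rewrite mulr1.
  case: ltnP => h; last by rewrite mulr0 Qu // ltn_neqAle h andbT eq_sym.
  by rewrite zy /isvar /y /= h // mulrC divfK.
set j' := (w^-1)%g j; have [p1 p2 p3] := h1 m (ltn_ord m).
rewrite /um; have [->//|jm] := eqVneq j' m.
case: ltnP => h; last by rewrite p2 // ltn_neqAle h andbT.
have [v|nv] := boolP (isvar (m, j')); first by rewrite zy // /y /= ltnNge (ltnW h).
rewrite yv0 // p3 //; move: nv; rewrite /isvar /= h /= negb_or -leqNgt => /andP[_].
rewrite -leqNgt leq_eqVlt val_eqE (inj_eq perm_inj) (negbTE jm) //.
Qed.

End Slice.

Lemma nth_addseq a b k : size a = size b -> nth 0%N (addseq a b) k = (nth 0%N a k + nth 0%N b k)%N.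
Proof. by elim: a b k => [|x a IH] [|y b] [|k] //= [e]; apply: IH. Qed.

(** * Sumsets of lowest exponents *)

Section Superadditivity.
Variables (F : realFieldType) (n : nat) (w : 'S_n.+1) (K : nat) (rho : nat -> 'I_n.+1) (eps : nat -> F).
Notation N := n.+1.
Notation X := 'M[F]_N.
Notation d := #|[set p | isvar w p]|.
Notation V := (VV rho (Bl rho eps)).
Notation slice := (@slice F n w).
Implicit Types (T : 'I_N -> nat) (s : nat -> nat).

Lemma row_homog (e : 'I_N + nat -> nat) f : gr (Gen rho (Bl rho eps)) e f ->
  (forall k, (K <= k)%N -> e (inr k) = 0%N) -> forall (c : 'I_N -> F) (x : X),
  f (\matrix_(i, j) (c i * x i j)) =
  (\prod_r c r ^+ e (inl r)) * (\prod_(k < K) c (rho k) ^+ e (inr (nat_of_ord k))) * f x.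
Proof.
elim=> {e f} [|j g e f hg _ IH|e|c' e f g _ IHf _ IHg] he c x.
- by rewrite !big1 ?mulr1.
- have he' k : (K <= k)%N -> e (inr k) = 0%N by move=> /he; case: (e _).
  rewrite (IH he'); case: j hg he => [r|k] /= hg he.
    have [j ->] := hg; rewrite mxE.
    have -> : \prod_r0 c r0 ^+ (e (inl r0) + (inl r0 == inl r :> 'I_N + nat)) = c r * \prod_r0 c r0 ^+ e (inl r0).
      rewrite (bigD1 r) //= [in RHS](bigD1 r) //= eqxx addn1 exprS -mulrA; congr (_ * (_ * _)).
      by apply: eq_bigr => i ir; rewrite (inj_eq (@inl_inj _ _)) (negbTE ir) addn0.
    have -> : \prod_(k < K) c (rho k) ^+ (e (inr (nat_of_ord k)) + (inr (nat_of_ord k) == inl r :> 'I_N + nat)) = \prod_(k < K) c (rho k) ^+ e (inr (nat_of_ord k)).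
      by apply: eq_bigr => i _; rewrite addn0.
    by ring.
  have kK : (k < K)%N.
    by rewrite ltnNge; apply/negP => /he; rewrite eqxx; lia.
  have -> : \prod_r0 c r0 ^+ (e (inl r0) + (inl r0 == inr k :> 'I_N + nat)) = \prod_r0 c r0 ^+ e (inl r0).
    by apply: eq_bigr => i _; rewrite addn0.
  have -> : \prod_(l < K) c (rho l) ^+ (e (inr (nat_of_ord l)) + (inr (nat_of_ord l) == inr k :> 'I_N + nat)) = c (rho k) * \prod_(k < K) c (rho k) ^+ e (inr (nat_of_ord k)).
    rewrite (bigD1 (Ordinal kK)) //= [in RHS](bigD1 (Ordinal kK)) //= eqxx addn1 exprS -mulrA; congr (_ * (_ * _)).
    apply: eq_bigr => i; rewrite -val_eqE /= => /negbTE ik.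
    by rewrite (inj_eq (@inr_inj _ _)) ik addn0.
  have -> : g (\matrix_(i, j) (c i * x i j)) = c (rho k) * g x.
    case: hg => ->; first by rewrite mxE.
    by rewrite /Bl /ell mulr_sumr; apply: eq_bigr => i _; rewrite mxE mulrCA.
  by ring.
- by rewrite mulr0.
- by rewrite (IHf he) (IHg he); ring.
Qed.

Definition ppm (f : X -> F) (P : {mpoly F[d]}) := forall z, f (slice z) = P.@[z].

Lemma ppm_coord i m : ppm (fun x => x i (w m)) (Pm F w i m).
Proof. by move=> z; apply: slice_eval. Qed.

Lemma ppmM f g P Q : ppm f P -> ppm g Q -> ppm (fun x => f x * g x) (P * Q).
Proof. by move=> hf hg z; rewrite rmorphM /= hf hg. Qed.

Lemma ppm_lin c f g P Q : ppm f P -> ppm g Q -> ppm (fun x => c * f x + g x) (c *: P + Q).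
Proof. by move=> hf hg z; rewrite rmorphD /= mevalZ hf hg. Qed.

Lemma ppm_sum (I : Type) (r : seq I) (c : I -> F) f P : (forall i, ppm (f i) (P i)) ->
  ppm (fun x => \sum_(i <- r) c i * f i x) (\sum_(i <- r) c i *: P i).
Proof. by move=> h z; rewrite raddf_sum; apply: eq_bigr => i _; rewrite /= mevalZ h. Qed.

Lemma ppm_gr e f : gr (Gen rho (Bl rho eps)) e f -> exists P, ppm f P.
Proof.
have co r c : exists P, ppm (fun x => x r c) P.
  by exists (Pm F w r ((w^-1)%g c)) => z; rewrite -slice_eval permKV.
elim=> {e f} [|j g e f hg _ [P hP]|e|c e f g _ [P hP] _ [Q hQ]].
- by exists 1 => z; rewrite rmorph1.
- have [Q hQ] : exists Q, ppm g Q; last by exists (Q * P); apply: ppmM.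
  case: j hg => [r [c ->]|k [->|->]]; try exact: co.
  have h c : {P | ppm (fun x => x (rho k) c) P} by apply: boolp.cid; apply: co.
  exists (\sum_(c < N) eps k ^+ c *: sval (h c)).
  by apply: ppm_sum => c; case: (h c).
- by exists 0 => z; rewrite rmorph0.
- by exists (c *: P + Q); apply: ppm_lin.
Qed.

Definition has_low T s m := exists f P, [/\ V T s f, ppm f P & low P m].

(** Together with [rk_low] this translates ranks into numbers of distinct lowest exponents, to which
    the sumset inequality applies. *)
Lemma low_list T s a : (forall k, (K <= k)%N -> s k = 0%N) -> rk_ge (Dset 0 w) (V T s) a ->
  exists L, [/\ uniq L, size L = a & forall m, m \in L -> has_low T s m].
Proof.
move=> hs [fs [sf hf ind]].
have hP (i : 'I_a) : exists P, ppm (nth (fun=> 0) fs i) P.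
  by apply: ppm_gr (hf i _); rewrite sf.
pose P i := sval (boolp.cid (hP i)); have PP (i : 'I_a) : ppm (nth (fun=> 0) fs i) (P i) := svalP (boolp.cid (hP i)).
have [c hc i|L [uL sL hL]] := @low_span F d a P.
  pose c' k := if insub k is Some j then c j else 0.
  have := ind c' _ i; rewrite /c' valK sf; apply=> // x /Dset_slice[z [e ->]].
  have : \sum_(i < a) c i * nth (fun=> 0) fs i (slice z) = 0.
    have h := ppm_sum (index_enum _) c PP z; rewrite hc rmorph0 in h; exact: h.
  move=> h0; pose phi := (\prod_r e r ^+ T r) * (\prod_(k < K) e (rho k) ^+ s k).
  transitivity (phi * \sum_(i < a) c i * nth (fun=> 0) fs i (slice z)); last by rewrite h0 mulr0.
  rewrite mulr_sumr; move: (hf); rewrite sf => hf'; apply: eq_bigr => j _.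
  by rewrite valK (row_homog (hf' j (ltn_ord j))) // mulrCA.
exists L; split=> // m /hL[c hc].
exists (fun x => \sum_(i < a) c i * nth (fun=> 0) fs i x), (\sum_i c i *: P i); split=> //.
  by apply: gr_sum => i _; apply: grZ; apply: hf; rewrite sf.
exact: ppm_sum.
Qed.

Lemma rk_low T s L : uniq L -> (forall m, m \in L -> has_low T s m) ->
  rk_ge (Dset 0 w) (V T s) (size L).
Proof.
move=> uL hL; have h (i : 'I_(size L)) : exists fP : (X -> F) * {mpoly F[d]},
    [/\ V T s fP.1, ppm fP.1 fP.2 & low fP.2 (tnth (in_tuple L) i)].
  by have [|f [P h]] := hL (tnth (in_tuple L) i); [apply: mem_tnth | exists (f, P)].
pose g i := sval (boolp.cid (h i)); have gP i := svalP (boolp.cid (h i)).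
exists [seq (g i).1 | i <- enum 'I_(size L)].
have nt (i : 'I_(size L)) : nth (fun=> 0) [seq (g i).1 | i <- enum 'I_(size L)] i = (g i).1.
  by rewrite (nth_map i) ?size_enum_ord // nth_ord_enum.
split; first by rewrite size_map size_enum_ord.
  by move=> i; rewrite size_map size_enum_ord => iL; rewrite (nt (Ordinal iL)); have [] := gP (Ordinal iL).
move=> c hc i; rewrite size_map size_enum_ord => iL.
have := @low_indep F d _ (fun i => (g i).2) (tnth (in_tuple L)) (fun i => c i) _ _ _ (Ordinal iL); apply.
- by apply/tuple_uniqP.
- by move=> j; have [] := gP j.
apply/eqP; apply: contraT => /mpoly_nonroot[z]; case/eqP.
have := hc (slice z) (slice_Dset z); rewrite size_map size_enum_ord => <-.
rewrite raddf_sum; apply: eq_bigr => j _ /=; rewrite mevalZ (nt j).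
by have [_ -> _] := gP j.
Qed.

Lemma has_lowM T s T' s' m m' : has_low T s m -> has_low T' s' m' ->
  has_low (addT T T') (fun k => s k + s' k)%N (m + m')%MM.
Proof.
move=> [f [P [h1 h2 h3]]] [f' [P' [h1' h2' h3']]].
exists (fun x => f x * f' x), (P * P'); split; [|exact: ppmM|exact: lowM].
by apply: gr_ext (grM h1 h1') _ _ => // -[r|k].
Qed.

Definition onehot (r : 'I_N) : 'I_N -> nat := fun i => (i == r).

Lemma has_low_coord r (m : 'I_N) mm : low (Pm F w r m) mm -> has_low (onehot r) (fun=> 0%N) mm.
Proof.
move=> h; exists (fun x => x r (w m)), (Pm F w r m); split=> //; last exact: ppm_coord.
have hg : Gen rho (Bl rho eps) (inl r) (fun x => x r (w m)) by exists (w m).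
by apply: gr_ext (gr_gen hg) _ _ => // -[r'|k].
Qed.

Lemma has_low_sum (I : Type) (r : seq I) (T : I -> 'I_N -> nat) (m : I -> 'X_{1..d}) :
  (forall i, has_low (T i) (fun=> 0%N) (m i)) ->
  has_low (fun a => \sum_(i <- r) T i a)%N (fun=> 0%N) (\sum_(i <- r) m i)%MM.
Proof.
move=> h; elim: r => [|i r IH].
  exists (fun=> 1), 1; split.
  - by apply: gr_ext (gr1 _) _ _ => // -[a|k] //=; rewrite big_nil.
  - by move=> z; rewrite rmorph1.
  - rewrite big_nil; split; first by rewrite mcoeff1 eqxx oner_eq0.
    by move=> m'; rewrite ltNge le0x.
rewrite big_cons; have := has_lowM (h i) IH; congr (has_low _ _ _).
by apply: boolp.funext => a; rewrite /addT big_cons.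
Qed.

Lemma coeff_quadratic (p q : 'I_N * 'I_N) m : (mdeg m < 2)%N -> (Yv F w p * Yv F w q)@_m = 0.
Proof.
move=> hm; rewrite /Yv mulr_suml raddf_sum big1 // => k _; rewrite mulr_sumr raddf_sum big1 // => l _.
rewrite /= -mpolyXD mcoeffX; case: eqP => // e; move: hm; rewrite -e mdegD !mdeg1 //.
Qed.

Lemma low_diag i : low (Pm F w i i) 0%MM.
Proof.
split; last by move=> m'; rewrite ltNge le0x.
rewrite /Pm eqxx mcoeffD mcoeff1 eqxx raddf_sum big1 ?addr0 ?oner_neq0 // => l _.
by apply: coeff_quadratic; rewrite mdeg0.
Qed.

Lemma low_var k : low (Pm F w (var k).1 (var k).2) U_(k)%MM.
Proof.
have hv : isvar w (var k) by have := enum_valP k; rewrite inE.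
have ne : (var k).2 != (var k).1.
  by apply: contraTneq hv; rewrite /isvar => ->; rewrite !ltnn.
have Ye : Yv F w (var k) = 'X_k.
  rewrite /Yv (big_pred1 k) // => l /=; exact: (inj_eq enum_val_inj).
have co m : (mdeg m < 2)%N -> (Pm F w (var k).1 (var k).2)@_m = ('X_k : {mpoly F[d]})@_m.
  move=> hm; rewrite /Pm (negbTE ne) -surjective_pairing Ye mcoeffD raddf_sum.
  by rewrite [X in _ + X]big1 ?addr0 // => l _; apply: coeff_quadratic.
split; first by rewrite co ?mdeg1 // mcoeffX eqxx oner_neq0.
move=> m' lt; rewrite co; last by apply: leq_ltn_trans (lemc_mdeg (ltW lt)) _; rewrite mdeg1.
by rewrite mcoeffX; case: eqP => // e; move: lt; rewrite e ltxx.
Qed.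

(** Row i has n - code(w, i) free entries. Each contributes its variable ([low_var]) or the constant
    1 of a diagonal entry ([low_diag]), and code(w, i) further diagonal entries fill the degree up
    to n. *)
Lemma has_low_bits (x : 'I_d -> bool) : has_low (fun=> n) (fun=> 0%N) [multinom nat_of_bool (x k) | k < d].
Proof.
have h1 k : has_low (onehot (var k).1) (fun=> 0%N) (if x k then U_(k)%MM else 0%MM).
  by case: (x k); apply: has_low_coord; [apply: low_var | apply: low_diag].
have h2 : forall i : 'I_N, has_low (fun a => \sum_(l <- iota 0 (code w i)) onehot i a)%N (fun=> 0%N) (\sum_(l <- iota 0 (code w i)) 0)%MM.
  by move=> i; apply: has_low_sum => l; apply/has_low_coord/low_diag.
have := has_lowM (has_low_sum (index_enum _) h1) (has_low_sum (index_enum _) h2).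
congr (has_low _ _ _).
  apply: boolp.funext => a; rewrite /addT -[RHS](isvar_row w a); congr (_ + _)%N.
    transitivity (\sum_(p in [set p | isvar w p]) onehot p.1 a)%N.
      by rewrite [RHS]big_enum_val.
    transitivity (\sum_(p : 'I_N * 'I_N) (fun i j => isvar w (i, j) * onehot i a) p.1 p.2)%N.
      rewrite big_mkcond; apply: eq_bigr => -[i j] _; rewrite inE /=.
      by case: (isvar _ _); rewrite ?mul1n.
    rewrite -(pair_bigA _ (fun i j => isvar w (i, j) * onehot i a)%N) /=.
    rewrite (bigD1 a) //= [X in (_ + X)%N]big1 ?addn0.
      by apply: eq_bigr => j _; rewrite /onehot eqxx muln1.
    by move=> i ia; rewrite big1 // => j _; rewrite /onehot eq_sym (negbTE ia) muln0.
  rewrite (bigD1 a) //= [X in (_ + X)%N]big1 ?addn0.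
    by rewrite big_const_seq count_predT iter_addn /onehot eqxx mul1n addn0 size_iota.
  by move=> i ia; rewrite big1 // => j _; rewrite /onehot eq_sym (negbTE ia).
apply/mnmP => k; rewrite mnmDE !mnm_sumE mnmE [X in (_ + X)%N]big1 ?addn0; last first.
  by move=> i _; rewrite mnm_sumE big1 // => l _; rewrite mnm0E.
rewrite (bigD1 k) //= big1 ?addn0; first by case: (x k); rewrite ?mnm0E ?mnm1E ?eqxx.
by move=> l lk; case: (x l); rewrite ?mnm0E // mnm1E (negbTE lk).
Qed.

(** The extra degree n in every row is the price of the cube in [discrete_brunn_minkowski]. *)
Theorem slice_brunn_minkowski T s T' s' a b :
  (forall k, (K <= k)%N -> s k = 0%N) -> (forall k, (K <= k)%N -> s' k = 0%N) ->
  rk_ge (Dset 0 w) (V T s) a -> rk_ge (Dset 0 w) (V T' s') b ->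
  exists2 c, rk_ge (Dset 0 w) (V (fun r => T r + T' r + n)%N (fun k => s k + s' k)%N) c &
    (4 ^ codim w * (a * b) <= c ^ 2)%N.
Proof.
move=> hs hs' /(low_list hs)[A [uA sA hA]] /(low_list hs')[B [uB sB hB]].
pose tl (m : 'X_{1..d}) := [seq m k | k <- enum 'I_d].
have stl m : size (tl m) = d by rewrite size_map size_enum_ord.
have ntl m (k : 'I_d) : nth 0%N (tl m) k = m k.
  by rewrite /tl (nth_map k) ?size_enum_ord //; congr (m _); exact: nth_ord_enum.
have tlinj : injective tl.
  move=> m m' e; apply/mnmP => k; have := congr1 (nth 0%N ^~ k) e.
  by rewrite !ntl.
pose bits (x : {ffun 'I_d -> bool}) : 'X_{1..d} := [multinom nat_of_bool (x k) | k < d].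
pose C := undup [seq (p.1 + bits p.2)%MM | p <- [seq (q, x) | q <- [seq (m + m')%MM | m <- A, m' <- B], x <- enum {ffun 'I_d -> bool}]].
exists (size C).
  apply: rk_low; first exact: undup_uniq.
  move=> m; rewrite mem_undup => /mapP[[_ x] /allpairsP[[q x'] /= [/allpairsP[[m1 m2] /= [h1 h2 ->]] _ [-> ->]] ->]].
  have := has_lowM (has_lowM (hA _ h1) (hB _ h2)) (has_low_bits x').
  congr (has_low _ _ _); apply: boolp.funext => k; by rewrite addn0.
rewrite -card_isvar -sA -sB -(size_map tl A) -(size_map tl B) -(size_map tl C).
apply: discrete_brunn_minkowski; rewrite ?map_inj_uniq ?undup_uniq //.
- by move=> _ /mapP[m _ ->].
- by move=> _ /mapP[m _ ->].
move=> _ _ x /mapP[m1 h1 ->] /mapP[m2 h2 ->] sx.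
pose x' : {ffun 'I_d -> bool} := [ffun k : 'I_d => nth false x k].
have -> : addseq (addseq (tl m1) (tl m2)) (map nat_of_bool x) = tl (m1 + m2 + bits x')%MM.
  have s1 : size (addseq (tl m1) (tl m2)) = d by rewrite size_addseq !stl.
  have sz : size (addseq (addseq (tl m1) (tl m2)) (map nat_of_bool x)) = d.
    by rewrite size_addseq size_map ?s1 sx.
  apply: (@eq_from_nth _ 0%N) => [|k]; rewrite sz ?stl // => kd.
  rewrite !nth_addseq ?s1 ?stl ?size_map ?sx //.
  by rewrite /= (nth_map false) ?sx // -[k]/(nat_of_ord (Ordinal kd)) !ntl !mnmDE mnmE ffunE.
apply/mapP; exists (m1 + m2 + bits x')%MM => //; rewrite mem_undup.
apply/mapP; exists ((m1 + m2)%MM, x') => //; apply/allpairsP; exists ((m1 + m2)%MM, x'); split=> //.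
  by apply/allpairsP; exists (m1, m2).
by rewrite mem_enum.
Qed.

End Superadditivity.

(** * Leading coefficients *)

Section LeadingCoefficients.
Variable R : realType.
Implicit Types (p q : {poly R}) (c : R).

(** The coefficient c may be zero: products and sums are formed without discussing cancellation of
    leading terms. *)
Definition lc p k c := (size p <= k.+1)%N /\ p`_k = c.

Lemma lcM p q k l c c' : lc p k c -> lc q l c' -> lc (p * q) (k + l) (c * c').
Proof.
move=> [sp pk] [sq ql]; split.
  by apply: leq_trans (size_polyMleq _ _) _; rewrite -subn1 leq_subLR; apply: leq_trans (leq_add sp sq) _; rewrite addnS addSn.
have kl : (k < (k + l).+1)%N by rewrite ltnS leq_addr.
rewrite coefM (bigD1 (Ordinal kl)) //= addKn pk ql big1 ?addr0 // => i ik.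
have [ik'|ki] := ltnP i k; first by rewrite [q`_ _]nth_default ?mulr0 //; apply: leq_trans sq _; lia.
rewrite [p`_ _]nth_default ?mul0r //; apply: leq_trans sp _.
by rewrite ltn_neqAle ki andbT eq_sym; move: ik; rewrite -val_eqE.
Qed.

Lemma lcD p q k c c' : lc p k c -> lc q k c' -> lc (p + q) k (c + c').
Proof.
by move=> [sp pk] [sq qk]; split; [rewrite (leq_trans (size_polyD _ _)) ?geq_max ?sp | rewrite coefD pk qk].
Qed.

Lemma lc0 k : lc 0 k 0.
Proof. by split; rewrite ?size_poly0 ?coef0. Qed.

Lemma lcC c : lc c%:P 0 c.
Proof. by split; rewrite ?size_polyC_leq1 ?coefC. Qed.

Lemma lcX : lc 'X 1 1.
Proof. by split; rewrite ?size_polyX ?coefX. Qed.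

Lemma lcZ a p k c : lc p k c -> lc (a *: p) k (a * c).
Proof. by move=> h; rewrite -mul_polyC; have := lcM (lcC a) h. Qed.

Lemma lcN p k c : lc p k c -> lc (- p) k (- c).
Proof. by move=> h; rewrite -[- p]scaleN1r -[- c]mulN1r; apply: lcZ. Qed.

Lemma lcS p k c : lc p k c -> lc p k.+1 0.
Proof. by move=> [sp _]; split; [apply: leq_trans sp _ | apply: nth_default]. Qed.

Lemma lcXn k : lc 'X^k k 1.
Proof. by split; rewrite ?size_polyXn ?coefXn ?eqxx. Qed.

Lemma lc_prod (I : Type) (r : seq I) (P : I -> {poly R}) (k : I -> nat) (c : I -> R) : (forall i, lc (P i) (k i) (c i)) ->
  lc (\prod_(i <- r) P i) (\sum_(i <- r) k i) (\prod_(i <- r) c i).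
Proof.
move=> h; elim: r => [|i r IH]; first by rewrite !big_nil; exact: lcC.
by rewrite !big_cons; apply: lcM.
Qed.

Lemma lc_sum (I : eqType) (r : seq I) (P : I -> {poly R}) k (c : I -> R) : (forall i, i \in r -> lc (P i) k (c i)) ->
  lc (\sum_(i <- r) P i) k (\sum_(i <- r) c i).
Proof.
elim: r => [|i r IH] h; first by rewrite !big_nil; exact: lc0.
rewrite !big_cons; apply: lcD; first by apply: h; rewrite mem_head.
by apply: IH => j hj; apply: h; rewrite inE hj orbT.
Qed.

Lemma lc_ge0 p k c : lc p k c -> (forall x : nat, (0 < x)%N -> 0 <= p.[x%:R]) -> 0 <= c.
Proof.
move=> [sp pk] h; rewrite leNgt; apply/negP => c0.
have szp : size p = k.+1.
  apply/eqP; rewrite eqn_leq sp ltnNge; apply/negP => /(nth_default 0); rewrite pk => e.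
  by rewrite e ltxx in c0.
have [|b hb] := @poly_pinfty_gt_lc R (- p).
  by rewrite lead_coefN lead_coefE szp /= pk oppr_gt0.
pose x := (Num.bound `|b|).+1.
have bx : b <= x%:R.
  apply: le_trans (ler_norm _) _; apply/ltW/(lt_le_trans (archi_boundP (normr_ge0 b))).
  by rewrite ler_nat.
have := hb _ bx; rewrite hornerN lead_coefN lead_coefE szp /= pk.
have := h x isT; lra.
Qed.

End LeadingCoefficients.

(** * Polynomials that interpolate the counts *)

Section LimitPolynomials.
Variable R : realType.

Definition binp (t m : nat) : {poly R} :=
  (m`!%:R)^-1 *: \prod_(i < m) (t%:R *: 'X - i%:R%:P).

Fixpoint bbp (s t a m : nat) : {poly R} :=
  match a, m with
  | 0, _ => binp t m
  | _, 0 => 1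
  | a'.+1, m'.+1 => bbp s t a' m'.+1 + (s%:R *: 'X) * bbp s t a' m'
  end.

(* The coefficient of z^m in exp(t z) (1 + s z)^a; hh is its leading coefficient
   as a polynomial in s. *)
Fixpoint gg (s t a m : nat) : R :=
  match a, m with
  | 0, _ => t%:R ^+ m / m`!%:R
  | _, 0 => 1
  | a'.+1, m'.+1 => gg s t a' m'.+1 + s%:R * gg s t a' m'
  end.

Fixpoint ggp (s t a m : nat) : {poly R} :=
  match a, m with
  | 0, _ => (t%:R ^+ m / m`!%:R)%:P
  | _, 0 => 1
  | a'.+1, m'.+1 => ggp s t a' m'.+1 + (s%:R *: 'X) * ggp s t a' m'
  end.

Definition hh (t a m : nat) : R := if (a <= m)%N then t%:R ^+ (m - a) / (m - a)`!%:R else 0.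

Lemma binp_lc t m : lc (binp t m) m (t%:R ^+ m / m`!%:R).
Proof.
rewrite mulrC; apply: lcZ.
have := @lc_prod R _ (index_enum 'I_m) (fun i => t%:R *: 'X - i%:R%:P) (fun=> 1%N) (fun=> t%:R) _.
rewrite sum_nat_const card_ord muln1 prodr_const card_ord; apply=> i.
rewrite -[t%:R in X in lc _ _ X]addr0; apply: lcD; first by rewrite -[t%:R in X in lc _ _ X]mulr1; apply/lcZ/lcX.
by rewrite -oppr0; apply/lcN/(@lcS R _ 0)/lcC.
Qed.

Lemma binp_eval t m x : (binp t m).[x%:R] = 'C(t * x, m)%:R.
Proof.
rewrite /binp hornerZ horner_prod.
have e : \prod_(i < m) (t%:R *: 'X - i%:R%:P).[x%:R] = ((t * x) ^_ m)%:R :> R.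
  elim: m => [|m IH]; first by rewrite big_ord0.
  rewrite big_ord_recr /= IH !hornerE ffactnSr natrM -natrM; have [h|h] := leqP m (t * x).
    by rewrite natrB.
  by rewrite ffact_small ?mul0r.
by rewrite e -bin_ffact natrM mulrCA mulVf ?mulr1 // pnatr_eq0 -lt0n fact_gt0.
Qed.

Lemma bbp_lc s t a m : lc (bbp s t a m) m (gg s t a m).
Proof.
elim: a m => [|a IH] [|m] /=; try exact: binp_lc; first exact: lcC.
apply: lcD => //; have := lcM (lcZ s%:R (lcX R)) (IH m); by rewrite mulr1.
Qed.

Lemma bbp_eval s t a m x : (bbp s t a m).[x%:R] = (bb (s * x) (t * x) a m)%:R.
Proof.
elim: a m => [|a IH] [|m] /=; try exact: binp_eval; first by rewrite hornerC.
by rewrite !hornerE !IH natrD !natrM.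
Qed.

Lemma ggp_lc s t a m : lc (ggp s t a m) a (s%:R ^+ a * hh t a m).
Proof.
elim: a m => [|a IH] [|m] /=; rewrite ?mul1r /hh ?subn0 ?expr0 ?mul1r; try exact: lcC.
  by rewrite ltn0 mulr0 -polyC1; split; rewrite ?size_polyC ?oner_eq0 // coefC.
rewrite -[s%:R ^+ _ * _]add0r; apply: lcD; first exact: lcS (IH _).
by have := lcM (lcZ s%:R (lcX R)) (IH m); rewrite mulr1 add1n mulrA -exprS /hh ltnS subSS.
Qed.

Lemma ggp_eval s t a m x : (ggp s t a m).[x%:R] = gg (s * x) t a m.
Proof.
elim: a m => [|a IH] [|m] /=; rewrite ?hornerC //.
by rewrite !hornerE !IH natrM.
Qed.

End LimitPolynomials.

(** * Passage to the leading coefficients *)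

Section Asymptotics.
Variables (R : realType) (n : nat) (w : 'S_n.+1).
Hypothesis wmax : w ord_max = ord_max.
Notation N := n.+1.
Notation d := (codim w).

Section Fixed.
Variables (K : nat) (rho : nat -> 'I_N).
Hypothesis rho_sorted : forall k l, (k <= l)%N -> (l < K)%N -> (rho l <= rho k)%N.
Notation al := (alpha K rho).
Hypothesis al_le : forall r, (al r <= n)%N.

Definition scal (x : nat) (t : 'I_N -> nat) : 'I_N -> nat := fun r => (t r * x)%N.

(** The products have row degrees t x + t' x + 2 alpha + n, a bounded amount above what belongs to
    the count for t + t'. Both this and the error of the upper bound go into C x^d, one order below
    x times the counts. *)
Lemma kappa_ineq (s : nat) (t t' : 'I_N -> nat) : exists C : R, forall x, (0 < x)%N ->
  4 ^+ d * (x%:R * Hw R (s * x) 0 w (scal x t) al) * (x%:R * Hw R (s * x) 0 w (scal x t') al) <=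
  (x%:R * Hw R (2 * s * x) 0 w (scal x (addT t t')) al + C * x%:R ^+ d) ^+ 2.
Proof.
pose a := (\max_r t r + \max_r t' r + 2 * n + 2 * s)%N.
have ta r : (t r + t' r + 2 * n <= a)%N.
  rewrite /a; apply: leq_trans (leq_addr _ _); rewrite leq_add2r.
  by apply: leq_add; [apply: (leq_bigmax r) | apply: (leq_bigmax r)].
have [C1 [b [C10 ub]]] := has_ub_max R wmax a.
have [C2 C20 gr] := @Hw_growth R n w al a (n + n).
exists (C1 + C2) => x x0.
pose b' := (maxn b a * x)%N.
have [eps [dist hg]] := @good_pencils R n (s * x) (2 * s * x) K rho b' rho_sorted.
have bnd (u : 'I_N -> nat) : (forall r, (u r <= a)%N) -> forall r, (scal x u r <= b')%N.
  by move=> hu r; rewrite leq_mul2r (leq_trans (hu r)) ?leq_maxr ?orbT.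
have tb r : (t r <= a)%N by apply: leq_trans (ta r); rewrite -addnA leq_addr.
have tb' r : (t' r <= a)%N by apply: leq_trans (ta r); rewrite -addnA addnCA leq_addr.
have [[r1 h1 l1] _] := hg 0%N w _ (leq0n _) (bnd t tb).
have [[r2 h2 l2] _] := hg 0%N w _ (leq0n _) (bnd t' tb').
have sK k : (K <= k)%N -> sS (s * x) K k = 0%N by rewrite /sS leqNgt => /negbTE ->.
have [c hc ineq] := slice_brunn_minkowski sK sK h1 h2.
pose T r := (scal x t r + scal x t' r + al r + n)%N.
have hS : (2 * s * x <= a * x)%N by rewrite leq_mul2r leq_addl orbT.
have hT r : (T r <= a * x)%N.
  apply: leq_trans (leq_mul (ta r) (leqnn x)).
  have := al_le r; have := leq_pmulr (n + n) x0; rewrite /T /scal; nia.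
have c1 : rkR (Dset 0 w) (VV rho (Bl rho eps) (addT T al) (sS (2 * s * x) K)) c%:R.
  exists c => //; apply: rk_ge_mono hc => // f hf; apply: VV_ext hf _ _ _ => // [r|k].
    by rewrite /T /addT; lia.
  by rewrite /sS; case: ifP => _; lia.
have u1 := ub x (2 * s * x)%N K rho eps T c%:R x0 hS dist al_le
  (fun v U hU => (hg 0%N v U (leq0n _) (fun r => leq_trans (hU r) (leq_mul (leq_maxl _ _) (leqnn _)))).2) hT c1.
have u2 := gr x (2 * s * x)%N (scal x (addT t t')) T x0.
have {}u2 : x%:R * Hw R (2 * s * x) 0 w T al <= x%:R * Hw R (2 * s * x) 0 w (scal x (addT t t')) al + C2 * x%:R ^+ d.
  apply: u2 => // r; rewrite /scal /addT.
  - by rewrite leq_mul2r; apply/orP; right; apply: leq_trans (ta r); rewrite leq_addr.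
  - by rewrite /T /scal mulnDl; lia.
  - by rewrite /T /scal mulnDl; have := al_le r; lia.
have cc : 0 <= x%:R * c%:R :> R by rewrite mulr_ge0 ?ler0n.
apply: le_trans (_ : (x%:R * c%:R) ^+ 2 <= _); last first.
  by rewrite ler_sqr ?nnegrE //; [move: u1 u2; lra | move: u1 u2 cc; lra].
have x1 : (0 : R) <= x%:R by apply: ler0n.
apply: le_trans (_ : 4 ^+ d * (x%:R * r1%:R) * (x%:R * r2%:R) <= _).
  have H0 S U : 0 <= Hw R S 0 w U al by apply: Hw_ge0.
  have f0 : (0 : R) <= 4 ^+ d by rewrite exprn_ge0.
  by rewrite ler_pM ?mulr_ge0 ?ler_wpM2l ?mulr_ge0.
have := ineq; rewrite -(ler_nat R) !natrM !natrX => h.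
rewrite (_ : _ * _ * _ = x%:R ^+ 2 * (4 ^+ d * (r1%:R * r2%:R))); last by ring.
by rewrite exprMn ler_wpM2l ?exprn_ge0.
Qed.

Definition Gs s (t : 'I_N -> nat) : R := lf (fun m => \prod_r gg R s (t r) (al r) (n - m r)) (Sch R w).
Definition Phi (t : 'I_N -> nat) : R := lf (fun m => \prod_r hh R (t r) (al r) (n - m r)) (Sch R w).

Lemma Hw_poly s t : exists2 p : {poly R}, lc p d (Gs s t) &
  forall x, p.[x%:R] = Hw R (s * x) 0 w (scal x t) al.
Proof.
exists (\sum_(m <- msupp (Sch R w)) (Sch R w)@_m *: \prod_r bbp R s (t r) (al r) (n - m r)).
  apply: lc_sum => m hm; apply: lcZ; rewrite -(sum_codim hm).
  by apply: lc_prod => r; apply: bbp_lc.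
move=> x; rewrite horner_sum; apply: eq_bigr => m _; rewrite hornerZ horner_prod wt0E natr_prod.
by congr (_ * _); apply: eq_bigr => r _; rewrite bbp_eval.
Qed.

Lemma Gs_poly c t : exists2 p : {poly R}, lc p K (c%:R ^+ K * Phi t) &
  forall x, p.[x%:R] = Gs (c * x) t.
Proof.
have sK : (\sum_r al r = K)%N.
  rewrite /alpha exchange_big /= (eq_bigr (fun=> 1%N)) => [|k _]; first by rewrite sum_nat_const card_ord muln1.
  by rewrite (bigD1 (rho k)) //= eqxx big1 // => r; rewrite eq_sym => /negbTE ->.
exists (\sum_(m <- msupp (Sch R w)) (Sch R w)@_m *: \prod_r ggp R c (t r) (al r) (n - m r)).
  rewrite /Phi /lf mulr_sumr; apply: lc_sum => m hm; rewrite mulrCA; apply: lcZ.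
  have := @lc_prod R _ (index_enum 'I_N) _ _ _ (fun r => ggp_lc R c (t r) (al r) (n - m r)).
  by rewrite big_split prodrXr /= sK.
move=> x; rewrite horner_sum; apply: eq_bigr => m _; rewrite hornerZ horner_prod.
by congr (_ * _); apply: eq_bigr => r _; rewrite ggp_eval.
Qed.

Lemma Gs_ineq s t t' : 4 ^+ d * Gs s t * Gs s t' <= Gs (2 * s) (addT t t') ^+ 2.
Proof.
have [C hC] := kappa_ineq s t t'.
have [p lp ep] := Hw_poly s t; have [p' lp' ep'] := Hw_poly s t'.
have [q lq eq] := Hw_poly (2 * s) (addT t t').
rewrite -subr_ge0.
have lXp : lc ('X * p) d.+1 (Gs s t) by have := lcM (lcX R) lp; rewrite mul1r add1n.
have lXp' : lc ('X * p') d.+1 (Gs s t') by have := lcM (lcX R) lp'; rewrite mul1r add1n.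
have lXq : lc ('X * q + C *: 'X^d) d.+1 (Gs (2 * s) (addT t t')).
  rewrite -[Gs _ _]addr0; apply: lcD; first by have := lcM (lcX R) lq; rewrite mul1r add1n.
  by apply: lcS; apply: lcZ; apply: lcXn.
have L := lcD (lcM lXq lXq) (lcN (lcM (lcZ (4 ^+ d) lXp) lXp')).
rewrite expr2; apply: lc_ge0 L _ => x x0.
rewrite hornerD hornerN subr_ge0 !hornerM hornerZ hornerD !hornerM hornerZ hornerXn hornerX ep ep' eq -expr2.
exact: hC.
Qed.

(** Leading coefficients in s: each of the K pencils brings one factor of its degree, hence 2 ^ K
    for degree 2 s. *)
Theorem Phi_ineq t t' : 4 ^+ d * Phi t * Phi t' <= (2 ^+ K * Phi (addT t t')) ^+ 2.
Proof.
have [p lp ep] := Gs_poly 1 t; have [p' lp' ep'] := Gs_poly 1 t'.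
have [q lq eq] := Gs_poly 2 (addT t t').
move: lp lp'; rewrite expr1n !mul1r => lp lp'.
have L := lcD (lcM lq lq) (lcN (lcM (lcZ (4 ^+ d) lp) lp')).
rewrite -subr_ge0 expr2; apply: lc_ge0 L _ => x x0.
rewrite hornerD hornerN subr_ge0 !hornerM hornerZ ep ep' eq -expr2 mul1n.
exact: Gs_ineq.
Qed.

End Fixed.
End Asymptotics.

(** * Exchange in supports *)

Section Exchange.
Variables (n : nat) (J : 'rV[int]_n -> Prop) (D : int).
Notation e := (@unit_vec n).
Implicit Types (a b c : 'rV[int]_n) (i j p q : 'I_n).

Hypothesis Jsum : forall a, J a -> \sum_k a 0 k = D.
Hypothesis local_exchange : forall a p i q j, p != q -> p != j -> i != q -> i != j ->
  J (a + e p + e i) -> J (a + e q + e j) ->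
  (J (a + e p + e q) /\ J (a + e i + e j)) \/ (J (a + e p + e j) /\ J (a + e i + e q)).

Definition dist a b : int := \sum_k Num.max (a 0 k - b 0 k) 0.

Hypothesis mixing : forall a b, J a -> J b -> 1 < dist a b ->
  exists c p q, [/\ J c, forall k, Num.min (a 0 k) (b 0 k) <= c 0 k,
    b 0 p < a 0 p /\ b 0 p < c 0 p & a 0 q < b 0 q /\ a 0 q < c 0 q].

Lemma dist_lt a b a' b' p :
  (forall k, Num.max (a' 0 k - b' 0 k) 0 <= Num.max (a 0 k - b 0 k) 0) ->
  Num.max (a' 0 p - b' 0 p) 0 < Num.max (a 0 p - b 0 p) 0 -> dist a' b' < dist a b.
Proof.
move=> h hp; rewrite /dist (bigD1 p) //= [ltRHS](bigD1 p) //= ltr_leD //.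
by apply: ler_sum => k _.
Qed.

Lemma dist_sym a b : J a -> J b -> dist a b = dist b a.
Proof.
move=> /Jsum ha /Jsum hb; apply/eqP; rewrite -subr_eq0 /dist -sumrB.
rewrite (eq_bigr (fun k => a 0 k - b 0 k)) => [|k _]; last by lia.
by rewrite sumrB ha hb subrr.
Qed.

Lemma shiftE a i j k : (a - e i + e j) 0 k = a 0 k - (k == i)%:R + (k == j)%:R.
Proof. by rewrite !mxE /=. Qed.

Definition exch a b i := exists j, [/\ a 0 j < b 0 j, J (a - e i + e j) & J (b - e j + e i)].

Lemma dist1 a b i : J a -> J b -> b 0 i < a 0 i -> dist a b <= 1 -> exch a b i.
Proof.
move=> ja jb ai d1; have [j aj] : exists j, a 0 j < b 0 j.
  apply: boolp.contrapT => no; have : 0 < \sum_k (a 0 k - b 0 k).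
    rewrite (bigD1 i) //= ltr_wpDr ?subr_gt0 //; apply: sumr_ge0 => k _.
    by rewrite subr_ge0 leNgt; apply/negP => h; apply: no; exists k.
  by rewrite sumrB (Jsum ja) (Jsum jb) subrr ltxx.
have ij : i != j by apply: contraTneq ai => ->; rewrite -leNgt ltW.
have d1' : dist b a <= 1 by rewrite dist_sym.
have one (x y : 'rV[int]_n) (l k : 'I_n) : y 0 l < x 0 l -> dist x y <= 1 -> Num.max (x 0 k - y 0 k) 0 = (k == l)%:R.
  move=> hl; rewrite /dist (bigD1 l) //= => h.
  have s0 : 0 <= \sum_(m | m != l) Num.max (x 0 m - y 0 m) 0.
    by apply: sumr_ge0 => m _; rewrite le_max lexx orbT.
  have [->|kl] := eqVneq k l.
    by move: h s0; set s := \sum_(m | _) _; rewrite /=; lia.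
  move: h s0; rewrite (bigD1 k) //=; set s := \sum_(m | _) _.
  have s1 : 0 <= s by apply: sumr_ge0 => m _; rewrite le_max lexx orbT.
  by lia.
have ba : b = a - e i + e j.
  apply/rowP => k; rewrite shiftE.
  by have := one a b i k ai d1; have := one b a j k aj d1'; case: (k == i); case: (k == j) => /=; lia.
exists j; split=> //; rewrite -?ba //.
by rewrite ba addrK subrK.
Qed.

(** Induction on the distance, supposing that no j works for i. A move b - e_y + e_x in J that
    leaves i a surplus yields by [stepB] some j with U j, together with W y and the move for j in
    place of y; a second application gives W j, a contradiction ([noB]). The mirror image is [noA].
    The point c of [mixing] is nearer to b than a is, and induction on it produces such a move. *)
Lemma exchange_dist (N : nat) a b i : dist a b <= N%:Z -> J a -> J b -> b 0 i < a 0 i -> exch a b i.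
Proof.
elim: N a b i => [|N IH] a b i dN ja jb ai; first by apply: dist1 => //; lia.
have [d1|d2] := leP (dist a b) 1; first exact: dist1.
have [c [p [q [jc cmin [p1 p2] [q1 q2]]]]] := mixing ja jb d2.
apply: boolp.contrapT => nex.
(* The two halves of an exchange for i; by assumption they never hold for the same j. *)
pose U j := a 0 j < b 0 j /\ J (a - e i + e j).
pose W j := a 0 j < b 0 j /\ J (b - e j + e i).
have UW j : U j -> W j -> False by move=> [h h1] [_ h2]; apply: nex; exists j.
have ne x y : b 0 x < a 0 x -> a 0 y < b 0 y -> x != y.
  by move=> h1 h2; apply: contraTneq h1 => ->; rewrite -leNgt ltW.
have stepB x y : b 0 x < a 0 x -> a 0 y < b 0 y -> J (b - e y + e x) -> b 0 i + (i == x)%:R < a 0 i ->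
    exists2 j, U j & W y /\ J (b - e j + e x).
  move=> hx hy jb' hi; have xy := ne _ _ hx hy.
  have [||j [h1 h2 h3]] := IH a (b - e y + e x) i _ ja jb'.
  - have : dist a (b - e y + e x) < dist a b; last by lia.
    apply: (@dist_lt _ _ _ _ x) => [k|]; rewrite shiftE ?eqxx ?(negbTE xy) /=; last by lia.
    have [ky|_] := eqVneq k y; last by case: (k == x) => /=; lia.
    by rewrite ky [y == x]eq_sym (negbTE xy) /=; lia.
  - by rewrite shiftE; have := ne _ _ ai hy; case: (i =P y) => //= _ _; lia.
  have jx : j != x.
    by apply: contraTneq h1 => ->; rewrite shiftE eqxx (negbTE xy) /=; lia.
  have hj : a 0 j < b 0 j by move: h1; rewrite shiftE (negbTE jx); case: (j == y) => /=; lia.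
  exists j; first by [].
  have ix := ne _ _ ai hj; have ie := ne _ _ ai hy; have xj := ne _ _ hx hj.
  have [||[k1 k2]|[k1 k2]] := @local_exchange (b - e y - e j) x i y j xy xj ie ix.
  - by move: h3; congr (J _); apply/rowP => k; rewrite !mxE; ring.
  - by move: jb; congr (J _); apply/rowP => k; rewrite !mxE; ring.
  - split; first by split=> //; move: k2; congr (J _); apply/rowP => k; rewrite !mxE; ring.
    by move: k1; congr (J _); apply/rowP => k; rewrite !mxE; ring.
  case: (UW j); first by split.
  by split=> //; move: k2; congr (J _); apply/rowP => k; rewrite !mxE; ring.
have noB x y : b 0 x < a 0 x -> a 0 y < b 0 y -> J (b - e y + e x) -> ~ (b 0 i + (i == x)%:R < a 0 i).
  move=> hx hy jb' hi; have [j uj [_ jj]] := stepB x y hx hy jb' hi.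
  by have [j' uj' [wj _]] := stepB x j hx uj.1 jj hi; apply: (UW j).
have stepA x y : b 0 x < a 0 x -> a 0 y < b 0 y -> J (a - e x + e y) -> b 0 i + (i == x)%:R < a 0 i ->
    exists2 j, W j & U y /\ J (a - e x + e j).
  move=> hx hy ja' hi; have xy := ne _ _ hx hy.
  have [||j [h1 h2 h3]] := IH (a - e x + e y) b i _ ja' jb.
  - have : dist (a - e x + e y) b < dist a b; last by lia.
    apply: (@dist_lt _ _ _ _ x) => [k|]; rewrite shiftE ?eqxx ?(negbTE xy) /=; last by lia.
    have [ky|_] := eqVneq k y; last by case: (k == x) => /=; lia.
    by rewrite ky [y == x]eq_sym (negbTE xy) /=; lia.
  - by rewrite shiftE; have := ne _ _ ai hy; case: (i =P y) => //= _ _; lia.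
  have jx : j != x.
    by apply: contraTneq h1 => ->; rewrite shiftE eqxx (negbTE xy) /=; lia.
  have hj : a 0 j < b 0 j by move: h1; rewrite shiftE (negbTE jx); case: (j == y) => /=; lia.
  exists j; first by [].
  have ix := ne _ _ ai hj; have ie := ne _ _ ai hy; have xj := ne _ _ hx hj.
  have [||[k1 k2]|[k1 k2]] := @local_exchange (a - e x - e i) x i y j xy xj ie ix.
  - by move: ja; congr (J _); apply/rowP => k; rewrite !mxE; ring.
  - by move: h2; congr (J _); apply/rowP => k; rewrite !mxE; ring.
  - split; first by split=> //; move: k1; congr (J _); apply/rowP => k; rewrite !mxE; ring.
    by move: k2; congr (J _); apply/rowP => k; rewrite !mxE; ring.
  case: (UW j); last by [].
  by split=> //; move: k1; congr (J _); apply/rowP => k; rewrite !mxE; ring.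
have noA x y : b 0 x < a 0 x -> a 0 y < b 0 y -> J (a - e x + e y) -> ~ (b 0 i + (i == x)%:R < a 0 i).
  move=> hx hy ja' hi; have [j wj [_ jj]] := stepA x y hx hy ja' hi.
  by have [j' wj' [uj _]] := stepA x j hx wj.1 jj hi; apply: (UW j).
have [y hy jb'] : exists2 y, a 0 y < b 0 y & J (b - e y + e p).
  have [|y [y1 y2 y3]] := IH c b p _ jc jb p2.
    rewrite (dist_sym jc jb); have : dist b c < dist b a; last by rewrite (dist_sym jb ja); lia.
    by apply: (@dist_lt _ _ _ _ q) => [k|]; [have := cmin k | have := cmin q]; lia.
  by exists y => //; have := cmin y; lia.
(* The only escape from [noB] is p = i with surplus exactly 1. As the distance exceeds 1, another
   coordinate p' then has a surplus, and a move there contradicts [noA]. *)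
have pi : p = i /\ a 0 i = b 0 i + 1.
  have := noB p y p1 hy jb'; have [->|ip] := eqVneq i p; rewrite /= ?addr0.
    by split=> //; move: p1; lia.
  by move=> /(_ ai).
case: pi => pi ai1; rewrite pi in jb' p1 p2.
have [p' p'i hp'] : exists2 p', p' != i & b 0 p' < a 0 p'.
  apply: boolp.contrapT => no; move: d2; rewrite ltNge => /negP; apply.
  rewrite /dist (bigD1 i) //= big1 ?addr0; first by rewrite ai1; lia.
  move=> k ki; have : ~ b 0 k < a 0 k by move=> h; apply: no; exists k.
  by lia.
have iy := ne _ _ ai hy; have py := ne _ _ hp' hy.
have [||j [j1 j2 j3]] := IH a (b - e y + e i) p' _ ja jb'.
- have : dist a (b - e y + e i) < dist a b; last by lia.
  apply: (@dist_lt _ _ _ _ i) => [k|]; rewrite shiftE ?eqxx ?(negbTE iy) /=; last by lia.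
  have [ky|_] := eqVneq k y; last by case: (k == i) => /=; lia.
  by rewrite ky [y == i]eq_sym (negbTE iy) /=; lia.
- by rewrite shiftE (negbTE p'i) (negbTE py) /=; lia.
have ji : j != i by apply: contraTneq j1 => ->; rewrite shiftE eqxx (negbTE iy) /=; lia.
have hj : a 0 j < b 0 j by move: j1; rewrite shiftE (negbTE ji); case: (j == y) => /=; lia.
by apply: (noA p' j hp' hj j2); rewrite eq_sym (negbTE p'i) /= addr0.
Qed.

Lemma exchange_Mconvex : M_convex J.
Proof.
move=> i a b ja jb ai; apply: (@exchange_dist `|dist a b|%N) => //.
by rewrite abszE ler_norm.
Qed.

End Exchange.

(** * Derivatives of the dual Schubert polynomial *)

(** Realizes prescribed numbers of pencils per row, listed from the bottom row upwards as
    [good_pencils] requires. *)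
Lemma alpha_exists n (al : 'I_n.+1 -> nat) : exists K (rho : nat -> 'I_n.+1),
  [/\ forall k l, (k <= l)%N -> (l < K)%N -> (rho l <= rho k)%N,
      forall r, alpha K rho r = al r & K = (\sum_r al r)%N].
Proof.
pose L := flatten [seq nseq (al r) r | r <- rev (enum 'I_n.+1)].
exists (size L), (nth ord0 L); split.
- have : sorted (fun r s : 'I_n.+1 => s <= r)%N L.
    have : sorted (fun r s : 'I_n.+1 => s <= r)%N (rev (enum 'I_n.+1)).
      rewrite rev_sorted; have := iota_sorted 0 n.+1; rewrite -val_enum_ord sorted_map.
      by apply: sub_sorted => r s /=.
    rewrite /L; elim: (rev _) => //= r s IH hs.
    have hs' := path_sorted hs; have {}IH := IH hs'.
    have /allP ge : all (fun x : 'I_n.+1 => x <= r)%N s.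
      by apply: (order_path_min _ hs) => x y z /= h1 h2; apply: leq_trans h2 h1.
    elim: (al r) => //= m IHm; case: m IHm => [|m] /=; last by move=> ->; rewrite leqnn.
    move=> _; set F := flatten _ in IH *; case eF : F IH => [//|y F'] /= ->; rewrite andbT.
    have : y \in F by rewrite eF mem_head.
    by case/flattenP => _ /mapP[z hz ->]; rewrite mem_nseq => /andP[_ /eqP ->]; apply: ge.
  move=> sL k l kl lK; have tr : transitive (fun r s : 'I_n.+1 => s <= r)%N.
    by move=> x y z /= h1 h2; apply: leq_trans h2 h1.
  have [->|kl'] := eqVneq k l; first exact: leqnn.
  apply: (sorted_ltn_nth tr ord0 sL) => //; rewrite ?inE //; first exact: leq_ltn_trans kl lK.
  by rewrite ltn_neqAle kl'.
- move=> r; rewrite /alpha -(big_mkord xpredT (fun k => nat_of_bool (nth ord0 L k == r))).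
  rewrite -(big_nth ord0 xpredT (fun x => nat_of_bool (x == r))) /L big_flatten /= big_map.
  rewrite (perm_big (enum 'I_n.+1)) ?perm_rev // big_enum /= (bigD1 r) //= big_nseq eqxx.
  rewrite big1 ?addn0 => [|s /negbTE sr]; last by rewrite big_nseq sr; elim: (al s) => //= m ->.
  by elim: (al r) => //= m ->.
rewrite /L size_flatten /shape -map_comp sumnE big_map (perm_big (enum 'I_n.+1)) ?perm_rev // big_enum.
by apply: eq_bigr => r _; rewrite /= size_nseq.
Qed.

Section Derivatives.
Variables (R : realType) (n : nat).
Implicit Types (g : {mpoly R[n]}) (t : 'I_n -> nat) (c : 'X_{1..n}).

(* The value at t of the derivative of order c of the normalization of g. *)
Definition dval g c t : R := lf (fun m => \prod_k hh R (t k) (c k) (m k)) g.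

Definition superadditive g := forall c e t t',
  (forall m, m \in msupp g -> mdeg m = e + mdeg c)%N ->
  4 ^+ e * dval g c t * dval g c t' <= dval g c (fun k => t k + t' k)%N ^+ 2.

Variable w : 'S_n.

Lemma reversalE : reversal n.-1 (Sch R w) =
  \sum_(m <- msupp (Sch R w)) (Sch R w)@_m *: 'X_[[multinom (n.-1 - m i)%N | i < n]].
Proof. by []. Qed.

Lemma dval_reversal c t : dval (reversal n.-1 (Sch R w)) c t =
  lf (fun m => \prod_k hh R (t k) (c k) (n.-1 - m k)%N) (Sch R w).
Proof.
rewrite /dval reversalE lf_sum; apply: eq_bigr => m _; rewrite lfZ lfX; congr (_ * _).
by apply: eq_bigr => k _; rewrite mnmE.
Qed.

Lemma lf_mwiden (phi : 'X_{1..n.+1} -> R) (p : {mpoly R[n]}) :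
  lf phi (mwiden p) = lf (fun m => phi (mnmwiden m)) p.
Proof.
rewrite {1}[p]mpolyE raddf_sum lf_sum; apply: eq_bigr => m _.
by rewrite /= mwidenZ lfZ mwidenX lfX.
Qed.

Lemma reversal_supp m : m \in msupp (reversal n.-1 (Sch R w)) ->
  exists2 m', m' \in msupp (Sch R w) & m = [multinom (n.-1 - m' i)%N | i < n].
Proof.
rewrite reversalE => /msupp_sum_le /flatten_mapP[m' hm'].
rewrite filter_predT in hm' *; move=> /msuppZ_le; rewrite msuppX inE => /eqP ->.
by exists m'.
Qed.

Lemma Sch_exponent' m k : m \in msupp (Sch R w) -> (m k <= n.-1)%N.
Proof. by move=> /Sch_exponent/(_ k); lia. Qed.

Lemma rev_supp m : m \in msupp (Sch R w) ->
  [multinom (n.-1 - m i)%N | i < n] \in msupp (reversal n.-1 (Sch R w)).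
Proof.
move=> hm; rewrite mcoeff_msupp reversalE raddf_sum (bigD1_seq m) ?msupp_uniq //=.
rewrite mcoeffZ mcoeffX eqxx mulr1 big1_seq ?addr0 -?mcoeff_msupp // => m' /andP[mm hm'].
rewrite mcoeffZ mcoeffX; case: eqP => [/mnmP e|]; rewrite ?mulr0 //.
case/eqP: mm; apply/mnmP => k; have := e k; rewrite !mnmE.
by have := Sch_exponent' k hm; have := Sch_exponent' k hm'; lia.
Qed.

Lemma reversal_superadditive : superadditive (reversal n.-1 (Sch R w)).
Proof.
move=> c e t t' hdeg.
have [/existsP[k ck]|small] := boolP [exists k, (n <= c k)%N].
  have z u : dval (reversal n.-1 (Sch R w)) c u = 0.
    rewrite dval_reversal /lf big1_seq // => m _; rewrite (bigD1 k) //= /hh leqNgt.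
    by rewrite (_ : (_ < _)%N = true) ?mul0r ?mulr0 //; have := ltn_ord k; lia.
  by rewrite !z mulr0 expr0n.
have {}small k : (c k < n)%N.
  by rewrite ltnNge; apply: contra small => h; apply/existsP; exists k.
have [s0|[m0 hm0]] : msupp (Sch R w) = [::] \/ exists m, m \in msupp (Sch R w).
  by case: (msupp (Sch R w)) => [|m l]; [left | right; exists m; rewrite mem_head].
  have z u : dval (reversal n.-1 (Sch R w)) c u = 0 by rewrite dval_reversal /lf s0 big_nil.
  by rewrite !z mulr0 expr0n.
(* One pencil beyond c k compensates n - m k = (n.-1 - m k) + 1. In the added row the exponent is
   constantly n, and n pencils reduce its factor to 1. *)
pose al (r : 'I_n.+1) : nat := if unlift ord_max r is Some k then (c k).+1 else n.
have [K [rho [srt alE KE]]] := alpha_exists al.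
have al_le r : (alpha K rho r <= n)%N by rewrite alE /al; case: unliftP.
pose ext (u : 'I_n -> nat) (r : 'I_n.+1) : nat := if unlift ord_max r is Some k then u k else 0%N.
have wl (k : 'I_n) : lift ord_max k = widen_ord (leqnSn n) k.
  by apply: ord_inj; rewrite lift_max_nat.
have widE (m : 'X_{1..n}) k : mnmwiden m (lift ord_max k) = m k by rewrite wl mnmwiden_widen.
have widM (m : 'X_{1..n}) : mnmwiden m ord_max = 0%N by rewrite mnmwiden_ordmax.
have lastE (T : Type) (idx : T) (op : Monoid.com_law idx) (f : 'I_n.+1 -> T) :
    \big[op/idx]_r f r = op (\big[op/idx]_k f (lift ord_max k)) (f ord_max).
  rewrite big_ord_recr /=; congr (op _ _); apply: eq_bigr => k _; congr f; exact/esym/wl.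
have PE u : Phi R (stab w) K rho (ext u) = dval (reversal n.-1 (Sch R w)) c u.
  rewrite /Phi Sch_stab lf_mwiden dval_reversal; apply: lf_ext => m hm.
  rewrite lastE /= /ext unlift_none widM alE /al unlift_none subn0 /hh leqnn subnn expr0 fact0 divr1 mulr1.
  apply: eq_bigr => k _; rewrite alE /al !liftK widE.
  have -> : (n - m k = (n.-1 - m k).+1)%N by have := Sch_exponent' k hm; have := ltn_ord k; lia.
  by rewrite ltnS subSS.
have extD : addT (ext t) (ext t') = ext (fun k => t k + t' k)%N.
  by apply: boolp.funext => r; rewrite /addT /ext; case: unliftP.
have := Phi_ineq R (stab_max w) srt al_le (ext t) (ext t'); rewrite extD !PE => h.
have KE' : K = (mdeg c + n + n)%N.
  rewrite KE lastE /= /al unlift_none mdegE; congr (_ + _)%N.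
  under eq_bigr => k _ do rewrite liftK -addn1.
  by rewrite big_split /= sum_nat_const card_ord muln1.
have dE : codim (stab w) = (e + K)%N.
  have hm1 : mnmwiden m0 \in msupp (Sch R (stab w)).
    by rewrite Sch_stab mcoeff_msupp mwiden_mnmwiden -mcoeff_msupp.
  rewrite -(sum_codim hm1) lastE /= widM subn0 KE' addnA; congr (_ + _)%N.
  have := hdeg _ (rev_supp hm0); rewrite addnA => <-; rewrite mdegE.
  transitivity (\sum_(k < n) ((n.-1 - m0 k) + 1))%N.
    by apply: eq_bigr => k _; rewrite widE; have := Sch_exponent' k hm0; have := ltn_ord k; lia.
  rewrite big_split /= sum_nat_const card_ord muln1; congr (_ + _)%N.
  by apply: eq_bigr => k _; rewrite mnmE.
move: h; rewrite dE exprD exprMn -exprM mulnC exprM (_ : 2 ^+ 2 = 4 :> R); last by rewrite -natrX.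
rewrite [4 ^+ e * _]mulrC -!mulrA ler_pM2l //; apply: exprn_gt0; lra.
Qed.

End Derivatives.

(** * Quadratic forms *)

Section Form.
Variables (R : realType) (n : nat) (M : 'M[R]_n).
Implicit Types (x y z : 'rV[R]_n).

Definition bf x y : R := (x *m M *m y^T) 0 0.

Lemma bfDl x y z : bf (x + y) z = bf x z + bf y z.
Proof. by rewrite /bf !mulmxDl mxE. Qed.

Lemma bfDr x y z : bf z (x + y) = bf z x + bf z y.
Proof. by rewrite /bf linearD mulmxDr mxE. Qed.

Lemma bfZl a x y : bf (a *: x) y = a * bf x y.
Proof. by rewrite /bf -!scalemxAl mxE. Qed.

Lemma bfZr a x y : bf x (a *: y) = a * bf x y.
Proof. by rewrite /bf linearZ -!scalemxAr mxE. Qed.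

Lemma bfE x y : bf x y = \sum_i \sum_j x 0 i * M i j * y 0 j.
Proof.
rewrite /bf mxE exchange_big; apply: eq_bigr => j _; rewrite !mxE mulr_suml.
by apply: eq_bigr => i _.
Qed.

Lemma bf_delta i j : bf (delta_mx 0 i) (delta_mx 0 j) = M i j.
Proof. by rewrite /bf -rowE trmx_delta -colE !mxE. Qed.

Hypothesis Msym : forall i j, M i j = M j i.
Hypothesis M0 : forall i j, 0 <= M i j.

Lemma bf_sym x y : bf x y = bf y x.
Proof.
rewrite !bfE exchange_big; apply: eq_bigr => i _; apply: eq_bigr => j _.
by rewrite Msym; ring.
Qed.

Definition nn x := forall k, 0 <= x 0 k.

Lemma bf_ge0 x y : nn x -> nn y -> 0 <= bf x y.
Proof. by move=> hx hy; rewrite bfE; do 2!(apply: sumr_ge0 => ? _); rewrite !mulr_ge0. Qed.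

Lemma bf_mono x y x' y' : nn x -> nn y -> (forall k, x 0 k <= x' 0 k) -> (forall k, y 0 k <= y' 0 k) ->
  bf x y <= bf x' y'.
Proof.
move=> hx hy hxx hyy; rewrite !bfE; apply: ler_sum => i _; apply: ler_sum => j _.
by apply: ler_pM => //; [rewrite mulr_ge0 | rewrite ler_wpM2r].
Qed.

Definition nrow (t : 'I_n -> nat) : 'rV[R]_n := \row_k (t k)%:R.

Hypothesis Mnat : forall t t', 16 * bf (nrow t) (nrow t) * bf (nrow t') (nrow t') <=
  bf (nrow t + nrow t') (nrow t + nrow t') ^+ 2.

(** The vectors kp x and kp y are rounded down, with kp so large that each positive entry becomes at
    least j; rounding then costs a factor of at least 1 - 1/j. The result is a polynomial inequality
    of degree 4 in j, whose limit [lc_ge0] extracts. *)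
Lemma bf_real x y : nn x -> nn y -> 16 * bf x x * bf y y <= bf (x + y) (x + y) ^+ 2.
Proof.
move=> hx hy; set c1 := bf (x + y) _; set c2 := 16 * _ * _.
rewrite -subr_ge0.
have lcj : lc ('X - 1%:P : {poly R}) 1 1.
  by have := lcD (lcX R) (lcN (lcS (lcC (1 : R)))); rewrite oppr0 addr0.
have L : lc ((c1 ^+ 2) *: 'X^4 - c2 *: ('X - 1%:P) ^+ 4) 4 (c1 ^+ 2 - c2).
  rewrite -[c1 ^+ 2 in X in lc _ _ X]mulr1 -[c2 in X in lc _ _ X]mulr1.
  apply: lcD (lcZ _ (lcXn R 4)) (lcN (lcZ _ _)).
  by have := lcM lcj (lcM lcj (lcM lcj lcj)); rewrite !mul1r.
apply: lc_ge0 L _ => j j0; rewrite hornerD hornerN !hornerZ hornerXn horner_exp hornerXsubC subr_ge0.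
(* Division by a zero entry gives 0, so only positive entries constrain kp. *)
pose s := \sum_k (j%:R / x 0 k) + \sum_k (j%:R / y 0 k).
have s1 : 0 <= \sum_k (j%:R / x 0 k) by apply: sumr_ge0 => k _; rewrite divr_ge0.
have s2 : 0 <= \sum_k (j%:R / y 0 k) by apply: sumr_ge0 => k _; rewrite divr_ge0.
have s0 : 0 <= s by rewrite addr_ge0.
pose kp : R := (Num.bound s)%:R.
have kps : s <= kp by apply/ltW/archi_boundP.
have kp0 : 0 < kp by apply: le_lt_trans s0 (archi_boundP s0).
have fl z : nn z -> \sum_k (j%:R / z 0 k) <= kp -> exists t, [/\ forall k, (nrow t) 0 k <= kp * z 0 k
    & forall k, (j%:R - 1) * kp * z 0 k <= j%:R * (nrow t) 0 k].
  move=> hz hs; exists (fun k => Num.truncn (kp * z 0 k)).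
  have tr k := truncn_itv (mulr_ge0 (ltW kp0) (hz k)).
  split=> k; rewrite mxE; first by case/andP: (tr k).
  have [->|zk] := eqVneq (z 0 k) 0; first by rewrite !mulr0 mulr_ge0.
  have zk0 : 0 < z 0 k by rewrite lt_neqAle eq_sym zk hz.
  have h : j%:R <= kp * z 0 k.
    rewrite -ler_pdivrMr //; apply: le_trans hs; rewrite (bigD1 k) //= lerDl.
    by apply: sumr_ge0 => l _; rewrite divr_ge0.
  case/andP: (tr k) => _; rewrite -natr1 => h'.
  have j1 : (0 : R) <= j%:R by [].
  have := ler_wpM2l j1 (ltW h'); nra.
have [t [t1 t2]] := fl x hx (le_trans (ler_wpDr s2 (lexx _)) kps).
have [t' [t1' t2']] := fl y hy (le_trans (ler_wpDl s1 (lexx _)) kps).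
have nnn u : nn (nrow u) by move=> k; rewrite mxE.
have nj : 0 <= j%:R - 1 :> R by rewrite subr_ge0 ler1n.
have lowb z u : nn z -> (forall k, (j%:R - 1) * kp * z 0 k <= j%:R * (nrow u) 0 k) ->
    ((j%:R - 1) * kp) ^+ 2 * bf z z <= j%:R ^+ 2 * bf (nrow u) (nrow u).
  move=> hz hu; rewrite !expr2 -!mulrA -[_ * bf (nrow u) _]bfZr -bfZl -[kp * (_ * _)]mulrCA.
  have -> : (j%:R - 1) * ((j%:R - 1) * (kp * (kp * bf z z))) = bf (((j%:R - 1) * kp) *: z) (((j%:R - 1) * kp) *: z).
    by rewrite bfZl bfZr; ring.
  by apply: bf_mono => k; rewrite !mxE ?mulr_ge0 ?(ltW kp0) //; have := hu k; rewrite mxE.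
have nnt : nn (nrow t + nrow t') by move=> k; rewrite mxE addr_ge0 ?nnn.
have nxy : nn (x + y) by move=> k; rewrite mxE addr_ge0 ?hx ?hy.
have upb : bf (nrow t + nrow t') (nrow t + nrow t') <= kp ^+ 2 * c1.
  rewrite /c1 expr2 -mulrA -bfZr -bfZl.
  have tt k : (nrow t + nrow t') 0 k <= (kp *: (x + y)) 0 k.
    have -> : (nrow t + nrow t') 0 k = nrow t 0 k + nrow t' 0 k by rewrite [LHS]mxE.
    have -> : (kp *: (x + y)) 0 k = kp * x 0 k + kp * y 0 k by rewrite [LHS]mxE mxE mulrDr.
    by apply: lerD.
  exact: bf_mono.
have L1 := lowb x t hx t2; have L2 := lowb y t' hy t2'.
have B0 z : nn z -> 0 <= bf z z by move=> hz; apply: bf_ge0.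
have Mt := Mnat t t'.
have kp4 : 0 < kp ^+ 4 by rewrite exprn_gt0.
rewrite -(ler_pM2l kp4).
have j4 : 0 <= j%:R ^+ 4 :> R by rewrite exprn_ge0.
apply: le_trans (_ : j%:R ^+ 4 * (16 * bf (nrow t) (nrow t) * bf (nrow t') (nrow t')) <= _).
  have := ler_pM (mulr_ge0 (sqr_ge0 _) (B0 _ hx)) (mulr_ge0 (sqr_ge0 _) (B0 _ hy)) L1 L2.
  rewrite /c2 !exprMn; set A := bf x x; set A' := bf y y; set B := bf (nrow t) _; set B' := bf (nrow t') _.
  move=> h; rewrite (_ : kp ^+ 4 * _ = 16 * ((j%:R - 1) ^+ 2 * kp ^+ 2 * A * ((j%:R - 1) ^+ 2 * kp ^+ 2 * A'))); last by ring.
  rewrite (_ : j%:R ^+ 4 * _ = 16 * (j%:R ^+ 2 * B * (j%:R ^+ 2 * B'))); last by ring.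
  by rewrite ler_pM2l.
apply: le_trans (ler_wpM2l j4 Mt) _.
rewrite [leRHS](_ : _ = j%:R ^+ 4 * (kp ^+ 2 * c1) ^+ 2); last by ring.
rewrite ler_wpM2l // ler_sqr ?nnegrE //; last by rewrite mulr_ge0 ?sqr_ge0 //; apply: B0.
exact: B0.
Qed.

(** Rescaling x and y to the same value P^2 of the form, P = s s', turns superadditivity into 4 P^2
    <= 2 P (P + B), that is P <= B. *)
Lemma reverse_CS x y : nn x -> nn y -> bf x x * bf y y <= bf x y ^+ 2.
Proof.
move=> hx hy; set A := bf x x; set A' := bf y y; set B := bf x y.
have A0 : 0 <= A by apply: bf_ge0.
have A0' : 0 <= A' by apply: bf_ge0.
have B0 : 0 <= B by apply: bf_ge0.
pose s := Num.sqrt A; pose s' := Num.sqrt A'.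
have s0 : 0 <= s by apply: sqrtr_ge0.
have s0' : 0 <= s' by apply: sqrtr_ge0.
have es : s ^+ 2 = A by rewrite sqr_sqrtr.
have es' : s' ^+ 2 = A' by rewrite sqr_sqrtr.
have [h|h] := leP (s * s') B.
  by rewrite -es -es' -exprMn ler_sqr ?nnegrE // mulr_ge0.
have := @bf_real (s' *: x) (s *: y) _ _.
rewrite !bfDl !bfDr !bfZl !bfZr [bf y x]bf_sym -/A -/A' -/B => /(_ _ _) h1.
have {}h1 := h1 (fun k => ltac:(by rewrite mxE mulr_ge0)) (fun k => ltac:(by rewrite mxE mulr_ge0)).
move: h1; rewrite -es -es'; set P := s * s' in h *.
rewrite (_ : 16 * _ * _ = (4 * (P * P)) ^+ 2); last by rewrite /P; ring.
rewrite (_ : _ + _ + (_ + _) = 2 * (P * (P + B))); last by rewrite /P; ring.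
have P0 : 0 < P by apply: le_lt_trans h.
rewrite ler_sqr ?nnegrE ?mulr_ge0 ?addr_ge0 ?(ltW P0) //.
by move: h P0; nra.
Qed.

(** Replacing x by x + c y changes both sides by the same amount, and for large c the new vector is
    nonnegative. *)
Lemma reverse_CS_all y : nn y -> (forall k, 0 < y 0 k) -> forall x, bf x x * bf y y <= bf x y ^+ 2.
Proof.
move=> hy hy' x; pose c := \sum_k (`|x 0 k| / y 0 k).
have h k : 0 <= (x + c *: y) 0 k.
  rewrite !mxE; have : `|x 0 k| / y 0 k <= c.
    rewrite /c (bigD1 k) //= lerDl; apply: sumr_ge0 => l _; apply: divr_ge0 => //; exact: normr_ge0.
  rewrite ler_pdivrMr // => h; have := ler_norm (- x 0 k); rewrite normrN; lra.
have := @reverse_CS (x + c *: y) y h hy.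
rewrite !bfDl !bfDr !bfZl !bfZr [bf y x]bf_sym; nra.
Qed.

(** Were M p l positive, s e_p + e_l and e_q + e_i would violate [reverse_CS] for large s: the
    product of their squares is at least 4 s (M p l) (M q i), while their mixed value c is
    independent of s. *)
Lemma isolated p q i : M p q = 0 -> M p i = 0 -> 0 < M q i -> forall l, M p l = 0.
Proof.
move=> pq pi qi l; apply/eqP; apply: contraT => pl.
have pl0 : 0 < M p l by rewrite lt_neqAle eq_sym pl M0.
pose c := M l q + M l i; have c0 : 0 <= c by rewrite addr_ge0.
pose s := c ^+ 2 / (M p l * M q i) + 1.
have s0 : 0 < s by rewrite ltr_pwDr // divr_ge0 ?sqr_ge0 ?mulr_ge0.
pose x : 'rV[R]_n := s *: delta_mx 0 p + delta_mx 0 l.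
pose y : 'rV[R]_n := delta_mx 0 q + delta_mx 0 i.
have nx : nn x by move=> k; rewrite !mxE addr_ge0 ?mulr_ge0 ?ler0n ?(ltW s0).
have ny : nn y by move=> k; rewrite !mxE addr_ge0 ?ler0n.
have := reverse_CS nx ny.
rewrite /x /y !bfDl !bfDr !bfZl !bfZr !bf_delta pq pi !mulr0 !addr0 add0r [M l p]Msym [M i q]Msym -/c.
have e : s * (M p l * M q i) = c ^+ 2 + M p l * M q i.
  by rewrite /s mulrDl mul1r divfK // mulf_neq0 ?gt_eqF.
have := mulr_gt0 pl0 qi.
have := M0 p p; have := M0 l l; have := M0 q q; have := M0 i i.
set a := M p p; set b := M l l; set u := M q q; set v := M i i; set P := M p l in e *; set Q := M q i in e *.
move=> v0 u0 b0 a0 PQ0.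
have X1 : 2 * s * P <= s * (s * a) + s * P + (s * P + b).
  have : 0 <= s * (s * a) by rewrite !mulr_ge0 ?(ltW s0).
  by lra.
have X2 : 2 * Q <= u + Q + (Q + v) by lra.
have := ler_pM _ _ X1 X2 => /(_ _ _) h.
have {}h := h ltac:(by rewrite !mulr_ge0 ?(ltW s0) ?M0) ltac:(by rewrite mulr_ge0 ?M0).
by move: e PQ0 h; rewrite /c; nra.
Qed.

(** If both alternatives fail, one of the four indices has zero entries against both members of the
    other linked pair, and [isolated] contradicts its own link. *)
Lemma local_exchange_mx p i q j : 0 < M p i -> 0 < M q j ->
  (0 < M p q /\ 0 < M i j) \/ (0 < M p j /\ 0 < M i q).
Proof.
move=> pi qj.
have pos a b : (0 < M a b) \/ M a b = 0.
  by have := M0 a b; rewrite le_eqVlt => /predU1P[<-|]; [right|left].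
have no a b c d : 0 < M a d -> 0 < M b c -> M a b = 0 -> M a c = 0 -> False.
  by move=> h1 h2 h3 h4; have := isolated h3 h4 h2 d => e; rewrite e ltxx in h1.
have ip : 0 < M i p by rewrite Msym.
have jq : 0 < M j q by rewrite Msym.
have [pq|pq] := pos p q; have [ij|ij] := pos i j; have [pj|pj] := pos p j; have [iq|iq] := pos i q; try by tauto.
all: exfalso; first [exact: no pi qj pq pj | exact: no ip qj iq ij |
  by apply: (no q p i j) => //; rewrite Msym | by apply: (no j p i q) => //; rewrite Msym].
Qed.

End Form.

From mathcomp Require Import complex.

(** * Positive eigenvalues of real symmetric matrices *)

Lemma linear_relation (K : fieldType) (u v : K) :
  exists a b, a * u + b * v = 0 /\ (a != 0) || (b != 0).
Proof.
have [u0|un] := eqVneq u 0.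
  by exists 1, 0; rewrite u0 mulr0 mul0r addr0 oner_neq0.
by exists v, (- u); rewrite mulNr [v * u]mulrC subrr oppr_eq0 un orbT.
Qed.

Lemma bilinear_expand (K : comPzRingType) n (A : 'M[K]_n) (u v : 'rV_n) (u' v' : 'cV_n) a b a' b' :
  ((a *: u + b *: v) *m A *m (a' *: u' + b' *: v')) 0 0 =
  a * a' * (u *m A *m u') 0 0 + a * b' * (u *m A *m v') 0 0 +
  b * a' * (v *m A *m u') 0 0 + b * b' * (v *m A *m v') 0 0.
Proof.
have entD (X Y : 'M[K]_1) : (X + Y) 0 0 = X 0 0 + Y 0 0 by rewrite mxE.
have entZ c (X : 'M[K]_1) : (c *: X) 0 0 = c * X 0 0 by rewrite mxE.
rewrite !mulmxDl !mulmxDr -!scalemxAl -!scalemxAr !entD !entZ !mulrA.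
by rewrite !addrA ![_ * a']mulrC ![_ * b']mulrC.
Qed.

Lemma bilinear_conj (K : comPzRingType) n (A : 'M[K]_n) (x y : 'rV_n) (c : K) : A^T = A -> c * c = -1 ->
  ((x + c *: y) *m A *m (x^T - c *: y^T)) 0 0 = (x *m A *m x^T) 0 0 + (y *m A *m y^T) 0 0.
Proof.
move=> hA cc; rewrite -{1}[x]scale1r -{1}[x^T]scale1r -scaleNr bilinear_expand.
have -> : (y *m A *m x^T) 0 0 = (x *m A *m y^T) 0 0.
  have -> : (y *m A *m x^T) 0 0 = ((y *m A *m x^T)^T) 0 0 by rewrite [RHS]mxE.
  by rewrite !trmx_mul trmxK hA mulmxA.
by rewrite !mul1r mulr1 mulrN cc opprK mul1r mulNr addrNK.
Qed.

Lemma linear_expand (K : comPzRingType) n (A : 'M[K]_n) (x y : 'rV_n) (c : K) (v : 'cV_n) :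
  ((x + c *: y) *m A *m v) 0 0 = (x *m A *m v) 0 0 + c * (y *m A *m v) 0 0.
Proof. by rewrite !mulmxDl -!scalemxAl mxE [X in _ + X = _]mxE. Qed.

(** Two eigenvectors with positive eigenvalues span a plane on which the hermitian form is positive,
    and the plane meets the hyperplane z A y = 0 nontrivially. *)
Lemma positive_orthogonal (K : numClosedFieldType) n (A P : 'M[K]_n) (D : 'rV_n) (y : 'cV_n) i j :
  P \is unitarymx -> A = invmx P *m diag_mx D *m P -> i != j -> 0 < D 0 i -> 0 < D 0 j ->
  exists z : 'rV_n, (z *m A *m y) 0 0 = 0 /\ 0 < (z *m A *m map_mx Num.conj z^T) 0 0.
Proof.
move=> Pu hA ij di dj.
have PP : P *m map_mx Num.conj P^T = 1%:M by apply/unitarymxP.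
have PAP : P *m A *m map_mx Num.conj P^T = diag_mx D.
  by rewrite {1}hA !mulmxA mulmxV ?unitarymx_unit // mul1mx -mulmxA PP mulmx1.
have [a [b [ab0 abn]]] := linear_relation ((row i P *m A *m y) 0 0) ((row j P *m A *m y) 0 0).
pose z := a *: row i P + b *: row j P.
have rP k l : (row k P *m A *m map_mx Num.conj (row l P)^T) 0 0 = (k == l)%:R * D 0 k.
  have := congr1 (fun X : 'M[K]_n => X k l) PAP; rewrite /diag_mx mxE [RHS]mxE mulr_natl => <-.
  by rewrite mxE; apply: eq_bigr => m _; rewrite -row_mul; congr (_ * _); [rewrite mxE | rewrite !mxE].
exists z; split.
  by rewrite /z !mulmxDl -!scalemxAl mxE [X in X + _ = _]mxE [X in _ + X = _]mxE.
have -> : map_mx Num.conj z^T = a^* *: map_mx Num.conj (row i P)^T + b^* *: map_mx Num.conj (row j P)^T.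
  by apply/matrixP => k l; rewrite !mxE rmorphD !rmorphM.
rewrite /z bilinear_expand !rP !eqxx (eq_sym j) (negbTE ij) !mul0r !mulr0 !mul1r !addr0 -!normCK.
have n1 (c : K) : 0 <= `|c| ^+ 2 by rewrite exprn_ge0.
have [a0|an] := eqVneq a 0.
  have bn : b != 0 by move: abn; rewrite a0 eqxx.
  by rewrite ltr_wpDl ?mulr_ge0 ?(ltW di) // mulr_gt0 ?exprn_gt0 ?normr_gt0.
by rewrite ltr_pwDl ?mulr_ge0 ?(ltW dj) // mulr_gt0 ?exprn_gt0 ?normr_gt0.
Qed.

Section Spectral.
Variables (R : realType) (n : nat) (M : 'M[R]_n).
Hypothesis Msym : M^T = M.
Notation C := (R[i]).
Notation rc := (real_complex R).
Notation A := (map_mx rc M : 'M[C]_n).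
Notation ctr X := (map_mx (@Num.conj C) X^T).

(** The diagonalization takes place over the complex numbers; the real eigenvalues alone are brought
    back, which suffices for the characteristic polynomial. *)
Lemma A_spectral : exists P (D : 'rV[R]_n), P \is unitarymx /\ A = invmx P *m diag_mx (map_mx rc D) *m P.
Proof.
have hA : A \is hermsymmx.
  apply: realsym_hermsym.
    by apply/is_hermitianmxP; rewrite expr0 scale1r map_mx_id //; apply/matrixP => i j; rewrite !mxE -{1}Msym mxE.
  by apply/mxOverP => i j; rewrite mxE; apply/complex_realP; exists (M i j).
exists (spectralmx A), (map_mx (@complex.Re R) (spectral_diag A)); split; first exact: spectral_unitarymx.
have e : map_mx rc (map_mx (@complex.Re R) (spectral_diag A)) = spectral_diag A.
  apply/matrixP => i j; rewrite !mxE; apply: RRe_real.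
  by have /mxOverP := hermitian_spectral_diag_real hA; apply.
by rewrite e; apply/orthomx_spectralP/hermitian_normalmx.
Qed.

Lemma char_poly_conj (P B : 'M[C]_n) : P \in unitmx -> char_poly (invmx P *m B *m P) = char_poly B.
Proof.
move=> Pu; rewrite /char_poly /char_poly_mx.
pose Q := map_mx (@polyC C) P; pose Qi := map_mx (@polyC C) (invmx P).
have QQ : Qi *m Q = 1%:M by rewrite -map_mxM mulVmx // map_mx1.
have -> : 'X%:M - map_mx polyC (invmx P *m B *m P) = Qi *m ('X%:M - map_mx polyC B) *m Q.
  rewrite mulmxBr mulmxBl !map_mxM; congr (_ - _).
  by rewrite scalar_mxC -mulmxA QQ mulmx1.
rewrite !det_mulmx mulrAC -det_mulmx QQ det1 mul1r //.
Qed.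

Lemma char_poly_real P (D : 'rV[R]_n) : P \is unitarymx ->
  A = invmx P *m diag_mx (map_mx rc D) *m P -> char_poly M = \prod_i ('X - (D 0 i)%:P).
Proof.
move=> Pu hA; apply: (map_poly_inj rc); rewrite map_char_poly {1}hA char_poly_conj ?unitarymx_unit //.
rewrite char_poly_trig; last by apply: diag_mx_is_trig.
rewrite rmorph_prod; apply: eq_bigr => i _; rewrite rmorphB /= map_polyX map_polyC !mxE eqxx //.
Qed.

Lemma mup_prod (D : 'I_n -> R) a : mup a (\prod_i ('X - (D i)%:P)) = (\sum_i (D i == a))%N.
Proof.
elim: (index_enum _) => [|i r IH]; rewrite ?big_nil ?big_cons.
  by apply: mupNroot; rewrite root1.
rewrite mupM ?IH ?polyXsubC_eq0 //; last first.
  by rewrite prodf_seq_neq0; apply/allP => j _; rewrite polyXsubC_eq0.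
by congr (_ + _)%N; rewrite -[X in mup a X]expr1 mup_XsubCX; case: eqP.
Qed.

Lemma num_positive_card (D : 'rV[R]_n) : char_poly M = \prod_i ('X - (D 0 i)%:P) ->
  (num_positive_eigenvalues M <= #|[pred i : 'I_n | (0 < D 0 i)%R]|)%N.
Proof.
move=> e; rewrite /num_positive_eigenvalues e.
under eq_bigr => a _ do rewrite mup_prod.
rewrite exchange_big -sum1_card [leqRHS]big_mkcond; apply: leq_sum => i _ /=.
rewrite inE; case: ltP => h; last first.
  rewrite big1 // => a a0; case: eqP => // ea; by move: a0; rewrite -ea ltNge h.
rewrite -e; apply: leq_trans (_ : \sum_(a <- rootsR (char_poly M)) (D 0%R i == a) <= _)%N.
  by rewrite big_mkcond; apply: leq_sum => a _; case: ifP.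
have u : uniq (rootsR (char_poly M)) by apply: uniq_roots.
under eq_bigr => a _ do rewrite eq_sym.
rewrite -big_mkcond sum1_count.
have h2 : count (eq_op^~ (D 0 i)) (rootsR (char_poly M)) = (D 0 i \in rootsR (char_poly M)) := count_uniq_mem _ u.
by rewrite h2; case: (_ \in _).
Qed.

Definition rform (x y : 'rV[R]_n) : R := (x *m M *m y^T) 0 0.

(** Two positive eigenvalues would give z = x1 + i x2 orthogonal to y with positive hermitian
    square, the sum of the values of the form at x1 and x2. Both real vectors are orthogonal to y,
    so the hypothesis makes both values nonpositive. *)
Lemma one_positive (y : 'rV[R]_n) : 0 < rform y y ->
  (forall x, rform x x * rform y y <= rform x y ^+ 2) -> (num_positive_eigenvalues M <= 1)%N.
Proof.
move=> y0 hy; have [P [D [Pu hA]]] := A_spectral.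
apply: leq_trans (num_positive_card (char_poly_real Pu hA)) _.
rewrite leqNgt; apply/negP => /card_gt1P[i [j [di dj ij]]].
rewrite !inE in di dj.
have d1 : 0 < (map_mx rc D) 0 i by rewrite mxE ltcR.
have d2 : 0 < (map_mx rc D) 0 j by rewrite mxE ltcR.
have [z [zy zpos]] := positive_orthogonal ((map_mx rc y)^T) Pu hA ij d1 d2.
pose x1 := map_mx (@complex.Re R) z; pose x2 := map_mx (@complex.Im R) z.
have ez : z = map_mx rc x1 + 'i%C *: map_mx rc x2.
  by apply/matrixP => k l; rewrite !mxE -complexE.
have fC (u v : 'rV[R]_n) : (map_mx rc u *m A *m (map_mx rc v)^T) 0 0 = rc (rform u v).
  by rewrite map_trmx -!map_mxM mxE.
have zt : ctr z = (map_mx rc x1)^T - 'i%C *: (map_mx rc x2)^T.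
  by apply/matrixP => k l; rewrite !mxE; case: (z l k) => u v; apply/eqP; rewrite eq_complex /=; apply/andP; split; apply/eqP; ring.
have h1 : rform x1 y = 0 /\ rform x2 y = 0.
  have := linear_expand A (map_mx rc x1) (map_mx rc x2) 'i%C (map_mx rc y)^T.
  rewrite -ez zy !fC => /esym/eqP.
  by rewrite eq_complex /= => /andP[/eqP e1 /eqP e2]; split; lra.
have AT : A^T = A by rewrite map_trmx Msym.
have ii : 'i%C * 'i%C = -1 :> C by rewrite -expr2 sqr_i.
have := bilinear_conj (map_mx rc x1) (map_mx rc x2) AT ii.
rewrite -ez -zt !fC => e; move: zpos; rewrite e -rmorphD ltcR.
have := hy x1; have := hy x2; rewrite h1.1 h1.2 expr0n /=.
by move: y0; nra.
Qed.

End Spectral.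

(** * Lorentzian polynomials *)

Lemma Posz_sum (I : Type) (r : seq I) (f : I -> nat) :
  (\sum_(i <- r) f i)%N%:Z = \sum_(i <- r) (f i)%:Z.
Proof. exact: (big_morph Posz PoszD). Qed.

Section Lorentzian.
Variables (R : realType) (n : nat) (g : {mpoly R[n]}) (D : nat).
Hypothesis gpos : forall m, 0 <= g@_m.
Hypothesis ghom : forall m, m \in msupp g -> mdeg m = D.
Hypothesis gsup : superadditive g.
Implicit Types (m c : 'X_{1..n}) (t : 'I_n -> nat).

Lemma mdeg2 m : mdeg m = 2%N -> exists p q, m = (U_(p) + U_(q))%MM.
Proof.
move=> h; have [p hp] : exists p, (0 < m p)%N.
  apply/existsP; apply: contraT; rewrite negb_exists => /forallP h0.
  by move: h; rewrite mdegE big1 // => k _; apply/eqP; rewrite -leqn0 leqNgt.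
have e : m = (U_(p) + (m - U_(p)))%MM.
  apply/mnmP => k; rewrite mnmDE mnmBE mnm1E; case: eqP => [<-|]; first by rewrite subnKC.
  by rewrite subn0.
have : mdeg (m - U_(p)) == 1%N by move: h; rewrite {1}e mdegD mdeg1; lia.
by rewrite mdeg_eq1 => /existsP[q /eqP eq]; exists p, q; rewrite -eq.
Qed.

Lemma U2_eq (p q i j : 'I_n) : ((U_(p) + U_(q))%MM == (U_(i) + U_(j))%MM :> 'X_{1..n}) =
  ((i == p) && (j == q)) || ((i == q) && (j == p)).
Proof.
apply/eqP/idP => [/mnmP e|/orP[] /andP[/eqP -> /eqP ->] //]; last by rewrite addmC.
have := e p; have := e q; have := e i; have := e j; rewrite !mnmDE !mnm1E !eqxx.
rewrite ![i == _]eq_sym ![j == _]eq_sym [q == p]eq_sym.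
by case: (p =P q) => [<-|_]; case: (p == i); case: (p == j); rewrite ?[j == i]eq_sym; case: (i == j); case: (q == i); case: (q == j).
Qed.

Lemma sum_delta2 (p q : 'I_n) (x : 'I_n -> R) :
  \sum_i \sum_j ((i == p) && (j == q))%:R * (x i * x j) = x p * x q.
Proof.
rewrite (bigD1 p) //= [X in _ + X]big1 ?addr0 => [|i /negbTE ip]; last first.
  by rewrite big1 // => j _; rewrite ip mul0r.
rewrite (bigD1 q) //= !eqxx mul1r [X in _ + X]big1 ?addr0 // => j /negbTE jq.
by rewrite jq andbF mul0r.
Qed.

(** Two ordered pairs contribute for p != q and one for p = q, which matches 2 / m!. *)
Lemma quad_term m (x : 'I_n -> R) : mdeg m = 2%N ->
  \sum_i \sum_j (m == (U_(i) + U_(j))%MM)%:R * (x i * x j) = 2 * \prod_k (x k ^+ m k / (m k)`!%:R).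
Proof.
move=> /mdeg2[p [q ->]].
transitivity (\sum_i \sum_j (((i == p) && (j == q)) || ((i == q) && (j == p)))%:R * (x i * x j)).
  by apply: eq_bigr => i _; apply: eq_bigr => j _; rewrite U2_eq.
have [<-|pq] := eqVneq p q.
  transitivity (2 * (x p * x p / 2)); last first.
    congr (_ * _); rewrite (bigD1 p) //= big1 ?mulr1 => [|k kp]; last first.
      by rewrite mnmDE !mnm1E eq_sym (negbTE kp) expr0 fact0 divr1.
    by rewrite mnmDE !mnm1E eqxx expr2.
  rewrite mulrC divfK ?pnatr_eq0 // -sum_delta2.
  by apply: eq_bigr => i _; apply: eq_bigr => j _; rewrite orbb.
transitivity (\sum_i \sum_j ((i == p) && (j == q))%:R * (x i * x j) +
              \sum_i \sum_j ((i == q) && (j == p))%:R * (x i * x j)).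
  rewrite -big_split; apply: eq_bigr => i _; rewrite -big_split; apply: eq_bigr => j _ /=.
  rewrite -mulrDl -natrD; congr (_%:R * _).
  case: (i =P p) => [->|_]; last by rewrite /= add0n.
  by rewrite (negbTE pq) orbF addn0.
rewrite !sum_delta2 (bigD1 p) //= (bigD1 q) /=; last by rewrite eq_sym.
rewrite big1 ?mulr1 => [|k /andP[kp kq]]; last first.
  by rewrite mnmDE !mnm1E ![_ == k]eq_sym (negbTE kp) (negbTE kq) expr0 fact0 divr1.
rewrite !mnmDE !mnm1E !eqxx (eq_sym q) (negbTE pq) (_ : true + false = 1)%N // (_ : false + true = 1)%N //.
by rewrite (_ : 1`! = 1)%N // !divr1 !expr1; ring.
Qed.

Lemma coeff_lf m : g@_m = \sum_(m' <- msupp g) g@_m' * (m' == m)%:R.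
Proof.
have [hm|hm] := boolP (m \in msupp g).
  rewrite (bigD1_seq m) ?msupp_uniq //= eqxx mulr1 big1 ?addr0 // => m' /negbTE ->.
  by rewrite mulr0.
rewrite (memN_msupp_eq0 hm) big1_seq // => m' /andP[_ hm']; case: eqP => [e|]; rewrite ?mulr0 //.
by rewrite -e hm' in hm.
Qed.

(** The Hessian of the derivative of order c of the normalization, when that derivative is
    quadratic; the factorials cancel. *)
Definition Mq c : 'M[R]_n := \matrix_(i, j) g@_(c + (U_(i) + U_(j)))%MM.

Lemma hh_le x (a m : nat) : (a <= m)%N -> hh R x a m = x%:R ^+ (m - a) / (m - a)`!%:R.
Proof. by rewrite /hh => ->. Qed.

Lemma hh_prod0 c m t : ~~ [forall k, (c k <= m k)%N] -> \prod_k hh R (t k) (c k) (m k) = 0.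
Proof. by rewrite negb_forall => /existsP[k hk]; rewrite (bigD1 k) //= /hh (negbTE hk) mul0r. Qed.

Lemma hh_prod c m t : [forall k, (c k <= m k)%N] ->
  \prod_k hh R (t k) (c k) (m k) = \prod_k ((t k)%:R ^+ (m - c)%MM k / ((m - c)%MM k)`!%:R).
Proof. by move=> /forallP h; apply: eq_bigr => k _; rewrite hh_le // mnmBE. Qed.

Lemma mnm_le_subK c m : [forall k, (c k <= m k)%N] -> m = (c + (m - c))%MM.
Proof. by move=> /forallP h; apply/mnmP => k; rewrite mnmDE mnmBE subnKC. Qed.

Lemma dval_quad c t : (mdeg c + 2 = D)%N -> 2 * dval g c t = bf (Mq c) (nrow R t) (nrow R t).
Proof.
move=> hc; rewrite bfE; under eq_bigr => i _ do under eq_bigr => j _ do rewrite !mxE mulrAC.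
transitivity (\sum_(m <- msupp g) g@_m * (2 * \prod_k hh R (t k) (c k) (m k))).
  by rewrite /dval /lf mulr_sumr; apply: eq_bigr => m _; rewrite mulrCA.
transitivity (\sum_(m <- msupp g) g@_m * (\sum_i \sum_j (m == (c + (U_(i) + U_(j)))%MM)%:R * ((t i)%:R * (t j)%:R))).
  apply: eq_big_seq => m hm; congr (_ * _).
  have [cm|cm] := boolP [forall k, (c k <= m k)%N]; last first.
    rewrite hh_prod0 // mulr0 big1 // => i _; rewrite big1 // => j _.
    case: eqP => [e|]; rewrite ?mul0r //; case/negP: cm; apply/forallP => k.
    by rewrite e mnmDE leq_addr.
  have e := mnm_le_subK cm; have dm : mdeg (m - c) = 2%N.
    by have := ghom hm; rewrite {1}e mdegD; lia.
  rewrite hh_prod // -quad_term //; apply: eq_bigr => i _; apply: eq_bigr => j _.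
  by rewrite {2}e eqm_add2l.
transitivity (\sum_(m <- msupp g) \sum_i \sum_j g@_m * ((m == (c + (U_(i) + U_(j)))%MM)%:R * ((t i)%:R * (t j)%:R))).
  by apply: eq_bigr => m _; rewrite mulr_sumr; apply: eq_bigr => i _; rewrite mulr_sumr.
rewrite exchange_big; apply: eq_bigr => i _; rewrite exchange_big; apply: eq_bigr => j _.
by rewrite [in RHS]coeff_lf mulr_sumr; apply: eq_bigr => m _ /=; rewrite mulrA mulrC.
Qed.

Lemma nrowD t t' : nrow R (fun k => t k + t' k)%N = nrow R t + nrow R t'.
Proof. by apply/rowP => k; rewrite !mxE natrD. Qed.

Lemma Mq_nat c : (mdeg c + 2 = D)%N -> forall t t',
  16 * bf (Mq c) (nrow R t) (nrow R t) * bf (Mq c) (nrow R t') (nrow R t') <=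
  bf (Mq c) (nrow R t + nrow R t') (nrow R t + nrow R t') ^+ 2.
Proof.
move=> hc t t'; rewrite -nrowD -!dval_quad //.
have := gsup (c := c) (e := 2) t t' _.
set x := dval _ _ t; set y := dval _ _ t'; set z := dval _ _ _ => /(_ _) h.
have {}h := h (fun m hm => ltac:(by rewrite (ghom hm) -hc addnC)).
nra.
Qed.

Lemma Mq_sym c i j : Mq c i j = Mq c j i.
Proof. by rewrite !mxE [(U_(i) + _)%MM]addmC. Qed.

Lemma Mq_ge0 c i j : 0 <= Mq c i j.
Proof. by rewrite mxE. Qed.

Definition J (a : 'rV[int]_n) := exists2 m, 0 < g@_m & a = \row_k (m k)%:Z.

Lemma posP m : (0 < g@_m) = (m \in msupp g).
Proof. by rewrite mcoeff_msupp lt_neqAle gpos andbT eq_sym. Qed.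

Lemma J_sum a : J a -> \sum_k a 0 k = D%:Z.
Proof.
move=> [m]; rewrite posP => /ghom <- ->; rewrite mdegE Posz_sum.
by apply: eq_bigr => k _; rewrite mxE.
Qed.

Lemma row_mnm (a : 'rV[int]_n) c p q : (forall k, a 0 k = (c k)%:Z) ->
  a + unit_vec p + unit_vec q = \row_k ((c + (U_(p) + U_(q)))%MM k)%:Z.
Proof.
move=> ac; apply/rowP => k; rewrite !mxE ac !mnmDE !mnm1E [k == p]eq_sym [k == q]eq_sym /=.
by rewrite !PoszD addrA; congr (_ + _ + _); case: (_ == _).
Qed.

Lemma J_exchange a p i q j : p != q -> p != j -> i != q -> i != j ->
  J (a + unit_vec p + unit_vec i) -> J (a + unit_vec q + unit_vec j) ->
  (J (a + unit_vec p + unit_vec q) /\ J (a + unit_vec i + unit_vec j)) \/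
  (J (a + unit_vec p + unit_vec j) /\ J (a + unit_vec i + unit_vec q)).
Proof.
move=> pq pj iq ij [m hm em] [m' hm' em'].
have a0 k : 0 <= a 0 k.
  have := congr1 (fun x : 'rV[int]_n => x 0 k) em; have := congr1 (fun x : 'rV[int]_n => x 0 k) em'.
  rewrite !mxE /=; case: (k =P p) => [->|_]; first by rewrite (negbTE pq) (negbTE pj) /=; lia.
  by case: (k =P i) => [->|_]; rewrite ?(negbTE iq) ?(negbTE ij) /=; lia.
pose c : 'X_{1..n} := [multinom `|a 0%R k|%N | k < n].
have ac k : a 0 k = (c k)%:Z by rewrite mnmE gez0_abs.
have mE (x y : 'I_n) (u : 'X_{1..n}) : a + unit_vec x + unit_vec y = \row_k (u k)%:Z -> u = (c + (U_(x) + U_(y)))%MM.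
  rewrite (row_mnm _ _ ac) => /rowP e; apply/mnmP => k.
  by have := e k; rewrite !mxE => -[].
have hM : (mdeg c + 2 = D)%N.
  have /ghom : m \in msupp g by rewrite -posP.
  by rewrite (mE _ _ _ em) !mdegD !mdeg1.
have h1 : 0 < Mq c p i by rewrite mxE -(mE _ _ _ em).
have h2 : 0 < Mq c q j by rewrite mxE -(mE _ _ _ em').
have JM x y : 0 < Mq c x y -> J (a + unit_vec x + unit_vec y).
  by rewrite mxE => h; eexists; [exact: h | exact: row_mnm].
case: (local_exchange_mx (Mq_sym c) (Mq_ge0 c) (Mq_nat hM) h1 h2) => -[k1 k2]; [left|right]; split; exact: JM.
Qed.

Lemma dval_gt0 c m t : 0 < g@_m -> (forall k, (c k <= m k)%N) ->
  (forall k, (c k < m k)%N -> (0 < t k)%N) -> 0 < dval g c t.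
Proof.
move=> hm cm ht; rewrite /dval /lf (bigD1_seq m) ?msupp_uniq -?posP //= ltr_pwDl //.
  rewrite mulr_gt0 // prodr_gt0 // => k _; rewrite hh_le // divr_gt0 ?ltr0n ?fact_gt0 //.
  have := cm k; rewrite leq_eqVlt => /predU1P[->|lt]; first by rewrite subnn.
  by rewrite exprn_gt0 // ltr0n ht.
apply: sumr_ge0 => m' _; apply: mulr_ge0 => //; apply: prodr_ge0 => k _; rewrite /hh.
by case: ifP => // _; rewrite divr_ge0 ?exprn_ge0.
Qed.

(** Otherwise every exponent above c = min(ma, mb) leaves c only on the side of a or only on that of
    b, and the derivative of order c becomes A x^e + B y^e along [tau x y]. For e >= 2 such a sum is
    not superadditive: the arguments (s, 0) and (s, 2) with A s > B refute it. *)
Lemma J_mixing a b : J a -> J b -> 1 < dist a b ->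
  exists f p q, [/\ J f, forall k, Num.min (a 0 k) (b 0 k) <= f 0 k,
    b 0 p < a 0 p /\ b 0 p < f 0 p & a 0 q < b 0 q /\ a 0 q < f 0 q].
Proof.
move=> [ma ha ea] [mb hb eb] dab; apply: boolp.contrapT => no.
pose c : 'X_{1..n} := [multinom minn (ma k) (mb k) | k < n].
pose Ga k := (mb k < ma k)%N; pose Gb k := (ma k < mb k)%N.
pose tau x y k := (x * Ga k + y * Gb k)%N.
have ca k : (c k <= ma k)%N by rewrite mnmE geq_minl.
have cb k : (c k <= mb k)%N by rewrite mnmE geq_minr.
have sep m : m \in msupp g -> (forall k, (c k <= m k)%N) ->
    (forall k, Ga k -> m k = c k) \/ (forall k, Gb k -> m k = c k).
  rewrite -posP => hm cm; apply: boolp.contrapT => /boolp.not_orP[/boolp.existsNP[p /boolp.not_implyP[gp np]] /boolp.existsNP[q /boolp.not_implyP[gq nq]]].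
  apply: no; exists (\row_k (m k)%:Z), p, q; split; first by exists m.
  - by move=> k; rewrite ea eb !mxE; have := cm k; rewrite mnmE; lia.
  - by rewrite ea eb !mxE; have := cm p; move: np gp; rewrite /Ga mnmE; lia.
  - by rewrite ea eb !mxE; have := cm q; move: nq gq; rewrite /Gb mnmE; lia.
pose e := (mdeg ma - mdeg c)%N.
have dma : mdeg ma = D by apply: ghom; rewrite -posP.
have cD : (mdeg c <= D)%N by rewrite -dma !mdegE; apply: leq_sum.
have hdeg m : m \in msupp g -> mdeg m = (e + mdeg c)%N by move=> /ghom ->; rewrite /e dma subnK.
have e2 : (2 <= e)%N.
  suff E : dist a b = e%:Z by move: dab; rewrite E; lia.
  have : mdeg ma = (e + mdeg c)%N by rewrite hdeg // -posP.
  rewrite !mdegE => h; have {}h : e = (\sum_k (ma k - c k))%N.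
    by apply/eqP; rewrite -(eqn_add2r (\sum_k c k)) -h -big_split; apply/eqP/eq_bigr => k _; rewrite /= subnK.
  rewrite h Posz_sum /dist; apply: eq_bigr => k _; rewrite ea eb !mxE mnmE; lia.
pose A := dval g c (tau 1 0)%N; pose B := dval g c (tau 0 1)%N.
have A0 : 0 < A by apply: (dval_gt0 ha ca) => k; rewrite mnmE /tau /Ga; lia.
have B0 : 0 < B by apply: (dval_gt0 hb cb) => k; rewrite mnmE /tau /Gb; lia.
have split_ x y : dval g c (tau x y) = A * x%:R ^+ e + B * y%:R ^+ e.
  rewrite /A /B /dval /lf !mulr_suml -big_split; apply: eq_big_seq => m hm /=.
  rewrite -!mulrA -mulrDr; congr (_ * _).
  have [cm|cm] := boolP [forall k, (c k <= m k)%N]; last by rewrite !hh_prod0 // !mul0r addr0.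
  rewrite !hh_prod // !big_split /=; set F := \prod_k (_ `!%:R)^-1.
  have dme : mdeg (m - c) = e by have := hdeg m hm; rewrite {1}(mnm_le_subK cm) mdegD; lia.
  have pw (z : R) (f : 'I_n -> R) : \prod_k (z * f k) ^+ (m - c)%MM k = z ^+ e * \prod_k f k ^+ (m - c)%MM k.
    under eq_bigr => k _ do rewrite exprMn.
    by rewrite big_split /= prodrXr -mdegE dme.
  have [k0 hk0] : exists k, (0 < (m - c)%MM k)%N.
    apply/existsP; apply: contraT; rewrite negb_exists => /forallP h0.
    by move: dme; rewrite mdegE big1 ?(ltn_eqF e2) //; [move=> h; move: e2; rewrite -h | move=> k _; apply/eqP; rewrite -leqn0 leqNgt].
  case: (sep m hm (forallP cm)) => hG.
    have z k : Ga k -> (m - c)%MM k = 0%N by move=> gk; rewrite mnmBE hG ?subnn.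
    have -> : \prod_k (tau x y k)%:R ^+ (m - c)%MM k = y%:R ^+ e * \prod_k (tau 0 1 k)%N%:R ^+ (m - c)%MM k :> R.
      rewrite -pw; apply: eq_bigr => k _; case gk : (Ga k); first by rewrite z.
      by rewrite /tau gk !muln0 !add0n natrM mul1n.
    have -> : \prod_k (tau 1 0 k)%N%:R ^+ (m - c)%MM k = 0 :> R.
      rewrite (bigD1 k0) //= /tau; case gk : (Ga k0); first by move: hk0; rewrite z.
      by rewrite expr0n; case: ((m - c)%MM k0) hk0 => // ? _; rewrite mul0r.
    by rewrite !mul0r add0r [RHS]mulrC mulrA.
  have z k : Gb k -> (m - c)%MM k = 0%N by move=> gk; rewrite mnmBE hG ?subnn.
  have -> : \prod_k (tau x y k)%:R ^+ (m - c)%MM k = x%:R ^+ e * \prod_k (tau 1 0 k)%N%:R ^+ (m - c)%MM k :> R.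
    rewrite -pw; apply: eq_bigr => k _; case gk : (Gb k); first by rewrite z.
    by rewrite /tau gk !muln0 !addn0 natrM mul1n.
  have -> : \prod_k (tau 0 1 k)%N%:R ^+ (m - c)%MM k = 0 :> R.
    rewrite (bigD1 k0) //= /tau; case gk : (Gb k0); first by move: hk0; rewrite z.
    by rewrite expr0n; case: ((m - c)%MM k0) hk0 => // ? _; rewrite mul0r.
  by rewrite !mul0r addr0 [RHS]mulrC mulrA.
pose s := (Num.bound (B / A)).+1.
have hs : B < A * s%:R.
  rewrite mulrC -ltr_pdivrMr //; apply: lt_le_trans (archi_boundP (divr_ge0 (ltW B0) (ltW A0))) _.
  by rewrite ler_nat.
have := gsup (tau s 0)%N (tau s 2)%N hdeg.
have -> : (fun k => tau s 0 k + tau s 2 k)%N = tau (2 * s)%N 2%N.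
  by apply: boolp.funext => k; rewrite /tau; case: (Ga k); case: (Gb k); lia.
rewrite !split_ natrM exprMn expr0n (gtn_eqF (ltnW e2)) mulr0 addr0.
have e4 : 4 ^+ e = (2 ^+ e) ^+ 2 :> R by rewrite -exprM mulnC exprM; congr (_ ^+ _); rewrite -natrX.
rewrite e4.
have se : s%:R <= s%:R ^+ e :> R by apply: ler_eXnr => //; [exact: ltnW | rewrite ler1n].
have t4 : 4 <= 2 ^+ e :> R.
  by rewrite -(subnKC e2) exprD -natrX ler_peMr // exprn_ege1 // ler1n.
move: (s%:R ^+ e) se t4 => S se t4; move: (2 ^+ e) t4 => T t4 h.
have S0 : B < A * S by apply: lt_le_trans hs _; rewrite ler_pM2l.
have T0 : 0 < T by lra.
(* With X = A S the inequality reads B (X T - 2 X - B) <= 0, against T >= 4 and X > B > 0. *)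
have : T ^+ 2 * ((A * S) * (A * S + B * T)) <= T ^+ 2 * (A * S + B) ^+ 2 by move: h; lra.
rewrite ler_pM2l ?exprn_gt0 //; move: (A * S) S0 => X S0 h1.
have X0 : 0 < X by apply: lt_trans S0.
have XT : X * 4 <= X * T by rewrite ler_pM2l.
have BX : 0 < B * (X * T - 2 * X - B) by apply: mulr_gt0 => //; lra.
by move: h1 BX; lra.
Qed.

Lemma normalizationE m : (normalization g)@_m = g@_m / (\prod_(i < n) (m i)`!)%N%:R.
Proof.
rewrite /normalization raddf_sum coeff_lf mulr_suml; apply: eq_bigr => m' _.
by rewrite /= mcoeffZ mcoeffX; case: eqP => [->|_]; rewrite ?mulr1 // !mulr0 mul0r.
Qed.

Lemma factP m : (0 : R) < (\prod_(i < n) (m i)`!)%N%:R.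
Proof. by rewrite ltr0n prodn_gt0 // => i; apply: fact_gt0. Qed.

(** After normalization differentiation is a mere shift of exponents. *)
Lemma derivativesE (s : seq 'I_n) m :
  (foldr (fun i p => p^`M(i)) (normalization g) s)@_m =
  g@_(\sum_(i <- s) U_(i) + m)%MM / (\prod_(i < n) (m i)`!)%N%:R.
Proof.
elim: s m => [|i s IH] m /=; first by rewrite big_nil add0m normalizationE.
rewrite mcoeff_mderiv IH big_cons.
have -> : (\sum_(j <- s) U_(j) + (m + U_(i)) = U_(i) + \sum_(j <- s) U_(j) + m)%MM.
  by rewrite [(m + _)%MM]addmC addmA [(_ + U_(i))%MM]addmC.
rewrite -[_ *+ (m i).+1]mulr_natr -mulrA; congr (_ * _).
have -> : (\prod_(j < n) ((m + U_(i))%MM j)`!)%N = ((\prod_(j < n) (m j)`!) * (m i).+1)%N.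
  rewrite (bigD1 i) //= [in RHS](bigD1 i) //= mnmDE mnm1E eqxx addn1 factS [RHS]mulnC mulnA.
  congr (_ * _)%N; apply: eq_bigr => j ji; by rewrite mnmDE mnm1E eq_sym (negbTE ji) addn0.
by rewrite natrM invfM -mulrA mulVf ?mulr1 // pnatr_eq0.
Qed.

Lemma quadratic_formE (s : seq 'I_n) :
  quadratic_form_mx (foldr (fun i p => p^`M(i)) (normalization g) s) = 2^-1 *: Mq (\sum_(i <- s) U_(i))%MM.
Proof.
apply/matrixP => i j; rewrite !mxE !derivativesE.
have [<-|ij] := eqVneq i j.
  rewrite mulrC; congr (_^-1 * _); rewrite (bigD1 i) //= big1 ?muln1 => [|k ki].
    by rewrite mnmDE mnm1E eqxx.
  by rewrite mnmDE !mnm1E eq_sym (negbTE ki).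
rewrite [(\prod_(_ < n) _)%N]big1 ?divr1 1?mulrC // => k _; rewrite mnmDE !mnm1E.
by have [<-|_] := eqVneq i k; [rewrite eq_sym (negbTE ij) | case: (j == k)].
Qed.

Theorem superadditive_lorentzian : lorentzian (normalization g).
Proof.
have sP m : (m \in msupp (normalization g)) = (m \in msupp g).
  by rewrite !mcoeff_msupp normalizationE mulf_eq0 invr_eq0 (gt_eqF (factP m)) orbF.
have sJ a : Defs.support (normalization g) a <-> J a.
  by split=> -[m hm ea]; exists m => //; move: hm; rewrite sP posP.
exists D; split.
- by apply/dhomogP => m; rewrite sP => /ghom.
- by move=> m; rewrite normalizationE divr_ge0 // ltW ?factP.
- have M := exchange_Mconvex J_sum J_exchange J_mixing.
  move=> i a b /sJ ja /sJ jb ab; have [j [h1 h2 h3]] := M i a b ja jb ab.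
  by exists j; split=> //; apply/sJ.
move=> s sD; rewrite quadratic_formE; set c := (\sum_(i <- s) _)%MM.
have hc : (mdeg c + 2 = D)%N.
  by rewrite -sD; congr (_ + _)%N; rewrite /c; elim: (s) => [|i l IH]; rewrite ?big_nil ?mdeg0 // big_cons mdegD mdeg1 IH.
have sym : (2^-1 *: Mq c)^T = 2^-1 *: Mq c.
  by apply/matrixP => i j; rewrite !mxE [(U_(i) + _)%MM]addmC.
pose y : 'rV[R]_n := const_mx 1.
have rE x z : rform (2^-1 *: Mq c) x z = 2^-1 * bf (Mq c) x z.
  by rewrite /rform /bf -scalemxAr -scalemxAl mxE.
have ny : nn y by move=> k; rewrite mxE.
have y1 k : 0 < y 0 k by rewrite mxE ltr01.
(* For the all-ones vector y the value of the form is the sum of the entries: either the nonnegative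
   matrix is zero, or y is the positive vector that [one_positive] asks for. *)
have := bf_ge0 (Mq_ge0 c) ny ny; rewrite le_eqVlt => /predU1P[y0|y0].
  have M0 : Mq c = 0.
    apply/matrixP => i j; rewrite [RHS]mxE; apply/eqP; apply: contraT => ne.
    have pos : 0 < Mq c i j by rewrite lt_neqAle eq_sym ne Mq_ge0.
    move: y0; rewrite bfE (bigD1 i) //= (bigD1 j) //= => y0.
    have : 0 < y 0 i * Mq c i j * y 0 j by rewrite !mulr_gt0.
    have t1 : 0 <= \sum_(l | l != j) y 0 i * Mq c i l * y 0 l.
      by apply: sumr_ge0 => l _; rewrite !mulr_ge0 ?Mq_ge0.
    have t2 : 0 <= \sum_(k | k != i) \sum_l y 0 k * Mq c k l * y 0 l.
      by apply: sumr_ge0 => k _; apply: sumr_ge0 => l _; rewrite !mulr_ge0 ?Mq_ge0.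
    by move: y0 t1 t2; lra.
  rewrite M0 scaler0; apply: leq_trans (num_positive_card (D := 0) _) _.
    rewrite char_poly_trig; last by apply/is_trig_mxP => i j _; rewrite mxE.
    by apply: eq_bigr => i _; rewrite !mxE.
  by rewrite eq_card0 // => i; rewrite !inE mxE ltxx.
apply: (one_positive sym (y := y)); first by rewrite rE mulr_gt0 ?invr_gt0 ?ltr0n.
move=> x; rewrite !rE; have := reverse_CS_all (Mq_sym c) (Mq_ge0 c) (Mq_nat hc) ny y1 x.
by set p := bf _ x x; set q := bf _ y y; set r := bf _ x y; nra.
Qed.

End Lorentzian.

Theorem theorem6 (R : realType) (n : nat) (hn : (1 <= n)%N) (w : 'S_n)
    (S : {mpoly R[n]}) (hS : is_schubert w S) :
  lorentzian (normalization (reversal n.-1 S)).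
Proof.
case: n hn w S hS => // k _ w S hS; set n := k.+1.
(* The degree: reversal complements each of the n exponents to n - 1, and the Schubert polynomial
   has degree [len w]. *)
rewrite -(SchE hS); apply: (@superadditive_lorentzian R n _ (n * n.-1 - len w)).
- move=> m; rewrite reversalE raddf_sum; apply: sumr_ge0 => m' _.
  rewrite /= mcoeffZ; apply: mulr_ge0; first exact: Sch_coeff_ge0.
  by rewrite mcoeffX ler0n.
- move=> m /reversal_supp[m' hm' ->]; have /dhomogP/(_ _ hm') /= <- := Sch_homog R w.
  have -> : (n * n.-1 = \sum_(i < n) n.-1)%N by rewrite sum_nat_const card_ord.
  rewrite !mdegE -sumnB => [|i _]; last exact: Sch_exponent' hm'.
  by apply: eq_bigr => i _; rewrite mnmE.
- exact: reversal_superadditive.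
Qed.
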